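(* Let $m$ be a locally finite nonnegative Borel measure on $\mathbb{R}$ such that $\operatorname{supp} m\cap(-\infty,-b]\neq\emptyset$ and $\operatorname{supp} m\cap[b,\infty)\neq\emptyset$ for all $b>0$, and let $\Psi$ be the convex function associated with $m$. Let $g:\mathbb{R}\to\mathbb{R}$ be a continuous function such that $g(x)=o(\Psi(x))$ as $|x|\to\infty$. Then there exists a unique continuous function $U:\mathbb{R}\times[0,\infty)\to\mathbb{R}$ such that $U(x,t)=o(\Psi(x))$ as $|x|\to\infty$ locally uniformly in $t$ and such that $$2m(x)U_t(x,t)=U_{xx}(x,t)\qquad\text{for } t>0$$ holds in the sense of distributions on $\mathbb{R}\times(0,\infty)$, with the initial values $U(x,0)=\overline g(x)$ for $x\in\mathbb{R}$. Moreover, the function $U$ is given by the stochastic representation $$U(x,t)=\mathbb{E}\, g(X^x_t)=\mathbb{E}\,\overline g(X^x_t),$$ where $X^x$ is the generalized diffusion with speed measure $m$ and starting point $x$.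
   Context: Function $\Psi$: define $\Phi(x):=2\int_{[0,x)}y\,m(dy)$ for $x\ge 0$, $\Phi(x):=2\int_{[x,0)}y\,m(dy)$ for $x<0$, and $\Psi(x):=\int_0^x\Phi(y)\,dy$. ($\Psi$ is nonnegative and convex.) Function $\overline g$: the continuous function that agrees with $g$ on $\operatorname{supp} m$ and is affine on each connected component of $\mathbb{R}\setminus\operatorname{supp} m$. Distributional equation: $mU_t$ is interpreted as the distributional derivative $(Um)_t$, so $2mU_t=U_{xx}$ means $$-2\iint U\varphi_t\,m(dx)\,dt=\iint U\varphi_{xx}\,dx\,dt\quad\text{for all }\varphi\in C_c^\infty(\mathbb{R}\times(0,\infty)).$$ Generalized diffusion with speed measure $m$ and starting point $x$: let $B$ be a standard Brownian motion with $B_0=0$ and $L^y_u$ its local time at $y$ up to time $u$ (jointly continuous occupation density with respect to Lebesgue measure). Put $\Gamma^x_u:=\int_{\mathbb{R}}L^{y-x}_u\,m(dy)$, $A^x_t:=\inf\{u:\Gamma^x_u>t\}$, and $X^x_t:=x+B_{A^x_t}$ for $t\ge0$. *)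

(* Defs.v *)
From HB Require Import structures.
From mathcomp Require Import all_boot all_order all_algebra.
From mathcomp Require Import all_classical all_reals all_analysis.

Set Implicit Arguments.
Unset Strict Implicit.
Unset Printing Implicit Defensive.

Import Order.TTheory GRing.Theory Num.Theory.
Import numFieldNormedType.Exports.

Local Open Scope classical_set_scope.
Local Open Scope ring_scope.

Section speed_measure.
Context {R : realType}.
Local Notation leb := (@lebesgue_measure R).
Variable m : {measure set (measurableTypeR R) -> \bar R}.

Definition locally_finite : Prop :=
  forall x : R, exists V : set R, [/\ open V, V x & (m V < +oo)%E].

Definition supp : set R :=
  [set x | forall V : set R, open V -> V x -> (0 < m V)%E].

Definition Phi (x : R) : R :=
  if 0 <= x then 2 * \int[m]_(y in `[0, x[) y
  else 2 * \int[m]_(y in `[x, 0[) y.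

(* The second branch is the oriented integral from 0 to x < 0. *)
Definition Psi (x : R) : R :=
  if 0 <= x then \int[leb]_(y in `[0, x]) Phi y
  else - \int[leb]_(y in `[x, 0]) Phi y.

(* The filter of |x| -> oo. *)
Definition at_infinity : set_system R :=
  [set S | pinfty_nbhs R S /\ ninfty_nbhs R S].

#[global] Instance at_infinity_filter : ProperFilter at_infinity.
Proof.
split; first by move=> [+ _]; exact: filter_not_empty.
split.
- by split; exact: filterT.
- by move=> S T [S1 S2] [T1 T2]; split; exact: filterI.
- by move=> S T ST [S1 S2]; split; exact: (filterS ST).
Qed.

Canonical at_infinity_filter_on : filter_on R :=
  FilterType at_infinity (@filter_filter _ _ at_infinity_filter).

Definition littleo_Psi (g : R -> R) : Prop := g =o_at_infinity Psi.

(* The neighbourhood of infinity does not depend on t in [0, T]. *)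
Definition littleo_Psi_locally_uniformly (U : R -> R -> R) : Prop :=
  forall T : R, 0 <= T -> forall eps : R, 0 < eps ->
    \forall x \near at_infinity,
      forall t, 0 <= t <= T -> `|U x t| <= eps * `|Psi x|.

Definition is_affine_interpolation (g h : R -> R) : Prop :=
  [/\ continuous h,
      (forall x, supp x -> h x = g x) &
      (forall x, ~ supp x -> exists a b : R, forall y,
         connected_component (~` supp) x y -> h y = a * y + b)].

(* Definite description: when [supp] is unbounded in both directions there is
   exactly one such function. *)
Definition gbar (g : R -> R) : R -> R := get (is_affine_interpolation g).

Definition partial_x (f : R -> R -> R) : R -> R -> R :=
  fun x t => derive1 (f^~ t) x.

Definition partial_t (f : R -> R -> R) : R -> R -> R :=
  fun x t => derive1 (f x) t.

Fixpoint Ck (k : nat) (f : R -> R -> R) : Prop :=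
  continuous (fun p : R * R => f p.1 p.2) /\
  if k is k'.+1 then
    [/\ (forall x t : R, derivable (f^~ t) x 1 /\ derivable (f x) t 1),
        Ck k' (partial_x f) & Ck k' (partial_t f)]
  else True.

(* C_c^oo(R x (0, oo)), each test function being extended by 0 to the plane. *)
Definition test_function (phi : R -> R -> R) : Prop :=
  let S := closure [set p : R * R | phi p.1 p.2 != 0] in
  [/\ (forall k, Ck k phi), compact S & S `<=` [set p | 0 < p.2]].

Definition heat_distributional (U : R -> R -> R) : Prop :=
  forall phi, test_function phi ->
    - 2 * \int[leb]_(t in `]0, +oo[) \int[m]_x (U x t * partial_t phi x t)
    = \int[leb]_(t in `]0, +oo[)
        \int[leb]_x (U x t * partial_x (partial_x phi) x t).

(* A function on R x [0, oo) is represented by a total one whose values at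
   negative times are irrelevant. *)
Definition is_solution (g : R -> R) (U : R -> R -> R) : Prop :=
  [/\ {within [set p : R * R | 0 <= p.2], continuous (fun p => U p.1 p.2)},
      littleo_Psi_locally_uniformly U,
      heat_distributional U &
      forall x, U x 0 = gbar g x].

End speed_measure.

Section generalized_diffusion.
Context {R : realType} {d : measure_display} {Omega : measurableType d}.
Variable P : probability Omega R.
Local Notation leb := (@lebesgue_measure R).

(* For a finite family, the product rule over all Borel sets gives the rule for
   every subfamily, by taking the other sets to be the whole line. *)
Definition mutually_independent (n : nat) (X : 'I_n -> Omega -> R) : Prop :=
  forall E : 'I_n -> set R, (forall i, measurable (E i)) ->
    P (\bigcap_(i in [set: 'I_n]) (X i @^-1` E i))
    = (\prod_(i < n) P (X i @^-1` E i))%E.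

(* Processes are indexed by R; only times t >= 0 are meaningful. *)
Definition brownian_motion (B : R -> {RV P >-> R}) : Prop :=
  [/\ (forall w, B 0 w = 0),
      (forall w, {within [set t : R | 0 <= t], continuous (B^~ w)}),
      (forall (n : nat) (t : nat -> R), 0 <= t 0%N ->
         (forall i, t i <= t i.+1) ->
         mutually_independent (fun i : 'I_n => B (t i.+1) \- B (t i))) &
      (* The second parameter of [normal_prob] is the standard deviation. *)
      (forall s t : R, 0 <= s -> s < t -> forall E : set R, measurable E ->
         P ((B t \- B s) @^-1` E) = normal_prob 0 (Num.sqrt (t - s)) E)].

(* [L y u] is the local time at level y up to time u.  It is continuous and
   nonnegative on the whole of Omega; the occupation density formula holds
   almost surely, with one exceptional set for all u and E. *)
Definition local_time (B : R -> {RV P >-> R}) (L : R -> R -> {RV P >-> R}) :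
    Prop :=
  [/\ (forall w, {within [set p : R * R | 0 <= p.2],
                    continuous (fun p => L p.1 p.2 w)}),
      (forall y u w, 0 <= u -> 0 <= L y u w) &
      {ae P, forall w, forall (u : R) (E : set R), 0 <= u -> measurable E ->
         leb [set s : R | 0 <= s <= u /\ E (B s w)]
         = (\int[leb]_(y in E) (L y u w)%:E)%E}].

Variable m : {measure set (measurableTypeR R) -> \bar R}.
Variables (B : R -> {RV P >-> R}) (L : R -> R -> {RV P >-> R}).

Definition Gamma (x u : R) (w : Omega) : \bar R :=
  (\int[m]_y (L (y - x) u w)%:E)%E.

(* [inf] is 0 on the empty set; under the standing assumptions Gamma tends to
   +oo almost surely, so that this value only matters on a null set. *)
Definition inverse_clock (x t : R) (w : Omega) : R :=
  inf [set u : R | 0 <= u /\ (t%:E < Gamma x u w)%E].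

Definition diffusion (x t : R) (w : Omega) : R := x + B (inverse_clock x t w) w.

End generalized_diffusion.

(* Main.v *)
Require Import Defs.
From HB Require Import structures.
From mathcomp Require Import all_boot all_order all_algebra finmap.
From mathcomp Require Import all_classical all_reals all_analysis.
From mathcomp Require Import measurable_realfun.
From mathcomp Require Import ring lra zify.

Set Implicit Arguments.
Unset Strict Implicit.
Unset Printing Implicit Defensive.

Import Order.TTheory GRing.Theory Num.Theory.
Import numFieldNormedType.Exports.

Local Open Scope classical_set_scope.
Local Open Scope ring_scope.


(** Write A f = f'' / (2 m) for the generator and w = 1 + Psi for the weight [wgt]. The equation A f
    = h is never read through derivatives: [Rel m f h] is its integral against hat functions, which
    relates three values of [f] to an integral of [h] against [m]. This form survives locally
    uniform limits and carries a maximum principle whose maximizers lie in the support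
    ([max_in_supp]). Since Psi'' = 2 |x| m ([Rel_Psi]) and |x| <= C1 w, a consequence of the support
    being unbounded on both sides ([abs_le_wgt]), one has w'' <= 2 C1 w m. Hence e w + C is a
    barrier, and comparison works in the class o(Psi).

    Existence. Dirichlet problems on growing intervals give the resolvent J lam = (1 - lam A)^-1 on
    continuous functions that are o(Psi) ([Jsol_exists]). As lam tends to 0, J lam g converges in
    the norm weighted by w to the affine interpolation of g ([J_limit], [gbar_spec]). Iterated
    resolvents with dyadic steps are the backward Euler scheme. Halving a step costs O(step^2) on
    the domain of A^2, which is dense, so the scheme converges ([E_refine], [Ue_cauchy]). The limit
    U solves the equation integrated in time: A applied to the primitive of U in t equals U(t) -
    U(0) ([mild], [mild_exists]). Difference quotients in time turn this into the distributional
    equation ([mild_heat]).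

    Uniqueness. Conversely, testing with a smoothed hat in x times a smoothed indicator in t shows
    that every continuous distributional solution satisfies the integrated equation ([heat_Rel]).
    For the difference D of two solutions, the time primitive of D obeys a maximum principle with
    barrier e w exp(C t) ([parabolic_maximum]), hence vanishes.

    Representation. Let u be a nonnegative supersolution of the heat equation. Averaged in space at
    scale h and evaluated along a Gaussian random walk whose clock advances by dt times a smeared
    density of m, it is almost a supermartingale; this only needs a Taylor expansion and Gaussian
    moments ([one_step], [chain_supermartingale]). Sampling the walk from the Brownian path, the
    walk stopped when its clock reaches t converges path by path to the diffusion, by the occupation
    formula ([clock_approx], [conv_hit]). Fatou then gives E u(X_t, 0) <= u(x, t) ([level_bound],
    [supersol_bound]). Applying this to U and to -U, averaged over a short time and lifted by a
    small barrier ([mild_supersol]), yields E gbar(X_t) = U(x, t) ([diffusion_expectation]).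
    Supersolutions growing at infinity also show that the clock almost surely passes each level
    ([clock_unbounded]). Finally X_t lies almost surely in the support ([hit_supp]), where g and its
    interpolation agree. *)

(** * Epsilon-delta forms of continuity in one and two variables *)

Section epsilon_delta.
Context {R : realType}.
Implicit Types (f : R -> R) (F : R -> R -> R) (A e x t : R).

Lemma continuous_epsP f :
  continuous f <-> forall x e, 0 < e ->
    exists2 d, 0 < d & forall y, `|y - x| < d -> `|f y - f x| <= e.
Proof.
split=> [cf x e e0|H x].
  have /cvgrPdist_le /(_ e e0) := cf x.
  move/nbhs_ballP => [d /= d0 Hd]; exists d => // y yx.
  by rewrite distrC; apply: Hd; rewrite /ball /= distrC.
apply/cvgrPdist_le => e e0; have [d d0 Hd] := H x e e0.
apply/nbhs_ballP; exists d => //= y; rewrite /ball /= => yx.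
by rewrite distrC; apply: Hd; rewrite distrC.
Qed.

Definition continuous2 F := continuous (fun p : R * R => F p.1 p.2).

Lemma continuous2_epsP F :
  continuous2 F <-> forall x t e, 0 < e ->
    exists2 d, 0 < d & forall x' t', `|x' - x| < d -> `|t' - t| < d ->
      `|F x' t' - F x t| <= e.
Proof.
split=> [cF x t e e0|H [x t]].
  have /cvgrPdist_le /(_ e e0) := cF (x, t).
  move/(@nbhs_ballP R (R * R)%type) => [d /= d0 Hd]; exists d => // x' t' hx ht.
  rewrite distrC; apply: (Hd (x', t')).
  by split; rewrite /ball /= distrC.
apply/cvgrPdist_le => e e0; have [d d0 Hd] := H x t e e0.
apply/(@nbhs_ballP R (R * R)%type); exists d => //= -[x' t'] [/=].
rewrite /ball /= => h1 h2; rewrite distrC; apply: Hd; rewrite distrC //.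
Qed.

Lemma continuous2_unif F A e : continuous2 F -> 0 < e ->
  exists2 d, 0 < d & forall x t x' t', `|x| <= A -> `|t| <= A ->
    `|x' - x| < d -> `|t' - t| < d -> `|F x' t' - F x t| <= e.
Proof.
move=> cF e0.
have cK : compact (`[-A, A] `*` `[-A, A] : set (R * R)).
  by apply: compact_setX; exact: segment_compact.
have e20 : 0 < e / 2 by lra.
pose K := `[-A, A] `*` `[-A, A] : set (R * R).
pose P (d : R) (p : R * R) := forall x' t', `|x' - p.1| < d ->
  `|t' - p.2| < d -> `|F x' t' - F p.1 p.2| <= e.
have H : \forall d \near (0 : R)^'+, K `<=` P d.
  apply: (iffLR (compact_near_coveringP _) cK).
  move=> -[x t] _.
  have [d d0 Hd] := iffLR (continuous2_epsP _) cF x t (e / 2) e20.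
  exists (ball (x, t) (d / 2), [set r | 0 < r < d / 2]).
    split => /=; first by apply: nbhsx_ballx; lra.
    near=> r; apply/andP; split; near: r; first exact: nbhs_right_gt.
    by apply: nbhs_right_lt; lra.
  move=> [[x1 t1] r] /= [[b1 b2] /andP[r0 r1]] x' t' h1 h2.
  rewrite /ball /= in b1 b2.
  have l1 : `|x1 - x| < d by rewrite distrC; lra.
  have l2 : `|t1 - t| < d by rewrite distrC; lra.
  have l3 : `|x' - x| < d.
    by rewrite -(subrK x1 x') -addrA (le_lt_trans (ler_normD _ _))// (distrC x1); lra.
  have l4 : `|t' - t| < d.
    by rewrite -(subrK t1 t') -addrA (le_lt_trans (ler_normD _ _))// (distrC t1); lra.
  have := Hd _ _ l1 l2; have := Hd _ _ l3 l4.
  by rewrite /= !ler_norml; lra.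
have [d [/= d0 Hd]] := filter_ex (filterI (nbhs_right_gt (0 : R)) H).
exists d => //.
move=> x t x' t' hx ht h1 h2; apply: (Hd (x, t)) => //=.
split; rewrite /= in_itv /= -ler_norml //.
Unshelve. all: by end_near.
Qed.

Lemma continuous2_bounded F A : continuous2 F ->
  exists M, forall x t, `|x| <= A -> `|t| <= A -> `|F x t| <= M.
Proof.
move=> cF.
have cK : compact (`[-A, A] `*` `[-A, A] : set (R * R)).
  by apply: compact_setX; exact: segment_compact.
have cFK : {within (`[-A, A] `*` `[-A, A] : set (R * R)),
    continuous (fun p => F p.1 p.2)}.
  exact: continuous_subspaceT.
have := compact_bounded (continuous_compact cFK cK).
move=> [M [Mr HM]]; exists (M + 1) => x t hx ht.
apply: (HM (M + 1)); first by lra.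
exists (x, t) => //=.
by rewrite !in_itv /= -!ler_norml.
Qed.

Lemma continuous2_fst f : continuous f -> continuous2 (fun x _ => f x).
Proof.
move=> /continuous_epsP cf; apply/continuous2_epsP => x t e e0.
by have [d d0 Hd] := cf x e e0; exists d => // x' t' h _; apply: Hd.
Qed.

Lemma continuous_unif f A e : continuous f -> 0 < e ->
  exists2 d, 0 < d & forall x x', `|x| <= A ->
    `|x' - x| < d -> `|f x' - f x| <= e.
Proof.
move=> cf e0; have [d d0 Hd] := continuous2_unif A (continuous2_fst cf) e0.
exists d => // x x' hx h; apply: (Hd x 0 x' 0) => //; rewrite ?subr0 normr0 //.
by rewrite (le_trans _ hx).
Qed.

Lemma continuous_bounded f A : continuous f ->
  exists M, forall x, `|x| <= A -> `|f x| <= M.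
Proof.
move=> cf; have [M HM] := continuous2_bounded A (continuous2_fst cf).
exists M => x hx; apply: (HM x x) => //.
Qed.

Lemma continuous2_slice1 F t : continuous2 F -> continuous (F^~ t).
Proof.
move=> /continuous2_epsP cF; apply/continuous_epsP => x e e0.
have [d d0 Hd] := cF x t e e0; exists d => // y h; apply: Hd => //.
by rewrite subrr normr0.
Qed.

Lemma continuous2_slice2 F x : continuous2 F -> continuous (F x).
Proof.
move=> /continuous2_epsP cF; apply/continuous_epsP => t e e0.
have [d d0 Hd] := cF x t e e0; exists d => // y h; apply: Hd => //.
by rewrite subrr normr0.
Qed.

Lemma continuous2_swap F : continuous2 F -> continuous2 (fun x y => F y x).
Proof.
move=> /continuous2_epsP cF; apply/continuous2_epsP => x t e e0.
have [d d0 Hd] := cF t x e e0; exists d => // x' t' h1 h2; exact: Hd.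
Qed.

Lemma continuous2_comp1 F (u : R -> R) : continuous2 F -> continuous u ->
  continuous2 (fun x t => F (u x) t).
Proof.
move=> /continuous2_epsP cF /continuous_epsP cu; apply/continuous2_epsP => x t e e0.
have [d d0 Hd] := cF (u x) t e e0.
have [d' d'0 Hd'] := cu x (d / 2) ltac:(lra).
exists (Num.min d d'); first by rewrite lt_min d0.
move=> x' t'; rewrite !lt_min => /andP[_ h1] /andP[h2 _]; apply: Hd => //.
by apply: le_lt_trans (Hd' _ h1) _; lra.
Qed.

Lemma continuous_approx f : (forall A e, 0 < e -> exists g, continuous g /\
    forall x, `|x| <= A -> `|g x - f x| <= e) -> continuous f.
Proof.
move=> H; apply/continuous_epsP => x e e0.
have e30 : 0 < e / 3 by lra.
have [g [/continuous_epsP cg Hg]] := H (`|x| + 1) (e / 3) e30.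
have [d d0 Hd] := cg x (e / 3) e30.
exists (Num.min d 1); first by rewrite lt_min d0 ltr01.
move=> y; rewrite lt_min => /andP[y1 y2].
have hy : `|y| <= `|x| + 1.
  by rewrite -(subrK x y) (le_trans (ler_normD _ _))//; lra.
have hx : `|x| <= `|x| + 1 by lra.
have := Hd y y1; have := Hg _ hy; have := Hg _ hx.
rewrite !ler_norml; lra.
Qed.

Lemma continuous2_approx F : (forall A e, 0 < e -> exists G, continuous2 G /\
    forall x t, `|x| <= A -> `|t| <= A -> `|G x t - F x t| <= e) -> continuous2 F.
Proof.
move=> H; apply/continuous2_epsP => x t e e0.
have e30 : 0 < e / 3 by lra.
have [G [/continuous2_epsP cG HG]] := H (`|x| + `|t| + 1) (e / 3) e30.
have [d d0 Hd] := cG x t (e / 3) e30.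
exists (Num.min d 1); first by rewrite lt_min d0 ltr01.
move=> x' t'; rewrite !lt_min => /andP[x1 x2] /andP[t1 t2].
have nx := normr_ge0 x; have nt := normr_ge0 t.
have hx' : `|x'| <= `|x| + `|t| + 1.
  by rewrite -(subrK x x') (le_trans (ler_normD _ _))//; lra.
have ht' : `|t'| <= `|x| + `|t| + 1.
  by rewrite -(subrK t t') (le_trans (ler_normD _ _))//; lra.
have hx : `|x| <= `|x| + `|t| + 1 by lra.
have ht : `|t| <= `|x| + `|t| + 1 by lra.
have := Hd _ _ x1 t1; have := HG _ _ hx' ht'; have := HG _ _ hx ht.
rewrite !ler_norml; lra.
Qed.

End epsilon_delta.

(** * Integrals of compactly supported continuous functions against a locally finite measure *)

Section compactly_supported_integrals.
Context {R : realType}.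
Variable mu : {measure set (measurableTypeR R) -> \bar R}.
Hypothesis lf : locally_finite mu.
Implicit Types (f g : R -> R) (F : R -> R -> R) (A B M k e x t c : R).

Lemma locally_finite_itv a b : (mu `[a, b]%classic < +oo)%E.
Proof.
have /choice [V HV] := lf.
have := @segment_compact R a b; rewrite compact_cover.
case/(_ R setT V) => [x _|x _|]; [by have [] := HV x| |].
  by exists x => //; have [] := HV x.
move=> D _ cov.
have oU : forall s : seq R, measurable (\big[setU/set0]_(i <- s) V i : set (measurableTypeR R)) /\
    (mu (\big[setU/set0]_(i <- s) V i) < +oo)%E.
  elim=> [|x s [ms IH]]; first by rewrite big_nil measure0.
  have [oV _ fV] := HV x.
  have mV : measurable (V x : set (measurableTypeR R)) by exact: open_measurable.
  rewrite big_cons; split; first exact: measurableU.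
  by rewrite (le_lt_trans (measureU2 _ _ _))//= lte_add_pinfty.
have [mU fU] := oU (enum_fset D).
apply: le_lt_trans fU; apply: le_measure; rewrite ?inE //.
by move: cov; rewrite /cover bigcup_fset.
Qed.

Definition cc A f := continuous f /\ forall x, A < `|x| -> f x = 0.

Lemma cc_integrable A f : cc A f -> mu.-integrable setT (EFin \o f).
Proof.
move=> [cf f0].
have fD : EFin \o f = ((EFin \o f) \_ (`[-A, A] : set R)).
  apply/funext => x; rewrite patchE; case: ifPn => //.
  rewrite notin_setE /= in_itv /= -ler_norml => /negP.
  by rewrite -ltNge => /f0 ->.
rewrite fD; apply/integrable_restrict => //; rewrite setTI.
apply: measurable_bounded_integrable => //.
- exact: locally_finite_itv.
- apply: measurable_funTS; exact: continuous_measurable_fun.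
have [M HM] := continuous_bounded A cf.
exists M; split; first exact: num_real.
move=> r Mr x /=; rewrite in_itv /= -ler_norml => /HM h.
by rewrite (le_trans h)// ltW.
Qed.

Lemma cc_restrict A f : cc A f ->
  \int[mu]_x f x = \int[mu]_(x in `[-A, A]) f x.
Proof.
move=> [cf f0]; rewrite [RHS]Rintegral_mkcond; congr fine.
apply: eq_integral => x _; rewrite patchE; case: ifPn => //.
rewrite notin_setE /= in_itv /= -ler_norml => /negP.
by rewrite -ltNge => /f0 ->.
Qed.

Lemma cc_widen A B f : A <= B -> cc A f -> cc B f.
Proof. by move=> AB [cf f0]; split => // x Bx; apply: f0; exact: le_lt_trans Bx. Qed.

Lemma ccD A f g : cc A f -> cc A g -> cc A (fun x => f x + g x).
Proof.
move=> [cf f0] [cg g0]; split; last by move=> x h; rewrite f0// g0// addr0.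
by move=> x; apply: cvgD; [exact: cf|exact: cg].
Qed.

Lemma ccZ A f k : cc A f -> cc A (fun x => k * f x).
Proof.
move=> [cf f0]; split; last by move=> x h; rewrite f0// mulr0.
by move=> x; apply: cvgM; [exact: cvg_cst|exact: cf].
Qed.

Lemma ccMr A f g : cc A f -> continuous g -> cc A (fun x => f x * g x).
Proof.
move=> [cf f0] cg; split; last by move=> x h; rewrite f0// mul0r.
by move=> x; apply: cvgM; [exact: cf|exact: cg].
Qed.

Lemma ccMl A f g : continuous f -> cc A g -> cc A (fun x => f x * g x).
Proof.
move=> cf [cg g0]; split; last by move=> x h; rewrite g0// mulr0.
by move=> x; apply: cvgM; [exact: cf|exact: cg].
Qed.

Lemma ccB A f g : cc A f -> cc A g -> cc A (fun x => f x - g x).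
Proof.
move=> cf cg; have := ccD cf (ccZ (-1) cg).
by under [X in cc _ X]eq_fun do rewrite mulN1r.
Qed.

Lemma cc_RintD A f g : cc A f -> cc A g ->
  \int[mu]_x (f x + g x) = \int[mu]_x f x + \int[mu]_x g x.
Proof. by move=> cf cg; rewrite RintegralD//; [exact: cc_integrable cf|exact: cc_integrable cg]. Qed.

Lemma cc_RintB A f g : cc A f -> cc A g ->
  \int[mu]_x (f x - g x) = \int[mu]_x f x - \int[mu]_x g x.
Proof. by move=> cf cg; rewrite RintegralB//; [exact: cc_integrable cf|exact: cc_integrable cg]. Qed.

Lemma cc_RintZ A f k : cc A f -> \int[mu]_x (k * f x) = k * \int[mu]_x f x.
Proof. by move=> cf; rewrite RintegralZl//; exact: cc_integrable cf. Qed.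

Lemma cc_Rint_le A f g : cc A f -> cc A g -> (forall x, f x <= g x) ->
  \int[mu]_x f x <= \int[mu]_x g x.
Proof. by move=> cf cg fg; rewrite le_Rintegral//; [exact: cc_integrable cf|exact: cc_integrable cg]. Qed.

Definition mass A : R := fine (mu `[-A, A]%classic).

Lemma mass_ge0 A : 0 <= mass A.
Proof. by rewrite fine_ge0. Qed.

Lemma cc_Rint_bound A f M : cc A f -> (forall x, `|x| <= A -> `|f x| <= M) ->
  `|\int[mu]_x f x| <= M * mass A.
Proof.
move=> cf fM; rewrite (cc_restrict cf).
have fi : mu.-integrable `[-A, A] (EFin \o f).
  by apply: integrableS (cc_integrable cf).
have := @le_normr_Rintegral _ _ _ mu `[-A, A] f (measurable_itv _) fi.
move=> /le_trans; apply; rewrite -(@Rintegral_cst _ _ _ mu `[-A, A])//.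
apply: le_Rintegral => //.
- exact: integrable_norm.
- apply: measurable_bounded_integrable => //; first exact: locally_finite_itv.
  exists `|M|; split; first exact: num_real.
  by move=> r Mr x _ /=; rewrite ltW.
- by move=> x /=; rewrite in_itv /= -ler_norml; exact: fM.
Qed.

Lemma cc_Rint_dist A f g e : cc A f -> cc A g ->
  (forall x, `|x| <= A -> `|f x - g x| <= e) ->
  `|\int[mu]_x f x - \int[mu]_x g x| <= e * mass A.
Proof.
by move=> cf cg fg; rewrite -(cc_RintB cf cg); apply: cc_Rint_bound => //; exact: ccB.
Qed.

Lemma cc_Rint_gt0 A f (V : set R) c : cc A f -> (forall x, 0 <= f x) ->
  open V -> (0 < mu V)%E -> 0 < c -> (forall x, V x -> c <= f x) ->
  0 < \int[mu]_x f x.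
Proof.
move=> cf f0 oV mV c0 Vf.
have mV' : measurable (V : set (measurableTypeR R)) by exact: open_measurable.
have VA : V `<=` `[-A, A].
  move=> x /Vf cx /=; rewrite in_itv /= -ler_norml leNgt; apply/negP => /(proj2 cf) fx.
  by move: cx; rewrite fx; lra.
have Vfin : (mu V < +oo)%E.
  by apply: le_lt_trans (locally_finite_itv (-A) A); apply: le_measure; rewrite ?inE.
have fV : mu.-integrable V (EFin \o f).
  by apply: integrableS (cc_integrable cf).
have h1 : c * fine (mu V) <= \int[mu]_(x in V) f x.
  rewrite -(@Rintegral_cst _ _ _ mu V)//; apply: le_Rintegral => //.
  apply: measurable_bounded_integrable => //.
  exists `|c|; split; first exact: num_real.
  by move=> r Mr x _ /=; rewrite ltW.
have h2 : \int[mu]_(x in V) f x <= \int[mu]_x f x.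
  rewrite Rintegral_mkcond; apply: le_Rintegral => //.
  - have := (iffLR (@integrable_mkcond _ _ _ mu V (EFin \o f) mV') fV).
    by apply: eq_integrable => // x _ /=; rewrite restrict_EFin.
  - exact: cc_integrable cf.
  - by move=> x _; rewrite patchE; case: ifP.
apply: lt_le_trans (le_trans h1 h2); rewrite mulr_gt0// fine_gt0//.
by rewrite mV.
Qed.

Lemma cc_continuous_param A F : continuous2 F ->
  (forall x y, A < `|y| -> F x y = 0) -> continuous (fun x => \int[mu]_y F x y).
Proof.
move=> cF F0; apply/continuous_epsP => x e e0.
pose B := `|x| + `|A| + 1.
have K0 : 0 < mass A + 1 by rewrite ltr_wpDl ?ltr01 ?mass_ge0.
have [d d0 Hd] := continuous2_unif B cF (divr_gt0 e0 K0).
exists d => // x' hx'.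
have cFx z : cc A (F z) by split; [exact: continuous2_slice2|move=> y; exact: F0].
apply: le_trans (@cc_Rint_dist A (F x') (F x) (e / (mass A + 1)) (cFx _) (cFx _) _) _.
  move=> y hy; apply: Hd => //; rewrite ?subrr ?normr0// /B.
    by have := normr_ge0 A; lra.
  by have := ler_norm A; have := normr_ge0 x; lra.
rewrite mulrAC ler_pdivrMr// ler_pM2l//; lra.
Qed.

End compactly_supported_integrals.

Section leb_mass.
Context {R : realType}.
Local Notation leb := (@lebesgue_measure R).

Lemma leb_locally_finite : locally_finite leb.
Proof.
move=> x; exists `]x - 1, x + 1[%classic; split.
- exact: interval_open.
- by rewrite /= in_itv /=; apply/andP; split; lra.
- apply: (@le_lt_trans _ _ (lebesgue_measure `]x - 1, x + 1[%classic)) => //.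
  by rewrite lebesgue_measure_itv /=; case: ifP => _; rewrite ltry.
Qed.

Lemma leb_mass (A : R) : 0 <= A -> mass leb A = 2 * A.
Proof.
move=> A0; transitivity (fine (lebesgue_measure `[-A, A]%classic)) => //.
rewrite lebesgue_measure_itv /= lte_fin.
case: ltP => h /=; first lra.
have : A = 0 by lra.
by move=> ->; rewrite mulr0.
Qed.

End leb_mass.

(** * Joint measurability and Fubini's theorem *)

Section caratheodory_functions.
Context {R : realType}.

Definition grid (n : nat) (y : R) : R := (Num.floor (y * n.+1%:R))%:~R / n.+1%:R.

Lemma grid_dist n y : `|grid n y - y| <= n.+1%:R^-1.
Proof.
have n0 : 0 < n.+1%:R :> R by rewrite ltr0n.
have /andP[h1 h2] := floor_itv (y * n.+1%:R).
rewrite intrD in h2.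
have -> : grid n y - y = ((Num.floor (y * n.+1%:R))%:~R - y * n.+1%:R) / n.+1%:R.
  by rewrite mulrBl mulfK// gt_eqF.
rewrite normrM [X in _ * X]gtr0_norm ?invr_gt0// ler_piMl ?invr_ge0 1?ltW//.
rewrite ltr_norml; lra.
Qed.

Lemma grid_cvg y : (fun n => grid n y) @ \oo --> y.
Proof.
apply/cvgrPdist_le => e e0; near=> n.
rewrite distrC (le_trans (grid_dist n y))//; near: n.
have /cvgrPdist_le /(_ e e0) := @cvg_harmonic R.
by apply: filterS => k /=; rewrite sub0r normrN ger0_norm ?invr_ge0.
Unshelve. all: by end_near.
Qed.

(** By continuity in [y], [G] is the pointwise limit of its versions with [y] rounded to the grid;
    these are constant in [y] on countably many cells, hence jointly measurable. *)
Lemma measurable_caratheodory d (T : measurableType d) (G : T -> R -> R) :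
  (forall y, measurable_fun setT (G^~ y)) -> (forall w, continuous (G w)) ->
  measurable_fun setT (fun p : T * measurableTypeR R => G p.1 p.2).
Proof.
move=> mG cG.
apply: (@measurable_fun_cvg _ _ _ setT (fun n p => G p.1 (grid n p.2))); last first.
  move=> -[w y] _ /=; apply: continuous_cvg; [exact: cG|exact: grid_cvg].
move=> n _ E mE; rewrite setTI.
have -> : (fun p : T * measurableTypeR R => G p.1 (grid n p.2)) @^-1` E =
    \bigcup_(k : int) (((G^~ (k%:~R / n.+1%:R)) @^-1` E) `*`
       [set` `[(k%:~R / n.+1%:R : R), ((k + 1)%:~R / n.+1%:R)[]).
  have n0 : 0 < n.+1%:R :> R by rewrite ltr0n.
  apply/seteqP; split => [[w y] /= Ewy|[w y] /= [k _ [/= Ek]]].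
    exists (Num.floor (y * n.+1%:R)) => //; split => //=.
    by rewrite in_itv /= ler_pdivrMr// ltr_pdivlMr// floor_itv.
  rewrite in_itv /= ler_pdivrMr// ltr_pdivlMr// => /floor_def yk.
  by rewrite /grid yk.
apply: countable_bigcupT_measurable; first exact: countableP.
move=> k; apply: measurableX => //.
by rewrite -[X in measurable X]setTI; exact: mG.
Qed.

Lemma measurable_continuous2 (F : R -> R -> R) : continuous2 F ->
  measurable_fun setT (fun p : measurableTypeR R * measurableTypeR R => F p.1 p.2).
Proof.
move=> cF; apply: (@measurable_caratheodory _ (measurableTypeR R) F).
  by move=> y; apply: continuous_measurable_fun; exact: continuous2_slice1.
by move=> x; exact: continuous2_slice2.
Qed.

End caratheodory_functions.

Section sigma_finite_copy.
Context {R : realType}.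
Variable mu : {measure set (measurableTypeR R) -> \bar R}.
Hypothesis lf : locally_finite mu.

Lemma locally_finite_sigma_finite : sigma_finite setT mu.
Proof.
exists (fun n => `[- n%:R, n%:R]%classic).
  apply/esym/seteqP; split => // x _.
  exists (Num.truncn `|x|).+1 => //=.
  by rewrite in_itv /= -ler_norml ltW// truncnS_gt.
by move=> n; split => //; exact: locally_finite_itv.
Qed.

(** An alias of [mu] indexed by the proof of local finiteness, so that the sigma-finite structure
    required by Fubini can be attached to it. *)
Definition sfm of locally_finite mu : set (measurableTypeR R) -> \bar R := mu.

HB.instance Definition _ := Measure.copy (sfm lf) mu.
HB.instance Definition _ := Measure_isSigmaFinite.Build _ _ _ (sfm lf)
  locally_finite_sigma_finite.

End sigma_finite_copy.

Section fubini_compact_support.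
Context {R : realType}.
Variables mu nu : {measure set (measurableTypeR R) -> \bar R}.
Hypotheses (lfmu : locally_finite mu) (lfnu : locally_finite nu).

(** Absolute integrability on the product is automatic: the inner integral of [|F|] is again
    continuous with compact support. *)
Lemma cc_Fubini (A B : R) (F : R -> R -> R) : continuous2 F ->
  (forall x y, A < `|x| -> F x y = 0) -> (forall x y, B < `|y| -> F x y = 0) ->
  \int[mu]_x (\int[nu]_y F x y) = \int[nu]_y (\int[mu]_x F x y).
Proof.
move=> cF FA FB.
have cF1 y : cc A (F^~ y) by split; [exact: continuous2_slice1|move=> x; exact: FA].
have cF2 x : cc B (F x) by split; [exact: continuous2_slice2|move=> y; exact: FB].
pose f (p : measurableTypeR R * measurableTypeR R) := (F p.1 p.2)%:E.
have mf : measurable_fun setT f.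
  by apply/measurable_EFinP; exact: measurable_continuous2.
have cN : continuous2 (fun x y => `|F x y|).
  move=> p; apply: (@continuous_comp _ _ _ _ (fun x : R => `|x|)); first exact: cF.
  exact: norm_continuous.
have cN2 x : cc B (fun y => `|F x y|).
  split; first exact: (@continuous2_slice2 _ (fun x y => `|F x y|) x cN).
  by move=> y /FB ->; rewrite normr0.
have cN1 : cc A (fun x => \int[nu]_y `|F x y|).
  split.
    apply: (@cc_continuous_param _ _ lfnu B (fun x y => `|F x y|) cN).
    by move=> x y h; rewrite FB// normr0.
  move=> x h; under eq_Rintegral do rewrite FA// normr0.
  by rewrite Rintegral_cst// mul0r.
have intf : (sfm lfmu \x sfm lfnu)%E.-integrable setT f.
  apply/integrable12ltyP => //.
  apply: (@le_lt_trans _ _ (\int[mu]_x (\int[nu]_y `|F x y|)%:E)%E).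
    rewrite le_eqVlt; apply/orP; left; apply/eqP; apply: eq_integral => x _.
    rewrite /f /Rintegral fineK//.
    exact: integrable_fin_num (cc_integrable lfnu (cN2 x)).
  exact: integrable_lty (cc_integrable lfmu cN1).
have E := Fubini intf; rewrite /f /= in E.
rewrite /Rintegral; congr fine.
transitivity (\int[mu]_x \int[nu]_y (F x y)%:E)%E.
  apply: eq_integral => x _; rewrite fineK//.
  exact: integrable_fin_num (cc_integrable lfnu (cF2 x)).
transitivity (\int[nu]_y \int[mu]_x (F x y)%:E)%E; first exact: E.
apply: eq_integral => y _; rewrite fineK//.
exact: integrable_fin_num (cc_integrable lfmu (cF1 y)).
Qed.

End fubini_compact_support.

(** * Hat functions and the three-point form of f'' = 2 h m *)

Section three_points.
Context {R : realType}.
Implicit Types (f g h : R -> R) (a b c x y k : R).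

Definition pos x : R := Num.max x 0.

Lemma pos_ge0 x : 0 <= pos x. Proof. by rewrite /pos le_max lexx orbT. Qed.

Lemma posE x : 0 <= x -> pos x = x.
Proof. by move=> x0; rewrite /pos; case: ltP => //; lra. Qed.

Lemma pos0 x : x <= 0 -> pos x = 0.
Proof. by move=> x0; rewrite /pos; case: ltP => //; lra. Qed.

Lemma pos_lip x y : `|pos x - pos y| <= `|x - y|.
Proof.
have [x0|x0] := leP x 0; have [y0|y0] := leP y 0;
  rewrite ?(pos0 x0) ?(pos0 y0) ?(posE (ltW x0)) ?(posE (ltW y0)) //.
- by rewrite subrr normr0.
- rewrite sub0r normrN; rewrite gtr0_norm// ler_normr; lra.
- rewrite subr0 gtr0_norm// ler_normr; lra.
Qed.

Lemma pos_continuous : continuous pos.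
Proof.
apply/continuous_epsP => x e e0; exists e => // y h.
by rewrite (le_trans (pos_lip _ _))// ltW.
Qed.

(* For f'' = 2 h m this is 2 \int tent h dm: three-point form of the equation. *)
Definition T3 a b c f := (c - b) * f a + (b - a) * f c - (c - a) * f b.

(** For a < b < c this is, in [y], the hat supported on [[a, c]] with apex [(b - a) * (c - b)] at
    [b]. Divided by [c - a] it is Green's function on [[a, c]] of minus the second derivative, with
    pole [b]. *)
Definition tent a b c y := T3 a b c (fun x => pos (x - y)).

Lemma T3D a b c f g : T3 a b c (fun x => f x + g x) = T3 a b c f + T3 a b c g.
Proof. rewrite /T3; ring. Qed.

Lemma T3B a b c f g : T3 a b c (fun x => f x - g x) = T3 a b c f - T3 a b c g.
Proof. rewrite /T3; ring. Qed.

Lemma T3Z a b c k f : T3 a b c (fun x => k * f x) = k * T3 a b c f.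
Proof. rewrite /T3; ring. Qed.

Lemma T3_affine a b c k l : T3 a b c (fun x => k * x + l) = 0.
Proof. rewrite /T3; ring. Qed.

Lemma T3_cst a b c l : T3 a b c (fun=> l) = 0.
Proof. rewrite /T3; ring. Qed.

Lemma tent_left a b c y : a < b -> b < c -> y <= a -> tent a b c y = 0.
Proof.
move=> ab bc ya; rewrite /tent /T3 !posE; lra.
Qed.

Lemma tent_right a b c y : a < b -> b < c -> c <= y -> tent a b c y = 0.
Proof. move=> ab bc ya; rewrite /tent /T3 !pos0; lra. Qed.

Lemma tentEl a b c y : a < b -> b < c -> a <= y -> y <= b ->
  tent a b c y = (y - a) * (c - b).
Proof.
move=> ab bc ya yb; rewrite /tent /T3 (@pos0 (a - y)) ?(@posE (c - y)) ?(@posE (b - y)); lra.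
Qed.

Lemma tentEr a b c y : a < b -> b < c -> b <= y -> y <= c ->
  tent a b c y = (c - y) * (b - a).
Proof.
move=> ab bc yb yc; rewrite /tent /T3 (@pos0 (a - y)) ?(@posE (c - y)) ?(@pos0 (b - y)); lra.
Qed.

Lemma tent_bounds a b c y : a < b -> b < c -> 0 <= tent a b c y <= (b - a) * (c - b).
Proof.
move=> ab bc.
have [ya|ay] := leP y a; first by rewrite tent_left// lexx /= mulr_ge0//; lra.
have [cy|yc] := leP c y; first by rewrite tent_right// lexx /= mulr_ge0//; lra.
have [yb|yb] := leP y b.
  rewrite tentEl ?(ltW ay)// mulr_ge0 /= ?ler_pM2r; lra.
rewrite tentEr ?(ltW yb) ?(ltW yc)// mulr_ge0 /=; try lra.
by rewrite [leRHS]mulrC ler_pM2r; lra.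
Qed.

Lemma tent_ge0 a b c y : a < b -> b < c -> 0 <= tent a b c y.
Proof. by move=> ab bc; have /andP[] := tent_bounds y ab bc. Qed.

Lemma tent_continuous2 b : continuous2 (fun a y => pos (a - y)).
Proof.
move=> p; apply: (@continuous_comp _ _ _ (fun p : R * R => p.1 - p.2) pos).
  by apply: cvgB; [exact: cvg_fst|exact: cvg_snd].
exact: pos_continuous.
Qed.

Lemma pos_sub_continuous x : continuous (fun y => pos (x - y)).
Proof. exact: (@continuous2_slice2 _ (fun a y => pos (a - y)) x (tent_continuous2 0)). Qed.

Lemma tent_continuous a b c : continuous (tent a b c).
Proof.
move=> y; apply: cvgB; first apply: cvgD; apply: cvgM;
  try exact: cvg_cst; exact: pos_sub_continuous.
Qed.

Lemma tent_cc A a b c : a < b -> b < c -> - A <= a -> c <= A -> cc A (tent a b c).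
Proof.
move=> ab bc Aa cA; split; first exact: tent_continuous.
move=> y; rewrite ltr_normr => /orP[h|h].
  by rewrite tent_right//; lra.
by rewrite tent_left//; lra.
Qed.

(** In its middle argument the hat is an affine function minus [(be - al)] times the positive part
    of [x - y], and [T3] annihilates affine functions. *)
Lemma T3_green al be a b c y :
  T3 a b c (fun x => tent al x be y) = - (be - al) * tent a b c y.
Proof. rewrite /tent /T3; ring. Qed.

Lemma T3_abs a b c y : T3 a b c (fun x => `|x - y|) = 2 * tent a b c y.
Proof.
have E x : `|x - y| = 2 * pos (x - y) - (1 * x + (- y)).
  have [h|h] := leP 0 (x - y); first by rewrite ger0_norm// posE//; lra.
  by rewrite ltr0_norm// pos0 ?ltW//; lra.
rewrite /T3 !E /tent /T3; ring.
Qed.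

End three_points.

Section string_equation.
Context {R : realType}.
Variable m : {measure set (measurableTypeR R) -> \bar R}.
Hypothesis lf : locally_finite m.
Implicit Types (f g h q : R -> R) (a b c x y k e : R).

(** The equation f'' = 2 h m tested against one hat. Only three values of [f] and the restriction of
    [h] to [[a, c]] enter, so no regularity of [f] is involved and atoms of [m] or gaps in its
    support need no special treatment. *)
Definition rel3 a b c f h :=
  T3 a b c f = 2 * \int[m]_y (tent a b c y * h y).

(* The equation f'' = 2 h m on [al, be], resp. on the line. *)
Definition RelI al be f h := forall a b c, al <= a -> a < b -> b < c -> c <= be ->
  rel3 a b c f h.

Definition Rel f h := forall a b c, a < b -> b < c -> rel3 a b c f h.

Lemma Rel_RelI al be f h : Rel f h -> RelI al be f h.
Proof. by move=> H a b c _ ab bc _; exact: H. Qed.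

Lemma RelI_sub al be al' be' f h : al <= al' -> be' <= be ->
  RelI al be f h -> RelI al' be' f h.
Proof. by move=> h1 h2 H a b c h3 ab bc h4; apply: H => //; lra. Qed.

Lemma tent_mul_cc a b c h : a < b -> b < c -> continuous h ->
  cc (`|a| + `|c|) (fun y => tent a b c y * h y).
Proof.
move=> ab bc ch; apply: ccMr => //; apply: tent_cc => //.
  by have := ler_norm (- a); have := normr_ge0 c; rewrite normrN; lra.
by have := ler_norm c; have := normr_ge0 a; lra.
Qed.

Lemma rel3D a b c f f' h h' : a < b -> b < c -> continuous h -> continuous h' ->
  rel3 a b c f h -> rel3 a b c f' h' ->
  rel3 a b c (fun x => f x + f' x) (fun x => h x + h' x).
Proof.
move=> ab bc ch ch' r r'; rewrite /rel3 T3D r r' -mulrDr.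
by rewrite -(cc_RintD lf (tent_mul_cc ab bc ch) (tent_mul_cc ab bc ch'));
  under [in RHS]eq_Rintegral do rewrite mulrDr.
Qed.

Lemma rel3Z a b c k f h : a < b -> b < c -> continuous h ->
  rel3 a b c f h -> rel3 a b c (fun x => k * f x) (fun x => k * h x).
Proof.
move=> ab bc ch r; rewrite /rel3 T3Z r mulrCA.
by rewrite -(cc_RintZ lf _ (tent_mul_cc ab bc ch));
  under [in RHS]eq_Rintegral do rewrite mulrCA.
Qed.

Lemma rel3B a b c f f' h h' : a < b -> b < c -> continuous h -> continuous h' ->
  rel3 a b c f h -> rel3 a b c f' h' ->
  rel3 a b c (fun x => f x - f' x) (fun x => h x - h' x).
Proof.
move=> ab bc ch ch' r r'; rewrite /rel3 T3B r r' -mulrBr.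
by rewrite -(cc_RintB lf (tent_mul_cc ab bc ch) (tent_mul_cc ab bc ch'));
  under [in RHS]eq_Rintegral do rewrite mulrBr.
Qed.

Lemma rel3_ext a b c f f' h h' : a < b -> b < c ->
  (forall x, a <= x <= c -> f x = f' x) -> (forall x, a <= x <= c -> h x = h' x) ->
  rel3 a b c f h -> rel3 a b c f' h'.
Proof.
move=> ab bc ff hh r; rewrite /rel3; transitivity (T3 a b c f).
  by rewrite /T3 !ff//; apply/andP; split; lra.
rewrite r; congr (2 * _); apply: eq_Rintegral => y _.
have [ya|ay] := leP y a; first by rewrite tent_left// !mul0r.
have [cy|yc] := leP c y; first by rewrite tent_right// !mul0r.
by rewrite hh// !ltW.
Qed.

Lemma rel3_cst a b c k : rel3 a b c (fun=> k) (fun=> 0).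
Proof.
rewrite /rel3 T3_cst; under eq_Rintegral do rewrite mulr0.
by rewrite Rintegral_cst// mul0r mulr0.
Qed.

Lemma rel3_affine a b c k l : rel3 a b c (fun x => k * x + l) (fun=> 0).
Proof.
rewrite /rel3 T3_affine; under eq_Rintegral do rewrite mulr0.
by rewrite Rintegral_cst// mul0r mulr0.
Qed.

(** Both sides are continuous for uniform convergence on [[a, c]]; a defect [d] is contradicted by
    an approximation that is fine enough. *)
Lemma rel3_limit a b c f h : a < b -> b < c -> continuous h ->
  (forall e, 0 < e -> exists f' h', [/\ continuous h', rel3 a b c f' h',
     forall x, a <= x <= c -> `|f' x - f x| <= e &
     forall x, a <= x <= c -> `|h' x - h x| <= e]) -> rel3 a b c f h.
Proof.
move=> ab bc ch H; apply/eqP; rewrite -subr_eq0 -normr_le0 leNgt; apply/negP => d0.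
set d := `|_| in d0.
pose A := `|a| + `|c|; pose M := mass m A.
have M0 : 0 <= M by exact: mass_ge0.
(* An approximation within [e] changes the defect by less than [K * e], so [e = d / (2 * K)] is
   enough. *)
pose K := 2 * (c - a) + 2 * ((b - a) * (c - b)) * M + 1.
have p0 : 0 <= (b - a) * (c - b) by rewrite mulr_ge0//; lra.
have q0 : 0 <= 2 * ((b - a) * (c - b)) * M by rewrite mulr_ge0// mulr_ge0.
have K0 : 0 < K by rewrite /K; lra.
have e0 : 0 < d / (2 * K) by rewrite divr_gt0// mulr_gt0.
have [f' [h' [ch' r df dh]]] := H _ e0.
set e := d / (2 * K) in e0 df dh.
have h1 : `|T3 a b c f' - T3 a b c f| <= 2 * (c - a) * e.
  rewrite -T3B /T3.
  have := df a; have := df b; have := df c; rewrite !ler_norml.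
  move=> /(_ _) /andP[|u1 u2]; first by apply/andP; split; lra.
  move=> /(_ _) /andP[|u3 u4]; first by apply/andP; split; lra.
  move=> /(_ _) /andP[|u5 u6]; first by apply/andP; split; lra.
  apply/andP; split; nra.
have h2 : `|\int[m]_y (tent a b c y * h' y) - \int[m]_y (tent a b c y * h y)| <=
    (b - a) * (c - b) * e * M.
  apply: (cc_Rint_dist lf (tent_mul_cc ab bc ch') (tent_mul_cc ab bc ch)) => y _.
  rewrite -mulrBr normrM.
  have /andP[t0 t1] := tent_bounds y ab bc.
  have [ya|ay] := leP y a.
    by rewrite tent_left// normr0 mul0r mulr_ge0// ltW.
  have [cy|yc] := leP c y.
    by rewrite tent_right// normr0 mul0r mulr_ge0// ltW.
  by rewrite ger0_norm// ler_pM// dh// !ltW.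
have : d <= (2 * (c - a) + 2 * ((b - a) * (c - b)) * M) * e.
  rewrite /d; move: r h1 h2; rewrite /rel3 => ->.
  set I1 := \int[m]_y _; set I2 := \int[m]_y _ => h1 h2.
  have -> : T3 a b c f - 2 * I2 = - (2 * I1 - T3 a b c f) + 2 * (I1 - I2) by ring.
  rewrite (le_trans (ler_normD _ _))// normrN [leRHS]mulrDl; apply: lerD => //.
  rewrite normrM ger0_norm//.
  rewrite (_ : 2 * _ * M * e = 2 * ((b - a) * (c - b) * e * M)); last by ring.
  by rewrite ler_pM2l.
have : (2 * (c - a) + 2 * ((b - a) * (c - b)) * M) * e <= K * e.
  by rewrite ler_pM2r// /K; lra.
have : K * e = d / 2 by rewrite /e; field; rewrite gt_eqF.
by lra.
Qed.

End string_equation.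

(** * The maximum principle, with maximizers in the support *)

Section maximum_principle.
Context {R : realType}.
Variable m : {measure set (measurableTypeR R) -> \bar R}.
Hypothesis lf : locally_finite m.
Implicit Types (f g h q D v phi : R -> R) (a b c x y k e : R).

Lemma closed_supp : closed (supp m).
Proof.
move=> x clx V oV Vx.
have [y [sy Vy]] := clx V (open_nbhs_nbhs (conj oV Vx)).
exact: sy.
Qed.

Lemma not_supp x : ~ supp m x ->
  exists2 d, 0 < d & m `]x - d, x + d[%classic = 0%E.
Proof.
move=> /existsNP [V /not_implyP [oV /not_implyP [Vx /negP]]].
rewrite -leNgt => mV.
have /nbhs_ballP [d /= d0 dV] := open_nbhs_nbhs (conj oV Vx).
exists d => //; apply/eqP; rewrite eq_le measure_ge0 andbT.
apply: le_trans mV; apply: le_measure; rewrite ?inE//.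
  exact: open_measurable.
move=> y /=; rewrite in_itv /= => yd; apply: dV.
by rewrite /ball /= ltr_norml; lra.
Qed.

Lemma Rint_null_itv a b (f : R -> R) : m `]a, b[%classic = 0%E ->
  (forall y, y <= a -> f y = 0) -> (forall y, b <= y -> f y = 0) ->
  continuous f -> \int[m]_y f y = 0.
Proof.
move=> mab fa fb cf.
have -> : \int[m]_y f y = \int[m]_(y in `]a, b[) f y.
  rewrite [RHS]Rintegral_mkcond; apply: eq_Rintegral => y _; rewrite patchE.
  case: ifPn => //; rewrite notin_setE /= in_itv /= => /negP.
  by rewrite negb_and -!leNgt => /orP[/fa|/fb].
rewrite /Rintegral; rewrite null_set_integral//.
by apply/measurable_EFinP; apply: measurable_funTS; exact: continuous_measurable_fun.
Qed.

(* The largest maximizer lies in the support, since off the support [D] is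
   affine, and [D] cannot be convex around it. *)
Lemma max_in_supp al be D q x0 : continuous D -> continuous q ->
  RelI m al be D q -> al <= x0 <= be -> D al < D x0 -> D be < D x0 ->
  (forall x, al <= x <= be -> D x <= D x0) ->
  exists x1, [/\ al < x1 < be, supp m x1, D x1 = D x0 & q x1 <= 0].
Proof.
move=> cD cq rD x0I Dal Dbe Dmax.
pose S := [set x | al <= x <= be /\ D x = D x0].
have Sx0 : S x0 by [].
have supS : has_sup S.
  by split; [exists x0|exists be => x [/andP[]]].
pose x1 := sup S.
have ubS x : S x -> x <= x1 by move=> Sx; exact: sup_ubound (proj2 supS) x Sx.
have x1I : al <= x1 <= be.
  apply/andP; split; first by apply: le_trans (ubS _ Sx0); case/andP: x0I.
  by apply: ge_sup; [exists x0|move=> x [/andP[]]].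
have Dx1 : D x1 = D x0.
  apply/eqP; rewrite eq_le Dmax//= leNgt; apply/negP => lt1.
  have [d d0 Hd] := iffLR (continuous_epsP D) cD x1 ((D x0 - D x1) / 2) ltac:(lra).
  have [y Sy yx1] := sup_adherent d0 supS.
  have := Hd y; rewrite (proj2 Sy).
  have := ubS y Sy; rewrite -/x1 in yx1 => yx.
  rewrite ler0_norm; last by lra.
  by move=> /(_ ltac:(lra)); rewrite ger0_norm; lra.
have x1lt : al < x1 < be.
  case/andP: x1I; rewrite !le_eqVlt => /orP[/eqP h|->].
    by move: Dal; rewrite h Dx1 ltxx.
  by case/orP => [/eqP h|->//]; move: Dbe; rewrite -h Dx1 ltxx.
(* With a nonnegative right-hand side the three-point relation reads as midpoint convexity of [D] at
   its maximizer [x1]. Then [x1 + r] is a maximizer too, although [x1] is the largest one. *)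
have key r : 0 < r -> al <= x1 - r -> x1 + r <= be ->
    (0 <= \int[m]_y (tent (x1 - r) x1 (x1 + r) y * q y)) -> False.
  move=> r0 h1 h2 I0.
  have := rD (x1 - r) x1 (x1 + r) h1 ltac:(lra) ltac:(lra) h2.
  rewrite /rel3 /T3 => E.
  have Da : D (x1 - r) <= D x1 by rewrite Dx1 Dmax//; apply/andP; split; lra.
  have Dc : D (x1 + r) <= D x1 by rewrite Dx1 Dmax//; apply/andP; split; lra.
  have Dc' : D (x1 + r) = D x1.
    apply/eqP; rewrite eq_le Dc /=.
    have : 0 <= r * (D (x1 - r) - D x1) + r * (D (x1 + r) - D x1).
      have -> : r * (D (x1 - r) - D x1) + r * (D (x1 + r) - D x1) =
        (x1 + r - x1) * D (x1 - r) + (x1 - (x1 - r)) * D (x1 + r) -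
        (x1 + r - (x1 - r)) * D x1 by ring.
      by rewrite E mulr_ge0.
    by rewrite -mulrDr pmulr_rge0// => k; lra.
  have := ubS (x1 + r); rewrite /S /= Dc' Dx1 => /(_ _).
  move=> H; have : x1 + r <= x1 by apply: H; split => //; apply/andP; split; lra.
  by lra.
exists x1; split => //.
  apply: contrapT => /not_supp [d d0 md].
  pose r := Num.min d (Num.min (x1 - al) (be - x1)).
  have r0 : 0 < r by rewrite !lt_min d0 !subr_gt0; case/andP: x1lt => -> ->.
  have rd : r <= d by rewrite ge_min lexx.
  have ra : r <= x1 - al by rewrite !ge_min lexx orbT.
  have rb : r <= be - x1 by rewrite !ge_min lexx !orbT.
  apply: (key r) => //; [lra|lra|].
  rewrite (@Rint_null_itv (x1 - d) (x1 + d))//.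
  - by move=> y yd; rewrite tent_left ?mul0r//; lra.
  - by move=> y yd; rewrite tent_right ?mul0r//; lra.
  - move=> y; apply: cvgM; [exact: tent_continuous|exact: cq].
rewrite leNgt; apply/negP => q0.
have [d d0 Hd] := iffLR (continuous_epsP q) cq x1 (q x1 / 2) ltac:(lra).
pose r := Num.min (d / 2) (Num.min (x1 - al) (be - x1)).
have r0 : 0 < r by rewrite !lt_min divr_gt0// !subr_gt0; case/andP: x1lt => -> ->.
have rd : r <= d / 2 by rewrite ge_min lexx.
have ra : r <= x1 - al by rewrite !ge_min lexx orbT.
have rb : r <= be - x1 by rewrite !ge_min lexx !orbT.
apply: (key r) => //; [lra|lra|].
apply: Rintegral_ge0 => y _.
have [ya|ay] := leP y (x1 - r); first by rewrite tent_left ?mul0r//; lra.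
have [cy|yc] := leP (x1 + r) y; first by rewrite tent_right ?mul0r//; lra.
rewrite mulr_ge0 ?tent_ge0//; try lra.
by have := Hd y; rewrite ltr_norml ler_norml => /(_ ltac:(lra)); lra.
Qed.

(** If [v - phi] had a positive maximum, [max_in_supp] would produce a point of the support with
    [phi < v] and [p <= q], against the last hypothesis. That hypothesis is the supersolution
    property in the form in which barriers verify it. *)
Lemma comparison_itv al be v phi p q :
  continuous v -> continuous phi -> continuous p -> continuous q ->
  RelI m al be v p -> RelI m al be phi q ->
  v al <= phi al -> v be <= phi be ->
  (forall x, al < x < be -> supp m x -> phi x < v x -> q x < p x) ->
  forall x, al <= x <= be -> v x <= phi x.
Proof.
move=> cv cphi cp cq rv rphi hal hbe H x xI.
have ab : al <= be by case/andP: xI => *; lra.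
pose D y := v y - phi y.
have cD : continuous D by move=> y; apply: cvgB; [exact: cv|exact: cphi].
have [x0 x0I Dmax] := EVT_max ab (continuous_subspaceT cD).
have [Dx0|Dx0] := leP (D x0) 0.
  by have := Dmax x; rewrite in_itv /= => /(_ xI); rewrite /D in Dx0 *; lra.
have rD : RelI m al be D (fun y => p y - q y).
  by move=> a b c h1 h2 h3 h4; apply: rel3B => //; [exact: rv|exact: rphi].
have cpq : continuous (fun y => p y - q y).
  by move=> y; apply: cvgB; [exact: cp|exact: cq].
have [||||x1 [x1I sx1 Dx1 pq]] := max_in_supp (x0 := x0) cD cpq rD.
- by rewrite in_itv in x0I.
- by rewrite /D in Dx0 *; lra.
- by rewrite /D in Dx0 *; lra.
- by move=> y yI; apply: Dmax; rewrite in_itv.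
have := H x1 x1I sx1; rewrite /D in Dx1 Dx0 => /(_ ltac:(lra)); lra.
Qed.

Lemma comparison_line v phi p q :
  continuous v -> continuous phi -> continuous p -> continuous q ->
  Rel m v p -> Rel m phi q ->
  (exists A, forall x, A <= `|x| -> v x <= phi x) ->
  (forall x, supp m x -> phi x < v x -> q x < p x) ->
  forall x, v x <= phi x.
Proof.
move=> cv cphi cp cq rv rphi [A HA] H x.
pose B := `|A| + `|x| + 1.
have nA := normr_ge0 A; have nx := normr_ge0 x.
have AB : A <= `|B| by rewrite ger0_norm /B; have := ler_norm A; lra.
apply: (@comparison_itv (- B) B v phi p q) => //.
- exact: Rel_RelI.
- exact: Rel_RelI.
- by apply: HA; rewrite normrN.
- exact: HA.
- by move=> y _; exact: H.
- by rewrite -ler_norml /B; lra.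
Qed.

End maximum_principle.

(** * Psi as an integral against [m] *)

Section psi_kernel.
Context {R : realType}.
Variable m : {measure set (measurableTypeR R) -> \bar R}.
Hypothesis lf : locally_finite m.
Local Notation leb := (@lebesgue_measure R).
Implicit Types (f g h q D v phi : R -> R) (a b c x y s k e A : R).

(** The kernel obtained by exchanging the two integrations in the definition of [Psi]. Its second
    derivative in [x] is |y| times the unit mass at [y], which is what [T3_kap] expresses. *)
Definition kap x y : R := pos (x - y) * pos y + pos (y - x) * pos (- y).

Lemma kap_continuous2 : continuous2 kap.
Proof.
have cp (u : R * R -> R) : continuous u -> continuous (fun p => pos (u p)).
  by move=> cu p; apply: (@continuous_comp _ _ _ u pos); [exact: cu|exact: pos_continuous].
move=> p; apply: cvgD; apply: cvgM.
- by apply: (cp (fun p => p.1 - p.2)) => r; apply: cvgB; [exact: cvg_fst|exact: cvg_snd].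
- by apply: (cp (fun p => p.2)) => r; exact: cvg_snd.
- by apply: (cp (fun p => p.2 - p.1)) => r; apply: cvgB; [exact: cvg_snd|exact: cvg_fst].
- by apply: (cp (fun p => - p.2)) => r; apply: cvgN; exact: cvg_snd.
Qed.

Lemma kap_out x y : `|x| < `|y| -> kap x y = 0.
Proof.
rewrite ltr_normr !ltr_norml /kap => /orP[|] /andP[h1 h2].
  by rewrite (@pos0 _ (x - y)) ?(@pos0 _ (- y)) ?mul0r ?mulr0 ?addr0//; lra.
by rewrite (@pos0 _ y) ?(@pos0 _ (y - x)) ?mul0r ?mulr0 ?addr0//; lra.
Qed.

Lemma kap_cc A x : `|x| <= A -> cc A (kap x).
Proof.
move=> xA; split; first exact: continuous2_slice2 kap_continuous2.
by move=> y Ay; apply: kap_out; exact: le_lt_trans Ay.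
Qed.

Lemma kap_ge0 x y : 0 <= kap x y.
Proof. by rewrite addr_ge0// mulr_ge0// pos_ge0. Qed.

Lemma T3_kap a b c y : T3 a b c (fun x => kap x y) = tent a b c y * `|y|.
Proof.
have E x : pos (y - x) = pos (x - y) - (x - y).
  have [h|h] := leP 0 (x - y); first by rewrite (posE h) pos0; lra.
  by rewrite (pos0 (ltW h)) posE; lra.
have [y0|y0] := leP 0 y.
  by rewrite /tent /T3 /kap (posE y0) (@pos0 _ (- y)) ?ger0_norm//; [ring|lra].
rewrite /tent /T3 /kap (pos0 (ltW y0)) (@posE _ (- y)) ?ltr0_norm//; last lra.
by rewrite !E; ring.
Qed.

Lemma tonelli_sections (D : R -> R -> bool) (w : R -> R) :
  measurable_fun setT (fun p : measurableTypeR R * measurableTypeR R => D p.1 p.2) ->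
  (forall y, 0 <= w y) -> continuous w ->
  (\int[leb]_s \int[m]_y (if D s y then w y else 0)%:E =
   \int[m]_y \int[leb]_s (if D s y then w y else 0)%:E)%E.
Proof.
move=> mD w0 cw.
pose f (p : measurableTypeR R * measurableTypeR R) :=
  (if D p.1 p.2 then w p.2 else 0)%:E.
have mf : measurable_fun setT f.
  apply/measurable_EFinP; apply: measurable_fun_ifT => //.
  by apply: measurableT_comp => //; exact: continuous_measurable_fun.
have f0 p : (0 <= f p)%E by rewrite lee_fin; case: ifP.
exact: (@fubini_tonelli _ _ _ _ _ (sfm leb_locally_finite) (sfm lf) f mf f0).
Qed.

(** Tonelli's computation common to both signs of [x]: [D] is the domain of the double integral, [w]
    the positive or negative part of [y], and [ph] the inner integral against [m]. *)
Lemma Psi_sections x a b (D : R -> R -> bool) (w ph : R -> R) :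
  measurable_fun setT (fun p : measurableTypeR R * measurableTypeR R => D p.1 p.2) ->
  (forall y, 0 <= w y) -> continuous w ->
  (forall s y, D s y -> a <= s <= b) ->
  (forall y, \int[leb]_s (if D s y then w y else 0)%:E = (kap x y)%:E)%E ->
  (forall s, a <= s <= b -> (\int[m]_y (if D s y then w y else 0)%:E = (ph s)%:E)%E) ->
  (\int[leb]_(s in `[a, b]) (2 * ph s)%:E)%E = (2 * \int[m]_y kap x y)%:E.
Proof.
move=> mD w0 cw Dab kE phE.
pose I : set R := `[a, b]%classic.
have kf : (\int[m]_y (kap x y)%:E)%E \is a fin_num.
  exact: integrable_fin_num (cc_integrable lf (kap_cc (lexx `|x|))).
have mI : measurable_fun setT (fun s : measurableTypeR R => \int[m]_y (if D s y then w y else 0)%:E)%E.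
  have := @measurable_fun_fubini_tonelli_F _ _ _ _ _ (sfm lf)
    (fun p : measurableTypeR R * measurableTypeR R => (if D p.1 p.2 then w p.2 else 0)%:E).
  apply; last by move=> p /=; rewrite lee_fin; case: ifP.
  apply/measurable_EFinP; apply: measurable_fun_ifT => //.
  by apply: measurableT_comp => //; exact: continuous_measurable_fun.
rewrite EFinM [X in (_ * X)%E](_ : _ = \int[m]_y (kap x y)%:E)%E; last by rewrite fineK.
transitivity (\int[leb]_(s in I) (2%:E * \int[m]_y (if D s y then w y else 0)%:E))%E.
  apply: eq_integral => s; rewrite inE /= in_itv /= => sx.
  by rewrite phE// EFinM.
rewrite ge0_integralZl_EFin//; last 3 first.
- exact: measurable_itv.
- by move=> s _; apply: integral_ge0 => y _; rewrite lee_fin; case: ifP.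
- exact: measurable_funTS.
congr (_ * _)%E.
transitivity (\int[leb]_s (\int[m]_y (if D s y then w y else 0)%:E))%E.
  rewrite integral_mkcond; apply: eq_integral => s _; rewrite patchE.
  case: ifPn => //; rewrite mem_setE in_itv /= => h.
  rewrite integral0_eq// => y _; case: ifP => // /Dab sab.
  by rewrite sab in h.
by rewrite (tonelli_sections mD w0 cw); apply: eq_integral => y _; rewrite -kE.
Qed.

Lemma id_integrable_itv a b (i : interval R) : [set` i] `<=` `[a, b]%classic ->
  m.-integrable [set` i] (EFin \o (@id R)).
Proof.
move=> iab; apply: measurable_bounded_integrable => //.
  apply: le_lt_trans (locally_finite_itv lf a b); apply: le_measure; rewrite ?inE//.
exists (`|a| + `|b|); split; first exact: num_real.
move=> r sr y /= /iab; rewrite /= in_itv /= => /andP[y0 ys].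
apply: le_trans (ltW sr); rewrite ler_norml.
have := ler_norm (- a); have := ler_norm b; rewrite normrN.
by have := normr_ge0 a; have := normr_ge0 b; lra.
Qed.

Lemma Psi_kap x : Psi m x = 2 * \int[m]_y kap x y.
Proof.
have m1 : measurable_fun setT (fun p : measurableTypeR R * measurableTypeR R => p.1 : R) by exact: measurable_fst.
have m2 : measurable_fun setT (fun p : measurableTypeR R * measurableTypeR R => p.2 : R) by exact: measurable_snd.
have [x0|x0] := leP 0 x.
  have E : (\int[leb]_(s in `[0%R : R, x]) (2 * \int[m]_(y in `[0%R : R, s[) y)%:E)%E =
      (2 * \int[m]_y kap x y)%:E.
    apply: (@Psi_sections x 0 x (fun s y => [&& 0 <= s <= x, 0 <= y & y < s]) pos).
    - by repeat apply: measurable_and; try exact: measurable_fun_ler; exact: measurable_fun_ltr.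
    - exact: pos_ge0.
    - exact: pos_continuous.
    - by move=> s y /and3P[].
    - move=> y; have [y0|y0] := ltP y 0.
        rewrite /kap (pos0 (ltW y0)) (@pos0 _ (y - x)) ?mul0r ?mulr0 ?addr0; last lra.
        by rewrite integral0_eq// => s _ /=; rewrite andbF.
      transitivity (\int[leb]_(s in `]y, x]) (pos y)%:E)%E.
        rewrite [RHS]integral_mkcond; apply: eq_integral => s _.
        rewrite patchE mem_setE in_itv /= ?y0 /=.
        case: (ltP y s) => ys; rewrite ?andbF//= andbT.
        have -> : 0 <= s by lra.
        by rewrite /=; case: ifP.
      rewrite integral_cst//=.
      transitivity ((pos y)%:E * lebesgue_measure `]y, x]%classic)%E => //.
      rewrite lebesgue_measure_itv /= lte_fin /kap (@pos0 _ (- y)) ?mulr0 ?addr0; last lra.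
      case: ltP => h; first by rewrite (@posE _ (x - y)) -?EFinM ?(mulrC (x - y))//; lra.
      by rewrite (@pos0 _ (x - y)) ?mul0r ?mule0//; lra.
    - move=> s sx; rewrite [in RHS]/Rintegral fineK; last first.
        apply: integrable_fin_num => //; apply: (@id_integrable_itv 0 s).
        by apply: subset_itvl; rewrite bnd_simp.
      rewrite [RHS]integral_mkcond; apply: eq_integral => y _.
      rewrite patchE mem_setE in_itv /= sx /=.
      by case: ifPn => // /andP[y0 _]; rewrite posE.
  rewrite /Psi x0 /Rintegral.
  transitivity (fine (2 * \int[m]_y kap x y)%:E) => //; rewrite -E; congr fine.
  apply: eq_integral => s; rewrite inE /= in_itv /= => /andP[s0 _].
  by rewrite /Phi s0.
have E : (\int[leb]_(s in `[x, 0%R : R]) (2 * - \int[m]_(y in `[s, 0%R : R[) y)%:E)%E =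
    (2 * \int[m]_y kap x y)%:E.
  apply: (@Psi_sections x x 0 (fun s y => [&& x <= s <= 0, s <= y & y < 0]) (fun y => pos (- y))).
  - by repeat apply: measurable_and; try exact: measurable_fun_ler; exact: measurable_fun_ltr.
  - by move=> y; exact: pos_ge0.
  - move=> y; apply: continuous_comp; [exact: oppr_continuous|exact: pos_continuous].
  - by move=> s y /and3P[].
  - move=> y; have [y0|y0] := leP 0 y.
      rewrite /kap (@pos0 _ (- y)) ?mulr0 ?addr0; last lra.
      rewrite (@pos0 _ (x - y)) ?mul0r; last lra.
      by rewrite integral0_eq// => s _ /=; rewrite !andbF.
    transitivity (\int[leb]_(s in `[x, y]) (pos (- y))%:E)%E.
      rewrite [RHS]integral_mkcond; apply: eq_integral => s _.
      rewrite patchE mem_setE in_itv /= ?y0 /= andbT.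
      case: (leP s y) => ys; rewrite ?andbF//= andbT.
      have -> : s <= 0 by lra.
      by rewrite andbT; case: ifP.
    rewrite integral_cst//=.
    transitivity ((pos (- y))%:E * lebesgue_measure `[x, y]%classic)%E => //.
    rewrite lebesgue_measure_itv /= lte_fin /kap (@pos0 _ y) ?mulr0 ?add0r; last lra.
    case: ltP => h; first by rewrite (@posE _ (y - x)) -?EFinM ?(mulrC (y - x))//; lra.
    by rewrite (@pos0 _ (y - x)) ?mul0r ?mule0//; lra.
  - move=> s sx; rewrite [in RHS]/Rintegral.
    have fi : m.-integrable `[s, 0[ (EFin \o (@id R)).
      apply: (@id_integrable_itv s 0).
      by apply: subset_itvl; rewrite bnd_simp.
    rewrite EFinN fineK; last exact: integrable_fin_num fi.
    rewrite -integralN; last exact: integrable_add_def fi.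
    rewrite [RHS]integral_mkcond; apply: eq_integral => y _.
    rewrite patchE mem_setE in_itv /= sx /=.
    by case: ifPn => // /andP[_ y0]; rewrite posE//; lra.
rewrite /Psi leNgt x0 /= /Rintegral.
transitivity (fine (2 * \int[m]_y kap x y)%:E) => //; rewrite -E -fineN; congr fine.
(* At [s = 0] the definition of [Phi] takes its first branch, but both integrals are then over an
   empty interval. *)
have PhiE s : x <= s <= 0 -> Phi m s = - (2 * - \int[m]_(y in `[s, 0%R[) y).
  move=> /andP[_ s0]; rewrite /Phi mulrN opprK; case: ifP => // s0'.
  have -> : s = 0 by lra.
  by rewrite set_itvxx.
transitivity (- \int[leb]_(y in `[x, 0%R : R]) (- (2 * - \int[m]_(z in `[y, 0%R : R[) z)%:E))%E.
  congr (- _)%E; apply: eq_integral => s; rewrite inE /= in_itv /= => h.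
  by rewrite PhiE// EFinN.
rewrite integral_ge0N ?oppeK//.
move=> s /=; rewrite in_itv /= => h; rewrite lee_fin mulr_ge0//.
have fi : m.-integrable `[s, 0[ (EFin \o (@id R)).
  apply: (@id_integrable_itv s 0).
  by apply: subset_itvl; rewrite bnd_simp.
rewrite oppr_ge0 -fine0 fine_le//; first exact: integrable_fin_num fi.
apply: (@le_trans _ _ (\int[m]_(y in `[s, 0%R : R[) 0%:E)%E).
  apply: le_integral => //; first exact: integrable0.
  by move=> y; rewrite inE /= in_itv /= lee_fin => /andP[_ /ltW].
by rewrite integral0.
Qed.

End psi_kernel.

(** * The weight 1 + Psi, functions affine on gaps, and growth at infinity *)

Section weight.
Context {R : realType}.
Variable m : {measure set (measurableTypeR R) -> \bar R}.
Hypothesis lf : locally_finite m.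
Implicit Types (f g h q D v phi : R -> R) (a b c x y s k e A M : R).

Lemma Psi_continuous : continuous (Psi m).
Proof.
apply: continuous_approx => A e e0.
pose B := `|A|.
have B0 : 0 <= B by exact: normr_ge0.
(* Truncation of [x] to [[-B, B]], which gives all the kernels [kap (cl x)] one compact support. *)
pose cl x := pos (x + B) - pos (x - B) - B.
have clE x : `|x| <= B -> cl x = x.
  rewrite ler_norml /cl => /andP[h1 h2]; rewrite posE ?pos0//; lra.
have clB x : `|cl x| <= B.
  rewrite /cl ler_norml; have [h1|h1] := leP (x + B) 0; have [h2|h2] := leP (x - B) 0.
  - by rewrite !pos0//; lra.
  - by lra.
  - by rewrite (pos0 h2) posE; lra.
  - by rewrite !posE; lra.
have cc : continuous cl.
  have cs k : continuous (fun x => pos (x + k)).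
    move=> x; apply: (@continuous_comp _ _ _ (fun x => x + k) pos); last exact: pos_continuous.
    by apply: cvgD; [exact: cvg_id|exact: cvg_cst].
  by move=> x; apply: cvgB; [apply: cvgB; exact: cs|exact: cvg_cst].
exists (fun x => 2 * \int[m]_y kap (cl x) y); split; last first.
  move=> x xA; have xB : `|x| <= B by rewrite (le_trans xA)// ler_norm.
  by rewrite clE// Psi_kap// subrr normr0 ltW.
move=> x; apply: cvgM; first exact: cvg_cst.
apply: (@cc_continuous_param _ _ lf B (fun x y => kap (cl x) y)).
  exact: continuous2_comp1 kap_continuous2 cc.
by move=> z y By; apply: kap_out; apply: le_lt_trans By.
Qed.

Lemma Psi_ge0 x : 0 <= Psi m x.
Proof.
by rewrite Psi_kap// mulr_ge0//; apply: Rintegral_ge0 => y _; exact: kap_ge0.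
Qed.

Lemma Psi_at0 : Psi m 0 = 0.
Proof.
rewrite Psi_kap// (@eq_Rintegral _ _ _ _ _ (fun=> 0)).
  by rewrite Rintegral_cst// mul0r mulr0.
move=> y _; have [->|y0] := eqVneq y 0; last by rewrite kap_out// normr0 normr_gt0.
by rewrite /kap oppr0 (pos0 (lexx 0)) !mulr0 addr0.
Qed.

(** That is, Psi'' = 2 |x| m: integrate [T3_kap] in [y]. *)
Lemma Rel_Psi : Rel m (Psi m) (fun x => `|x|).
Proof.
move=> a b c ab bc; rewrite /rel3.
pose A := `|a| + `|b| + `|c|.
have na := normr_ge0 a; have nb := normr_ge0 b; have nc := normr_ge0 c.
have ca : cc A (kap a) by apply: kap_cc; rewrite /A; lra.
have cb : cc A (kap b) by apply: kap_cc; rewrite /A; lra.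
have cc' : cc A (kap c) by apply: kap_cc; rewrite /A; lra.
rewrite /T3 !Psi_kap//.
under [in RHS]eq_Rintegral do rewrite -T3_kap /T3.
rewrite (cc_RintB lf (ccD (ccZ _ ca) (ccZ _ cc')) (ccZ _ cb)).
rewrite (cc_RintD lf (ccZ _ ca) (ccZ _ cc')).
rewrite (cc_RintZ lf _ ca) (cc_RintZ lf _ cb) (cc_RintZ lf _ cc').
ring.
Qed.

(** The gauge for growth at infinity. It is at least 1, satisfies w'' = 2 |x| m, and dominates a
    multiple of |x|; hence w'' <= 2 C1 w m, which makes its multiples supersolutions for small
    resolvent parameters. *)
Definition wgt x : R := 1 + Psi m x.

Lemma wgt_ge1 x : 1 <= wgt x.
Proof. by rewrite lerDl Psi_ge0. Qed.

Lemma wgt_gt0 x : 0 < wgt x.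
Proof. exact: lt_le_trans (wgt_ge1 x). Qed.

Lemma wgt_continuous : continuous wgt.
Proof. by move=> x; apply: cvgD; [exact: cvg_cst|exact: Psi_continuous]. Qed.

Lemma abs_continuous : continuous (fun x : R => `|x|).
Proof. exact: norm_continuous. Qed.

Lemma Rel_wgt : Rel m wgt (fun x => `|x|).
Proof.
move=> a b c ab bc.
have c0 : continuous (fun _ : R => 0 : R) by move=> z; exact: cvg_cst.
apply: (rel3_ext ab bc (f := fun x => 1 + Psi m x) (h := fun x => 0 + `|x|)) => //.
  by move=> x _; rewrite add0r.
apply: (rel3D lf ab bc c0 abs_continuous (rel3_cst _ _ _ _ _)).
exact: Rel_Psi.
Qed.

(* Affine on the complement of the support. *)
Definition gap_affine f := forall a b c, a < b -> b < c ->
  (forall x, a < x < c -> ~ supp m x) -> T3 a b c f = 0.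

(** Compare [f] with its chord from above and from below: the condition on points of the support is
    vacuous inside a gap. *)
Lemma Rel_gap_affine f h : continuous f -> continuous h -> Rel m f h -> gap_affine f.
Proof.
move=> cf ch rf a b c ab bc ns.
pose k := (f c - f a) / (c - a); pose l := f a - k * a.
have kE : k * (c - a) = f c - f a by rewrite /k mulfVK// subr_eq0 gt_eqF//; lra.
have c0 : continuous (fun _ : R => 0 : R) by move=> z; exact: cvg_cst.
have cphi : continuous (fun x => k * x + l).
  by move=> x; apply: cvgD; [apply: cvgM; [exact: cvg_cst|exact: cvg_id]|exact: cvg_cst].
have bI : a <= b <= c by lra.
have e1 : f a = k * a + l by rewrite /l; ring.
have e2 : f c = k * c + l by rewrite /l; move: kE; lra.
have h1 : f b <= k * b + l.
  apply: (@comparison_itv _ m lf a c f (fun x => k * x + l) h (fun=> 0)) => //.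
  - exact: Rel_RelI.
  - by move=> ? ? ? _ ? ? _; exact: rel3_affine.
  - by rewrite -e1.
  - by rewrite -e2.
  - by move=> x /ns.
have h2 : k * b + l <= f b.
  apply: (@comparison_itv _ m lf a c (fun x => k * x + l) f (fun=> 0) h) => //.
  - by move=> ? ? ? _ ? ? _; exact: rel3_affine.
  - exact: Rel_RelI.
  - by rewrite -e1.
  - by rewrite -e2.
  - by move=> x /ns.
have e3 : f b = k * b + l by lra.
rewrite /T3 e1 e2 e3; ring.
Qed.

Hypothesis m_supp : forall b : R, 0 < b ->
  supp m `&` `]-oo, - b] !=set0 /\ supp m `&` `[b, +oo[ !=set0.

(** Because the support is unbounded on both sides, a gap is a bounded interval with endpoints in
    the closed set [supp m]. *)
Lemma gap_ends x : ~ supp m x -> exists p q : R, [/\ p < x < q, supp m p, supp m q &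
  forall y, p < y < q -> ~ supp m y].
Proof.
move=> nsx.
pose b := `|x| + 1.
have b0 : 0 < b by rewrite ltr_wpDl.
have [[p0 [sp0 hp0]] [q0 [sq0 hq0]]] := m_supp b0.
rewrite /= in_itv /= in hp0; rewrite /= in_itv /= andbT in hq0.
have xp : p0 < x by have := ler_norm (- x); rewrite normrN; rewrite /b in hp0; lra.
have xq : x < q0 by have := ler_norm x; rewrite /b in hq0; lra.
pose P := [set y | supp m y /\ y <= x]; pose Q := [set y | supp m y /\ x <= y].
have sP : has_sup P by split; [exists p0; split => //; exact: ltW|exists x => y []].
have sQ : has_inf Q by split; [exists q0; split => //; exact: ltW|exists x => y []].
have supP : supp m (sup P).
  apply: closed_supp; rewrite -[X in closure X](setIid).
  move=> V /nbhs_ballP[d /= d0 dV].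
  have [y Py yd] := sup_adherent d0 sP.
  exists y; split; first by split; exact: (proj1 Py).
  apply: dV; rewrite /ball /= ltr_norml.
  by have := sup_ubound (proj2 sP) Py; lra.
have infQ : supp m (inf Q).
  apply: closed_supp; rewrite -[X in closure X](setIid).
  move=> V /nbhs_ballP[d /= d0 dV].
  have [y Qy yd] := inf_adherent d0 sQ.
  exists y; split; first by split; exact: (proj1 Qy).
  apply: dV; rewrite /ball /= ltr_norml.
  by have := inf_lbound (proj2 sQ) Qy; lra.
have Px : sup P <= x by apply: ge_sup; [exact: (proj1 sP)|move=> y []].
have Qx : x <= inf Q by apply: lb_le_inf; [exact: (proj1 sQ)|move=> y []].
exists (sup P), (inf Q); split => //.
  apply/andP; split; rewrite lt_neqAle ?Px ?Qx andbT; apply/eqP => E.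
    by apply: nsx; rewrite -E.
  by apply: nsx; rewrite E.
move=> y /andP[y1 y2] sy.
have [yx|xy] := leP y x.
  by have := sup_ubound (proj2 sP) (conj sy yx); lra.
by have := inf_lbound (proj2 sQ) (conj sy (ltW xy)); lra.
Qed.

Lemma gap_affine_le f g : gap_affine f -> gap_affine g ->
  (forall x, supp m x -> f x <= g x) -> forall x, f x <= g x.
Proof.
move=> gf gg H x; have [/H//|nsx] := pselect (supp m x).
have [p [q [/andP[px xq] sp sq ns]]] := gap_ends nsx.
have := gf p x q px xq ns; have := gg p x q px xq ns.
rewrite /T3; have := H p sp; have := H q sq => hq hp E1 E2.
have h1 : (q - x) * f p <= (q - x) * g p by rewrite ler_wpM2l//; lra.
have h2 : (x - p) * f q <= (x - p) * g q by rewrite ler_wpM2l//; lra.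
have h3 : (q - p) * f x <= (q - p) * g x by lra.
by rewrite -(ler_pM2l (x := q - p))//; lra.
Qed.

(** Points [p <= -1] and [q >= 1] of the support make [Psi] positive at [2 * p] and [2 * q];
    convexity and [Psi m 0 = 0] then give linear growth beyond these points. *)
Lemma Psi_gt0_far : exists A s, [/\ 0 < A, 0 < s & forall x, A <= `|x| -> s * `|x| <= Psi m x].
Proof.
have kap_pos p : supp m p -> 1 <= `|p| -> 0 < Psi m (2 * p).
  move=> sp p1; rewrite Psi_kap// mulr_gt0//.
  pose V : set R := `]p - 1/2, p + 1/2[%classic.
  have oV : open V by exact: interval_open.
  have mV : (0 < m V)%E by apply: sp => //; rewrite /V /= in_itv /=; lra.
  (* For [y] within 1/2 of [p], both factors of the nonzero product in [kap (2 * p) y] are at least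
     1/2. *)
  apply: (@cc_Rint_gt0 _ _ lf `|2 * p| _ V (1/4)) => //.
  - exact: kap_cc.
  - exact: kap_ge0.
  move=> y; rewrite /V /= in_itv /= /kap => /andP[y1 y2].
  have [p0|p0] := leP 0 p.
    rewrite ger0_norm// in p1.
    rewrite (@posE _ (2 * p - y)) ?(@posE _ y) ?(@pos0 _ (y - 2 * p)) ?mul0r ?addr0; [|lra..].
    have : 0 <= (2 * p - y - 1/2) * (y - 1/2) by rewrite mulr_ge0//; lra.
    by lra.
  rewrite ltr0_norm// in p1.
  rewrite (@pos0 _ (2 * p - y)) ?(@posE _ (- y)) ?(@posE _ (y - 2 * p)) ?mul0r ?add0r; [|lra..].
  have : 0 <= (y - 2 * p - 1/2) * (- y - 1/2) by rewrite mulr_ge0//; lra.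
  by lra.
have [[p [sp hp]] [q [sq hq]]] := m_supp (ltr01 : 0 < (1 : R)).
rewrite /= in_itv /= in hp; rewrite /= in_itv /= andbT in hq.
have Pp : 0 < Psi m (2 * p) by apply: kap_pos => //; rewrite ler0_norm; lra.
have Pq : 0 < Psi m (2 * q) by apply: kap_pos => //; rewrite ger0_norm; lra.
pose s1 := Psi m (2 * p) / (- (2 * p)); pose s2 := Psi m (2 * q) / (2 * q).
have s10 : 0 < s1 by rewrite divr_gt0//; lra.
have s20 : 0 < s2 by rewrite divr_gt0//; lra.
have e1 : Psi m (2 * p) = s1 * (- (2 * p)) by rewrite /s1 mulfVK// gt_eqF//; lra.
have e2 : Psi m (2 * q) = s2 * (2 * q) by rewrite /s2 mulfVK// gt_eqF//; lra.
have T0 a b c : a < b -> b < c -> 0 <= T3 a b c (Psi m).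
  move=> ab bc; rewrite (Rel_Psi ab bc) mulr_ge0//.
  by apply: Rintegral_ge0 => y _; rewrite mulr_ge0// tent_ge0.
exists (2 * q - 2 * p + 1), (Num.min s1 s2); split; [lra|by rewrite lt_min s10|].
move=> x; rewrite ler_normr => /orP[xA|xA].
  have x2 : 2 * q < x by lra.
  have := T0 0 (2 * q) x ltac:(lra) x2; rewrite /T3 Psi_at0 e2 => H.
  have : (2 * q) * (s2 * x) <= 2 * q * Psi m x by lra.
  rewrite ler_pM2l; last lra.
  apply: le_trans; rewrite ger0_norm; last lra.
  by rewrite ler_wpM2r ?ge_min ?lexx ?orbT//; lra.
have x2 : x < 2 * p by lra.
have := T0 x (2 * p) 0 x2 ltac:(lra); rewrite /T3 Psi_at0 e1 => H.
have : (- (2 * p)) * (s1 * - x) <= (- (2 * p)) * Psi m x by lra.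
rewrite ler_pM2l; last lra.
apply: le_trans; rewrite ltr0_norm; last lra.
by rewrite ler_wpM2r ?ge_min ?lexx//; lra.
Qed.

Lemma abs_le_wgt : exists2 C : R, 0 < C & forall x, `|x| <= C * wgt x.
Proof.
have [A [s [A0 s0 H]]] := Psi_gt0_far.
exists (A + s^-1); first by rewrite addr_gt0// invr_gt0.
move=> x; have w1 := wgt_ge1 x; have P0 := Psi_ge0 x.
have si : 0 < s^-1 by rewrite invr_gt0.
have [xA|Ax] := leP `|x| A.
  have h1 : A * 1 <= A * wgt x by rewrite ler_pM2l.
  have h2 : 0 <= s^-1 * wgt x by rewrite mulr_ge0//; lra.
  by rewrite mulrDl; lra.
have h1 : `|x| <= s^-1 * Psi m x.
  by rewrite -(ler_pM2l s0) mulrA mulfV ?gt_eqF// mul1r; apply: H; exact: ltW.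
have h2 : s^-1 * Psi m x <= s^-1 * wgt x by rewrite ler_pM2l// /wgt; lra.
have h3 : 0 <= A * wgt x by rewrite mulr_ge0//; lra.
by rewrite mulrDl; lra.
Qed.

Lemma wgt_infty M : exists2 A : R, 0 < A & forall x, A <= `|x| -> M <= wgt x.
Proof.
have [C C0 HC] := abs_le_wgt.
exists (C * (`|M| + 1)) => [|x]; first by rewrite mulr_gt0// ltr_wpDl.
move=> /le_trans /(_ (HC x)); rewrite ler_pM2l//.
by have := ler_norm M; lra.
Qed.

(** For continuous [f] this says f = o(Psi), as Psi tends to infinity. The additive form is the one
    that barriers [e * wgt m x + C] propagate through the resolvent. *)
Definition small f := forall e, 0 < e -> exists C, forall x, `|f x| <= e * wgt x + C.

Definition C0 f := continuous f /\ small f.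

Lemma small_at_infty f : small f -> forall e, 0 < e ->
  exists2 A : R, 0 < A & forall x, A <= `|x| -> `|f x| <= e * wgt x.
Proof.
move=> sf e e0; have e20 : 0 < e / 2 by lra.
have [C HC] := sf _ e20.
have [A A0 HA] := wgt_infty (2 * C / e).
exists A => // x /HA h; apply: le_trans (HC x) _.
have : C <= e / 2 * wgt x.
  have : (e / 2) * (2 * C / e) <= e / 2 * wgt x by rewrite ler_pM2l.
  by have -> : (e / 2) * (2 * C / e) = C by field; rewrite gt_eqF.
by lra.
Qed.

Lemma littleo_small g : continuous g -> littleo_Psi m g -> small g.
Proof.
move=> cg /eqoP lg e e0.
have [h1 h2] := lg e e0.
case: h1 => M1 [_ H1]; case: h2 => M2 [_ H2].
pose A := `|M1| + `|M2| + 1.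
have [M HM] := continuous_bounded A cg.
exists `|M| => x; have P0 := Psi_ge0 x.
have ew : e * `|Psi m x| <= e * wgt x by rewrite ler_pM2l// ger0_norm// /wgt; lra.
have [xA|Ax] := leP `|x| A.
  apply: le_trans (HM x xA) _; apply: le_trans (ler_norm _) _.
  by rewrite lerDr mulr_ge0 ?ltW ?wgt_gt0.
have : `|g x| <= e * `|Psi m x|.
  move: Ax; rewrite ltr_normr /A => /orP[h|h].
    by apply: H1; have := ler_norm M1; have := normr_ge0 M2; lra.
  by apply: H2; have := ler_norm (- M2); rewrite normrN; have := normr_ge0 M1; lra.
by have := normr_ge0 M; lra.
Qed.

End weight.

(** * Limits of Cauchy sequences of functions and a fixed point theorem *)

Section uniform_cauchy.
Context {R : realType}.

(** The limit comes with the transfer of every Cauchy estimate, at the same rank and with the same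
    bound. Uniformity in [x], plain or weighted, can thus be read off afterwards. *)
Lemma unif_cauchy_lim (X : Type) (u : nat -> X -> R) :
  (forall x (e : R), 0 < e -> exists n0, forall n k, (n0 <= n)%N -> (n0 <= k)%N ->
     `|u n x - u k x| <= e) ->
  exists l : X -> R, forall x n0 (e : R),
    (forall n k, (n0 <= n)%N -> (n0 <= k)%N -> `|u n x - u k x| <= e) ->
    forall n, (n0 <= n)%N -> `|u n x - l x| <= e.
Proof.
move=> H; exists (fun x => lim ((u^~ x) @ \oo)) => x n0 e Hn n nn0.
have cu : cvg ((u^~ x) @ \oo).
  apply: cauchy_cvg; apply: cauchy_exP => d /= d0.
  have [k0 Hk] := H x (d / 2) ltac:(lra).
  exists (u k0 x); exists k0 => // k /= kk0; rewrite /ball /=.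
  by apply: le_lt_trans (Hk _ _ (leqnn _) kk0) _; lra.
apply/ler_addgt0Pr => d d0.
have /cvgrPdist_le /(_ d d0) [k0 _ Hk] := cu.
have h1 := Hn n (maxn n0 k0) nn0 (leq_maxl _ _).
have h2 := Hk (maxn n0 k0) (leq_maxr _ _).
rewrite -(subrKA (u (maxn n0 k0) x)) (le_trans (ler_normD _ _))// lerD//.
by rewrite distrC.
Qed.

Lemma expr_lt_eps (th e : R) : 0 <= th < 1 -> 0 < e ->
  exists n0, forall n, (n0 <= n)%N -> th ^+ n <= e.
Proof.
move=> /andP[t0 t1] e0.
have : `|th| < 1 by rewrite ger0_norm.
move=> /cvg_expr /cvgrPdist_le /(_ e e0) [n0 _ Hn]; exists n0 => n /Hn.
by rewrite sub0r normrN ger0_norm// exprn_ge0.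
Qed.

Lemma geometric_dist (u : nat -> R) (th M : R) : 0 <= th < 1 ->
  (forall n, `|u n.+1 - u n| <= M * th ^+ n) ->
  forall n0 n k, (n0 <= n)%N -> (n0 <= k)%N ->
    `|u n - u k| <= 2 * (M * th ^+ n0 / (1 - th)).
Proof.
move=> /andP[t0 t1] H n0.
have M0 : 0 <= M by have := H 0%N; rewrite expr0 mulr1; apply: le_trans.
have s0 : 0 < 1 - th by lra.
have key j : `|u (n0 + j)%N - u n0| <= M * th ^+ n0 / (1 - th) * (1 - th ^+ j).
  elim: j => [|j IH]; first by rewrite addn0 subrr normr0 expr0 subrr mulr0.
  rewrite addnS -(subrKA (u (n0 + j)%N)) (le_trans (ler_normD _ _))//.
  have := H (n0 + j)%N; rewrite exprD => h.
  apply: (le_trans (lerD h IH)); rewrite exprS le_eqVlt; apply/orP; left; apply/eqP.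
  by field; rewrite gt_eqF.
have key' k : (n0 <= k)%N -> `|u k - u n0| <= M * th ^+ n0 / (1 - th).
  move=> /subnKC <-; apply: le_trans (key _) _.
  rewrite ler_piMr// ?divr_ge0 ?mulr_ge0 ?exprn_ge0//; first exact: ltW.
  by have := exprn_ge0 (k - n0) t0; lra.
move=> n k /key' h1 /key' h2; rewrite -(subrKA (u n0)) (le_trans (ler_normD _ _))//.
by rewrite (distrC (u n0)); lra.
Qed.

(** Banach's theorem on a class [P] closed under uniform limits. Distances are given as bounds, so
    only the first increment [T u0 - u0] has to be bounded. *)
Lemma picard (P : (R -> R) -> Prop) (T : (R -> R) -> R -> R) (th M0 : R) (u0 : R -> R) :
  0 <= th < 1 -> P u0 -> (forall u, P u -> P (T u)) ->
  (forall u v M, P u -> P v -> (forall x, `|u x - v x| <= M) ->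
     forall x, `|T u x - T v x| <= th * M) ->
  (forall x, `|T u0 x - u0 x| <= M0) ->
  (forall u, (forall e, 0 < e -> exists2 v, P v & forall x, `|v x - u x| <= e) -> P u) ->
  exists2 u, P u & forall x, T u x = u x.
Proof.
move=> th01 Pu0 PT CT HM0 Pcl.
have /andP[t0 t1] := th01.
pose u n := iter n T u0.
have Pu n : P (u n) by elim: n => //= n; exact: PT.
have M00 : 0 <= M0 by apply: le_trans (HM0 0).
have du n x : `|u n.+1 x - u n x| <= M0 * th ^+ n.
  elim: n x => [|n IH] x; first by rewrite expr0 mulr1; exact: HM0.
  rewrite exprS mulrCA; exact: (CT (u n.+1) (u n)).
have gd x := geometric_dist th01 (du^~ x).
have s0 : 0 < 1 - th by lra.
have small_tail e : 0 < e -> exists n0, 2 * (M0 * th ^+ n0 / (1 - th)) <= e.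
  move=> e0.
  have K0 : 0 < 2 * (M0 + 1) / (1 - th) by rewrite divr_gt0// mulr_gt0//; lra.
  have [n0 /(_ n0 (leqnn _)) Hn] := expr_lt_eps th01 (divr_gt0 e0 K0).
  exists n0; rewrite ler_pdivlMr// in Hn.
  apply: le_trans Hn.
  have -> : th ^+ n0 * (2 * (M0 + 1) / (1 - th)) =
     2 * (M0 * th ^+ n0 / (1 - th)) + 2 * (th ^+ n0 / (1 - th)) by ring.
  by rewrite lerDl mulr_ge0// divr_ge0 ?exprn_ge0// ltW.
have [l Hl] := @unif_cauchy_lim R u (fun x e e0 =>
  let: ex_intro n0 Hn := small_tail e e0 in
  ex_intro _ n0 (fun n k h1 h2 => le_trans (gd x n0 n k h1 h2) Hn)).
have ul e : 0 < e -> exists n0, forall n, (n0 <= n)%N -> forall x, `|u n x - l x| <= e.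
  move=> /small_tail [n0 Hn]; exists n0 => n nn0 x.
  by apply: (Hl x n0) => // i j h1 h2; apply: le_trans (gd x n0 i j h1 h2) _.
have Pl : P l.
  by apply: Pcl => e /ul [n0 Hn]; exists (u n0) => // x; exact: Hn.
exists l => // x; apply/eqP; rewrite -subr_eq0 -normr_le0; apply/ler_addgt0Pr => e e0.
rewrite add0r; have [n0 Hn] := ul (e / 2) ltac:(lra).
rewrite -(subrKA (u n0.+1 x)) (le_trans (ler_normD _ _))//.
have h1 := Hn n0.+1 (leqnSn _) x.
have h2 : `|T l x - u n0.+1 x| <= th * (e / 2).
  by apply: (CT l (u n0)) => // z; rewrite distrC; exact: Hn.
have : th * (e / 2) <= e / 2 by rewrite ler_piMl//; lra.
lra.
Qed.

End uniform_cauchy.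

(** * The Dirichlet problem v'' = 2 mu (v - f) m on a bounded interval *)

Section dirichlet.
Context {R : realType}.
Variable m : {measure set (measurableTypeR R) -> \bar R}.
Hypothesis lf : locally_finite m.
Variables al be : R.
Hypothesis albe : al < be.
Implicit Types (f g h q D v phi : R -> R) (a b c x y s k e A M mu r : R).

Definition clamp x := al + (pos (x - al) - pos (x - be)).

Lemma clampE x : al <= x <= be -> clamp x = x.
Proof. by move=> /andP[h1 h2]; rewrite /clamp posE ?pos0//; lra. Qed.

Lemma clamp_lo x : x <= al -> clamp x = al.
Proof. by move=> h; have ab := albe; rewrite /clamp !pos0//; lra. Qed.

Lemma clamp_hi x : be <= x -> clamp x = be.
Proof. by move=> h; have ab := albe; rewrite /clamp !posE//; lra. Qed.

Lemma clampI x : al <= clamp x <= be.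
Proof.
have albe' := albe.
have [h|h] := leP x al; first by rewrite clamp_lo// lexx ltW.
have [h'|h'] := leP be x; first by rewrite clamp_hi// lexx ltW.
by rewrite clampE !ltW.
Qed.

Lemma clamp_continuous : continuous clamp.
Proof.
have albe' := albe.
have cs k : continuous (fun x => pos (x - k)).
  move=> x; apply: (@continuous_comp _ _ _ (fun x => x - k) pos); last exact: pos_continuous.
  by apply: cvgB; [exact: cvg_id|exact: cvg_cst].
by move=> x; apply: cvgD; [exact: cvg_cst|apply: cvgB; exact: cs].
Qed.

Lemma tent_ll y : tent al al be y = 0. Proof. rewrite /tent /T3; ring. Qed.

Lemma tent_rr y : tent al be be y = 0. Proof. rewrite /tent /T3; ring. Qed.

Lemma tent_weak b y : al <= b <= be -> 0 <= tent al b be y <= (be - al) * (be - al).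
Proof.
have albe' := albe.
move=> /andP[]; have p0 : 0 <= (be - al) * (be - al) by rewrite mulr_ge0//; lra.
rewrite le_eqVlt => /orP[/eqP <- _|ab]; first by rewrite tent_ll lexx.
rewrite le_eqVlt => /orP[/eqP ->|bc]; first by rewrite tent_rr lexx.
have /andP[-> h] := tent_bounds y ab bc; apply: le_trans h _.
by rewrite ler_pM//; lra.
Qed.

Let B : R := `|al| + `|be|.

Lemma green_cc b q : al <= b <= be -> continuous q -> cc B (fun y => tent al b be y * q y).
Proof.
have albe' := albe.
move=> /andP[]; rewrite le_eqVlt => /orP[/eqP <- _|ab].
  move=> cq; split; last by move=> y _; rewrite tent_ll mul0r.
  by move=> y; apply: cvgM; [exact: tent_continuous|exact: cq].
rewrite le_eqVlt => /orP[/eqP ->|bc] cq; last exact: tent_mul_cc.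
split; last by move=> y _; rewrite tent_rr mul0r.
by move=> y; apply: cvgM; [exact: tent_continuous|exact: cq].
Qed.

(** Green's operator for v'' = 2 q m with zero boundary values; clamping [x] extends the solution by
    0 to the line. *)
Definition green q x := - (2 / (be - al)) * \int[m]_y (tent al (clamp x) be y * q y).

Lemma green_lo q x : x <= al -> green q x = 0.
Proof.
have albe' := albe.
move=> h; rewrite /green clamp_lo//; under eq_Rintegral do rewrite tent_ll mul0r.
by rewrite Rintegral_cst// mul0r mulr0.
Qed.

Lemma green_hi q x : be <= x -> green q x = 0.
Proof.
have albe' := albe.
move=> h; rewrite /green clamp_hi//; under eq_Rintegral do rewrite tent_rr mul0r.
by rewrite Rintegral_cst// mul0r mulr0.
Qed.

Lemma green_continuous q : continuous q -> continuous (green q).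
Proof.
have albe' := albe.
move=> cq x; apply: cvgM; first exact: cvg_cst.
apply: (@cc_continuous_param _ _ lf B (fun x y => tent al (clamp x) be y * q y)).
  have ct : continuous2 (fun b y => tent al b be y).
    move=> p; apply: cvgB; first apply: cvgD.
    - apply: cvgM; first by apply: cvgB; [exact: cvg_cst|exact: cvg_fst].
      apply: (@continuous_comp _ _ _ snd (fun y => pos (al - y))); first exact: cvg_snd.
      exact: pos_sub_continuous.
    - apply: cvgM; first by apply: cvgB; [exact: cvg_fst|exact: cvg_cst].
      apply: (@continuous_comp _ _ _ snd (fun y => pos (be - y))); first exact: cvg_snd.
      exact: pos_sub_continuous.
    - apply: cvgM; first exact: cvg_cst.
      exact: (tent_continuous2 0 (x := p)).
  move=> p; apply: cvgM.
    exact: (continuous2_comp1 ct clamp_continuous (x := p)).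
  by apply: (@continuous_comp _ _ _ snd q); [exact: cvg_snd|exact: cq].
by move=> z y By; apply: (proj2 (green_cc (clampI z) cq)).
Qed.

Lemma green_RelI q : continuous q -> RelI m al be (green q) q.
Proof.
have albe' := albe.
move=> cq a b c ala ab bc cbe; rewrite /rel3 /T3 /green !clampE; [|lra..].
have ca : cc B (fun y => tent al a be y * q y) by apply: green_cc => //; lra.
have cb : cc B (fun y => tent al b be y * q y) by apply: green_cc => //; lra.
have cc' : cc B (fun y => tent al c be y * q y) by apply: green_cc => //; lra.
have E : \int[m]_y (- (be - al) * (tent a b c y * q y)) =
    (c - b) * \int[m]_y (tent al a be y * q y) + (b - a) * \int[m]_y (tent al c be y * q y)
    - (c - a) * \int[m]_y (tent al b be y * q y).
  rewrite -(cc_RintZ lf _ ca) -(cc_RintZ lf _ cb) -(cc_RintZ lf _ cc').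
  rewrite -(cc_RintD lf (ccZ _ ca) (ccZ _ cc')).
  rewrite -(cc_RintB lf (ccD (ccZ _ ca) (ccZ _ cc')) (ccZ _ cb)).
  apply: eq_Rintegral => y _.
  by rewrite [LHS]mulrA -T3_green /T3; ring.
rewrite (cc_RintZ lf _ (tent_mul_cc ab bc cq)) in E.
have n0 : be - al != 0 by rewrite gt_eqF//; lra.
set I1 := \int[m]_y (tent al a be y * q y) in E *.
set I2 := \int[m]_y (tent al b be y * q y) in E *.
set I3 := \int[m]_y (tent al c be y * q y) in E *.
transitivity (- (2 / (be - al)) * ((c - b) * I1 + (b - a) * I3 - (c - a) * I2)); first by ring.
by rewrite -E; field.
Qed.

Lemma green_dist q q' M : continuous q -> continuous q' ->
  (forall x, `|q x - q' x| <= M) ->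
  forall x, `|green q x - green q' x| <= 2 * (be - al) * mass m B * M.
Proof.
have albe' := albe.
move=> cq cq' H x; rewrite /green -mulrBr normrM.
have b0 : 0 < be - al by lra.
have -> : `|- (2 / (be - al))| = 2 / (be - al).
  by rewrite normrN ger0_norm// divr_ge0// ltW.
have h : `|\int[m]_y (tent al (clamp x) be y * q y) - \int[m]_y (tent al (clamp x) be y * q' y)|
    <= (be - al) * (be - al) * M * mass m B.
  apply: (cc_Rint_dist lf (green_cc (clampI x) cq) (green_cc (clampI x) cq')) => y _.
  have /andP[t0 t1] := tent_weak y (clampI x).
  by rewrite -mulrBr normrM ger0_norm// ler_pM.
have -> : 2 * (be - al) * mass m B * M =
    2 / (be - al) * ((be - al) * (be - al) * M * mass m B) by field; rewrite gt_eqF.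
by rewrite ler_wpM2l// divr_ge0// ltW.
Qed.

(* [v] solves v'' = 2 mu (v - f) m on [al, be] with zero boundary values. *)
Definition Dsol mu f v := [/\ continuous v, forall x, x <= al -> v x = 0,
  forall x, be <= x -> v x = 0 & RelI m al be v (fun x => mu * (v x - f x))].

Lemma Dsol_continuous mu f v : continuous f -> Dsol mu f v ->
  continuous (fun x => mu * (v x - f x)).
Proof.
have albe' := albe.
move=> cf [cv _ _ _] x; apply: cvgM; first exact: cvg_cst.
by apply: cvgB; [exact: cv|exact: cf].
Qed.

(** The translate [v' + M] is a supersolution for the datum [f]. Hence the solution operator does
    not increase the sup norm, whatever [mu] is, and this is what allows the continuation in
    [Dsol_step]. *)
Lemma Dsol_le mu f f' v v' M : 0 < mu -> continuous f -> continuous f' ->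
  Dsol mu f v -> Dsol mu f' v' -> 0 <= M -> (forall x, f x - f' x <= M) ->
  forall x, v x - v' x <= M.
Proof.
have albe' := albe.
move=> mu0 cf cf' sv sv' M0 H x.
have cq := Dsol_continuous cf sv; have cq' := Dsol_continuous cf' sv'.
have [cv v1 v2 rv] := sv; have [cv' v1' v2' rv'] := sv'.
have [h|h] := leP x al; first by rewrite v1// v1'// subr0.
have [h'|h'] := leP be x; first by rewrite v2// v2'// subr0.
rewrite lerBlDr addrC.
apply: (@comparison_itv _ m lf al be v (fun x => v' x + M) (fun x => mu * (v x - f x))
  (fun x => mu * (v' x - f' x))) => //.
- by move=> y; apply: cvgD; [exact: cv'|exact: cvg_cst].
- move=> a b c h1 h2 h3 h4.
  apply: (rel3_ext h2 h3 (f := fun x => v' x + M) (h := fun x => mu * (v' x - f' x) + 0)) => //.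
    by move=> y _; rewrite addr0.
  have c0 : continuous (fun _ : R => 0 : R) by move=> z; exact: cvg_cst.
  apply: (rel3D lf h2 h3 cq' c0); [exact: rv'|exact: rel3_cst].
- by rewrite v1// v1'//; lra.
- by rewrite v2// v2'//; lra.
- by move=> y _ _ hy; rewrite ltr_pM2l//; have := H y; lra.
- by rewrite !ltW.
Qed.

Lemma Dsol_dist mu f f' v v' M : 0 < mu -> continuous f -> continuous f' ->
  Dsol mu f v -> Dsol mu f' v' -> (forall x, `|f x - f' x| <= M) ->
  forall x, `|v x - v' x| <= M.
Proof.
have albe' := albe.
move=> mu0 cf cf' sv sv' H x.
have M0 : 0 <= M by exact: le_trans (H x).
have h1 := Dsol_le mu0 cf cf' sv sv' M0 (fun y => le_trans (ler_norm _) (H y)) x.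
have h2 := Dsol_le mu0 cf' cf sv' sv M0
  (fun y => le_trans (ler_norm _) (eq_ind _ (fun z => z <= M) (H y) _ (distrC _ _))) x.
by rewrite ler_norml; lra.
Qed.

Let P (u : R -> R) := [/\ continuous u, forall x : R, x <= al -> u x = 0 &
  forall x, be <= x -> u x = 0 :> R].

Let P_closed u : (forall e, 0 < e -> exists2 v, P v & forall x, `|v x - u x| <= e) -> P u.
Proof.
have albe' := albe.
move=> H; split.
- by apply: continuous_approx => A e /H [v [cv _ _] Hv]; exists v; split.
- move=> x h; apply/eqP; rewrite -normr_le0; apply/ler_addgt0Pr => e /H [v [_ v1 _] Hv].
  by rewrite add0r -normrN -[- u x]add0r -(v1 x h).
- move=> x h; apply/eqP; rewrite -normr_le0; apply/ler_addgt0Pr => e /H [v [_ _ v2] Hv].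
  by rewrite add0r -normrN -[- u x]add0r -(v2 x h).
Qed.

Let P_bounded u : P u -> exists M, forall x, `|u x - 0| <= M.
Proof.
have albe' := albe.
move=> [cu u1 u2]; have [M HM] := continuous_bounded B cu.
have B0 : 0 <= B by rewrite addr_ge0.
have M0 : 0 <= M by apply: le_trans (HM 0 _); rewrite ?normr0.
exists M => x; rewrite subr0.
have [h|h] := leP x al; first by rewrite u1// normr0.
have [h'|h'] := leP be x; first by rewrite u2// normr0.
apply: HM; rewrite ler_norml /B.
have := ler_norm (- al); have := ler_norm be; rewrite normrN.
by have := normr_ge0 al; have := normr_ge0 be; lra.
Qed.

Let P0 : P (fun=> 0).
Proof. by split => // x; exact: cvg_cst. Qed.

(** Solutions are the fixed points of v -> [green] of [mu * (v - f)], a contraction when [mu] is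
    small. *)
Lemma Dsol_small mu f : 0 < mu -> mu * (2 * (be - al) * mass m B) < 1 ->
  continuous f -> exists v, Dsol mu f v.
Proof.
have albe' := albe.
move=> mu0 muc cf.
pose T v := green (fun x => mu * (v x - f x)).
have cT v : continuous v -> continuous (fun x => mu * (v x - f x)).
  move=> cv x; apply: cvgM; first exact: cvg_cst.
  by apply: cvgB; [exact: cv|exact: cf].
have PT u : P u -> P (T u).
  move=> [cu _ _]; split; [exact: green_continuous (cT _ cu)|exact: green_lo|exact: green_hi].
have [M0 HM0] := P_bounded (PT _ P0).
have th01 : 0 <= mu * (2 * (be - al) * mass m B) < 1.
  by rewrite muc andbT !mulr_ge0 ?mass_ge0//; lra.
have [|v [cv v1 v2] Hv] := @picard _ P T _ M0 (fun=> 0) th01 P0 PT _ HM0 P_closed.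
- move=> u v M [cu _ _] [cv _ _] H x.
  rewrite (_ : _ * _ * M = 2 * (be - al) * mass m B * (mu * M)); last by ring.
  apply: green_dist; [exact: cT|exact: cT|].
  move=> y; rewrite -mulrBr normrM gtr0_norm// ler_pM2l//.
  by rewrite opprB addrA subrK.
- exists v; split => //.
  move=> a b c h1 h2 h3 h4; have := green_RelI (cT _ cv) h1 h2 h3 h4.
  by apply: rel3_ext => // x _; exact: Hv.
Qed.

(** Since r (v - f) = v - ((1 - r) v + r f), a solution for [r * mu] is a fixed point of the
    solution operator for [mu] applied to (1 - r) v + r f. By [Dsol_dist] this map contracts by |1 -
    r| < 1. *)
Lemma Dsol_step mu r : 0 < mu -> 0 < r < 2 ->
  (forall f, continuous f -> exists v, Dsol mu f v) ->
  forall f, continuous f -> exists v, Dsol (r * mu) f v.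
Proof.
have albe' := albe.
move=> mu0 /andP[r0 r2] H f cf.
have /choice [S HS] : forall f, exists v, continuous f -> Dsol mu f v.
  move=> f'; have [/H [v sv]|nc] := pselect (continuous f'); first by exists v.
  by exists f'.
pose F v x := (1 - r) * v x + r * f x.
have cF v : continuous v -> continuous (F v).
  move=> cv x; apply: cvgD; apply: cvgM; try exact: cvg_cst; [exact: cv|exact: cf].
pose T v := S (F v).
have PT u : P u -> P (T u).
  by move=> [cu _ _]; have [] := HS _ (cF _ cu).
have [M0 HM0] := P_bounded (PT _ P0).
have th01 : 0 <= `|1 - r| < 1 by rewrite normr_ge0 /= ltr_norml; lra.
have [|v [cv v1 v2] Hv] := @picard _ P T _ M0 (fun=> 0) th01 P0 PT _ HM0 P_closed.
- move=> u v M [cu _ _] [cv _ _] HM x.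
  apply: (Dsol_dist mu0 (cF _ cu) (cF _ cv) (HS _ (cF _ cu)) (HS _ (cF _ cv))) => y.
  rewrite /F opprD addrACA subrr addr0 -mulrBr normrM.
  by rewrite ler_wpM2l.
- exists v; split => //.
  have [_ _ _ rT] := HS _ (cF _ cv).
  move=> a b c h1 h2 h3 h4; have := rT a b c h1 h2 h3 h4.
  apply: rel3_ext => // x _; rewrite -/(T v) ?Hv//.
  by rewrite /F; ring.
Qed.

Lemma Dsol_exists mu f : 0 < mu -> continuous f -> exists v, Dsol mu f v.
Proof.
have albe' := albe.
move=> mu0.
(* Descend from [mu] by powers of 2/3 into the range of [Dsol_small], then climb back with
   [r = 3/2]. *)
pose c0 := 2 * (be - al) * mass m B + 1.
have c00 : 0 < c0 by rewrite /c0 ltr_wpDl// !mulr_ge0 ?mass_ge0//; lra.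
have th01 : 0 <= (2 / 3 : R) < 1 by lra.
have [n /(_ n (leqnn _)) Hn] := expr_lt_eps th01 (ltac:(by rewrite divr_gt0// mulr_gt0) : 0 < 1 / (c0 * mu)).
have pos_step (j : nat) : 0 < mu * (2 / 3) ^+ j by rewrite mulr_gt0// exprn_gt0//; lra.
have base : mu * (2 / 3) ^+ n * (2 * (be - al) * mass m B) < 1.
  rewrite ler_pdivlMr ?mulr_gt0// in Hn.
  apply: lt_le_trans Hn.
  have -> : (2 / 3) ^+ n * (c0 * mu) = mu * (2 / 3) ^+ n * (2 * (be - al) * mass m B) + mu * (2 / 3) ^+ n.
    by rewrite /c0; ring.
  by rewrite ltrDl.
have ex (k : nat) : (k <= n)%N -> forall f, continuous f -> exists v, Dsol (mu * (2 / 3) ^+ (n - k)) f v.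
  elim: k => [_|k IH kn]; first by rewrite subn0 => f' cf'; exact: Dsol_small.
  move=> f' cf'.
  have -> : mu * (2 / 3) ^+ (n - k.+1) = (3 / 2) * (mu * (2 / 3) ^+ (n - k)).
    have -> : (n - k)%N = (n - k.+1).+1 by lia.
    by rewrite exprS; field.
  apply: Dsol_step => //; [lra|apply: IH; exact: ltnW].
by have := ex n (leqnn _) f; rewrite subnn expr0 mulr1.
Qed.

End dirichlet.

(** * The resolvent on continuous functions that are o(Psi) *)

Section resolvent.
Context {R : realType}.
Variable m : {measure set (measurableTypeR R) -> \bar R}.
Hypothesis lf : locally_finite m.
Hypothesis m_supp : forall b : R, 0 < b ->
  supp m `&` `]-oo, - b] !=set0 /\ supp m `&` `[b, +oo[ !=set0.
Variable C1 : R.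
Hypothesis C1_gt0 : 0 < C1.
Hypothesis abs_le_C1 : forall x, `|x| <= C1 * wgt m x.
Implicit Types (f g h q D v phi : R -> R) (a b c x y s e A M C lam : R).

Lemma C0D f g : C0 m f -> C0 m g -> C0 m (fun x => f x + g x).
Proof.
move=> [cf sf] [cg sg]; split.
  by move=> x; apply: cvgD; [exact: cf|exact: cg].
move=> e e0; have [C HC] := sf (e / 2) ltac:(lra).
have [C' HC'] := sg (e / 2) ltac:(lra).
exists (C + C') => x; rewrite (le_trans (ler_normD _ _))//.
by have := HC x; have := HC' x; lra.
Qed.

Lemma C0Z f (k : R) : C0 m f -> C0 m (fun x => k * f x).
Proof.
move=> [cf sf]; split.
  by move=> x; apply: cvgM; [exact: cvg_cst|exact: cf].
move=> e e0; have k0 : 0 < `|k| + 1 by rewrite ltr_wpDl.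
have [C HC] := sf (e / (`|k| + 1)) (divr_gt0 e0 k0).
exists (`|k| * C) => x; rewrite normrM.
apply: le_trans (ler_wpM2l (normr_ge0 k) (HC x)) _.
rewrite mulrDr lerD2r mulrA ler_pM2r ?wgt_gt0//.
rewrite mulrA ler_pdivrMr// mulrC ler_pM2l//; lra.
Qed.

Lemma C0B f g : C0 m f -> C0 m g -> C0 m (fun x => f x - g x).
Proof.
move=> Cf Cg; have := C0D Cf (C0Z (-1) Cg).
by under [X in C0 _ X]eq_fun do rewrite mulN1r.
Qed.

Lemma C0_0 : C0 m (fun=> 0).
Proof.
split; first by move=> x; exact: cvg_cst.
by move=> e e0; exists 0 => x; rewrite normr0 addr0 mulr_ge0 ?ltW ?wgt_gt0.
Qed.

Lemma RelD f f' h h' : continuous h -> continuous h' ->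
  Rel m f h -> Rel m f' h' -> Rel m (fun x => f x + f' x) (fun x => h x + h' x).
Proof. by move=> ch ch' r r' a b c ab bc; apply: rel3D => //; [exact: r|exact: r']. Qed.

Lemma RelB f f' h h' : continuous h -> continuous h' ->
  Rel m f h -> Rel m f' h' -> Rel m (fun x => f x - f' x) (fun x => h x - h' x).
Proof. by move=> ch ch' r r' a b c ab bc; apply: rel3B => //; [exact: r|exact: r']. Qed.

Lemma RelZ (k : R) f h : continuous h ->
  Rel m f h -> Rel m (fun x => k * f x) (fun x => k * h x).
Proof. by move=> ch r a b c ab bc; apply: rel3Z => //; exact: r. Qed.

Lemma Rel_ext f f' h h' : (forall x, f x = f' x) -> (forall x, h x = h' x) ->
  Rel m f h -> Rel m f' h'.
Proof. by move=> ff hh r a b c ab bc; apply: rel3_ext (r _ _ _ ab bc). Qed.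

(* The barrier e w + C is a supersolution, because w'' = 2 |x| m <= 2 C1 w m. *)
Lemma barrier_gt lam e C x (u f : R) : 0 < lam -> 2 * C1 * lam <= 1 -> 0 <= e ->
  f <= e * wgt m x + C -> (1 + 2 * C1 * lam) * e * wgt m x + C < u ->
  (1 + 2 * C1 * lam) * e * `|x| < lam^-1 * (u - f).
Proof.
move=> l0 l1 e0 fx ux; have c0 := C1_gt0.
rewrite [ltRHS]mulrC ltr_pdivlMr//.
have ew : 0 <= e * wgt m x by rewrite mulr_ge0// ltW// wgt_gt0.
have := abs_le_C1 x; set w := wgt m x in fx ux ew * => ax.
have k0 : 0 <= (1 + 2 * C1 * lam) * e by rewrite mulr_ge0// addr_ge0// !mulr_ge0//; lra.
have h1 : (1 + 2 * C1 * lam) * e * `|x| <= (1 + 2 * C1 * lam) * e * (C1 * w).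
  by rewrite ler_wpM2l.
have h2 : (1 + 2 * C1 * lam) * e * `|x| * lam <= (1 + 2 * C1 * lam) * e * (C1 * w) * lam.
  by rewrite ler_pM2r.
apply: le_lt_trans h2 _.
have z0 : 0 < C1 * lam by rewrite mulr_gt0.
have h3 : 0 <= (e * w) * ((C1 * lam) * (1 - 2 * (C1 * lam))).
  by rewrite mulr_ge0// mulr_ge0//; lra.
by lra.
Qed.

Lemma kge0 lam e : 0 < lam -> 0 <= e -> 0 <= (1 + 2 * C1 * lam) * e.
Proof. by move=> l0 e0; have c0 := C1_gt0; rewrite mulr_ge0// addr_ge0// !mulr_ge0//; lra. Qed.

Lemma Rel_barrier (k C : R) : Rel m (fun x => k * wgt m x + C) (fun x => k * `|x|).
Proof.
have ck : continuous (fun x : R => k * `|x|).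
  by move=> x; apply: cvgM; [exact: cvg_cst|exact: abs_continuous].
have c0 : continuous (fun _ : R => 0 : R) by move=> z; exact: cvg_cst.
apply: (Rel_ext (f := fun x => k * wgt m x + C) (h := fun x => k * `|x| + 0)) => //.
  by move=> x; rewrite addr0.
apply: RelD => //; last by move=> ? ? ? ? ?; exact: rel3_cst.
by apply: RelZ; [exact: abs_continuous|exact: Rel_wgt].
Qed.

Lemma barrier_continuous (k C : R) : continuous (fun x => k * wgt m x + C).
Proof.
move=> x; apply: cvgD; last exact: cvg_cst.
by apply: cvgM; [exact: cvg_cst|exact: wgt_continuous].
Qed.

Lemma kabs_continuous (k : R) : continuous (fun x : R => k * `|x|).
Proof. by move=> x; apply: cvgM; [exact: cvg_cst|exact: abs_continuous]. Qed.

Lemma source_continuous (k : R) f v : continuous f -> continuous v ->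
  continuous (fun x => k * (v x - f x)).
Proof.
move=> cf cv x; apply: cvgM; first exact: cvg_cst.
by apply: cvgB; [exact: cv|exact: cf].
Qed.

(** This is v = (1 - lam A)^-1 f for the generator A v = v'' / (2 m); [Rel m v a] reads A v = a. *)
Definition Jsol lam f v := C0 m v /\ Rel m v (fun x => lam^-1 * (v x - f x)).

(** Compare with the barrier for [e + d]: as v = o(w), the surplus [d] dominates [v] near infinity,
    and then [d] is sent to 0. The factor [1 + 2 * C1 * lam] is the price of one resolvent; over
    many small steps it accumulates to an exponential. *)
Lemma Jsol_le lam f v e C : 0 < lam -> 2 * C1 * lam <= 1 -> 0 <= e -> 0 <= C ->
  continuous f -> Jsol lam f v ->
  (forall x, supp m x -> f x <= e * wgt m x + C) ->
  forall x, v x <= (1 + 2 * C1 * lam) * e * wgt m x + C.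
Proof.
move=> l0 l1 e0 C_0 cf [[cv sv] rv] fe x.
apply/ler_addgt0Pr => d' d'0.
pose d := d' / (2 * wgt m x).
have w0 := wgt_gt0 lf x.
have d0 : 0 < d by rewrite divr_gt0// mulr_gt0.
have k1 : 1 + 2 * C1 * lam <= 2 by lra.
have k0 : 1 <= 1 + 2 * C1 * lam by rewrite lerDl !mulr_ge0// ltW.
suff H : forall y, v y <= (1 + 2 * C1 * lam) * (e + d) * wgt m y + C.
  have h : (1 + 2 * C1 * lam) * d * wgt m x <= d'.
    apply: (@le_trans _ _ (2 * d * wgt m x)); first by rewrite !ler_pM2r.
    by rewrite /d le_eqVlt; apply/orP; left; apply/eqP; field; rewrite gt_eqF.
  by apply: le_trans (H x) _; lra.
have ed0 : 0 <= e + d by lra.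
apply: (@comparison_line _ m lf v _ (fun x => lam^-1 * (v x - f x))
   (fun x => (1 + 2 * C1 * lam) * (e + d) * `|x|)) => //.
- exact: barrier_continuous.
- exact: source_continuous.
- exact: kabs_continuous.
- exact: Rel_barrier.
- have [A _ HA] := small_at_infty lf m_supp sv d0.
  exists A => y /HA h; apply: le_trans (ler_norm _) _; apply: le_trans h _.
  rewrite -[leLHS]addr0 lerD// ler_pM2r ?wgt_gt0//.
  rewrite -[leLHS]mul1r ler_pM//; lra.
- move=> y sy hy; apply: barrier_gt hy => //.
  apply: le_trans (fe y sy) _; rewrite lerD2r ler_pM2r ?wgt_gt0//; lra.
Qed.

Lemma Jsol_sub lam f f' v v' : continuous f -> continuous f' ->
  Jsol lam f v -> Jsol lam f' v' ->
  Jsol lam (fun x => f x - f' x) (fun x => v x - v' x).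
Proof.
move=> cf cf' [Cv rv] [Cv' rv']; split; first exact: C0B.
have r := RelB (source_continuous (k := lam^-1) cf (proj1 Cv))
   (source_continuous (k := lam^-1) cf' (proj1 Cv')) rv rv'.
apply: (Rel_ext _ _ r) => // x.
by rewrite -mulrBr; congr (_ * _); ring.
Qed.

Lemma Jsol_uniq lam f f' v v' : 0 < lam -> 2 * C1 * lam <= 1 ->
  continuous f -> continuous f' -> (forall x, supp m x -> f x = f' x) ->
  Jsol lam f v -> Jsol lam f' v' -> forall x, v x = v' x.
Proof.
move=> l0 l1 cf cf' ff sv sv' x.
have key (g1 g2 u1 u2 : R -> R) : continuous g1 -> continuous g2 ->
   (forall x, supp m x -> g1 x = g2 x) -> Jsol lam g1 u1 -> Jsol lam g2 u2 -> u1 x <= u2 x.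
  move=> c1 c2 gg s1 s2.
  have cg : continuous (fun x => g1 x - g2 x).
    by move=> y; apply: cvgB; [exact: c1|exact: c2].
  have := @Jsol_le lam _ _ 0 0 l0 l1 (lexx _) (lexx _) cg (Jsol_sub c1 c2 s1 s2).
  move=> /(_ _ x); rewrite mulr0 mul0r addr0 subr_le0; apply.
  by move=> y /gg ->; rewrite subrr mul0r addr0.
apply/eqP; rewrite eq_le; apply/andP; split; first exact: (key f f').
by apply: (key f' f) => // y /ff.
Qed.

(** Exhaustion: the Dirichlet solutions on [[-(n+1), n+1]] obey the barrier bound uniformly in [n]
    and form a Cauchy sequence for the weighted sup norm, so the growth condition and the
    three-point relations pass to the limit. *)
Lemma Jsol_exists lam f : 0 < lam -> 2 * C1 * lam <= 1 -> C0 m f ->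
  exists v, Jsol lam f v.
Proof.
move=> l0 l1 [cf sf].
have li0 : 0 < lam^-1 by rewrite invr_gt0.
have n0 n : 0 < n.+1%:R :> R by rewrite ltr0n.
have nn n : - n.+1%:R < n.+1%:R :> R by have := n0 n; lra.
have /choice [u Hu] : forall n, exists v, Dsol m (- n.+1%:R) n.+1%:R lam^-1 f v.
  by move=> n; exact: Dsol_exists.
have cu n : continuous (u n) by have [] := Hu n.
have k1 : 1 + 2 * C1 * lam <= 2 by lra.
have k0 : 1 <= 1 + 2 * C1 * lam by rewrite lerDl !mulr_ge0// ltW.
have up n (e C : R) (g : R -> R) v : 0 <= e -> 0 <= C -> continuous g ->
    Dsol m (- n.+1%:R) n.+1%:R lam^-1 g v ->
    (forall x, g x <= e * wgt m x + C) ->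
    forall x, v x <= (1 + 2 * C1 * lam) * e * wgt m x + C.
  move=> e0 C_0 cg sv Hg x.
  have P0 y : 0 <= (1 + 2 * C1 * lam) * e * wgt m y + C.
    by apply: addr_ge0 => //; apply: mulr_ge0; [exact: kge0|apply: ltW; exact: wgt_gt0].
  have cq := Dsol_continuous (nn n) cg sv; have [cv v1 v2 rv] := sv.
  have [h|h] := leP x (- n.+1%:R); first by rewrite v1.
  have [h'|h'] := leP n.+1%:R x; first by rewrite v2.
  apply: (@comparison_itv _ m lf (- n.+1%:R) n.+1%:R v
     (fun x => (1 + 2 * C1 * lam) * e * wgt m x + C) (fun x => lam^-1 * (v x - g x))
     (fun x => (1 + 2 * C1 * lam) * e * `|x|)) => //.
  - exact: barrier_continuous.
  - exact: kabs_continuous.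
  - by apply: Rel_RelI; exact: Rel_barrier.
  - by rewrite v1.
  - by rewrite v2.
  - by move=> y _ _; exact: barrier_gt.
  - by rewrite !ltW.
have bound (e C : R) n x : 0 <= e -> 0 <= C -> (forall x, `|f x| <= e * wgt m x + C) ->
    `|u n x| <= (1 + 2 * C1 * lam) * e * wgt m x + C.
  move=> e0 C_0 Hf; rewrite ler_norml; apply/andP; split; last first.
    by apply: (up n e C f) => // y; exact: le_trans (ler_norm _) (Hf y).
  rewrite lerNl; apply: (up n e C (fun x => - f x) (fun x => - u n x)) => //.
  - by move=> y; apply: cvgN; exact: cf.
  - have [cv v1 v2 rv] := Hu n; split.
    + by move=> y; apply: cvgN; exact: cv.
    + by move=> y /v1 ->; rewrite oppr0.
    + by move=> y /v2 ->; rewrite oppr0.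
    + move=> a b c h1 h2 h3 h4.
      apply: (rel3_ext h2 h3 _ _ (rel3Z lf (-1) h2 h3 _ (rv a b c h1 h2 h3 h4))).
      * by move=> y _; ring.
      * by move=> y _; ring.
      * exact: source_continuous.
  - by move=> y; apply: le_trans (ler_norm _) _; rewrite normrN.
(* Far out every [u n] is below [3 * e * wgt]. On the smaller of two intervals the difference of two
   solutions has boundary values of that size, and [3 * e * wgt] is a supersolution of the
   homogeneous equation because [C1 <= lam^-1]. *)
have close (e : R) : 0 < e -> exists n0, forall n k, (n0 <= n)%N -> (n0 <= k)%N ->
    forall x, `|u n x - u k x| <= 3 * e * wgt m x.
  move=> e0; have [C' HC'] := sf e e0.
  pose C := `|C'|.
  have HC x : `|f x| <= e * wgt m x + C.
    by apply: le_trans (HC' x) _; rewrite lerD2l ler_norm.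
  have C_0 : 0 <= C by exact: normr_ge0.
  have [A A0 HA] := wgt_infty lf m_supp (C / e).
  exists (Num.truncn A).+1.
  have far x : A <= `|x| -> forall n, `|u n x| <= 3 * e * wgt m x.
    move=> /HA; rewrite ler_pdivrMr// => h n.
    apply: le_trans (bound e C n x (ltW e0) C_0 HC) _.
    have : (1 + 2 * C1 * lam) * e * wgt m x <= 2 * e * wgt m x by rewrite !ler_pM2r ?wgt_gt0.
    by lra.
  have An n : ((Num.truncn A).+1 <= n)%N -> A <= n.+1%:R.
    move=> h; apply: ltW; apply: lt_le_trans (truncnS_gt A) _.
    by rewrite ler_nat; exact: leqW.
  have half n k : ((Num.truncn A).+1 <= n)%N -> (n <= k)%N ->
      forall x, `|u n x - u k x| <= 3 * e * wgt m x.
    move=> hn nk x.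
    have [cn n1 n2 rn] := Hu n; have [ck k1' k2' rk] := Hu k.
    have [h|h] := leP n.+1%:R `|x|.
      have -> : u n x = 0.
        by move: h; rewrite ler_normr => /orP[h|h]; [exact: n2|apply: n1; lra].
      rewrite sub0r normrN; apply: far; exact: le_trans (An n hn) h.
    move: h; rewrite ltr_norml => /andP[h1 h2].
    have nk' : n.+1%:R <= k.+1%:R :> R by rewrite ler_nat.
    have rk' : RelI m (- n.+1%:R) n.+1%:R (u k) (fun x => lam^-1 * (u k x - f x)).
      by apply: RelI_sub rk => //; rewrite lerN2.
    have c3 : continuous (fun x : R => 3 * e * `|x|) by exact: kabs_continuous.
    have lC : C1 <= lam^-1.
      by rewrite -(ler_pM2r l0) mulVf ?gt_eqF//; have := mulr_gt0 C1_gt0 l0; lra.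
    have pw (z : R) (p q' : R) : p + 3 * e * wgt m z < q' ->
       lam^-1 * (p - f z) + 3 * e * `|z| < lam^-1 * (q' - f z).
      move=> hz.
      have : lam^-1 * (p + 3 * e * wgt m z) < lam^-1 * q' by rewrite ltr_pM2l.
      have : 3 * e * `|z| <= 3 * e * (lam^-1 * wgt m z).
        rewrite ler_pM2l ?mulr_gt0//; apply: le_trans (abs_le_C1 z) _.
        by rewrite ler_pM2r// wgt_gt0.
      by lra.
    have comp (p q' : R -> R) : continuous p -> continuous q' ->
        RelI m (- n.+1%:R) n.+1%:R p (fun x => lam^-1 * (p x - f x)) ->
        RelI m (- n.+1%:R) n.+1%:R q' (fun x => lam^-1 * (q' x - f x)) ->
        q' (- n.+1%:R) <= p (- n.+1%:R) + 3 * e * wgt m (- n.+1%:R) ->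
        q' n.+1%:R <= p n.+1%:R + 3 * e * wgt m n.+1%:R ->
        q' x <= p x + 3 * e * wgt m x.
      move=> cp cq rp rq b1 b2.
      apply: (@comparison_itv _ m lf (- n.+1%:R) n.+1%:R q' (fun x => p x + 3 * e * wgt m x)
        (fun x => lam^-1 * (q' x - f x)) (fun x => lam^-1 * (p x - f x) + 3 * e * `|x|)) => //.
      - move=> y; apply: cvgD; first exact: cp.
        by apply: cvgM; [exact: cvg_cst|exact: wgt_continuous].
      - exact: source_continuous.
      - by move=> y; apply: cvgD; [exact: source_continuous|exact: c3].
      - move=> a b c g1 g2 g3 g4; apply: rel3D => //; first exact: source_continuous.
          exact: rp.
        by apply: rel3Z => //; [exact: abs_continuous|exact: Rel_wgt].
      - by move=> y _ _ hy; exact: pw.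
      - by rewrite !ltW.
    have b3 z : `|z| = n.+1%:R -> `|u k z| <= 3 * e * wgt m z.
      by move=> zn; apply: far; rewrite zn; exact: An.
    have z1 := b3 (- n.+1%:R) (etrans (normrN _) (gtr0_norm (n0 n))).
    have z2 := b3 n.+1%:R (gtr0_norm (n0 n)).
    rewrite !ler_norml in z1 z2.
    have g1 := comp (u n) (u k) cn ck rn rk'; have g2 := comp (u k) (u n) ck cn rk' rn.
    have e1 : u n (- n.+1%:R) = 0 by exact: n1.
    have e2 : u n n.+1%:R = 0 by exact: n2.
    rewrite e1 e2 in g1 g2.
    have {}g1 := g1 ltac:(lra) ltac:(lra); have {}g2 := g2 ltac:(lra) ltac:(lra).
    by rewrite ler_norml; lra.
  move=> n k hn hk x; have [nk|/ltnW kn] := leqP n k; first exact: half.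
  by rewrite distrC; exact: half.
have pc x (e : R) : 0 < e -> exists n0, forall n k, (n0 <= n)%N -> (n0 <= k)%N ->
    `|u n x - u k x| <= e.
  move=> e0; have w0 := wgt_gt0 lf x.
  have e'0 : 0 < e / (3 * wgt m x) by rewrite divr_gt0// mulr_gt0.
  have [k Hk] := close _ e'0; exists k => i j hi hj.
  apply: le_trans (Hk i j hi hj x) _.
  by rewrite le_eqVlt; apply/orP; left; apply/eqP; field; rewrite gt_eqF.
have [l Hl] := unif_cauchy_lim pc.
have lim (e : R) : 0 < e -> exists n0, forall n, (n0 <= n)%N ->
    forall x, `|u n x - l x| <= 3 * e * wgt m x.
  move=> /close [k Hk]; exists k => n hn x; apply: (Hl x k) => // i j hi hj; exact: Hk.
have unif (A e : R) : 0 < e -> exists n0, forall n, (n0 <= n)%N ->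
    forall x, `|x| <= A -> `|u n x - l x| <= e.
  move=> e0; have [M HM] := continuous_bounded A (wgt_continuous lf).
  have M0 : 0 < `|M| + 1 by rewrite ltr_wpDl.
  have e'0 : 0 < e / (3 * (`|M| + 1)) by rewrite divr_gt0// mulr_gt0.
  have [k Hk] := lim _ e'0; exists k => n hn x xA; apply: le_trans (Hk n hn x) _.
  rewrite [leRHS](_ : e = 3 * (e / (3 * (`|M| + 1))) * (`|M| + 1)); last first.
    by field; rewrite gt_eqF.
  rewrite ler_pM2l ?mulr_gt0//.
  apply: le_trans (ler_norm _) _; apply: le_trans (HM x xA) _.
  by have := ler_norm M; lra.
have cl : continuous l.
  apply: continuous_approx => A e e0; have [k Hk] := unif A e e0.
  by exists (u k); split => // x xA; exact: Hk.
exists l; split; first split => //.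
  move=> e e0; have [C' HC'] := sf (e / 4) ltac:(lra).
  exists `|C'| => x.
  have [k /(_ k (leqnn _) x) Hk] := lim (e / 6) ltac:(lra).
  have h1 : `|u k x| <= (1 + 2 * C1 * lam) * (e / 4) * wgt m x + `|C'|.
    apply: bound => //; first lra.
    by move=> y; apply: le_trans (HC' y) _; rewrite lerD2l ler_norm.
  have h2 : (1 + 2 * C1 * lam) * (e / 4) * wgt m x <= 2 * (e / 4) * wgt m x.
    by rewrite !ler_pM2r ?wgt_gt0//; lra.
  have : `|l x| <= `|u k x| + `|u k x - l x|.
    rewrite -{1}(subrK (u k x) (l x)) (le_trans (ler_normD _ _))// distrC; lra.
  by lra.
move=> a b c ab bc; apply: (rel3_limit lf ab bc (source_continuous cf cl)) => e e0.
pose A := `|a| + `|c|.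
have e'0 : 0 < Num.min e (e * lam) by rewrite lt_min e0 mulr_gt0.
have [k Hk] := unif A _ e'0.
pose n := maxn k (Num.truncn A).
have An : A <= n.+1%:R.
  apply: ltW; apply: lt_le_trans (truncnS_gt A) _.
  by rewrite ler_nat ltnS leq_maxr.
have inA x : a <= x <= c -> `|x| <= A.
  move=> /andP[h1 h2]; rewrite ler_norml /A.
  have := ler_norm (- a); have := ler_norm c; rewrite normrN.
  by have := normr_ge0 a; have := normr_ge0 c; lra.
have aA := inA a; have cA := inA c; rewrite !ler_norml in aA cA.
have {}aA := aA ltac:(lra); have {}cA := cA ltac:(lra).
exists (u n), (fun x => lam^-1 * (u n x - f x)); split.
- exact: source_continuous.
- by have [_ _ _ r] := Hu n; apply: r => //; lra.
- move=> x /inA xA; apply: le_trans (Hk n (leq_maxl _ _) x xA) _.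
  by rewrite ge_min lexx.
- move=> x /inA xA; rewrite -mulrBr opprB addrA subrK normrM gtr0_norm//.
  rewrite -ler_pdivlMl// invrK mulrC; apply: le_trans (Hk n (leq_maxl _ _) x xA) _.
  by rewrite ge_min lexx orbT.
Qed.

(* Locked, to keep unification from unfolding the choice operator. *)
Definition J : R -> (R -> R) -> R -> R :=
  locked (fun lam f => xget (fun=> 0) [set v | Jsol lam f v]).

Section fixed_parameter.
Variable lam : R.
Hypotheses (lam_gt0 : 0 < lam) (lam_le : 2 * C1 * lam <= 1).

Lemma J_sol f : C0 m f -> Jsol lam f (J lam f).
Proof.
by move=> Cf; rewrite /J -lock; apply: (@xgetPex _ (fun=> 0) [set v | Jsol lam f v]); exact: Jsol_exists.
Qed.

Lemma J_C0 f : C0 m f -> C0 m (J lam f).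
Proof. by move=> /J_sol []. Qed.

Lemma J_Rel f : C0 m f -> Rel m (J lam f) (fun x => lam^-1 * (J lam f x - f x)).
Proof. by move=> /J_sol []. Qed.

Lemma J_uniq f f' v : C0 m f -> C0 m f' -> (forall x, supp m x -> f x = f' x) ->
  Jsol lam f' v -> J lam f = v.
Proof.
move=> Cf Cf' ff sv; apply/funext => x.
by apply: (Jsol_uniq lam_gt0 lam_le (proj1 Cf) (proj1 Cf') ff (J_sol Cf) sv).
Qed.

Lemma J_eq_supp f f' : C0 m f -> C0 m f' -> (forall x, supp m x -> f x = f' x) ->
  J lam f = J lam f'.
Proof. by move=> Cf Cf' ff; apply: (J_uniq Cf Cf' ff); exact: J_sol. Qed.

Lemma JB f f' : C0 m f -> C0 m f' ->
  J lam (fun x => f x - f' x) = (fun x => J lam f x - J lam f' x).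
Proof.
move=> Cf Cf'; apply: (J_uniq (C0B Cf Cf') (C0B Cf Cf')) => //.
by apply: Jsol_sub; [exact: (proj1 Cf)|exact: (proj1 Cf')|exact: J_sol|exact: J_sol].
Qed.

Lemma JZ f (k : R) : C0 m f -> J lam (fun x => k * f x) = (fun x => k * J lam f x).
Proof.
move=> Cf; apply: (J_uniq (C0Z k Cf) (C0Z k Cf)) => //.
split; first by apply: C0Z; exact: J_C0.
apply: (Rel_ext _ _ (RelZ k _ (J_Rel Cf))) => //.
  by move=> x; ring.
by apply: source_continuous; [exact: (proj1 Cf)|exact: (proj1 (J_C0 Cf))].
Qed.

Lemma J_le f e C : C0 m f -> 0 <= e -> 0 <= C ->
  (forall x, supp m x -> f x <= e * wgt m x + C) ->
  forall x, J lam f x <= (1 + 2 * C1 * lam) * e * wgt m x + C.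
Proof. by move=> Cf e0 C_0; apply: Jsol_le => //; [exact: (proj1 Cf)|exact: J_sol]. Qed.

Lemma J_bound f e C : C0 m f -> 0 <= e -> 0 <= C ->
  (forall x, supp m x -> `|f x| <= e * wgt m x + C) ->
  forall x, `|J lam f x| <= (1 + 2 * C1 * lam) * e * wgt m x + C.
Proof.
move=> Cf e0 C_0 Hf x; rewrite ler_norml; apply/andP; split; last first.
  by apply: J_le => // y sy; exact: le_trans (ler_norm _) (Hf y sy).
have := JZ (-1) Cf => E; rewrite lerNl.
have -> : - J lam f x = J lam (fun x => -1 * f x) x by rewrite E mulN1r.
apply: J_le => //; first exact: C0Z.
by move=> y sy; rewrite mulN1r; apply: le_trans (ler_norm _) _; rewrite normrN; exact: Hf.
Qed.

Lemma J_gap_affine f : C0 m f -> gap_affine m (J lam f).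
Proof.
move=> Cf; apply: Rel_gap_affine (J_Rel Cf) => //; first exact: (proj1 (J_C0 Cf)).
by apply: source_continuous; [exact: (proj1 Cf)|exact: (proj1 (J_C0 Cf))].
Qed.

(* The resolvent commutes with the generator. *)
Lemma J_generator v (a : R -> R) : C0 m v -> C0 m a -> Rel m v a ->
  J lam v = (fun x => v x + lam * J lam a x) /\ Rel m (J lam v) (J lam a).
Proof.
move=> Cv Ca r.
pose y x := v x + lam * J lam a x.
have cJa := proj1 (J_C0 Ca).
have ry : Rel m y (J lam a).
  apply: (Rel_ext _ _ (RelD (proj1 Ca) _ r (RelZ lam _ (J_Rel Ca)))) => //.
  - by move=> x; rewrite mulrA mulfV ?gt_eqF// mul1r addrC subrK.
  - move=> x; apply: cvgM; first exact: cvg_cst.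
    by apply: source_continuous; [exact: (proj1 Ca)|].
  - by apply: source_continuous; [exact: (proj1 Ca)|].
have E : J lam v = y.
  apply: (J_uniq Cv Cv) => //; split; first by apply: C0D => //; apply: C0Z; exact: J_C0.
  apply: Rel_ext ry => // x; rewrite /y addrAC subrr add0r mulrA mulVf ?gt_eqF// mul1r//.
by split; rewrite E.
Qed.

End fixed_parameter.

End resolvent.

(** * Strong continuity of the resolvent as its parameter tends to 0 *)

Section uniformity_on_compacts.
Context {R : realType}.

Lemma compact_uniform (A : R) (Q : R -> R -> Prop) :
  (forall x0 : R, `|x0| <= A -> exists d l0 : R, [/\ 0 < d, 0 < l0 &
     forall lam x, 0 < lam <= l0 -> `|x - x0| < d -> Q lam x]) ->
  exists2 l0 : R, 0 < l0 & forall lam x, 0 < lam <= l0 -> `|x| <= A -> Q lam x.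
Proof.
move=> H.
pose P (l x : R) := forall lam, 0 < lam <= l -> Q lam x.
have HH : \forall l \near (0 : R)^'+, `[-A, A] `<=` P l.
  apply: (iffLR (compact_near_coveringP _) (@segment_compact R (- A) A)).
  move=> x0; rewrite /= in_itv /= -ler_norml => /H [d [l0 [d0 l00 Hd]]].
  exists (ball x0 d, [set r | 0 < r < l0]).
    split => /=; first exact: nbhsx_ballx.
    near=> r; apply/andP; split; near: r; first exact: nbhs_right_gt.
    exact: nbhs_right_lt.
  move=> [x r] /= [bx /andP[r0 rl]] lam /andP[h1 h2]; apply: Hd.
    by rewrite h1 /=; lra.
  by rewrite distrC.
have [l [/= l0 Hl]] := filter_ex (filterI (nbhs_right_gt (0 : R)) HH).
exists l => // lam x hl hx; apply: Hl => //.
by rewrite /= in_itv /= -ler_norml.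
Unshelve. all: by end_near.
Qed.

End uniformity_on_compacts.

Lemma convex_bound {R : realType} (p x q A B C e : R) : p <= x -> x <= q ->
  `|A| <= e -> `|B| <= e -> `|C| <= e ->
  `|(q - x) * A + (x - p) * B + (q - p) * C| <= (q - p) * (2 * e).
Proof.
move=> px xq hA hB hC.
have -> : (q - p) * (2 * e) = (q - x) * e + (x - p) * e + (q - p) * e by ring.
rewrite (le_trans (ler_normD _ _))// lerD//.
  by rewrite (le_trans (ler_normD _ _))// lerD// normrM ger0_norm ?ler_wpM2l// subr_ge0.
by rewrite normrM ger0_norm ?ler_wpM2l// subr_ge0 (le_trans px).
Qed.

Lemma T3_dist {R : realType} (a b c r : R) (f f' : R -> R) : a <= b -> b <= c ->
  `|f a - f' a| <= r -> `|f b - f' b| <= r -> `|f c - f' c| <= r ->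
  `|T3 a b c f - T3 a b c f'| <= (c - a) * (2 * r).
Proof.
move=> ab bc ha hb hc.
have -> : T3 a b c f - T3 a b c f' =
    (c - b) * (f a - f' a) + (b - a) * (f c - f' c) + (c - a) * (f' b - f b).
  by rewrite /T3; ring.
by apply: convex_bound => //; rewrite distrC.
Qed.

Section strong_continuity.
Context {R : realType}.
Variable m : {measure set (measurableTypeR R) -> \bar R}.
Hypothesis lf : locally_finite m.
Hypothesis m_supp : forall b : R, 0 < b ->
  supp m `&` `]-oo, - b] !=set0 /\ supp m `&` `[b, +oo[ !=set0.
Variable C1 : R.
Hypothesis C1_gt0 : 0 < C1.
Hypothesis abs_le_C1 : forall x, `|x| <= C1 * wgt m x.
Implicit Types (f g h q D v phi : R -> R) (a b c x y s e A M C lam : R).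

(* Smearing |x - x0| along [m] near a point of the support. *)
Lemma cusp x0 r : supp m x0 -> 0 < r -> exists (k eta : R -> R) (M : R),
  [/\ continuous k, continuous eta, Rel m k eta, (0 <= M /\ forall y, eta y <= M) &
    forall x, `|k x - `|x - x0| | <= r].
Proof.
move=> sx0 r0.
pose beta y := pos (r - `|y - x0|).
have cbeta : continuous beta.
  move=> y; apply: (@continuous_comp _ _ _ (fun y => r - `|y - x0|) pos).
    apply: cvgB; first exact: cvg_cst.
    by apply: cvg_norm; apply: cvgB; [exact: cvg_id|exact: cvg_cst].
  exact: pos_continuous.
have b_out y : r <= `|y - x0| -> beta y = 0 by move=> h; rewrite /beta pos0//; lra.
pose A := `|x0| + r.
have ccb : cc A beta.
  split => // y Ay; apply: b_out.
  have : `|y| <= `|y - x0| + `|x0| by rewrite -{1}(subrK x0 y) ler_normD.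
  by rewrite /A in Ay; lra.
pose I := \int[m]_y beta y.
have I0 : 0 < I.
  apply: (@cc_Rint_gt0 _ m lf A beta `]x0 - r / 2, x0 + r / 2[%classic (r / 2)) => //.
  - by move=> y; exact: pos_ge0.
  - by apply: sx0; [exact: interval_open|rewrite /= in_itv /=; lra].
  - lra.
  - move=> y /=; rewrite in_itv /= => h.
    have : `|y - x0| < r / 2 by rewrite ltr_norml; lra.
    by move=> h'; rewrite /beta posE; lra.
(* Unit mass with respect to [m]; [I] is positive because [x0] lies in the support. *)
pose eta y := I^-1 * beta y.
have ceta : continuous eta.
  by move=> y; apply: cvgM; [exact: cvg_cst|exact: cbeta].
have eta0 y : 0 <= eta y by rewrite mulr_ge0 ?pos_ge0// invr_ge0 ltW.
have e_out y : r <= `|y - x0| -> eta y = 0 by move=> /b_out h; rewrite /eta h mulr0.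
have cce : cc A eta by exact: ccZ.
have int1 : \int[m]_y eta y = 1.
  by rewrite /eta (cc_RintZ lf _ ccb) mulVf// gt_eqF.
have cck x : cc A (fun y => `|x - y| * eta y).
  apply: ccMl => // y; apply: cvg_norm; apply: cvgB; [exact: cvg_cst|exact: cvg_id].
pose k x := \int[m]_y (`|x - y| * eta y).
exists k, eta, (I^-1 * r); split => //.
- apply: (@cc_continuous_param _ _ lf A (fun x y => `|x - y| * eta y)).
    move=> p; apply: cvgM.
      by apply: cvg_norm; apply: cvgB; [exact: cvg_fst|exact: cvg_snd].
    by apply: (@continuous_comp _ _ _ snd eta); [exact: cvg_snd|exact: ceta].
  by move=> x y; exact: (proj2 (cck x)).
- move=> a b c ab bc; rewrite /rel3 /T3 /k.
  rewrite -(cc_RintZ lf _ (cck a)) -(cc_RintZ lf _ (cck b)) -(cc_RintZ lf _ (cck c)).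
  rewrite -(cc_RintD lf (ccZ _ (cck a)) (ccZ _ (cck c))).
  rewrite -(cc_RintB lf (ccD (ccZ _ (cck a)) (ccZ _ (cck c))) (ccZ _ (cck b))).
  rewrite -(cc_RintZ lf _ (tent_mul_cc ab bc ceta)); apply: eq_Rintegral => y _.
  by rewrite mulrA -T3_abs /T3; ring.
- split; first by rewrite mulr_ge0 ?invr_ge0// ltW.
  move=> y; rewrite ler_wpM2l ?invr_ge0 ?(ltW I0)// /beta.
  have [h|h] := leP (r - `|y - x0|) 0; first by rewrite pos0// ltW.
  by rewrite posE; [have := normr_ge0 (y - x0); lra|exact: ltW].
- move=> x; have -> : `|x - x0| = \int[m]_y (`|x - x0| * eta y).
    by rewrite (cc_RintZ lf _ cce) int1 mulr1.
  have c0 : cc A (fun y => `|x - x0| * eta y) by exact: ccZ.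
  have cr : cc A (fun y => r * eta y) by exact: ccZ.
  have ri : \int[m]_y (r * eta y) = r by rewrite (cc_RintZ lf _ cce) int1 mulr1.
  have key y : `| `|x - y| * eta y - `|x - x0| * eta y| <= r * eta y.
    rewrite -mulrBl normrM (ger0_norm (eta0 y)).
    have [h|h] := leP r `|y - x0|; first by rewrite e_out// !mulr0.
    rewrite ler_wpM2r//; apply: le_trans (ler_dist_dist _ _) _.
    have -> : x - y - (x - x0) = - (y - x0) by ring.
    by rewrite normrN ltW.
  have cB := ccB (cck x) c0.
  have nri : \int[m]_y (-1 * (r * eta y)) = - r by rewrite (cc_RintZ lf _ cr) ri mulN1r.
  rewrite /k -(cc_RintB lf (cck x) c0) ler_norml; apply/andP; split.
    rewrite -nri; apply: (cc_Rint_le lf (ccZ _ cr) cB) => y.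
    by have := key y; rewrite ler_norml mulN1r => /andP[].
  rewrite -[leRHS]ri.
  by apply: (cc_Rint_le lf cB cr) => y; exact: le_trans (ler_norm _) (key y).
Qed.

(** The datum lies below the cone g(x0) + e1 + K |x - x0| + dl w. Replacing the cone by the function
    of [cusp] gives [phi] with a second derivative controlled by [m]. After a correction of order
    [lam * (K * M)] it is a supersolution of the resolvent equation, so it dominates [J m lam g]. *)
Lemma J_near_upper g x0 e : C0 m g -> supp m x0 -> 0 < e ->
  exists d l0, [/\ 0 < d, 0 < l0 & forall lam x, 0 < lam <= l0 -> `|x - x0| < d ->
    2 * C1 * lam <= 1 /\ J m lam g x <= g x0 + e].
Proof.
move=> Cg sx0 e0; have [cg sg] := Cg.
have c10 := C1_gt0.
pose e1 := e / 5; have e10 : 0 < e1 by rewrite /e1; lra.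
have w0 := wgt_gt0 lf x0.
have [d1 d10 Hd1] := iffLR (continuous_epsP _) (wgt_continuous lf) x0 1 ltr01.
pose dl := e1 / (2 * (wgt m x0 + 1)).
have dl0 : 0 < dl by rewrite divr_gt0//; lra.
have wnear x : `|x - x0| < d1 -> 2 * dl * wgt m x <= e1.
  move=> /Hd1; rewrite ler_norml => h.
  have h2 : wgt m x <= wgt m x0 + 1 by lra.
  apply: (@le_trans _ _ (2 * dl * (wgt m x0 + 1))); first by rewrite ler_pM2l// mulr_gt0.
  by rewrite /dl le_eqVlt; apply/orP; left; apply/eqP; field; rewrite gt_eqF//; lra.
have [C' HC'] := sg dl dl0.
pose C := `|C'|; have C_0 : 0 <= C by exact: normr_ge0.
have HC x : `|g x| <= dl * wgt m x + C.
  by apply: le_trans (HC' x) _; rewrite lerD2l ler_norm.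
have [d2 d20 Hd2] := iffLR (continuous_epsP _) cg x0 e1 e10.
(* Steep enough for the cone to exceed the growth bound on [g] wherever [|x - x0| >= d2]; closer to
   [x0], continuity suffices. *)
pose K := (C + `|g x0|) / d2.
have K0 : 0 <= K by rewrite divr_ge0 ?addr_ge0// ltW.
have gK x : g x <= g x0 + e1 + K * `|x - x0| + dl * wgt m x.
  have P1 : 0 <= K * `|x - x0| by rewrite mulr_ge0.
  have P2 : 0 <= dl * wgt m x by rewrite mulr_ge0 ?ltW ?wgt_gt0.
  have [h|h] := ltP `|x - x0| d2.
    by have := Hd2 x h; rewrite ler_norml; lra.
  have : C + `|g x0| <= K * `|x - x0|.
    by rewrite -[leLHS](@divfK _ d2) ?gt_eqF// ler_wpM2l.
  have := HC x; rewrite ler_norml; have := ler_norm (- g x0); rewrite normrN; lra.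
pose r := e1 / (2 * (K + 1)).
have K1 : 0 < K + 1 by lra.
have r0 : 0 < r by rewrite divr_gt0// mulr_gt0.
have Kr : 2 * (K * r) <= e1.
  have h : 2 * ((K + 1) * r) = e1 by rewrite /r; field; rewrite gt_eqF.
  by rewrite -h ler_pM2l// ler_pM2r//; lra.
have [k [eta [M [ck ceta rk [M0 HM] Hk]]]] := cusp sx0 r0.
have KM0 : 0 <= K * M by rewrite mulr_ge0.
(* The first bound gives access to the resolvent estimates, the second keeps the correction
   [lam * (K * M)] below [e1]. *)
pose l0 := Num.min (1 / (2 * C1)) (e1 / (K * M + 1)).
have l00 : 0 < l0 by rewrite lt_min !divr_gt0//; lra.
pose d := Num.min d1 (e1 / (K + 1)).
exists d, l0; split => //; first by rewrite lt_min d10 divr_gt0.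
move=> lam x /andP[lam0]; rewrite le_min => /andP[hl1 hl2].
rewrite lt_min => /andP[hd1 hd2].
have lam1 : 2 * C1 * lam <= 1 by rewrite mulrC -ler_pdivlMr ?mulr_gt0.
split=> //.
have li : 2 * C1 <= lam^-1 by rewrite -(ler_pM2r lam0) mulVf ?gt_eqF//.
have lKM : lam * (K * M) <= e1.
  apply: (@le_trans _ _ (lam * (K * M + 1))); first by rewrite ler_pM2l//; lra.
  by rewrite -ler_pdivlMr//; lra.
pose cst0 := g x0 + e1 + K * r + lam * (K * M).
pose phi x := K * k x + (2 * dl * wgt m x + cst0).
have Jg := J_sol lf m_supp C1_gt0 abs_le_C1 lam0 lam1 Cg.
have [[cJ sJ] rJ] := Jg.
have cphi : continuous phi.
  move=> z; apply: cvgD; last exact: barrier_continuous.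
  by apply: cvgM; [exact: cvg_cst|exact: ck].
have cKe : continuous (fun z => K * eta z).
  by move=> z; apply: cvgM; [exact: cvg_cst|exact: ceta].
have kge z : `|z - x0| <= k z + r by have := Hk z; rewrite ler_norml; lra.
have kle z : k z <= `|z - x0| + r by have := Hk z; rewrite ler_norml; lra.
have philow z : g x0 + e1 + K * `|z - x0| + 2 * dl * wgt m z + lam * (K * M) <= phi z.
  have : K * `|z - x0| <= K * (k z + r) by rewrite ler_wpM2l.
  by rewrite /phi /cst0; lra.
suff H : J m lam g x <= phi x.
  apply: le_trans H _; rewrite /phi /cst0.
  have h1 : K * k x <= K * (`|x - x0| + r) by rewrite ler_wpM2l.
  have h2 : K * `|x - x0| <= e1.
    apply: (@le_trans _ _ ((K + 1) * `|x - x0|)).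
      by rewrite ler_wpM2r//; lra.
    by rewrite mulrC -ler_pdivlMr// ltW.
  have h3 := wnear x hd1.
  by rewrite /e1 in h2 h3 Kr lKM *; lra.
apply: (@comparison_line _ m lf _ phi (fun z => lam^-1 * (J m lam g z - g z))
  (fun z => K * eta z + 2 * dl * `|z|)) => //.
- exact: source_continuous.
- by move=> z; apply: cvgD; [exact: cKe|exact: kabs_continuous].
- by apply: RelD => //; [exact: kabs_continuous|exact: RelZ|exact: Rel_barrier].
- have [A1 _ HA1] := small_at_infty lf m_supp sJ dl0.
  have [A2 _ HA2] := wgt_infty lf m_supp (`|g x0| / dl).
  exists (`|A1| + `|A2|) => z hz.
  have h1 : A1 <= `|z| by have := ler_norm A1; have := normr_ge0 A2; lra.
  have h2 : A2 <= `|z| by have := ler_norm A2; have := normr_ge0 A1; lra.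
  have h4 := le_trans (ler_norm _) (HA1 z h1).
  have := HA2 z h2; rewrite ler_pdivrMr// => h3.
  apply: le_trans (philow z).
  have P1 : 0 <= K * `|z - x0| by rewrite mulr_ge0.
  have P2 : 0 <= lam * (K * M) by rewrite mulr_ge0// ltW.
  by have := ler_norm (- g x0); rewrite normrN; lra.
- move=> z sz hz.
  have h1 : dl * wgt m z + lam * (K * M) < J m lam g z - g z.
    by have := philow z; have := gK z; lra.
  have h2 : lam^-1 * (dl * wgt m z + lam * (K * M)) < lam^-1 * (J m lam g z - g z).
    by rewrite ltr_pM2l// invr_gt0.
  apply: le_lt_trans h2.
  have h3 : 2 * dl * `|z| <= lam^-1 * (dl * wgt m z).
    apply: (@le_trans _ _ (2 * C1 * (dl * wgt m z))).
      have h6 : 2 * dl * `|z| <= 2 * dl * (C1 * wgt m z).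
        have dl20 : 0 < 2 * dl by lra.
        by rewrite ler_pM2l//; exact: abs_le_C1.
      by lra.
    by rewrite ler_wpM2r// mulr_ge0 ?ltW ?wgt_gt0.
  have h4 : lam^-1 * (lam * (K * M)) = K * M by rewrite mulrA mulVf ?mul1r// gt_eqF.
  have h5 : K * eta z <= K * M by rewrite ler_wpM2l.
  by rewrite mulrDr h4; lra.
Qed.

Lemma J_near g x0 e : C0 m g -> supp m x0 -> 0 < e ->
  exists d l0, [/\ 0 < d, 0 < l0 & forall lam x, 0 < lam <= l0 -> `|x - x0| < d ->
    2 * C1 * lam <= 1 /\ `|J m lam g x - g x0| <= e].
Proof.
move=> Cg sx0 e0.
have [d1 [l1 [d10 l10 H1]]] := J_near_upper Cg sx0 e0.
have [d2 [l2 [d20 l20 H2]]] := J_near_upper (C0Z lf (-1) Cg) sx0 e0.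
exists (Num.min d1 d2), (Num.min l1 l2); split; [by rewrite lt_min d10|by rewrite lt_min l10|].
move=> lam x; rewrite le_min lt_min => /andP[lam0 /andP[a1 a2]] /andP[b1 b2].
have [lam1 h1] := H1 lam x ltac:(by rewrite lam0) b1.
have [_] := H2 lam x ltac:(by rewrite lam0) b2.
rewrite (JZ lf m_supp C1_gt0 abs_le_C1 lam0 lam1 (-1) Cg) => h2; split => //.
by rewrite ler_norml; lra.
Qed.

(** Off the support, [J m lam g] is affine on the surrounding gap; it converges because its values
    at the two ends, which are in the support, do. *)
Lemma J_near_any g x0 e : C0 m g -> 0 < e ->
  exists L d l0, [/\ 0 < d, 0 < l0 & forall lam x, 0 < lam <= l0 -> `|x - x0| < d ->
    2 * C1 * lam <= 1 /\ `|J m lam g x - L| <= e].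
Proof.
move=> Cg e0; have [sx0|nsx0] := pselect (supp m x0).
  by exists (g x0); exact: J_near.
have [p [q [/andP[px xq] sp sq ns]]] := gap_ends m_supp nsx0.
have e20 : 0 < e / 2 by lra.
have [d1 [l1 [d10 l10 H1]]] := J_near Cg sp e20.
have [d2 [l2 [d20 l20 H2]]] := J_near Cg sq e20.
pose sl := (g q - g p) / (q - p).
have pq : 0 < q - p by lra.
pose L := g p + sl * (x0 - p).
pose d := Num.min (e / 2 / (`|sl| + 1)) (Num.min (x0 - p) (q - x0)).
have sl1 : 0 < `|sl| + 1 by rewrite ltr_wpDl.
exists L, d, (Num.min l1 l2); split.
- by rewrite !lt_min divr_gt0//= !subr_gt0 px.
- by rewrite lt_min l10.
move=> lam x; rewrite !lt_min le_min => /andP[lam0 /andP[a1 a2]] /and3P[b1 b2 b3].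
have z0 (z : R) : `|z - z| = 0 by rewrite subrr normr0.
have [lam1 h1] := H1 lam p ltac:(by rewrite lam0) ltac:(by rewrite z0).
have [_ h2] := H2 lam q ltac:(by rewrite lam0) ltac:(by rewrite z0).
split=> //.
rewrite !ltr_norml in b2 b3.
have ga := J_gap_affine lf m_supp C1_gt0 abs_le_C1 lam0 lam1 Cg.
have := ga p x q ltac:(lra) ltac:(lra) ns; rewrite /T3.
set u := J m lam g in h1 h2 * => E.
have slE : sl * (q - p) = g q - g p by rewrite /sl divfK// gt_eqF.
have E2 : (q - p) * (u x - L) = (q - x) * (u p - g p) + (x - p) * (u q - g q)
   + (q - p) * (sl * (x - x0)).
  have -> : (q - p) * (u x - L) = (q - p) * u x - (q - p) * L by ring.
  have -> : (q - p) * u x = (q - x) * u p + (x - p) * u q by lra.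
  rewrite /L.
  have -> : (q - p) * (g p + sl * (x0 - p)) = (q - p) * g p + (sl * (q - p)) * (x0 - p) by ring.
  have -> : (q - p) * (sl * (x - x0)) = (sl * (q - p)) * (x - x0) by ring.
  by rewrite slE; ring.
have h3 : `|sl * (x - x0)| <= e / 2.
  rewrite normrM; apply: (@le_trans _ _ ((`|sl| + 1) * `|x - x0|)).
    by rewrite ler_wpM2r//; lra.
  by rewrite mulrC -ler_pdivlMr// ltW.
rewrite -(ler_pM2l pq) -[X in X * _ <= _](gtr0_norm pq) -normrM E2.
have -> : (q - p) * e = (q - p) * (2 * (e / 2)) by field.
have px' : p <= x by lra.
have xq' : x <= q by lra.
exact: convex_bound.
Qed.

(** The limit along [lam = 1/(n+1)] exists pointwise by [J_near_any]. Convergence for all small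
    [lam] is uniform on compacts by a covering argument, and outside a large compact both terms are
    small multiples of the weight. *)
Lemma J_limit g : C0 m g -> exists h, [/\ C0 m h, gap_affine m h,
  forall x, supp m x -> h x = g x &
  forall e, 0 < e -> exists2 l0, 0 < l0 & forall lam x, 0 < lam <= l0 ->
    2 * C1 * lam <= 1 /\ `|J m lam g x - h x| <= e * wgt m x].
Proof.
move=> Cg; have [cg sg] := Cg.
have c10 := C1_gt0.
pose ln (n : nat) : R := n.+1%:R^-1.
have ln0 n : 0 < ln n by rewrite invr_gt0.
have lnl l : 0 < l -> exists n0, forall n, (n0 <= n)%N -> 0 < ln n <= l.
  move=> l0; exists (Num.truncn l^-1) => n hn; rewrite ln0 /=.
  rewrite -[l]invrK lef_pV2 ?posrE ?invr_gt0//.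
  by apply: ltW; apply: lt_le_trans (truncnS_gt _) _; rewrite ler_nat.
pose u n := J m (ln n) g.
have pc x (e : R) : 0 < e -> exists n0, forall n k, (n0 <= n)%N -> (n0 <= k)%N ->
    `|u n x - u k x| <= e.
  move=> e0; have e20 : 0 < e / 2 by lra.
  have [L [d [l0 [d0 l00 H]]]] := J_near_any x Cg e20.
  have [n0 Hn] := lnl l0 l00; exists n0 => n k hn hk.
  have xx : `|x - x| < d by rewrite subrr normr0.
  have [_ h1] := H _ x (Hn n hn) xx; have [_ h2] := H _ x (Hn k hk) xx.
  by rewrite !ler_norml in h1 h2 *; rewrite -/(u n) -/(u k) in h1 h2; lra.
have [h Hh] := unif_cauchy_lim pc.
have hlim x e : 0 < e -> exists n0, forall n, (n0 <= n)%N -> `|u n x - h x| <= e.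
  by move=> /(pc x) [n0 Hn]; exists n0; apply: Hh.
have near x0 e : 0 < e -> exists L d l0, [/\ 0 < d, 0 < l0,
    (forall lam x, 0 < lam <= l0 -> `|x - x0| < d ->
      2 * C1 * lam <= 1 /\ `|J m lam g x - L| <= e) &
    (forall x, `|x - x0| < d -> `|h x - L| <= e)].
  move=> e0; have [L [d [l0 [d0 l00 H]]]] := J_near_any x0 Cg e0.
  exists L, d, l0; split => // x hx; apply/ler_addgt0Pr => r r0.
  have [n0 Hn] := lnl l0 l00; have [n1 Hn1] := hlim x r r0.
  have [_ h1] := H _ x (Hn (maxn n0 n1) (leq_maxl _ _)) hx.
  have h2 := Hn1 (maxn n0 n1) (leq_maxr _ _); rewrite -/(u _) in h1.
  by rewrite !ler_norml in h1 h2 *; lra.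
have ch : continuous h.
  apply/continuous_epsP => x e e0; have e20 : 0 < e / 2 by lra.
  have [L [d [l0 [d0 l00 _ H]]]] := near x _ e20; exists d => // y hy.
  have h1 := H y hy; have h2 := H x; rewrite subrr normr0 in h2.
  by have {}h2 := h2 d0; rewrite !ler_norml in h1 h2 *; lra.
have n_ok n0 : exists n, [/\ (n0 <= n)%N, 0 < ln n & 2 * C1 * ln n <= 1].
  have [n1 Hn1] := lnl (1 / (2 * C1)) ltac:(by rewrite divr_gt0// mulr_gt0).
  exists (maxn n0 n1); split => //; first exact: leq_maxl.
  have /andP[_] := Hn1 (maxn n0 n1) (leq_maxr _ _).
  by rewrite ler_pdivlMr ?mulr_gt0// mulrC.
have bnd e C lam x : 0 <= e -> 0 <= C -> 0 < lam -> 2 * C1 * lam <= 1 ->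
   (forall x, `|g x| <= e * wgt m x + C) -> `|J m lam g x| <= 2 * e * wgt m x + C.
  move=> e0 C_0 lam0 lam1 Hg.
  apply: le_trans (J_bound lf m_supp C1_gt0 abs_le_C1 lam0 lam1 Cg e0 C_0 (fun y _ => Hg y) x) _.
  by rewrite lerD2r ler_pM2r ?wgt_gt0// ler_wpM2r//; lra.
have bndh e C x : 0 <= e -> 0 <= C ->
   (forall x, `|g x| <= e * wgt m x + C) -> `|h x| <= 2 * e * wgt m x + C.
  move=> e0 C_0 Hg; apply/ler_addgt0Pr => r r0.
  have [n1 Hn1] := hlim x r r0; have [n [hn l0 l1]] := n_ok n1.
  have h1 := bnd e C (ln n) x e0 C_0 l0 l1 Hg; have h2 := Hn1 n hn.
  by rewrite -/(u n) in h1; rewrite !ler_norml in h1 h2 *; lra.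
have gC e : 0 < e -> exists2 C, 0 <= C & forall x, `|g x| <= e * wgt m x + C.
  move=> /sg [C HC]; exists `|C| => // x.
  by apply: le_trans (HC x) _; rewrite lerD2l ler_norm.
exists h; split.
- split => // e e0; have [C C_0 HC] := gC (e / 2) ltac:(lra).
  exists C => x; apply: le_trans (bndh (e / 2) C x _ C_0 HC) _; first lra.
  by rewrite le_eqVlt; apply/orP; left; apply/eqP; field.
- move=> a b c ab bc ns; apply/eqP; rewrite -normr_le0; apply/ler_addgt0Pr => e e0.
  have K0 : 0 < 2 * (c - a) by lra.
  have e'0 : 0 < e / (2 * (c - a)) by rewrite divr_gt0.
  have [n1 H1] := hlim a _ e'0; have [n2 H2] := hlim b _ e'0; have [n3 H3] := hlim c _ e'0.
  have [n [hn l0 l1]] := n_ok (n1 + n2 + n3)%N.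
  have := J_gap_affine lf m_supp C1_gt0 abs_le_C1 l0 l1 Cg ab bc ns.
  rewrite -/(u n) => E0.
  have n1n : (n1 <= n)%N by rewrite (leq_trans _ hn)// -addnA leq_addr.
  have n2n : (n2 <= n)%N by rewrite (leq_trans _ hn)// addnAC leq_addl.
  have n3n : (n3 <= n)%N by rewrite (leq_trans _ hn)// leq_addl.
  have := T3_dist (ltW ab) (ltW bc) (H1 n n1n) (H2 n n2n) (H3 n n3n).
  rewrite E0 sub0r normrN add0r => /le_trans; apply.
  by rewrite le_eqVlt; apply/orP; left; apply/eqP; field; rewrite gt_eqF//; lra.
- move=> x sx; apply/eqP; rewrite -subr_eq0 -normr_le0; apply/ler_addgt0Pr => e e0.
  have e20 : 0 < e / 2 by lra.
  have [d [l0 [d0 l00 H]]] := J_near Cg sx e20.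
  have [n0 Hn] := lnl l0 l00; have [n1 Hn1] := hlim x _ e20.
  have [_ h1] := H _ x (Hn (maxn n0 n1) (leq_maxl _ _)) ltac:(by rewrite subrr normr0).
  have h2 := Hn1 (maxn n0 n1) (leq_maxr _ _); rewrite -/(u _) in h1.
  by rewrite add0r; rewrite !ler_norml in h1 h2 *; lra.
move=> e e0; have [C C_0 HC] := gC (e / 8) ltac:(lra).
have [A A0 HA] := wgt_infty lf m_supp (4 * C / e).
have loc x0 : `|x0| <= A -> exists d l0 : R, [/\ 0 < d, 0 < l0 &
    forall lam x, 0 < lam <= l0 -> `|x - x0| < d ->
    2 * C1 * lam <= 1 /\ `|J m lam g x - h x| <= e].
  move=> _; have e20 : 0 < e / 2 by lra.
  have [L [d [l0 [d0 l00 H1 H2]]]] := near x0 _ e20.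
  exists d, l0; split => // lam x hl hx.
  have [g1 g2] := H1 lam x hl hx; have g3 := H2 x hx; split => //.
  by rewrite !ler_norml in g2 g3 *; lra.
have [l0 l00 Hl0] := compact_uniform loc.
exists l0 => // lam x hl.
have [lam1 _] := Hl0 lam 0 hl ltac:(by rewrite normr0 ltW).
have /andP[lam0 _] := hl.
split => //; have [hx|hx] := leP `|x| A.
  have [_ H] := Hl0 lam x hl hx; apply: le_trans H _.
  by rewrite ler_peMr ?wgt_ge1// ltW.
have := HA x (ltW hx); rewrite ler_pdivrMr// => hC.
have h1 := bnd (e / 8) C lam x ltac:(lra) C_0 lam0 lam1 HC.
have h2 := bndh (e / 8) C x ltac:(lra) C_0 HC.
by rewrite !ler_norml in h1 h2 *; lra.
Qed.

End strong_continuity.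

(** * Primitives in the time variable *)

Section primitives.
Context {R : realType}.
Local Notation leb := (@lebesgue_measure R).
Implicit Types (u v : R -> R) (s t c e x : R).

(** For negative [t] the interval is empty and the value is 0; [pos] and [antider] take this into
    account. *)
Definition prim u t : R := \int[leb]_(r in `[0, t]) u r.

Lemma continuous_integrable_itv (mu : {measure set (measurableTypeR R) -> \bar R})
    (i : interval R) (a b : R) u : locally_finite mu -> continuous u ->
  [set` i] `<=` `[a, b]%classic -> mu.-integrable [set` i] (EFin \o u).
Proof.
move=> lf cu iab; apply: measurable_bounded_integrable => //.
- apply: le_lt_trans (locally_finite_itv lf a b); apply: le_measure; rewrite ?inE//.
- by apply: measurable_funTS; exact: continuous_measurable_fun.
have [M HM] := continuous_bounded (`|a| + `|b|) cu.
exists M; split; first exact: num_real.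
move=> r Mr x /= /iab; rewrite /= in_itv /= => /andP[h1 h2].
apply: le_trans (ltW Mr); apply: HM; rewrite ler_norml.
have := ler_norm (- a); have := ler_norm b; rewrite normrN.
by have := normr_ge0 a; have := normr_ge0 b; lra.
Qed.

Lemma Rint_itv_bound (a b c e : R) u : continuous u -> a <= b ->
  (forall r, a < r <= b -> `|u r - c| <= e) ->
  `|\int[leb]_(r in `]a, b]) u r - (b - a) * c| <= (b - a) * e.
Proof.
move=> cu ab H.
have lf := @leb_locally_finite R.
have sub : [set` `]a, b]] `<=` `[a, b]%classic by apply: subset_itvr; rewrite bnd_simp.
have mE : fine (leb `]a, b]%classic) = b - a.
  transitivity (fine (lebesgue_measure `]a, b]%classic)) => //.
  rewrite lebesgue_measure_itv /= lte_fin; case: ltP => //= h.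
  by lra.
have iu : leb.-integrable `]a, b] (EFin \o u) by exact: (continuous_integrable_itv lf cu sub).
have ic k : leb.-integrable `]a, b] (EFin \o (fun _ : R => k : R)).
  by apply: (continuous_integrable_itv lf _ sub) => y; exact: cvg_cst.
have cE k : \int[leb]_(r in `]a, b]) k = (b - a) * k.
  by rewrite Rintegral_cst// mulrC; congr (_ * _); exact: mE.
have h1 : \int[leb]_(r in `]a, b]) u r <= (b - a) * (c + e).
  rewrite -cE; apply: le_Rintegral => // r /=; rewrite in_itv /= => /H.
  by rewrite ler_norml; lra.
have h2 : (b - a) * (c - e) <= \int[leb]_(r in `]a, b]) u r.
  rewrite -cE; apply: le_Rintegral => // r /=; rewrite in_itv /= => /H.
  by rewrite ler_norml; lra.
move: h1 h2; move: (\int[leb]_(r in `]a, b]) u r) => I h1 h2.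
by rewrite ler_norml; lra.
Qed.

Lemma prim_incr u s t c e : continuous u -> 0 <= s <= t ->
  (forall r, s <= r <= t -> `|u r - c| <= e) ->
  `|prim u t - prim u s - (t - s) * c| <= (t - s) * e.
Proof.
move=> cu /andP[s0 st] H; rewrite /prim Rintegral_itvB.
- apply: Rint_itv_bound => // r /andP[h1 h2]; apply: H.
  by rewrite h2 ltW.
- by apply: (@continuous_integrable_itv _ _ 0 t) => //; exact: leb_locally_finite.
- by rewrite bnd_simp.
- by rewrite bnd_simp.
Qed.

Lemma prim0 u : prim u 0 = 0.
Proof. by rewrite /prim set_itv1 Rintegral_set1. Qed.

Lemma prim_diff_bound u s t M : continuous u -> 0 <= s <= t ->
  (forall r, s <= r <= t -> `|u r| <= M) -> `|prim u t - prim u s| <= (t - s) * M.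
Proof.
move=> cu st H; have := prim_incr (c := 0) (e := M) cu st.
by rewrite mulr0 subr0; apply=> r /H; rewrite subr0.
Qed.

Lemma prim_bound u t M : continuous u -> 0 <= t ->
  (forall r, 0 <= r <= t -> `|u r| <= M) -> `|prim u t| <= t * M.
Proof.
move=> cu t0 H; have := @prim_diff_bound u 0 t M cu.
by rewrite prim0 !subr0; apply => //; rewrite lexx.
Qed.

Lemma primD u v t : continuous u -> continuous v ->
  prim (fun r => u r + v r) t = prim u t + prim v t.
Proof.
move=> cu cv; rewrite /prim RintegralD//;
  apply: (@continuous_integrable_itv _ _ 0 t) => //; exact: leb_locally_finite.
Qed.

Lemma primB u v t : continuous u -> continuous v ->
  prim (fun r => u r - v r) t = prim u t - prim v t.
Proof.
move=> cu cv; rewrite /prim RintegralB//;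
  apply: (@continuous_integrable_itv _ _ 0 t) => //; exact: leb_locally_finite.
Qed.

Lemma primZ u t c : continuous u -> prim (fun r => c * u r) t = c * prim u t.
Proof.
move=> cu; rewrite /prim RintegralZl//.
by apply: (@continuous_integrable_itv _ _ 0 t) => //; exact: leb_locally_finite.
Qed.

Lemma prim_riemann u (a : nat -> R) h e n : continuous u -> 0 <= h ->
  (forall j r, (j < n)%N -> j%:R * h <= r <= j.+1%:R * h -> `|u r - a j| <= e) ->
  `|prim u (n%:R * h) - h * \sum_(j < n) a j| <= n%:R * h * e.
Proof.
move=> cu h0; elim: n => [_|n IH H]; first by rewrite big_ord0 !mul0r prim0 mulr0 subrr normr0.
have {}IH := IH (fun j r jn => H j r (ltnW jn)).
have nh : 0 <= n%:R * h <= n.+1%:R * h.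
  by rewrite mulr_ge0//= ler_wpM2r// ler_nat.
have := prim_incr (c := a n) (e := e) cu nh (fun r => H n r (ltnSn n)).
rewrite big_ord_recr /= -natr1 mulrDr !mulrDl mul1r.
by rewrite !ler_norml in IH *; lra.
Qed.

Lemma prim_deriv_eps u t e : continuous u -> 0 <= t -> 0 < e ->
  exists2 d, 0 < d & forall s, 0 <= s -> `|s - t| < d ->
    `|prim u s - prim u t - (s - t) * u t| <= `|s - t| * e.
Proof.
move=> cu t0 e0; have [d d0 Hd] := iffLR (continuous_epsP _) cu t e e0.
exists d => // s s0 hs.
have near (r : R) : (t <= r <= s) || (s <= r <= t) -> `|u r - u t| <= e.
  by move=> h; apply: Hd; move: hs; rewrite !ltr_norml; case/orP: h; lra.
have [st|ts] := leP t s.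
  rewrite [in leRHS]ger0_norm; last lra.
  by apply: prim_incr => //; [rewrite t0|move=> r h; apply: near; rewrite h].
rewrite [in leRHS]ltr0_norm; last lra.
have := @prim_incr u s t (u t) e cu ltac:(by rewrite s0 ltW) (fun r h => near r ltac:(by rewrite h orbT)).
by rewrite !ler_norml; lra.
Qed.

Lemma prim_param_continuous2 (F : R -> R -> R) :
  continuous2 F -> continuous2 (fun x t => prim (F x) (pos t)).
Proof.
move=> cF; apply/continuous2_epsP => x t e e0.
have B0 : 0 <= `|x| + `|t| + 2 by rewrite !addr_ge0.
have [M HM] := continuous2_bounded (`|x| + `|t| + 2) cF.
have M0 : 0 <= M by apply: le_trans (HM 0 0 _ _); rewrite ?normr0.
have K0 : 0 < `|t| + 2 by rewrite ltr_wpDl.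
have e20 : 0 < e / (2 * (`|t| + 2)) by rewrite divr_gt0// mulr_gt0.
have [d d0 Hd] := continuous2_unif (`|x| + `|t| + 2) cF e20.
have e30 : 0 < e / (2 * (M + 1)) by rewrite divr_gt0// mulr_gt0//; lra.
exists (Num.min d (Num.min 1 (e / (2 * (M + 1))))); first by rewrite !lt_min d0 ltr01.
move=> x' t'; rewrite !lt_min => /and3P[x1 x2 _] /and3P[_ t2 t3].
have nx := normr_ge0 x; have nt := normr_ge0 t.
have cs z : continuous (F z) by exact: continuous2_slice2.
have pt := pos_ge0 t; have pt' := pos_ge0 t'.
have hp : `|pos t' - pos t| <= `|t' - t| by exact: pos_lip.
have ptb : pos t <= `|t|.
  by have := pos_lip t 0; rewrite (pos0 (lexx 0)) !subr0 ger0_norm.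
have ptb' : pos t' <= `|t| + 1 by rewrite ler_norml in hp; lra.
have hx' : `|x'| <= `|x| + `|t| + 2.
  by rewrite -(subrK x x') (le_trans (ler_normD _ _))//; lra.
have a1 : `|prim (F x') (pos t) - prim (F x) (pos t)| <= e / 2.
  rewrite -primB//; apply: le_trans (prim_bound (M := e / (2 * (`|t| + 2))) _ pt _) _.
  - by move=> z; apply: cvgB; exact: cs.
  - move=> r /andP[r0 rt]; apply: Hd; rewrite ?subrr ?normr0//; first lra.
    by rewrite ger0_norm//; lra.
  - apply: (@le_trans _ _ ((`|t| + 2) * (e / (2 * (`|t| + 2))))).
      by rewrite ler_pM2r//; lra.
    by rewrite le_eqVlt; apply/orP; left; apply/eqP; field; rewrite gt_eqF.
have Fb r : 0 <= r <= `|t| + 1 -> `|F x' r| <= M.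
  by move=> /andP[r0 r1]; apply: HM => //; rewrite ger0_norm//; lra.
have Mt : `|t' - t| * M <= e / 2.
  apply: (@le_trans _ _ (e / (2 * (M + 1)) * (M + 1))).
    by rewrite ler_pM//; lra.
  by rewrite le_eqVlt; apply/orP; left; apply/eqP; field; rewrite gt_eqF//; lra.
have a2 : `|prim (F x') (pos t') - prim (F x') (pos t)| <= e / 2.
  apply: le_trans Mt; have [h|h] := leP (pos t) (pos t').
    apply: le_trans (prim_diff_bound (M := M) (cs x') _ _) _.
    - by rewrite pt.
    - by move=> r hr; apply: Fb; lra.
    - by rewrite ler_wpM2r//; rewrite ler_norml in hp; lra.
  rewrite distrC; apply: le_trans (prim_diff_bound (M := M) (cs x') _ _) _.
  - by rewrite pt' ltW.
  - by move=> r hr; apply: Fb; lra.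
  - by rewrite ler_wpM2r//; rewrite ler_norml in hp; lra.
by rewrite !ler_norml in a1 a2 *; lra.
Qed.

End primitives.

(** * The affine interpolation across the gaps of the support *)

Section affine_interpolation.
Context {R : realType}.
Variable m : {measure set (measurableTypeR R) -> \bar R}.
Hypothesis lf : locally_finite m.
Hypothesis m_supp : forall b : R, 0 < b ->
  supp m `&` `]-oo, - b] !=set0 /\ supp m `&` `[b, +oo[ !=set0.
Variable C1 : R.
Hypothesis C1_gt0 : 0 < C1.
Hypothesis abs_le_C1 : forall x, `|x| <= C1 * wgt m x.
Implicit Types (f g h : R -> R) (a b c x y e : R).

(** A component of the complement is an interval missing the ends [p] and [q] of the gap, hence
    contained in it; the affine function is the chord of [h] over [[p, q]]. *)
Lemma gap_affine_interpolation g h : continuous h -> gap_affine m h ->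
  (forall x, supp m x -> h x = g x) -> is_affine_interpolation m g h.
Proof.
move=> ch gh hg; split => // x nsx.
have [p [q [/andP[px xq] sp sq ns]]] := gap_ends m_supp nsx.
pose k := (h q - h p) / (q - p).
exists k, (h p - k * p) => y [C [Cx CA cC] Cy].
have iC : is_interval C by exact/connected_intervalP.
have py : p < y.
  rewrite ltNge; apply/negP => yp; apply: (CA p) => //.
  by apply: (iC y x) => //; rewrite yp ltW.
have yq : y < q.
  rewrite ltNge; apply/negP => qy; apply: (CA q) => //.
  by apply: (iC x y) => //; rewrite qy ltW.
have := gh p y q py yq ns; rewrite /T3 => E.
have pq : q - p != 0 by rewrite subr_eq0 gt_eqF//; lra.
have kE : k * (q - p) = h q - h p by rewrite /k divfK.
apply: (mulfI pq).
have -> : (q - p) * (k * y + (h p - k * p)) = (k * (q - p)) * (y - p) + (q - p) * h p by ring.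
by rewrite kE; lra.
Qed.

(** The component of [b] contains []a, c[], and continuity carries the affine formula to [a] and
    [c]. *)
Lemma interpolation_gap_affine g h : is_affine_interpolation m g h -> gap_affine m h.
Proof.
move=> [ch hg ha] a b c ab bc ns.
have [k [l Hkl]] := ha b (ns b ltac:(lra)).
have hE y : a < y < c -> h y = k * y + l.
  move=> yac; apply: Hkl; exists `]a, c[%classic.
    split; first by rewrite /= in_itv /=; lra.
      by move=> z /=; rewrite in_itv /=; exact: ns.
    apply/connected_intervalP; exact: interval_is_interval.
  by rewrite /= in_itv.
have cD : continuous (fun y => h y - (k * y + l)).
  move=> y; apply: cvgB; first exact: ch.
  by apply: cvgD; [apply: cvgM; [exact: cvg_cst|exact: cvg_id]|exact: cvg_cst].
have end0 z : (z = a) \/ (z = c) -> h z = k * z + l.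
  move=> hz; apply/eqP; rewrite -subr_eq0 -normr_le0; apply/ler_addgt0Pr => e e0.
  have [d d0 Hd] := iffLR (continuous_epsP _) cD z e e0.
  pose r := Num.min (d / 2) ((c - a) / 2).
  have r0 : 0 < r by rewrite lt_min !divr_gt0//; lra.
  have r1 : r <= d / 2 by rewrite ge_min lexx.
  have r2 : r <= (c - a) / 2 by rewrite ge_min lexx orbT.
  pose y := if z == a then z + r else z - r.
  have yI : a < y < c /\ `|y - z| < d.
    case: hz => hz; rewrite /y hz.
      by rewrite eqxx; split; [lra|rewrite ltr_norml; lra].
    by rewrite gt_eqF; [split; [lra|rewrite ltr_norml; lra]|lra].
  have := Hd y (proj2 yI); rewrite (hE y (proj1 yI)) subrr sub0r normrN.
  by rewrite add0r.
rewrite /T3 (end0 a) ?(end0 c) ?(hE b); [ring|lra|by right|by left].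
Qed.

Lemma gbar_interpolation g : C0 m g -> is_affine_interpolation m g (gbar m g).
Proof.
move=> Cg; have [h [[ch _] gh hg _]] := J_limit lf m_supp C1_gt0 abs_le_C1 Cg.
rewrite /gbar; apply: (@getPex _ (is_affine_interpolation m g)).
by exists h; exact: gap_affine_interpolation.
Qed.

(** By [gap_affine_le] a function affine on the gaps is determined by its values on the support, so
    [gbar m g] is the limit of [J_limit]. The resolvent sees only those values, hence the
    convergence also holds with [gbar m g] as datum. *)
Lemma gbar_spec g : C0 m g -> [/\ C0 m (gbar m g), gap_affine m (gbar m g),
  forall x, supp m x -> gbar m g x = g x &
  forall e, 0 < e -> exists2 l0, 0 < l0 & forall lam x, 0 < lam <= l0 ->
    2 * C1 * lam <= 1 /\ `|J m lam (gbar m g) x - gbar m g x| <= e * wgt m x].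
Proof.
move=> Cg; have [h [Ch gh hg Hlim]] := J_limit lf m_supp C1_gt0 abs_le_C1 Cg.
have gb := gbar_interpolation Cg; have [cb bg _] := gb.
have ga := interpolation_gap_affine gb.
have E : gbar m g = h.
  apply/funext => x; apply/eqP; rewrite eq_le; apply/andP; split.
    by apply: (gap_affine_le m_supp ga gh) => y sy; rewrite bg// hg.
  by apply: (gap_affine_le m_supp gh ga) => y sy; rewrite bg// hg.
rewrite E; split => // e /Hlim [l0 l00 H]; exists l0 => // lam x hl.
have [l1 h1] := H lam x hl; split => //.
have /andP[lam0 _] := hl.
rewrite (J_eq_supp lf m_supp C1_gt0 abs_le_C1 lam0 l1 Ch Cg)//.
Qed.

End affine_interpolation.

(** * Backward Euler steps and the effect of halving the step *)

Section euler_scheme.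
Context {R : realType}.
Variable m : {measure set (measurableTypeR R) -> \bar R}.
Hypothesis lf : locally_finite m.
Hypothesis m_supp : forall b : R, 0 < b ->
  supp m `&` `]-oo, - b] !=set0 /\ supp m `&` `[b, +oo[ !=set0.
Variable C1 : R.
Hypothesis C1_gt0 : 0 < C1.
Hypothesis abs_le_C1 : forall x, `|x| <= C1 * wgt m x.
Implicit Types (f g h phi b c : R -> R) (x y e t T M : R) (n k : nat).

(** Dyadic, so that successive time grids are nested; the constant gives [2 * C1 * mesh k <= 1/2],
    within the range of the resolvent estimates. *)
Definition mesh k : R := (4 * C1)^-1 / 2 ^+ k.

Lemma step_gt0 k : 0 < mesh k.
Proof. by rewrite divr_gt0 ?exprn_gt0// invr_gt0 mulr_gt0. Qed.

Lemma step_le k : 2 * C1 * mesh k <= 1.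
Proof.
have c0 := C1_gt0.
have -> : 2 * C1 * mesh k = (1 / 2) / 2 ^+ k.
  by rewrite /mesh; field; rewrite !gt_eqF ?exprn_gt0.
rewrite ler_pdivrMr ?exprn_gt0// mul1r.
have : 1 <= 2 ^+ k :> R by rewrite exprn_ege1//; lra.
lra.
Qed.

Lemma stepS k : mesh k = 2 * mesh k.+1.
Proof. by rewrite /mesh exprS; field; rewrite !gt_eqF ?exprn_gt0. Qed.

Lemma step_small e : 0 < e -> exists k0, forall k, (k0 <= k)%N -> mesh k <= e.
Proof.
move=> e0; have c0 := C1_gt0; have K0 : 0 < 4 * C1 by lra.
have [k0 H] := @expr_lt_eps R (1/2) (e * (4 * C1)) ltac:(lra) (mulr_gt0 e0 K0).
exists k0 => k /H; rewrite expr_div_n expr1n => h.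
by rewrite /mesh mulrC ler_pdivrMr// -[X in X <= _]mul1r.
Qed.

Let Jk k := J m (mesh k).
Let Jk_C0 k f (Cf : C0 m f) : C0 m (Jk k f) :=
  J_C0 lf m_supp C1_gt0 abs_le_C1 (step_gt0 k) (step_le k) Cf.

(** The backward Euler approximation of the semigroup exp(t A) at time [n * mesh k]. *)
Definition Jiter k n g : R -> R := iter n (J m (mesh k)) g.

Lemma E_C0 k n g : C0 m g -> C0 m (Jiter k n g).
Proof. by move=> Cg; elim: n => //= n IH; exact: Jk_C0. Qed.

Lemma E_B k n f g : C0 m f -> C0 m g ->
  Jiter k n (fun x => f x - g x) = (fun x => Jiter k n f x - Jiter k n g x).
Proof.
move=> Cf Cg; elim: n => //= n IH; rewrite -/(Jiter k n _) IH.
exact: (JB lf m_supp C1_gt0 abs_le_C1 (step_gt0 k) (step_le k) (E_C0 k n Cf) (E_C0 k n Cg)).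
Qed.

Lemma E_Z k n f (l : R) : C0 m f -> Jiter k n (fun x => l * f x) = (fun x => l * Jiter k n f x).
Proof.
move=> Cf; elim: n => //= n IH; rewrite -/(Jiter k n _) IH.
exact: (JZ lf m_supp C1_gt0 abs_le_C1 (step_gt0 k) (step_le k) l (E_C0 k n Cf)).
Qed.

Lemma growth_le (z : R) n : 0 <= z -> (1 + z) ^+ n <= expR (n%:R * z).
Proof.
move=> z0; rewrite mulrC expRM_natr lerXn2r ?nnegrE ?expR_ge0//; first lra.
exact: expR_ge1Dx.
Qed.

Lemma E_bound_pow k n f e M : C0 m f -> 0 <= e -> 0 <= M ->
  (forall x, `|f x| <= e * wgt m x + M) ->
  forall x, `|Jiter k n f x| <= (1 + 2 * C1 * mesh k) ^+ n * e * wgt m x + M.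
Proof.
move=> Cf e0 M0 Hf; elim: n => [|n IH] x; first by rewrite expr0 mul1r.
have c0 := C1_gt0; have s0 := step_gt0 k.
have k0 : 0 <= 1 + 2 * C1 * mesh k by have := mulr_gt0 c0 s0; lra.
have e1 : 0 <= (1 + 2 * C1 * mesh k) ^+ n * e by rewrite mulr_ge0// exprn_ge0.
have := J_bound lf m_supp C1_gt0 abs_le_C1 (step_gt0 k) (step_le k) (E_C0 k n Cf) e1 M0
  (fun y _ => IH y) x.
by rewrite exprS !mulrA.
Qed.

(** Bounds the growth factor [(1 + 2 * C1 * mesh k) ^+ n] uniformly in [k] as long as
    [n * mesh k <= T]. *)
Definition gr T : R := expR (2 * C1 * T).

Lemma gr_ge1 T : 0 <= T -> 1 <= gr T.
Proof.
move=> T0; have c0 := C1_gt0.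
by rewrite /gr -[leLHS]expR0 ler_expR; have := mulr_ge0 (ltW c0) T0; lra.
Qed.

Lemma gr_gt0 T : 0 < gr T. Proof. exact: expR_gt0. Qed.

Lemma E_bound k n T f e M : C0 m f -> 0 <= e -> 0 <= M -> n%:R * mesh k <= T ->
  (forall x, `|f x| <= e * wgt m x + M) ->
  forall x, `|Jiter k n f x| <= gr T * e * wgt m x + M.
Proof.
move=> Cf e0 M0 nT Hf x; have c0 := C1_gt0; have s0 := step_gt0 k.
apply: le_trans (E_bound_pow k n Cf e0 M0 Hf x) _.
rewrite lerD2r ler_pM2r ?wgt_gt0// ler_wpM2r//.
have z0 : 0 <= 2 * C1 * mesh k by have := mulr_gt0 c0 s0; lra.
apply: le_trans (growth_le n z0) _; rewrite /gr ler_expR.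
have -> : n%:R * (2 * C1 * mesh k) = 2 * C1 * (n%:R * mesh k) by ring.
by rewrite ler_pM2l//; lra.
Qed.

Lemma E_bound0 k n T f e : C0 m f -> 0 <= e -> n%:R * mesh k <= T ->
  (forall x, `|f x| <= e * wgt m x) -> forall x, `|Jiter k n f x| <= gr T * e * wgt m x.
Proof.
move=> Cf e0 nT Hf x; have := @E_bound k n T f e 0 Cf e0 (lexx _) nT _ x.
by rewrite addr0; apply => y; rewrite addr0.
Qed.

Lemma C0_wbound f : C0 m f -> exists2 M, 0 <= M & forall x, `|f x| <= M * wgt m x.
Proof.
move=> [_ /(_ 1 ltr01) [C HC]]; exists (1 + `|C|); first by rewrite addr_ge0.
move=> x; apply: le_trans (HC x) _; have w1 := wgt_ge1 lf x.
have : C <= `|C| * wgt m x.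
  by apply: le_trans (ler_norm C) _; rewrite ler_peMr.
by lra.
Qed.

(* One step of size 2 l against two steps of size l, up to second order. *)
Lemma two_steps k phi b c : C0 m phi -> C0 m b -> C0 m c -> Rel m phi b -> Rel m b c ->
  Jk k.+1 (Jk k.+1 phi) =
  (fun x => Jk k phi x - (mesh k.+1) ^+ 2 * Jk k.+1 (Jk k.+1 (Jk k c)) x).
Proof.
move=> Cp Cb Cc r1 r2; set l := mesh k.+1.
have gen j v a (Cv : C0 m v) (Ca : C0 m a) (r : Rel m v a) :=
  J_generator lf m_supp C1_gt0 abs_le_C1 (step_gt0 j) (step_le j) Cv Ca r.
have sub j f g (a : R) : C0 m f -> C0 m g ->
    Jk j (fun x => f x - a * g x) = (fun x => Jk j f x - a * Jk j g x).
  move=> Cf Cg; rewrite /Jk.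
  have := JZ lf m_supp C1_gt0 abs_le_C1 (step_gt0 j) (step_le j) a Cg.
  have := JB lf m_supp C1_gt0 abs_le_C1 (step_gt0 j) (step_le j) Cf (C0Z lf a Cg).
  by move=> /= -> ->.
have [e1 rp] := gen k _ _ Cp Cb r1; have [e2 rb] := gen k _ _ Cb Cc r2.
rewrite -/(Jk k) in e1 rp e2 rb.
have CJp := Jk_C0 k Cp; have CJb := Jk_C0 k Cb; have CJc := Jk_C0 k Cc.
have [e3 rp'] := gen k.+1 _ _ CJp CJb rp; have [e4 rb'] := gen k.+1 _ _ CJb CJc rb.
rewrite -/(Jk k.+1) -/l in e3 rp' e4 rb'.
(* That is, phi = (1 - 2 l A) J phi for the resolvent of step [2 * l]. Applying the resolvent of
   step [l] twice and using its commutation with A leaves only the second-order term. *)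
have phiE : phi = (fun x => Jk k phi x - (2 * l) * Jk k b x).
  by apply/funext => x; rewrite e1 stepS -/l; ring.
have C2b := Jk_C0 k.+1 CJb; have C2c := Jk_C0 k.+1 CJc.
have J1 : Jk k.+1 phi = (fun x => Jk k phi x - l * Jk k.+1 (Jk k b) x).
  rewrite [in LHS]phiE (sub k.+1 _ _ (2 * l) CJp CJb).
  apply/funext => x; rewrite e3.
  by move: (Jk k phi x) (Jk k.+1 (Jk k b) x) => A B; ring.
have e5 : Jk k.+1 (Jk k.+1 (Jk k b)) =
    (fun x => Jk k.+1 (Jk k b) x + l * Jk k.+1 (Jk k.+1 (Jk k c)) x).
  by have [] := gen k.+1 _ _ C2b C2c rb'.
rewrite J1 (sub k.+1 _ _ l CJp C2b).
apply/funext => x; rewrite e3 e5.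
move: (Jk k phi x) (Jk k.+1 (Jk k b) x) (Jk k.+1 (Jk k.+1 (Jk k c)) x) => A B Z.
by ring.
Qed.

Lemma Jk_wbound k f M : C0 m f -> 0 <= M -> (forall x, `|f x| <= M * wgt m x) ->
  forall x, `|Jk k f x| <= (1 + 2 * C1 * mesh k) * M * wgt m x.
Proof.
move=> Cf M0 Hf x.
have := J_bound lf m_supp C1_gt0 abs_le_C1 (step_gt0 k) (step_le k) Cf M0 (lexx 0) _ x.
by rewrite addr0; apply => y _; rewrite addr0.
Qed.

(** Telescoping: each coarse step is replaced by two fine ones at the cost given by [two_steps], of
    order [mesh k.+1 ^+ 2], and the later steps amplify that cost by at most the growth factor. *)
Lemma E_refine k n phi b c M : C0 m phi -> C0 m b -> C0 m c -> Rel m phi b -> Rel m b c ->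
  0 <= M -> (forall x, `|c x| <= M * wgt m x) ->
  forall x, `|Jiter k.+1 (2 * n) phi x - Jiter k n phi x| <=
    n%:R * (mesh k.+1) ^+ 2 * (((1 + 2 * C1 * mesh k) * (1 + 2 * C1 * mesh k.+1) ^+ 2) ^+ n)
    * M * wgt m x.
Proof.
set k1 := 1 + 2 * C1 * mesh k; set k2 := 1 + 2 * C1 * mesh k.+1; set l := mesh k.+1.
have c0 := C1_gt0; have s1 := step_gt0 k; have s2 := step_gt0 k.+1.
have k11 : 1 <= k1 by rewrite /k1; have := mulr_gt0 c0 s1; lra.
have k21 : 1 <= k2 by rewrite /k2; have := mulr_gt0 c0 s2; lra.
set kk := k1 * k2 ^+ 2.
have k22 : 1 <= k2 ^+ 2 by rewrite exprn_ege1.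
have kk1 : k1 <= kk by rewrite /kk ler_peMr//; lra.
have kk2 : k2 ^+ 2 <= kk by rewrite /kk ler_peMl//; lra.
have kk0 : 1 <= kk by lra.
elim: n phi b c M => [|n IH] phi b c M Cp Cb Cc r1 r2 M0 Hc x.
  by rewrite muln0 /= subrr normr0 !mul0r.
have [e1 rp] := J_generator lf m_supp C1_gt0 abs_le_C1 (step_gt0 k) (step_le k) Cp Cb r1.
have [e2 rb] := J_generator lf m_supp C1_gt0 abs_le_C1 (step_gt0 k) (step_le k) Cb Cc r2.
rewrite -!/(Jk k) in e1 rp e2 rb.
have CJp := Jk_C0 k Cp; have CJb := Jk_C0 k Cb; have CJc := Jk_C0 k Cc.
have k1M : 0 <= k1 * M by rewrite mulr_ge0//; lra.
have h1 := IH _ _ _ (k1 * M) CJp CJb CJc rp rb k1M (Jk_wbound k Cc M0 Hc) x.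
have C2c := Jk_C0 k.+1 CJc; have C3c := Jk_C0 k.+1 C2c.
have h2 : `|Jiter k.+1 (2 * n) (Jk k.+1 (Jk k.+1 (Jk k c))) x| <= k2 ^+ (2 * n) * (k2 ^+ 2 * (k1 * M)) * wgt m x.
  have k2M : 0 <= k2 * (k1 * M) by rewrite mulr_ge0//; lra.
  have b0 : 0 <= k2 ^+ 2 * (k1 * M) by rewrite mulr_ge0//; lra.
  have := @E_bound_pow k.+1 (2 * n) _ (k2 ^+ 2 * (k1 * M)) 0 C3c b0 (lexx 0) _ x.
  rewrite addr0; apply => y; rewrite addr0.
  have -> : k2 ^+ 2 * (k1 * M) = k2 * (k2 * (k1 * M)) by ring.
  exact: Jk_wbound k2M (Jk_wbound k.+1 CJc k1M (Jk_wbound k Cc M0 Hc)) y.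
have -> : Jiter k.+1 (2 * n.+1) phi = Jiter k.+1 (2 * n) (Jk k.+1 (Jk k.+1 phi)).
  by rewrite mulnS addnC /Jiter iterD.
have -> : Jiter k n.+1 phi = Jiter k n (Jk k phi) by rewrite /Jiter iterSr.
rewrite (two_steps k Cp Cb Cc r1 r2) -/l.
rewrite (E_B _ _ CJp (C0Z lf (l ^+ 2) C3c)) (E_Z _ _ _ C3c).
rewrite [X in `|X| <= _]addrAC.
apply: le_trans (ler_normB _ _) _.
have w0 := wgt_gt0 lf x.
have l20 : 0 <= l ^+ 2 by rewrite sqr_ge0.
have kn0 : 0 <= kk ^+ n by rewrite exprn_ge0//; lra.
have b1 : n%:R * l ^+ 2 * kk ^+ n * (k1 * M) * wgt m x <= n%:R * l ^+ 2 * kk ^+ n.+1 * M * wgt m x.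
  rewrite ler_pM2r// (exprSr kk).
  rewrite (_ : _ * (k1 * M) = n%:R * l ^+ 2 * kk ^+ n * M * k1); last by ring.
  rewrite (_ : _ * (kk ^+ n * kk) * M = n%:R * l ^+ 2 * kk ^+ n * M * kk); last by ring.
  apply: ler_wpM2l => //; apply: mulr_ge0 => //; apply: mulr_ge0 => //.
  exact: mulr_ge0.
have b2 : `|l ^+ 2 * Jiter k.+1 (2 * n) (Jk k.+1 (Jk k.+1 (Jk k c))) x| <= l ^+ 2 * kk ^+ n.+1 * M * wgt m x.
  rewrite normrM (ger0_norm l20).
  rewrite (_ : l ^+ 2 * kk ^+ n.+1 * M * wgt m x = l ^+ 2 * (kk ^+ n.+1 * M * wgt m x)); last by ring.
  apply: ler_wpM2l => //; apply: le_trans h2 _.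
  rewrite ler_pM2r// exprM (exprSr kk).
  rewrite (_ : _ * (k2 ^+ 2 * (k1 * M)) = (k2 ^+ 2) ^+ n * (kk * M)); last by rewrite /kk; ring.
  rewrite -mulrA ler_wpM2r//; first by rewrite mulr_ge0//; lra.
  by rewrite lerXn2r// nnegrE; lra.
apply: le_trans (lerD (le_trans h1 b1) b2) _.
by rewrite le_eqVlt; apply/orP; left; apply/eqP; rewrite -natr1; ring.
Qed.

End euler_scheme.

(** * Convergence of the Euler scheme to a mild solution *)

Section mild_solution.
Context {R : realType}.
Variable m : {measure set (measurableTypeR R) -> \bar R}.
Hypothesis lf : locally_finite m.
Hypothesis m_supp : forall b : R, 0 < b ->
  supp m `&` `]-oo, - b] !=set0 /\ supp m `&` `[b, +oo[ !=set0.
Variable C1 : R.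
Hypothesis C1_gt0 : 0 < C1.
Hypothesis abs_le_C1 : forall x, `|x| <= C1 * wgt m x.
Implicit Types (f h phi b c : R -> R) (x y e t s T M : R) (n k j : nat).

(* Solution integrated once in time; functions are frozen at negative times. *)
Definition mild (g : R -> R) (U : R -> R -> R) := [/\ continuous2 U,
  forall x t : R, t <= 0 -> U x t = g x,
  forall T e : R, 0 <= T -> 0 < e -> exists C, forall x t, t <= T -> `|U x t| <= e * wgt m x + C &
  forall t : R, 0 <= t -> Rel m (fun x => prim (U x) t) (fun x => U x t - g x)].

Local Notation step := (mesh C1).
Local Notation E := (Jiter m C1).
Local Notation gr := (gr C1).

Let s0 k : 0 < step k := step_gt0 C1_gt0 k.

Lemma pow_le_gr k n T : n%:R * step k <= T -> (1 + 2 * C1 * step k) ^+ n <= gr T.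
Proof.
move=> nT; have c0 := C1_gt0.
have z0 : 0 <= 2 * C1 * step k by have := mulr_gt0 c0 (s0 k); lra.
apply: le_trans (growth_le n z0) _; rewrite /gr ler_expR.
have -> : n%:R * (2 * C1 * step k) = 2 * C1 * (n%:R * step k) by ring.
by rewrite ler_pM2l//; lra.
Qed.

Definition steps k t : nat := Num.truncn (pos t / step k).

Lemma steps_itv k t : (steps k t)%:R * step k <= pos t < (steps k t).+1%:R * step k.
Proof.
have := @truncn_itv R (pos t / step k) (divr_ge0 (pos_ge0 t) (ltW (s0 k))).
by rewrite ler_pdivlMr// ltr_pdivrMr.
Qed.

Lemma steps_le k t T : 0 <= T -> t <= T -> (steps k t)%:R * step k <= T.
Proof.
move=> T0 tT; have /andP[h _] := steps_itv k t; apply: le_trans h _.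
by have [h|h] := leP t 0; [rewrite pos0|rewrite posE// ltW].
Qed.

Lemma steps_nat k j : steps k (j%:R * step k) = j.
Proof.
rewrite /steps posE; last by rewrite mulr_ge0// ltW.
by rewrite mulfK ?gt_eqF// natrK.
Qed.

Lemma steps0 k t : t <= 0 -> steps k t = 0%N.
Proof. by move=> t0; rewrite /steps pos0// mul0r truncn0. Qed.

Lemma stepsS k t : steps k.+1 t = (2 * steps k t)%N \/ steps k.+1 t = (2 * steps k t).+1.
Proof.
have /andP[h1 h2] := steps_itv k t; have /andP[h3 h4] := steps_itv k.+1 t.
have sl := s0 k.+1.
rewrite (stepS C1_gt0) in h1 h2.
set n := steps k t in h1 h2 *; set n' := steps k.+1 t in h3 h4 *.
have a1 : (2 * n < n'.+1)%N.
  rewrite -(ltr_nat R) -(ltr_pM2r sl); apply: le_lt_trans h4.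
  by apply: le_trans h1; rewrite natrM; lra.
have a2 : (n' < (2 * n).+2)%N.
  rewrite -(ltr_nat R) -(ltr_pM2r sl); apply: le_lt_trans h3 _.
  apply: lt_le_trans h2 _; rewrite -natr1 -[in leRHS]natr1 -[in leRHS]natr1 natrM.
  by rewrite le_eqVlt; apply/orP; left; apply/eqP; ring.
by lia.
Qed.

Definition Ue f k x t := E k (steps k t) f x.

Lemma Ue_bound f k T e M : C0 m f -> 0 <= T -> 0 <= e -> 0 <= M ->
  (forall x, `|f x| <= e * wgt m x + M) ->
  forall x t, t <= T -> `|Ue f k x t| <= gr T * e * wgt m x + M.
Proof. by move=> Cf T0 e0 M0 Hf x t tT; apply: E_bound => //; exact: steps_le. Qed.

Lemma Ue_dist f h k T e : C0 m f -> C0 m h -> 0 <= T -> 0 <= e ->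
  (forall x, `|f x - h x| <= e * wgt m x) ->
  forall x t, t <= T -> `|Ue f k x t - Ue h k x t| <= gr T * e * wgt m x.
Proof.
move=> Cf Ch T0 e0 Hf x t tT.
have := @Ue_bound _ k T e 0 (C0B lf Cf Ch) T0 e0 (lexx _) _ x t tT.
rewrite addr0 /Ue (E_B lf m_supp C1_gt0 abs_le_C1 _ _ Cf Ch); apply=> y.
by rewrite addr0.
Qed.

(** One implicit step adds [step k] times A of the result, and A commutes with the iterates; here
    [b] is A phi. *)
Lemma E_step k n phi b : C0 m phi -> C0 m b -> Rel m phi b ->
  E k n.+1 phi = (fun x => E k n phi x + step k * E k n.+1 b x).
Proof.
move=> Cp Cb r.
have C3 := J_C0 lf m_supp C1_gt0 abs_le_C1 (s0 k) (step_le C1_gt0 k) Cb.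
have [e1 _] := J_generator lf m_supp C1_gt0 abs_le_C1 (s0 k) (step_le C1_gt0 k) Cp Cb r.
have e2 : (fun x => phi x + step k * J m (step k) b x) =
    (fun x => phi x - (- step k) * J m (step k) b x).
  by apply/funext => x; ring.
rewrite /Jiter !iterSr -!/(Jiter _ _ _ _ _) e1 e2.
rewrite (E_B lf m_supp C1_gt0 abs_le_C1 _ _ Cp (C0Z lf (- step k) C3)).
rewrite (E_Z lf m_supp C1_gt0 abs_le_C1 _ _ _ C3).
by apply/funext => x; ring.
Qed.

Lemma E_time k n n' T phi b M : C0 m phi -> C0 m b -> Rel m phi b -> 0 <= M ->
  (forall x, `|b x| <= M * wgt m x) -> (n <= n')%N -> n'%:R * step k <= T ->
  forall x, `|E k n' phi x - E k n phi x| <= (n' - n)%:R * step k * (gr T * M) * wgt m x.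
Proof.
move=> Cp Cb r M0 Hb /subnKC <-; move: (n' - n)%N => j {n'} jT x.
elim: j jT => [|j IH] jT; first by rewrite addn0 subnn subrr normr0 !mul0r.
have jT' : (n + j)%:R * step k <= T.
  by apply: le_trans jT; rewrite ler_pM2r// ler_nat leq_add2l.
have := IH jT'; have := E_bound0 lf m_supp C1_gt0 abs_le_C1 Cb M0 jT Hb x.
rewrite addnS (E_step k (n + j) Cp Cb r) -addnS !addKn => h1 h2.
have -> : E k (n + j) phi x + step k * E k (n + j.+1) b x - E k n phi x =
   (E k (n + j) phi x - E k n phi x) + step k * E k (n + j.+1) b x by ring.
apply: le_trans (ler_normD _ _) _; rewrite normrM (gtr0_norm (s0 k)).
have h3 : step k * `|E k (n + j.+1) b x| <= step k * (gr T * M * wgt m x).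
  by rewrite ler_pM2l.
apply: le_trans (lerD h2 h3) _.
by rewrite -natr1 le_eqVlt; apply/orP; left; apply/eqP; ring.
Qed.

(** Compare at the index [2 * n] by [E_refine]; the finer grid may have completed one more step,
    which [E_time] bounds by a multiple of the step length. *)
Lemma Ue_refine T phi b c : 0 <= T -> C0 m phi -> C0 m b -> C0 m c ->
  Rel m phi b -> Rel m b c -> exists2 K : R, 0 <= K & forall k x t, t <= T ->
    `|Ue phi k.+1 x t - Ue phi k x t| <= K * wgt m x * (1 / 2) ^+ k.
Proof.
move=> T0 Cp Cb Cc r1 r2.
have [Mb Mb0 HMb] := C0_wbound lf Cb; have [Mc Mc0 HMc] := C0_wbound lf Cc.
have c0 := C1_gt0.
pose tau := (4 * C1)^-1; have tau0 : 0 < tau by rewrite invr_gt0 mulr_gt0.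
have g0 := gr_gt0 C1 T.
exists (T * tau * (gr T * gr T ^+ 2) * Mc + tau * (gr T * Mb)).
  by rewrite addr_ge0// !mulr_ge0 ?exprn_ge0// ltW.
move=> k x t tT; have w0 := wgt_gt0 lf x.
have sl := s0 k.+1; have sk := s0 k; have sE := stepS C1_gt0 k.
have stau : step k.+1 <= tau * (1 / 2) ^+ k.
  rewrite /mesh -/tau expr_div_n expr1n div1r ler_pM2l//.
  by rewrite lef_pV2 ?posrE ?exprn_gt0// ler_weXn2l//; lra.
set n := steps k t.
have nT : n%:R * step k <= T by exact: steps_le.
have nT' : n%:R * step k.+1 <= T.
  apply: le_trans nT; rewrite ler_wpM2l//; lra.
have h1 := E_refine lf m_supp C1_gt0 abs_le_C1 k n Cp Cb Cc r1 r2 Mc0 HMc x.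
have pw : ((1 + 2 * C1 * step k) * (1 + 2 * C1 * step k.+1) ^+ 2) ^+ n <= gr T * gr T ^+ 2.
  have p1 : 0 <= 1 + 2 * C1 * step k by have := mulr_gt0 c0 sk; lra.
  have p2 : 0 <= 1 + 2 * C1 * step k.+1 by have := mulr_gt0 c0 sl; lra.
  rewrite exprMn ler_pM ?exprn_ge0//; first exact: pow_le_gr.
  rewrite -exprM mulnC exprM lerXn2r ?nnegrE ?exprn_ge0//; first exact: ltW.
  exact: pow_le_gr.
have h2 : `|E k.+1 (2 * n) phi x - E k n phi x| <=
    T * tau * (gr T * gr T ^+ 2) * Mc * wgt m x * (1 / 2) ^+ k.
  apply: le_trans h1 _.
  rewrite (_ : n%:R * step k.+1 ^+ 2 * _ * Mc * wgt m x =
    (n%:R * step k.+1) * step k.+1 *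
    (((1 + 2 * C1 * step k) * (1 + 2 * C1 * step k.+1) ^+ 2) ^+ n) * (Mc * wgt m x)); last by ring.
  rewrite (_ : T * tau * _ * Mc * wgt m x * _ =
    T * (tau * (1 / 2) ^+ k) * (gr T * gr T ^+ 2) * (Mc * wgt m x)); last by ring.
  have p1 : 0 <= 1 + 2 * C1 * step k by have := mulr_gt0 c0 sk; lra.
  have p2 : 0 <= 1 + 2 * C1 * step k.+1 by have := mulr_gt0 c0 sl; lra.
  rewrite ler_wpM2r ?mulr_ge0 ?(ltW w0)//.
  have sl0 := ltW sl; have ns0 : 0 <= n%:R * step k.+1 by exact: mulr_ge0.
  apply: ler_pM => //; first exact: mulr_ge0.
    by apply: exprn_ge0; apply: mulr_ge0 => //; exact: exprn_ge0.
  exact: ler_pM.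
have h3 : `|Ue phi k.+1 x t - E k.+1 (2 * n) phi x| <=
    tau * (gr T * Mb) * wgt m x * (1 / 2) ^+ k.
  have N'T : (steps k.+1 t)%:R * step k.+1 <= T by exact: steps_le.
  have n'n : (2 * n <= steps k.+1 t)%N by have [->|->] := stepsS k t.
  apply: le_trans (E_time Cp Cb r1 Mb0 HMb n'n N'T x) _.
  rewrite (_ : tau * _ * wgt m x * _ = (tau * (1 / 2) ^+ k) * (gr T * Mb * wgt m x)); last by ring.
  rewrite -mulrA ler_wpM2r ?mulr_ge0 ?(ltW g0) ?(ltW w0)//.
  apply: le_trans stau; rewrite ler_piMl ?(ltW sl)// -[leRHS]/(1%:R) ler_nat.
  by have [->|->] := stepsS k t; rewrite ?subnn ?subSnn.
have -> : Ue phi k.+1 x t - Ue phi k x t = (Ue phi k.+1 x t - E k.+1 (2 * n) phi x) +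
   (E k.+1 (2 * n) phi x - E k n phi x) by rewrite /Ue -/n; ring.
apply: le_trans (ler_normD _ _) _; apply: le_trans (lerD h3 h2) _.
by rewrite le_eqVlt; apply/orP; left; apply/eqP; ring.
Qed.

Variable g : R -> R.
Hypothesis Cg : C0 m g.
Hypothesis g_strong : forall e, 0 < e -> exists2 l0 : R, 0 < l0 & forall lam x, 0 < lam <= l0 ->
    2 * C1 * lam <= 1 /\ `|J m lam g x - g x| <= e * wgt m x.

(** Two resolvents of small parameter applied to [g] give an element of the domain of A^2, with b =
    A phi and c = A b, and stay close to [g] by strong continuity. *)
Lemma smooth_approx e : 0 < e -> exists phi b c, [/\ C0 m phi, C0 m b, C0 m c,
  Rel m phi b /\ Rel m b c & forall x, `|phi x - g x| <= e * wgt m x].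
Proof.
move=> e0; have [l [l00 H]] := g_strong (ltac:(lra) : 0 < e / 3).
have [l1 _] := H l 0 ltac:(by rewrite l00 lexx).
have JC f (Cf : C0 m f) := J_C0 lf m_supp C1_gt0 abs_le_C1 l00 l1 Cf.
have JR f (Cf : C0 m f) := J_Rel lf m_supp C1_gt0 abs_le_C1 l00 l1 Cf.
pose v := J m l g; pose a x := l^-1 * (v x - g x).
have Cv : C0 m v by exact: JC.
have Ca : C0 m a by apply: C0Z => //; exact: C0B.
have ra : Rel m v a by exact: JR.
have [_ rb] := J_generator lf m_supp C1_gt0 abs_le_C1 l00 l1 Cv Ca ra.
exists (J m l v), (J m l a), (fun x => l^-1 * (J m l a x - a x)).
split; [exact: JC|exact: JC|apply: C0Z => //; apply: C0B => //; exact: JC| |].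
  by split => //; exact: JR.
move=> x; have vg y : `|v y - g y| <= e / 3 * wgt m y.
  by have [_ ] := H l y ltac:(by rewrite l00 lexx).
have h1 := vg x.
have e30 : 0 <= e / 3 by lra.
have := J_bound lf m_supp C1_gt0 abs_le_C1 l00 l1 (C0B lf Cv Cg) e30 (lexx 0) _ x.
rewrite (JB lf m_supp C1_gt0 abs_le_C1 l00 l1 Cv Cg) -/v addr0 => h2.
have {}h2 := h2 (fun y _ => eq_ind_r (fun z => _ <= z) (vg y) (addr0 _)).
have h3 : (1 + 2 * C1 * l) * (e / 3) * wgt m x <= 2 * (e / 3) * wgt m x.
  by rewrite !ler_pM2r ?wgt_gt0//; lra.
by rewrite !ler_norml in h1 h2 *; lra.
Qed.

(** Density: the iterates are bounded in the weighted norm uniformly in [k] ([Ue_dist]), so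
    convergence for a nearby element of the domain of A^2 carries over to [g]. *)
Lemma Ue_cauchy T e : 0 <= T -> 0 < e -> exists n0, forall n k, (n0 <= n)%N -> (n0 <= k)%N ->
  forall x t, t <= T -> `|Ue g n x t - Ue g k x t| <= e * wgt m x.
Proof.
move=> T0 e0; have g0 := gr_gt0 C1 T.
have e10 : 0 < e / (4 * gr T) by rewrite divr_gt0// mulr_gt0.
have [phi [b [c [Cp Cb Cc [r1 r2] Hphi]]]] := smooth_approx e10.
have [K K0 HK] := Ue_refine T0 Cp Cb Cc r1 r2.
have th01 : 0 <= (1 / 2 : R) < 1 by lra.
have K10 : 0 < 8 * (K + 1) by lra.
have [n0 Hn0] := expr_lt_eps th01 (divr_gt0 e0 K10).
have gE : gr T * (e / (4 * gr T)) = e / 4 by field; rewrite gt_eqF.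
exists n0 => n k hn hk x t tT; have w0 := wgt_gt0 lf x.
have h1 := Ue_dist n Cp Cg T0 (ltW e10) Hphi x tT.
have h2 := Ue_dist k Cp Cg T0 (ltW e10) Hphi x tT.
rewrite gE in h1 h2.
have h3 := geometric_dist th01 (fun j => HK j x t tT) hn hk.
have h4 : 2 * (K * wgt m x * (1 / 2) ^+ n0 / (1 - 1 / 2)) <= e / 2 * wgt m x.
  have := Hn0 n0 (leqnn _); rewrite ler_pdivlMr// => h.
  have e5 : 2 * (K * wgt m x * (1 / 2) ^+ n0 / (1 - 1 / 2)) = 4 * K * (1 / 2) ^+ n0 * wgt m x.
    by field.
  rewrite e5 ler_pM2r//.
  have : 0 <= (1 / 2 : R) ^+ n0 by rewrite exprn_ge0//; lra.
  by lra.
by rewrite !ler_norml in h1 h2 h3 *; lra.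
Qed.

(** The approximants jump at grid times, so equicontinuity in time is available only once the mesh
    is below the tolerance; [k0] ensures this. *)
Lemma Ue_time T e : 0 <= T -> 0 < e -> exists2 d : R, 0 < d & exists k0, forall k, (k0 <= k)%N ->
  forall x s t, s <= T -> t <= T -> `|s - t| < d -> `|Ue g k x s - Ue g k x t| <= e * wgt m x.
Proof.
move=> T0 e0; have g0 := gr_gt0 C1 T.
have e10 : 0 < e / (4 * gr T) by rewrite divr_gt0// mulr_gt0.
have [phi [b [c [Cp Cb Cc [r1 r2] Hphi]]]] := smooth_approx e10.
have [M M0 HM] := C0_wbound lf Cb.
have GM0 : 0 <= gr T * M by rewrite mulr_ge0// ltW.
have d0 : 0 < e / (4 * (gr T * M + 1)) by rewrite divr_gt0// mulr_gt0//; lra.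
exists (e / (4 * (gr T * M + 1))) => //.
have [k0 Hk0] := step_small C1_gt0 d0.
have gE : gr T * (e / (4 * gr T)) = e / 4 by field; rewrite gt_eqF.
exists k0 => k /Hk0 hk x.
have key s t : s <= T -> t <= T -> `|s - t| < e / (4 * (gr T * M + 1)) ->
    (steps k t <= steps k s)%N -> `|Ue g k x s - Ue g k x t| <= e * wgt m x.
  move=> sT tT st nn; have w0 := wgt_gt0 lf x.
  have h1 := Ue_dist k Cp Cg T0 (ltW e10) Hphi x sT.
  have h2 := Ue_dist k Cp Cg T0 (ltW e10) Hphi x tT.
  rewrite gE in h1 h2.
  have h3 := E_time Cp Cb r1 M0 HM nn (steps_le k T0 sT) x.
  rewrite -/(Ue phi k x s) -/(Ue phi k x t) in h3.
  have h4 : (steps k s - steps k t)%:R * step k <= 2 * (e / (4 * (gr T * M + 1))).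
    have /andP[a1 a2] := steps_itv k s; have /andP[a3 a4] := steps_itv k t.
    have a5 : pos s - pos t <= `|s - t| by apply: le_trans (ler_norm _) (pos_lip _ _).
    rewrite natrB// mulrBl; rewrite -natr1 mulrDl mul1r in a4; lra.
  have h5 : (steps k s - steps k t)%:R * step k * (gr T * M) * wgt m x <= e / 2 * wgt m x.
    rewrite ler_pM2r//; apply: (@le_trans _ _ (2 * (e / (4 * (gr T * M + 1))) * (gr T * M))).
      by rewrite ler_wpM2r.
    apply: (@le_trans _ _ (2 * (e / (4 * (gr T * M + 1))) * (gr T * M + 1))).
      by rewrite ler_wpM2l//; lra.
    by rewrite le_eqVlt; apply/orP; left; apply/eqP; field; rewrite gt_eqF//; lra.
  by rewrite !ler_norml in h1 h2 h3 *; lra.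
move=> s t sT tT st; have [nn|/ltnW nn] := leqP (steps k t) (steps k s); first exact: key.
by rewrite distrC; apply: key => //; rewrite distrC.
Qed.

(** The discrete mild equation: the resolvent equations of the single steps telescope. *)
Lemma sum_Rel k n : Rel m (fun x => step k * \sum_(j < n) E k j.+1 g x) (fun x => E k n g x - g x).
Proof.
elim: n => [|n IH].
  apply: (Rel_ext (f := fun=> 0) (h := fun=> 0)) => [x|x|]; last by move=> ? ? ? _ _; exact: rel3_cst.
    by rewrite big_ord0 mulr0.
  by rewrite subrr.
have Cn := E_C0 lf m_supp C1_gt0 abs_le_C1 k n Cg.
have Cn' := E_C0 lf m_supp C1_gt0 abs_le_C1 k n.+1 Cg.
have r := J_Rel lf m_supp C1_gt0 abs_le_C1 (s0 k) (step_le C1_gt0 k) Cn.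
have cs : continuous (fun x => (step k)^-1 * (E k n.+1 g x - E k n g x)).
  by apply: source_continuous; [exact: (proj1 Cn)|exact: (proj1 Cn')].
have cs1 : continuous (fun x => E k n g x - g x).
  by move=> x; apply: cvgB; [exact: (proj1 Cn)|exact: (proj1 Cg)].
have cs2 : continuous (fun x => step k * ((step k)^-1 * (E k n.+1 g x - E k n g x))).
  by move=> x; apply: cvgM; [exact: cvg_cst|exact: cs].
have rr := RelD lf cs1 cs2 IH (RelZ lf (step k) cs r).
apply: (Rel_ext _ _ rr) => x.
  by rewrite big_ord_recr /= mulrDr.
by rewrite mulrA mulfV ?gt_eqF// mul1r; ring.
Qed.

(** The limit of the Euler approximants; its integrated equation is the limit of [sum_Rel], in which
    the sum is a Riemann sum. *)
Lemma mild_exists : exists U, mild g U.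
Proof.
have pc (p : R * R) e : 0 < e -> exists n0, forall n k, (n0 <= n)%N -> (n0 <= k)%N ->
    `|Ue g n p.1 p.2 - Ue g k p.1 p.2| <= e.
  move=> e0; have w0 := wgt_gt0 lf p.1.
  have [n0 H] := Ue_cauchy (normr_ge0 p.2) (divr_gt0 e0 w0).
  exists n0 => n k hn hk; apply: le_trans (H n k hn hk p.1 p.2 (ler_norm _)) _.
  by rewrite divfK// gt_eqF.
have [l Hl] := @unif_cauchy_lim R (R * R)%type (fun n p => Ue g n p.1 p.2) pc.
pose U x t := l (x, t).
have lim T e : 0 <= T -> 0 < e -> exists n0, forall n, (n0 <= n)%N ->
    forall x t, t <= T -> `|Ue g n x t - U x t| <= e * wgt m x.
  move=> T0 e0; have [n0 H] := Ue_cauchy T0 e0; exists n0 => n hn x t tT.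
  by apply: (Hl (x, t) n0) => // i j hi hj; exact: H.
have limc A T e : 0 <= T -> 0 < e -> exists n0, forall n, (n0 <= n)%N ->
    forall x t, `|x| <= A -> t <= T -> `|Ue g n x t - U x t| <= e.
  move=> T0 e0; have [M HM] := continuous_bounded A (wgt_continuous lf).
  have M0 : 0 < `|M| + 1 by rewrite ltr_wpDl.
  have [n0 H] := lim T _ T0 (divr_gt0 e0 M0); exists n0 => n hn x t xA tT.
  apply: le_trans (H n hn x t tT) _; rewrite mulrAC ler_pdivrMr// ler_pM2l//.
  by apply: le_trans (ler_norm _) _; apply: le_trans (HM x xA) _; have := ler_norm M; lra.
have Utime T e : 0 <= T -> 0 < e -> exists2 d : R, 0 < d &
    forall x s t, s <= T -> t <= T -> `|s - t| < d -> `|U x s - U x t| <= e * wgt m x.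
  move=> T0 e0; have [d d0 [k0 H]] := Ue_time T0 (ltac:(lra) : 0 < e / 3).
  exists d => // x s t sT tT st; have [n0 Hn] := lim T (e / 3) T0 ltac:(lra).
  have h1 := H (maxn k0 n0) (leq_maxl _ _) x s t sT tT st.
  have h2 := Hn (maxn k0 n0) (leq_maxr _ _) x s sT.
  have h3 := Hn (maxn k0 n0) (leq_maxr _ _) x t tT.
  by rewrite !ler_norml in h1 h2 h3 *; lra.
have Ucx t : continuous (U^~ t).
  apply: continuous_approx => A e e0.
  have [n0 H] := limc A `|t| e (normr_ge0 t) e0.
  exists (fun x => Ue g n0 x t); split.
    exact: (proj1 (E_C0 lf m_supp C1_gt0 abs_le_C1 n0 (steps n0 t) Cg)).
  by move=> x xA; apply: H => //; exact: ler_norm.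
have cU : continuous2 U.
  apply/continuous2_epsP => x t e e0.
  have [M HM] := continuous_bounded (`|x| + 1) (wgt_continuous lf).
  have M0 : 0 < `|M| + 1 by rewrite ltr_wpDl.
  have e20 : 0 < e / 2 by lra.
  have [d d0 H] := Utime (`|t| + 1) _ ltac:(by rewrite addr_ge0) (divr_gt0 e20 M0).
  have [d' d'0 H'] := iffLR (continuous_epsP _) (Ucx t) x _ e20.
  exists (Num.min 1 (Num.min d d')); first by rewrite !lt_min ltr01 d0.
  move=> x' t'; rewrite !lt_min => /and3P[x1 x2 x3] /and3P[t1 t2 t3].
  have tt : t <= `|t| + 1 by have := ler_norm t; lra.
  have tt' : t' <= `|t| + 1 by rewrite ltr_norml in t1; have := ler_norm t; lra.
  have h1 := H x' t' t tt' tt t2; have h2 := H' x' x3.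
  have hx : `|x'| <= `|x| + 1.
    by rewrite -(subrK x x') (le_trans (ler_normD _ _))//; lra.
  have h3 : e / 2 / (`|M| + 1) * wgt m x' <= e / 2.
    rewrite mulrAC ler_pdivrMr// ler_pM2l//.
    by apply: le_trans (ler_norm _) _; apply: le_trans (HM x' hx) _; have := ler_norm M; lra.
  by rewrite !ler_norml in h1 h2 *; lra.
have U0 x t : t <= 0 -> U x t = g x.
  move=> t0; apply/eqP; rewrite -subr_eq0 -normr_le0; apply/ler_addgt0Pr => e e0.
  have [n0 H] := limc `|x| 0 e (lexx _) e0.
  by have := H n0 (leqnn _) x t (lexx _) t0; rewrite /Ue steps0//= distrC add0r.
exists U; split => //.
  move=> T e T0 e0; have g0 := gr_gt0 C1 T.
  have e10 : 0 < e / (2 * gr T) by rewrite divr_gt0// mulr_gt0.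
  have [C' HC'] := proj2 Cg _ e10.
  exists `|C'| => x t tT.
  have HC y : `|g y| <= e / (2 * gr T) * wgt m y + `|C'|.
    by apply: le_trans (HC' y) _; rewrite lerD2l ler_norm.
  have [n0 H] := lim T (e / 2) T0 ltac:(lra).
  have h1 := H n0 (leqnn _) x t tT.
  have h2 := Ue_bound n0 Cg T0 (ltW e10) (normr_ge0 C') HC x tT.
  have gE : gr T * (e / (2 * gr T)) = e / 2 by field; rewrite gt_eqF.
  by rewrite gE in h2; rewrite !ler_norml in h1 h2 *; lra.
move=> t t0 a b c ab bc.
have cUt : continuous (fun x => U x t - g x).
  by move=> x; apply: cvgB; [exact: Ucx|exact: (proj1 Cg)].
apply: (rel3_limit lf ab bc cUt) => e e0.
pose A := `|a| + `|c|.
have inA x : a <= x <= c -> `|x| <= A.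
  move=> /andP[h1 h2]; rewrite ler_norml /A.
  have := ler_norm (- a); have := ler_norm c; rewrite normrN.
  by have := normr_ge0 a; have := normr_ge0 c; lra.
have [M HM] := continuous2_bounded (A + t) cU.
have A0 : 0 <= A by rewrite addr_ge0.
have M0 : 0 <= M by apply: le_trans (HM 0 0 _ _); rewrite ?normr0 ?addr_ge0.
have t10 : 0 < t + 1 by lra.
pose e' := Num.min e (e / (4 * (t + 1))).
have e'0 : 0 < e' by rewrite lt_min e0 divr_gt0// mulr_gt0.
have e'e : e' <= e by rewrite ge_min lexx.
have e'4 : e' * (t + 1) <= e / 4.
  apply: (@le_trans _ _ (e / (4 * (t + 1)) * (t + 1))).
    by rewrite ler_pM2r// ge_min lexx orbT.
  by rewrite le_eqVlt; apply/orP; left; apply/eqP; field; rewrite gt_eqF.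
have [n0 Hn0] := limc A t e' t0 e'0.
have [d d0 Hd] := continuous2_unif (A + t) cU e'0.
have e30 : 0 < Num.min (d / 2) (e / (4 * (M + 1))) by rewrite lt_min !divr_gt0// mulr_gt0//; lra.
have [k0 Hk0] := step_small C1_gt0 e30.
pose k := maxn n0 k0; have hk0 := Hk0 k (leq_maxr _ _); have hn0 := Hn0 k (leq_maxl _ _).
rewrite le_min in hk0; have /andP[hkd hkM] := hk0.
pose n := steps k t.
(* The scheme is implicit, so the Riemann sum uses right endpoints; the unfinished last step
   contributes at most [step k * (M + 1)]. *)
exists (fun x => step k * \sum_(j < n) E k j.+1 g x), (fun x => E k n g x - g x); split.
- move=> x; apply: cvgB; last exact: (proj1 Cg).
  exact: (proj1 (E_C0 lf m_supp C1_gt0 abs_le_C1 k n Cg)).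
- exact: sum_Rel.
- move=> x /inA xA; have cx : continuous (U x) by exact: continuous2_slice2.
  have /andP[n1 n2] := steps_itv k t; rewrite posE// -/n in n1 n2.
  have sk := s0 k.
  have h1 : `|prim (U x) (n%:R * step k) - step k * \sum_(j < n) E k j.+1 g x| <= n%:R * step k * (2 * e').
    apply: (prim_riemann (a := fun j => E k j.+1 g x)) => //; first exact: ltW.
    move=> j r jn /andP[r1 r2].
    have jt : j.+1%:R * step k <= t by apply: le_trans n1; rewrite ler_pM2r// ler_nat.
    have j0 : 0 <= j%:R * step k by rewrite mulr_ge0// ltW.
    have g1 := hn0 x (j.+1%:R * step k) xA jt.
    rewrite /Ue steps_nat in g1.
    have g2 : `|U x r - U x (j.+1%:R * step k)| <= e'.
      apply: Hd; first lra.
      - by rewrite ger0_norm; lra.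
      - by rewrite subrr normr0.
      - rewrite -natr1 mulrDl mul1r in r2 *; rewrite ltr_norml; lra.
    by rewrite !ler_norml in g1 g2 *; lra.
  have h2 : `|prim (U x) t - prim (U x) (n%:R * step k)| <= (t - n%:R * step k) * M.
    apply: prim_diff_bound => //; first by rewrite n1 mulr_ge0// ltW.
    move=> r /andP[r1 r2]; apply: HM; first lra.
    have : 0 <= n%:R * step k by rewrite mulr_ge0// ltW.
    by move=> ?; rewrite ger0_norm; lra.
  have h3 : (t - n%:R * step k) * M <= e / 4.
    apply: (@le_trans _ _ (step k * (M + 1))).
      by rewrite ler_pM//; rewrite -natr1 mulrDl mul1r in n2; lra.
    apply: (@le_trans _ _ (e / (4 * (M + 1)) * (M + 1))).
      by rewrite ler_wpM2r//; lra.
    by rewrite le_eqVlt; apply/orP; left; apply/eqP; field; rewrite gt_eqF//; lra.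
  have h4 : n%:R * step k * (2 * e') <= e / 2.
    have : n%:R * step k * e' <= (t + 1) * e' by rewrite ler_pM2r//; lra.
    by lra.
  by rewrite !ler_norml in h1 h2 *; lra.
- move=> x /inA xA; have := hn0 x t xA (lexx _).
  by rewrite /Ue -/n opprB addrA subrK => h; apply: le_trans h _.
Qed.

End mild_solution.

(** * Differential calculus on the line *)

Section derivatives.
Context {R : realType}.
Local Notation leb := (@lebesgue_measure R).
Implicit Types (f g df dg u : R -> R) (a b c x y h e A B k l : R).

Definition has_derivative f df := forall x, is_derive x (1 : R) f (df x).

Lemma hd_derivable f df x : has_derivative f df -> derivable f x 1.
Proof. by move=> H; have := H x; case. Qed.

Lemma hd_derive1 f df : has_derivative f df -> derive1 f = df.
Proof. by move=> H; apply/funext => x; rewrite derive1E; have := H x; case. Qed.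

Lemma hd_continuous f df : has_derivative f df -> continuous f.
Proof.
move=> H x; apply: differentiable_continuous; rewrite -derivable1_diffP.
exact: hd_derivable H.
Qed.

Lemma derivable_hd f : (forall x, derivable f x 1) -> has_derivative f (derive1 f).
Proof. by move=> H x; rewrite derive1E; exact: derivableP. Qed.

Lemma hd_eq f df dg : has_derivative f df -> (forall x, df x = dg x) -> has_derivative f dg.
Proof. by move=> H /funext <-. Qed.

Lemma hd_cst k : has_derivative (fun=> k) (fun=> 0).
Proof. by move=> x; exact: is_derive_cst. Qed.

Lemma hd_id : has_derivative id (fun=> 1).
Proof. by move=> x; exact: is_derive_id. Qed.

Lemma hdD f g df dg : has_derivative f df -> has_derivative g dg ->
  has_derivative (fun x => f x + g x) (fun x => df x + dg x).
Proof. by move=> H1 H2 x; have := H1 x; have := H2 x => ? ?; exact: is_deriveD. Qed.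

Lemma hdB f g df dg : has_derivative f df -> has_derivative g dg ->
  has_derivative (fun x => f x - g x) (fun x => df x - dg x).
Proof. by move=> H1 H2 x; have := H1 x; have := H2 x => ? ?; exact: is_deriveB. Qed.

Lemma hdM f g df dg : has_derivative f df -> has_derivative g dg ->
  has_derivative (fun x => f x * g x) (fun x => f x * dg x + g x * df x).
Proof. by move=> H1 H2 x; have := H1 x; have := H2 x => ? ?; exact: is_deriveM. Qed.

Lemma hdZ f df k : has_derivative f df -> has_derivative (fun x => k * f x) (fun x => k * df x).
Proof. by move=> H x; have := H x => ?; exact: is_deriveZ. Qed.

Lemma hd_comp f g df dg : has_derivative f df -> has_derivative g dg ->
  has_derivative (fun x => f (g x)) (fun x => df (g x) * dg x).
Proof.
move=> H1 H2 x; have := H2 x; have := H1 (g x) => ? ?.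
exact: is_derive1_comp.
Qed.

Lemma hd_affine k l : has_derivative (fun x => k * x + l) (fun=> k).
Proof.
move=> x; have /(_ x) := hdD (hdZ k hd_id) (hd_cst l).
by rewrite mulr1 addr0.
Qed.

Lemma hd_shift f df h : has_derivative f df ->
  has_derivative (fun x => f (x + h)) (fun x => df (x + h)).
Proof.
move=> H x; have /(_ x) := hd_comp H (hdD hd_id (hd_cst h)).
by rewrite addr0 mulr1.
Qed.

Lemma is_derive_eps f x k : (forall e, 0 < e -> exists2 d, 0 < d & forall y,
    `|y - x| < d -> `|f y - f x - (y - x) * k| <= `|y - x| * e) ->
  is_derive x (1 : R) f k.
Proof.
move=> H.
have L : h^-1 *: (f (h *: 1 + x) - f x) @[h --> 0^'] --> k.
  apply/cvgrPdist_le => e e0; have [d d0 Hd] := H e e0.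
  near=> h.
  have h0 : h != 0 by near: h; exact: nbhs_dnbhs_neq.
  have hd : `|h| < d.
    near: h; apply: dnbhs0_lt => //.
  have := Hd (h + x); rewrite addrK => /(_ hd) g1.
  rewrite /GRing.scale /= mulr1 distrC.
  have -> : h^-1 * (f (h + x) - f x) - k = h^-1 * (f (h + x) - f x - h * k).
    by field.
  rewrite normrM normfV mulrC ler_pdivrMr ?normr_gt0// [leRHS]mulrC.
  exact: g1.
by apply: DeriveDef; [apply/cvg_ex; exists k|apply/cvg_lim].
Unshelve. all: by end_near.
Qed.

Lemma hd_lipschitz f df a b M : has_derivative f df -> a <= b ->
  (forall x, a <= x <= b -> `|df x| <= M) -> `|f b - f a| <= (b - a) * M.
Proof.
move=> H ab HM.
have [c cab ->] := MVT_segment ab (fun x _ => H x) (continuous_subspaceT (hd_continuous H)).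
rewrite normrM mulrC (ger0_norm (_ : 0 <= b - a)); last lra.
by rewrite ler_wpM2l ?HM//; lra.
Qed.

Lemma hd_taylor1 f df a b c M : has_derivative f df -> a <= b ->
  (forall x, a <= x <= b -> `|df x - c| <= M) -> `|f b - f a - (b - a) * c| <= (b - a) * M.
Proof.
move=> H ab HM; have := hd_lipschitz (hdB H (hd_affine c 0)) ab HM.
by rewrite !addr0 => h; apply: le_trans h; rewrite le_eqVlt; apply/orP; left; apply/eqP; congr `|_|; ring.
Qed.

Lemma FTC f df a b : has_derivative f df -> continuous df -> a <= b ->
  \int[leb]_(x in `[a, b]) df x = f b - f a.
Proof.
move=> H cd; rewrite le_eqVlt => /predU1P[->|ab].
  by rewrite set_itv1 Rintegral_set1 subrr.
rewrite /Rintegral (@continuous_FTC2 _ df f)//.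
- exact: continuous_subspaceT.
- have cf := hd_continuous H; split; first by move=> x _; exact: hd_derivable H.
    by apply: cvg_at_right_filter; exact: cf.
  by apply: cvg_at_left_filter; exact: cf.
- by move=> x _; rewrite (hd_derive1 H).
Qed.

(** The primitive vanishing at 0, on the whole line; for negative arguments, where [prim] is 0, it
    is obtained by reflection. *)
Definition antider u x := if 0 <= x then prim u x else - prim (fun r => u (- r)) (- x).

Lemma antider_hd u : continuous u -> has_derivative (antider u) u.
Proof.
move=> cu x; apply: is_derive_eps => e e0.
have cu' : continuous (fun r => u (- r)).
  by move=> r; apply: (@continuous_comp _ _ _ (fun r : R => - r) u); [exact: opp_continuous|exact: cu].
have AN y : y <= 0 -> antider u y = - prim (fun r => u (- r)) (- y).
  rewrite le_eqVlt /antider => /predU1P[->|y0]; first by rewrite lexx oppr0 !prim0 oppr0.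
  by case: ifPn => // h; move: y0; rewrite ltNge h.
have AP y : 0 <= y -> antider u y = prim u y by rewrite /antider => ->.
have [x0|x0|x0] := ltgtP x 0.
- have [d d0 Hd] := prim_deriv_eps cu' (ltac:(lra) : 0 <= - x) e0.
  exists (Num.min d (- x)) => [|y]; first by rewrite lt_min d0; lra.
  rewrite lt_min => /andP[h1 h2]; rewrite ltr_norml in h2.
  have E1 : - y - - x = - (y - x) by ring.
  have := Hd (- y) ltac:(lra); rewrite E1 normrN (opprK x) => /(_ h1).
  rewrite (AN y) ?(AN x); [|lra|lra].
  move: (prim _ (- y)) (prim _ (- x)) => p1 p2.
  have -> : - p1 - - p2 - (y - x) * u x = - (p1 - p2 - - (y - x) * u x) by ring.
  by rewrite normrN.
- have [d d0 Hd] := prim_deriv_eps cu (ltW x0) e0.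
  exists (Num.min d x) => [|y]; first by rewrite lt_min d0; lra.
  rewrite lt_min => /andP[h1 h2]; rewrite ltr_norml in h2.
  by rewrite (AP y) ?(AP x); [apply: Hd => //; lra|lra|lra].
- subst x; have [d d0 Hd] := prim_deriv_eps cu (lexx 0) e0.
  have [d' d'0 Hd'] := prim_deriv_eps cu' (lexx 0) e0.
  exists (Num.min d d') => [|y]; first by rewrite lt_min d0.
  rewrite lt_min => /andP[h1 h2]; rewrite (AP 0)// prim0.
  have [y0|y0] := leP 0 y; first by rewrite AP//; have := Hd y y0 h1; rewrite prim0.
  rewrite AN ?(ltW y0)//; have := Hd' (- y) ltac:(lra).
  rewrite prim0 !subr0 normrN => /(_ ltac:(by rewrite subr0 in h2)); rewrite oppr0.
  move: (prim _ (- y)) => p1.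
  have -> : - p1 - y * u 0 = - (p1 - - y * u 0) by ring.
  by rewrite normrN.
Qed.

Lemma cc_FTC A f df : has_derivative f df -> cc A df -> \int[leb]_x df x = f A - f (- A).
Proof.
move=> H cd; have [A0|A0] := leP 0 A.
  by rewrite (cc_restrict _ cd) (FTC H)//; [exact: (proj1 cd)|lra].
have d0 : df = fun=> 0 by apply/funext => x; apply: (proj2 cd); exact: lt_le_trans A0 _.
rewrite d0 Rintegral_cst// mul0r; rewrite d0 in H.
have := @hd_lipschitz f _ A (- A) 0 H ltac:(lra) (fun x _ => _).
by rewrite normr0 mulr0 normr_le0 => /(_ (fun _ => lexx _)); rewrite subr_eq0 => /eqP ->; rewrite subrr.
Qed.

Lemma cc_shift A f h : cc A f -> \int[leb]_x f (x + h) = \int[leb]_x f x.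
Proof.
move=> cf; have H := antider_hd (proj1 cf).
pose B := `|A| + `|h| + 1.
have cf' : cc B f by apply: cc_widen cf; have := ler_norm A; have := normr_ge0 h; rewrite /B; lra.
have cs : cc (B + `|h|) (fun x => f (x + h)).
  split=> [x|x hx].
    by apply: (@continuous_comp _ _ _ (fun x : R => x + h) f); [apply: cvgD; [exact: cvg_id|exact: cvg_cst]|exact: (proj1 cf)].
  apply: (proj2 cf'); have := ler_normB (x + h) h; rewrite addrK; lra.
rewrite (cc_FTC (hd_shift h H) cs) (cc_FTC H cf').
have cst a b : a <= b -> (forall x, a <= x <= b -> f x = 0) -> antider f b = antider f a.
  move=> ab H0; have := @hd_lipschitz (antider f) f a b 0 H ab.
  rewrite mulr0 normr_le0 subr_eq0 => hh; apply/eqP/hh => x /H0 ->; by rewrite normr0.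
have h1 := ler_norm h; have h2 := ler_norm (- h); rewrite normrN in h2.
have A0 := ler_norm A; have a0 := normr_ge0 A; have b0 := normr_ge0 h.
have out x : (B <= x) || (x <= - B) -> f x = 0.
  move=> xB; apply: (proj2 cf); rewrite ltr_normr.
  by apply/orP; move: xB; rewrite /B => /orP[]; [left|right]; lra.
rewrite (cst B (B + `|h| + h)) ?(cst (- (B + `|h|) + h) (- B))//; try lra.
  by move=> x /andP[_ x2]; rewrite out// x2 orbT.
by move=> x /andP[x1 _]; rewrite out// x1.
Qed.

End derivatives.

(** * From the three-point relation to the weak form in space *)

Section weak_form.
Context {R : realType}.
Variable m : {measure set (measurableTypeR R) -> \bar R}.
Hypothesis lf : locally_finite m.
Local Notation leb := (@lebesgue_measure R).
Implicit Types (W q : R -> R) (a b c x y t h e A k l : R).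

Variables (A : R) (psi psi1 psi2 : R -> R).
Hypothesis A_gt0 : 0 < A.
Hypothesis psi_hd : has_derivative psi psi1.
Hypothesis psi1_hd : has_derivative psi1 psi2.
Hypothesis psi_cc : cc A psi.
Hypothesis psi1_cc : cc A psi1.
Hypothesis psi2_cc : cc A psi2.

Lemma weak_affine k l : \int[leb]_x ((k * x + l) * psi2 x) = 0.
Proof.
have B0 : A < A + 1 by lra.
have H : has_derivative (fun x => (k * x + l) * psi1 x - k * psi x) (fun x => (k * x + l) * psi2 x).
  by apply: hd_eq (hdB (hdM (hd_affine k l) psi1_hd) (hdZ k psi_hd)) _ => x /=; ring.
have ca : continuous (fun x : R => k * x + l) by exact: hd_continuous (hd_affine k l).
rewrite (cc_FTC (A := A + 1) H); last first.
  by apply: cc_widen (ltW B0) _; exact: ccMl.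
have a1 := A_gt0.
by rewrite !(proj2 psi_cc) ?(proj2 psi1_cc) ?normrN ?gtr0_norm//; lra.
Qed.

Lemma weak_pos y : \int[leb]_x (pos (x - y) * psi2 x) = psi y.
Proof.
pose B := A + `|y| + 1.
have a1 := A_gt0; have y1 := ler_norm y; have y2 := normr_ge0 y.
have AB : A < B by rewrite /B; lra.
have yB : y <= B by rewrite /B; lra.
have cpos : continuous (fun x => pos (x - y)).
  by move=> x; apply: (@continuous_comp _ _ _ (fun x : R => x - y) (@pos R)); [apply: cvgB; [exact: cvg_id|exact: cvg_cst]|exact: pos_continuous].
have H : has_derivative (fun x => (1 * x - y) * psi1 x - 1 * psi x) (fun x => (1 * x - y) * psi2 x).
  by apply: hd_eq (hdB (hdM (hd_affine 1 (- y)) psi1_hd) (hdZ 1 psi_hd)) _ => x /=; ring.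
have ca : continuous (fun x : R => 1 * x - y) by exact: hd_continuous (hd_affine 1 (- y)).
transitivity (\int[leb]_(x in `[y, B]) ((1 * x - y) * psi2 x)).
  rewrite [RHS]Rintegral_mkcond; congr fine; apply: eq_integral => x _; rewrite patchE.
  case: ifPn => [|].
    by rewrite inE/= in_itv/= => /andP[x1 x2]; rewrite posE ?mul1r//; lra.
  rewrite notin_setE/= in_itv/= => /negP; rewrite negb_and -!ltNge => /orP[xy|Bx].
    by rewrite pos0 ?mul0r//; lra.
  by rewrite (proj2 psi2_cc) ?mulr0//; apply: lt_le_trans (ler_norm x); lra.
rewrite (FTC H) //; last by exact: (proj1 (ccMl ca psi2_cc)).
have nB : A < `|B| by apply: lt_le_trans (ler_norm B).
rewrite (proj2 psi_cc B nB) (proj2 psi1_cc B nB); ring.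
Qed.

(** On [[-B, B]] the three-point relation writes [W] as an affine function minus a potential of [q].
    Integrate against the second derivative of the test function and exchange integrals: affine
    parts vanish, and the positive part of [x - y] returns [psi y]. *)
Lemma Rel_weak W q : continuous W -> continuous q -> Rel m W q ->
  \int[leb]_x (W x * psi2 x) = 2 * \int[m]_y (q y * psi y).
Proof.
move=> cW cq r; have a1 := A_gt0.
pose B := A + 1; have AB : A < B by rewrite /B; lra.
have B0 : 0 < B by lra.
pose G x y := tent (- B) x B y.
pose k := (W B - W (- B)) / (2 * B); pose l := (W B + W (- B)) / 2.
have WE x : W x * psi2 x = (k * x + l) * psi2 x - B^-1 * (\int[m]_y (G x y * psi2 x * q y)).
  have [xA|Ax] := leP `|x| A; last first.
    rewrite (proj2 psi2_cc _ Ax) !mulr0; under eq_Rintegral do rewrite mulr0 mul0r.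
    by rewrite Rintegral_cst// mul0r mulr0 subr0.
  move: xA; rewrite ler_norml => /andP[x1 x2].
  have b1 : - B < x by lra.
  have b2 : x < B by lra.
  have := r _ _ _ b1 b2; rewrite /rel3 /T3.
  have ct := tent_mul_cc b1 b2 cq.
  transitivity ((k * x + l - B^-1 * \int[m]_y (tent (- B) x B y * q y)) * psi2 x).
    congr (_ * _); have -> : \int[m]_y (tent (- B) x B y * q y) =
       ((B - x) * W (- B) + (x - - B) * W B - (B - - B) * W x) / 2 by lra.
    by rewrite /k /l; field; rewrite gt_eqF.
  rewrite mulrBl; congr (_ - _).
  rewrite -mulrA [_ * psi2 x]mulrC -(cc_RintZ lf _ ct); congr (_ * _).
  by apply: eq_Rintegral => y _; rewrite /G; ring.
have cp (u : R * R -> R) : continuous u -> continuous (fun p => pos (u p)).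
  by move=> cu p; apply: (@continuous_comp _ _ _ u (@pos R)); [exact: cu|exact: pos_continuous].
have c1 : continuous (fun p : R * R => p.1) by move=> p; exact: cvg_fst.
have c2 : continuous (fun p : R * R => p.2) by move=> p; exact: cvg_snd.
have cc0 (z : R) : continuous (fun _ : R * R => z) by move=> p; exact: cvg_cst.
have cB (u v : R * R -> R) : continuous u -> continuous v -> continuous (fun p => u p - v p).
  by move=> h1 h2 p; apply: cvgB; [exact: h1|exact: h2].
have cM (u v : R * R -> R) : continuous u -> continuous v -> continuous (fun p => u p * v p).
  by move=> h1 h2 p; apply: cvgM; [exact: h1|exact: h2].
have cD (u v : R * R -> R) : continuous u -> continuous v -> continuous (fun p => u p + v p).
  by move=> h1 h2 p; apply: cvgD; [exact: h1|exact: h2].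
have cG : continuous2 G.
  rewrite /continuous2 /G /tent /T3.
  apply: (cB (fun p => (B - p.1) * pos (- B - p.2) + (p.1 - - B) * pos (B - p.2)) (fun p => (B - - B) * pos (p.1 - p.2))).
    apply: (cD (fun p => (B - p.1) * pos (- B - p.2)) (fun p => (p.1 - - B) * pos (B - p.2))).
      by apply: (cM _ _ (cB _ _ (cc0 B) c1) (cp _ (cB _ _ (cc0 (- B)) c2))).
    by apply: (cM _ _ (cB _ _ c1 (cc0 (- B))) (cp _ (cB _ _ (cc0 B) c2))).
  by apply: (cM _ _ (cc0 (B - - B)) (cp _ (cB _ _ c1 c2))).
have cK : continuous2 (fun x y => G x y * psi2 x * q y).
  exact: (cM _ _ (cM _ _ cG (continuous2_fst (proj1 psi2_cc))) (continuous2_swap (continuous2_fst cq))).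
have K1 x y : A < `|x| -> G x y * psi2 x * q y = 0.
  by move=> Ax; rewrite (proj2 psi2_cc _ Ax) mulr0 mul0r.
have K2 x y : B < `|y| -> G x y * psi2 x * q y = 0.
  have [xA|/K1 -> //] := leP `|x| A; move: xA; rewrite ler_norml => /andP[x1 x2].
  rewrite ltr_normr => By; rewrite /G.
  have -> : tent (- B) x B y = 0; last by rewrite !mul0r.
  by case/orP: By => By; [rewrite tent_right|rewrite tent_left]; lra.
rewrite (funext WE).
have cA : continuous (fun x : R => k * x + l) by exact: hd_continuous (hd_affine k l).
have ci : cc A (fun x => \int[m]_y (G x y * psi2 x * q y)).
  split; first exact: (cc_continuous_param lf cK K2).
  move=> x Ax; under eq_Rintegral do rewrite K1//.
  by rewrite Rintegral_cst// mul0r.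
rewrite (cc_RintB (@leb_locally_finite R) (ccMl cA psi2_cc) (ccZ _ ci)).
rewrite weak_affine (cc_RintZ (@leb_locally_finite R) _ ci).
rewrite (cc_Fubini (@leb_locally_finite R) lf cK K1 K2) sub0r.
have IE y : \int[leb]_x (G x y * psi2 x * q y) = - (2 * B) * (q y * psi y).
  pose k' := pos (B - y) - pos (- B - y); pose l' := B * (pos (- B - y) + pos (B - y)).
  have cpy : continuous (fun x => pos (x - y)).
    by move=> x; apply: (@continuous_comp _ _ _ (fun x : R => x - y) (@pos R)); [apply: cvgB; [exact: cvg_id|exact: cvg_cst]|exact: pos_continuous].
  have ca' : continuous (fun x : R => k' * x + l') by exact: hd_continuous (hd_affine k' l').
  transitivity (\int[leb]_x (q y * ((k' * x + l') * psi2 x) - (2 * B * q y) * (pos (x - y) * psi2 x))).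
    by apply: eq_Rintegral => x _; rewrite /G /tent /T3 /k' /l'; ring.
  have e1 := ccMl ca' psi2_cc; have e2 := ccMl cpy psi2_cc.
  rewrite (cc_RintB (@leb_locally_finite R) (ccZ _ e1) (ccZ _ e2)).
  rewrite (cc_RintZ (@leb_locally_finite R) _ e1) (cc_RintZ (@leb_locally_finite R) _ e2).
  by rewrite weak_affine weak_pos; ring.
rewrite (funext IE).
rewrite (cc_RintZ lf _ (ccMl cq psi_cc)).
by field; rewrite gt_eqF.
Qed.

End weak_form.

(** * Double integrals and supports of test functions *)

Section double_integrals.
Context {R : realType}.
Variable m : {measure set (measurableTypeR R) -> \bar R}.
Hypothesis lf : locally_finite m.
Local Notation leb := (@lebesgue_measure R).
Implicit Types (F G : R -> R -> R) (x t e A B : R).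

Definition cc2 A F := [/\ continuous2 F, forall x t, A < `|x| -> F x t = 0 &
  forall x t, A < `|t| -> F x t = 0].

Lemma cc2_slice A F t : cc2 A F -> cc A (F^~ t).
Proof. by move=> [cF F1 F2]; split => [|x]; [exact: continuous2_slice1|exact: F1]. Qed.

Lemma cc2_slice2 A F x : cc2 A F -> cc A (F x).
Proof. by move=> [cF F1 F2]; split => [|t]; [exact: continuous2_slice2|exact: F2]. Qed.

Lemma cc2_inner A F : cc2 A F -> cc A (fun t => \int[m]_x F x t).
Proof.
move=> [cF F1 F2]; split.
  by apply: (cc_continuous_param lf (continuous2_swap cF)) => x y; exact: F1.
by move=> t At; under eq_Rintegral do rewrite F2//; rewrite Rintegral_cst// mul0r.
Qed.

Lemma cc2_dist A F G e : cc2 A F -> cc2 A G ->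
  (forall x t, `|x| <= A -> `|t| <= A -> `|F x t - G x t| <= e) ->
  `|\int[leb]_t \int[m]_x F x t - \int[leb]_t \int[m]_x G x t| <= e * mass m A * mass leb A.
Proof.
move=> cF cG H; apply: (cc_Rint_dist (@leb_locally_finite R) (cc2_inner cF) (cc2_inner cG)).
move=> t tA; apply: (cc_Rint_dist lf (cc2_slice t cF) (cc2_slice t cG)) => x xA; exact: H.
Qed.

Lemma cc2_scale A F c : cc2 A F ->
  \int[leb]_t \int[m]_x (c * F x t) = c * \int[leb]_t \int[m]_x F x t.
Proof.
move=> cF; rewrite -(cc_RintZ (@leb_locally_finite R) _ (cc2_inner cF)).
by apply: eq_Rintegral => t _; rewrite (cc_RintZ lf _ (cc2_slice t cF)).
Qed.

Lemma cc2_mul A F G : continuous2 F -> cc2 A G -> cc2 A (fun x t => F x t * G x t).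
Proof.
move=> cF [cG G1 G2]; split.
- by move=> p; apply: cvgM; [exact: cF|exact: cG].
- by move=> x t h; rewrite G1// mulr0.
- by move=> x t h; rewrite G2// mulr0.
Qed.

Lemma cc2_widen A B F : A <= B -> cc2 A F -> cc2 B F.
Proof. by move=> AB [cF F1 F2]; split => // x t h; [apply: F1|apply: F2]; exact: le_lt_trans h. Qed.

Lemma cc2B A F G : cc2 A F -> cc2 A G -> cc2 A (fun x t => F x t - G x t).
Proof.
move=> [cF F1 F2] [cG G1 G2]; split.
- by move=> p; apply: cvgB; [exact: cF|exact: cG].
- by move=> x t h; rewrite F1// G1// subr0.
- by move=> x t h; rewrite F2// G2// subr0.
Qed.

Lemma continuous2_shift F h : continuous2 F -> continuous2 (fun x t => F x (t + h)).
Proof.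
move=> cF; apply: continuous2_swap; apply: (@continuous2_comp1 _ (fun x t => F t x) (fun x => x + h)).
  exact: continuous2_swap.
by move=> x; apply: cvgD; [exact: cvg_id|exact: cvg_cst].
Qed.

Lemma continuous2B F G : continuous2 F -> continuous2 G -> continuous2 (fun x t => F x t - G x t).
Proof. by move=> cF cG p; apply: cvgB; [exact: cF|exact: cG]. Qed.

Lemma continuous2M F G : continuous2 F -> continuous2 G -> continuous2 (fun x t => F x t * G x t).
Proof. by move=> cF cG p; apply: cvgM; [exact: cF|exact: cG]. Qed.

Lemma continuous2Z c F : continuous2 F -> continuous2 (fun x t => c * F x t).
Proof. by move=> cF p; apply: cvgM; [exact: cvg_cst|exact: cF]. Qed.

End double_integrals.

Section test_functions.
Context {R : realType}.
Implicit Types (f df : R -> R) (phi F : R -> R -> R) (x t d A : R).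

Lemma hd_local0 f df x d : has_derivative f df -> 0 < d ->
  (forall y, `|y - x| < d -> f y = 0) -> df x = 0.
Proof.
move=> H d0 f0; have fx : f x = 0 by apply: f0; rewrite subrr normr0.
have D : is_derive x (1 : R) f 0.
  apply: is_derive_eps => e e0; exists d => // y /f0 ->.
  by rewrite fx mulr0 !subr0 normr0 mulr_ge0// ltW.
by have [_ <-] := H x; have [_ <-] := D.
Qed.

Lemma vanish_partial_x F F1 (S : set (R * R)) : closed S ->
  (forall t, has_derivative (F^~ t) (F1^~ t)) ->
  (forall p, ~ S p -> F p.1 p.2 = 0) -> forall p, ~ S p -> F1 p.1 p.2 = 0.
Proof.
move=> cS H F0 [x t] nS; have oS := closed_openC cS.
have /nbhs_ballP [d /= d0 Hd] : nbhs (x, t) (~` S) by apply: open_nbhs_nbhs.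
apply: (hd_local0 (H t) d0) => y yx; apply: (F0 (y, t)); apply: Hd.
by split; [rewrite /ball /= distrC|exact: ballxx].
Qed.

Lemma vanish_partial_t F F1 (S : set (R * R)) : closed S ->
  (forall x, has_derivative (F x) (F1 x)) ->
  (forall p, ~ S p -> F p.1 p.2 = 0) -> forall p, ~ S p -> F1 p.1 p.2 = 0.
Proof.
move=> cS H F0 [x t] nS; have oS := closed_openC cS.
have /nbhs_ballP [d /= d0 Hd] : nbhs (x, t) (~` S) by apply: open_nbhs_nbhs.
apply: (hd_local0 (H x) d0) => y yx; apply: (F0 (x, y)); apply: Hd.
by split; [exact: ballxx|rewrite /ball /= distrC].
Qed.

Definition supported_in A F := cc2 A F /\ forall x t, t <= 0 -> F x t = 0.

Lemma test_function_hd phi : test_function phi ->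
  [/\ forall t, has_derivative (phi^~ t) ((partial_x phi)^~ t),
      forall x, has_derivative (phi x) (partial_t phi x) &
      forall t, has_derivative ((partial_x phi)^~ t) ((partial_x (partial_x phi))^~ t)].
Proof.
move=> [C _ _]; have /= [_ [D1 [_ [D2 _ _]] _]] := C 2%N.
split.
- by move=> t; apply: derivable_hd => x; have [] := D1 x t.
- by move=> x; apply: derivable_hd => t; have [] := D1 x t.
- by move=> t; apply: derivable_hd => x; have [] := D2 x t.
Qed.

Lemma test_function_support phi : test_function phi -> exists A, 0 < A /\
  [/\ supported_in A phi, supported_in A (partial_t phi),
      supported_in A (partial_x phi) & supported_in A (partial_x (partial_x phi))].
Proof.
move=> tp; have [h1 h2 h3] := test_function_hd tp.
move: tp; rewrite /test_function; set S := closure _ => -[C cS S0].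
have /= [c0 [_ [c1 [_ c11 _]] [c2 _]]] := C 2%N.
have clS : closed S by exact: closed_closure.
have v0 p : ~ S p -> phi p.1 p.2 = 0.
  by move=> nS; apply/eqP/negPn/negP => /negP hp; apply: nS; apply: subset_closure; exact/negP.
have v1 := vanish_partial_x clS h1 v0.
have v2 := vanish_partial_t clS h2 v0.
have v3 := vanish_partial_x clS h3 v1.
have [M [_ HM]] := compact_bounded cS.
pose A := `|M| + 1.
have SA p : S p -> `|p.1| <= A /\ `|p.2| <= A.
  have MA : M < A by rewrite /A; have := ler_norm M; lra.
  by move=> Sp; have := HM A MA p Sp; rewrite /Num.norm /= ge_max => /andP.
exists A; split; first by rewrite /A; have := normr_ge0 M; lra.
have supp F : continuous2 F -> (forall p, ~ S p -> F p.1 p.2 = 0) -> supported_in A F.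
  move=> cF F0; split; first split => //.
  - by move=> x t Ax; apply: (F0 (x, t)) => /SA [/= h _]; move: Ax; rewrite ltNge h.
  - by move=> x t Ax; apply: (F0 (x, t)) => /SA [/= _ h]; move: Ax; rewrite ltNge h.
  - by move=> x t t0; apply: (F0 (x, t)) => /S0 /=; rewrite ltNge t0.
by split; [exact: (supp _ c0 v0)|exact: (supp _ c2 v2)|exact: (supp _ c1 v1)|exact: (supp _ (proj1 c11) v3)].
Qed.

End test_functions.

(** * Mild solutions solve the equation in the sense of distributions *)

Section mild_is_weak.
Context {R : realType}.
Variable m : {measure set (measurableTypeR R) -> \bar R}.
Hypothesis lf : locally_finite m.
Local Notation leb := (@lebesgue_measure R).
Implicit Types (x t h e A : R).

Lemma supported_integral A (F : R -> R -> R) (mu : {measure set (measurableTypeR R) -> \bar R}) :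
  supported_in A F -> \int[leb]_(t in `]0, +oo[) \int[mu]_x F x t = \int[leb]_t \int[mu]_x F x t.
Proof.
move=> [_ F0]; rewrite [LHS]Rintegral_mkcond; congr fine; apply: eq_integral => t _.
rewrite patchE; case: ifPn => //; rewrite notin_setE/= in_itv/= andbT => /negP; rewrite -leNgt => t0.
by congr EFin; under eq_Rintegral do rewrite F0//; rewrite Rintegral_cst// mul0r.
Qed.

Lemma forward_quotient u t h e : continuous u -> 0 <= t -> 0 < h ->
  (forall r, t <= r <= t + h -> `|u r - u t| <= e) ->
  `|h^-1 * (prim u (t + h) - prim u t) - u t| <= e.
Proof.
move=> cu t0 h0 near; have := @prim_incr _ u t (t + h) (u t) e cu ltac:(lra).
have -> : t + h - t = h by ring.
move=> /(_ near) n; have -> : h^-1 * (prim u (t + h) - prim u t) - u t =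
   h^-1 * (prim u (t + h) - prim u t - h * u t) by field; rewrite gt_eqF.
by rewrite normrM normfV (gtr0_norm h0) ler_pdivrMl.
Qed.

Lemma backward_quotient (f df : R -> R) t h e : has_derivative f df -> 0 < h ->
  (forall r, t - h <= r <= t -> `|df r - df t| <= e) ->
  `|h^-1 * (f (t - h) - f t) + df t| <= e.
Proof.
move=> H h0 near; have := @hd_taylor1 _ _ _ (t - h) t (df t) e H ltac:(lra).
have -> : t - (t - h) = h by ring.
move=> /(_ near) n; have -> : h^-1 * (f (t - h) - f t) + df t =
   - (h^-1 * (f t - f (t - h) - h * df t)) by field; rewrite gt_eqF.
by rewrite normrN normrM normfV (gtr0_norm h0) ler_pdivrMl.
Qed.

(** Subtract the integrated equations at [t + h] and [t] and divide by [h]. In space this is tested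
    by [Rel_weak]; in time the difference quotient is moved from [U] to the test function by a
    shift. Both sides converge as [h] tends to 0, with an error controlled by [e * K]. *)
Lemma mild_heat g U : mild m g U -> heat_distributional m U.
Proof.
move=> [cU Uneg _ rU] phi tp.
have [hx ht hxx] := test_function_hd tp.
have [A [A0 [s0 st sx sxx]]] := test_function_support tp.
move: sx => [sx _].
have sUt : supported_in A (fun x t => U x t * partial_t phi x t).
  by split; [apply: cc2_mul => //; exact: (proj1 st)|move=> x t h; rewrite (proj2 st)// mulr0].
have sUx : supported_in A (fun x t => U x t * partial_x (partial_x phi) x t).
  by split; [apply: cc2_mul => //; exact: (proj1 sxx)|move=> x t h; rewrite (proj2 sxx)// mulr0].
rewrite (supported_integral m sUt) (supported_integral leb sUx).
set X := \int[leb]_t _; set Y := \int[leb]_t _.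
pose W x t := prim (U x) (pos t).
have cW : continuous2 W := prim_param_continuous2 cU.
pose B := A + 1.
have AB : A <= B by rewrite /B; lra.
have B0 : 0 < B by rewrite /B; lra.
have BB : B <= B + B by rewrite lerDl ltW.
pose K := mass leb B * mass leb B + 2 * (mass m B * mass leb B).
have K0 : 0 <= K by rewrite addr_ge0 ?mulr_ge0 ?mass_ge0.
suff key e : 0 < e -> `|Y - (- 2 * X)| <= e * K.
  apply/esym/eqP; rewrite -subr_eq0 -normr_le0; apply/ler_addgt0Pl => e e0.
  rewrite addr0; have := key (e / (K + 1)) ltac:(by rewrite divr_gt0//; lra).
  move=> h; apply: le_trans h _; rewrite -mulrA ler_piMr ?(ltW e0)//.
  by rewrite mulrC ler_pdivrMr; lra.
move=> e0.
have [M HM] := continuous2_bounded (B + B) cU.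
have [M' HM'] := continuous2_bounded (B + B) (let: And3 c _ _ := proj1 sxx in c).
have M0 : 0 <= M by apply: le_trans (HM 0 0 _ _); rewrite ?normr0//; lra.
have M'0 : 0 <= M' by apply: le_trans (HM' 0 0 _ _); rewrite ?normr0//; lra.
pose e' := e / (M + M' + 1).
have e'0 : 0 < e' by rewrite divr_gt0//; lra.
have e'M : e' * M <= e.
  by rewrite /e' mulrAC ler_pdivrMr ?ler_pM2l//; lra.
have e'M' : e' * M' <= e.
  by rewrite /e' mulrAC ler_pdivrMr ?ler_pM2l//; lra.
have [d1 d10 Hd1] := continuous2_unif (B + B) cU e'0.
have [d2 d20 Hd2] := continuous2_unif (B + B) (let: And3 c _ _ := proj1 st in c) e'0.
pose h := Num.min (1 / 2) (Num.min (d1 / 2) (d2 / 2)).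
have h0 : 0 < h by rewrite !lt_min !divr_gt0.
have hle : h <= 1 / 2 by rewrite ge_min lexx.
have hd1 : h <= d1 / 2 by rewrite /h ge_min [X in _ || X]ge_min lexx orbT.
have hd2 : h <= d2 / 2 by rewrite /h ge_min [X in _ || X]ge_min lexx !orbT.
have wid F : supported_in A F -> cc2 B F by move=> [sF _]; exact: cc2_widen AB sF.
have shF F : supported_in A F -> cc2 B (fun x t => F x (t - h)).
  move=> [[cF F1 F2] _]; split; first exact: continuous2_shift.
  - by move=> x t hz; apply: F1; exact: le_lt_trans hz.
  - by move=> x t hz; apply: F2; move: hz; rewrite /B; clear -hle h0; rewrite !ltr_normr => /orP[]?; apply/orP; [left|right]; lra.
pose Wh x t := h^-1 * (W x (t + h) - W x t).
have cWh : continuous2 Wh.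
  exact: (continuous2Z (continuous2B (continuous2_shift (h := h) cW) cW)).
have ccW : cc2 B (fun x t => Wh x t * partial_x (partial_x phi) x t).
  by apply: cc2_mul => //; exact: wid.
pose Uh x t := h^-1 * (U x (t + h) - U x t).
have cUh : continuous2 Uh.
  exact: (continuous2Z (continuous2B (continuous2_shift (h := h) cU) cU)).
have ccU : cc2 B (fun x t => Uh x t * phi x t).
  by apply: cc2_mul => //; exact: wid.
pose ph x t := h^-1 * (phi x (t - h) - phi x t).
have ccp : cc2 B ph.
  have [c1 p1 p2] := cc2B (shF _ s0) (wid _ s0); split.
  - exact: (continuous2Z c1).
  - by move=> x t hz; rewrite /ph p1// mulr0.
  - by move=> x t hz; rewrite /ph p2// mulr0.
have e1 : \int[leb]_t \int[leb]_x (Wh x t * partial_x (partial_x phi) x t) =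
    \int[leb]_t (2 * \int[m]_x (Uh x t * phi x t)).
  apply: eq_Rintegral => t _.
  have [t0|t0] := leP t 0.
    under eq_Rintegral do rewrite (proj2 sxx)// mulr0.
    under [in RHS]eq_Rintegral do rewrite (proj2 s0)// mulr0.
    by rewrite !Rintegral_cst// !mul0r mulr0.
  have cs1 z : continuous (fun x => U x z - g x).
    have cg : continuous g.
      by have -> : g = U^~ 0 by [apply/funext => x; rewrite Uneg]; exact: continuous2_slice1.
    by move=> x; apply: cvgB; [exact: continuous2_slice1|exact: cg].
  apply: (Rel_weak lf A0 (hx t) (hxx t) (cc2_slice t (proj1 s0)) (cc2_slice t sx) (cc2_slice t (proj1 sxx))).
  - exact: continuous2_slice1.
  - exact: continuous2_slice1.
  have r1 := rU (t + h) (ltW (addr_gt0 t0 h0)); have r2 := rU t (ltW t0).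
  have cB : continuous (fun x => (U x (t + h) - g x) - (U x t - g x)).
    by move=> x; apply: cvgB; exact: cs1.
  apply: Rel_ext (RelZ lf h^-1 cB (RelB lf (cs1 (t + h)) (cs1 t) r1 r2)) => x.
    by rewrite /Wh /W !posE ?(ltW t0) ?(ltW (addr_gt0 t0 h0)).
  by rewrite /Uh; congr (_ * _); ring.
(* Discrete integration by parts in time, from translation invariance of Lebesgue measure. *)
have e2 : \int[leb]_t \int[m]_x (Uh x t * phi x t) = \int[leb]_t \int[m]_x (U x t * ph x t).
  have [k1 k2 k3] := ccU; have [l1 l2 l3] := cc2_mul cU ccp.
  rewrite -(cc_Fubini lf (@leb_locally_finite R) k1 k2 k3).
  rewrite -(cc_Fubini lf (@leb_locally_finite R) l1 l2 l3).
  apply: eq_Rintegral => x _.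
  have a1 := cc2_slice2 x (cc2_mul cU (shF _ s0)).
  have a2 := cc2_slice2 x (cc2_mul cU (wid _ s0)).
  have a3 := cc2_slice2 x (cc2_mul (continuous2_shift (h := h) cU) (wid _ s0)).
  transitivity (h^-1 * (\int[leb]_t (U x (t + h) * phi x t) - \int[leb]_t (U x t * phi x t))).
    rewrite -(cc_RintB (@leb_locally_finite R) a3 a2).
    rewrite -(cc_RintZ (@leb_locally_finite R) _ (ccB a3 a2)).
    by apply: eq_Rintegral => t _; rewrite /Uh; ring.
  transitivity (h^-1 * (\int[leb]_t (U x t * phi x (t - h)) - \int[leb]_t (U x t * phi x t))).
    rewrite -(cc_shift h a1); congr (_ * (_ - _)).
    by apply: eq_Rintegral => t _; rewrite addrK.
  rewrite -(cc_RintB (@leb_locally_finite R) a1 a2).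
  rewrite -(cc_RintZ (@leb_locally_finite R) _ (ccB a1 a2)).
  by apply: eq_Rintegral => t _; rewrite /ph; ring.
have n1 : `|\int[leb]_t \int[leb]_x (Wh x t * partial_x (partial_x phi) x t) - Y| <=
    e * mass leb B * mass leb B.
  apply: (cc2_dist (@leb_locally_finite R) ccW (wid _ sUx)) => x t xB tB.
  have [t0|t0] := leP t 0; first by rewrite (proj2 sxx)// !mulr0 subrr normr0 ltW.
  rewrite -mulrBl normrM; apply: le_trans e'M'.
  have xBB := le_trans xB BB; have tBB := le_trans tB BB.
  apply: ler_pM => //; last exact: HM'.
  rewrite /Wh /W !posE ?(ltW t0) ?(ltW (addr_gt0 t0 h0))//.
  apply: forward_quotient => //; [exact: continuous2_slice2|exact: ltW|].
  move=> r rt; apply: Hd1 => //; first by rewrite subrr normr0.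
  by clear -rt hd1 d10; move: rt => /andP[r1 r2]; rewrite ger0_norm; lra.
have n2 : `|\int[leb]_t \int[m]_x (U x t * ph x t) - \int[leb]_t \int[m]_x (-1 * (U x t * partial_t phi x t))| <=
    e * mass m B * mass leb B.
  have cN : cc2 B (fun x t => -1 * (U x t * partial_t phi x t)).
    by apply: cc2_mul; [move=> p; exact: cvg_cst|exact: wid].
  apply: (cc2_dist lf (cc2_mul cU ccp) cN) => x t xB tB.
  have -> : U x t * ph x t - -1 * (U x t * partial_t phi x t) =
            U x t * (ph x t + partial_t phi x t) by ring.
  rewrite normrM; apply: le_trans e'M; rewrite mulrC.
  have xBB := le_trans xB BB; have tBB := le_trans tB BB.
  apply: ler_pM => //; last exact: HM.
  apply: backward_quotient => // r rt; apply: Hd2 => //; first by rewrite subrr normr0.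
  by clear -rt hd2 d20; move: rt => /andP[r1 r2]; rewrite ltr_norml; lra.
rewrite (cc2_scale lf _ (wid _ sUt)) -/X in n2.
rewrite (cc_RintZ (@leb_locally_finite R) _ (cc2_inner lf ccU)) e2 in e1.
rewrite {}e1 in n1; rewrite /K.
move: n1 n2; move: (\int[leb]_t _) => Z; rewrite !ler_norml.
move: (mass leb B) (mass m B) => p q /andP[n1 n2] /andP[n3 n4].
have -> : e * (p * p + 2 * (q * p)) = e * p * p + 2 * (e * q * p) by ring.
by clear -n1 n2 n3 n4; apply/andP; split; lra.
Qed.

End mild_is_weak.

(** * Smooth cutoffs and mollifiers *)

Section smooth_functions.
Context {R : realType}.
Implicit Types (f g df : R -> R) (x y e k l : R) (n : nat) (p : {poly R}).

Fixpoint Cn n f : Prop := if n is n'.+1 then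
  exists2 df, has_derivative f df & Cn n' df else continuous f.

Lemma Cn_continuous n f : Cn n f -> continuous f.
Proof. by case: n => //= n [df H _]; exact: hd_continuous H. Qed.

Lemma CnW n f : Cn n.+1 f -> Cn n f.
Proof.
elim: n f => [|n IH] f; first by move=> [df H _]; exact: hd_continuous H.
by move=> [df H Cf]; exists df => //; exact: IH.
Qed.

Lemma CnD n f g : Cn n f -> Cn n g -> Cn n (fun x => f x + g x).
Proof.
elim: n f g => [|n IH] f g; first by move=> cf cg x; apply: cvgD; [exact: cf|exact: cg].
by move=> [df Hf Cf] [dg Hg Cg]; eexists; [exact: hdD Hf Hg|exact: IH].
Qed.

Lemma CnM n f g : Cn n f -> Cn n g -> Cn n (fun x => f x * g x).
Proof.
elim: n f g => [|n IH] f g; first by move=> cf cg x; apply: cvgM; [exact: cf|exact: cg].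
move=> Cf Cg; have Cf' := CnW Cf; have Cg' := CnW Cg.
move: Cf Cg => [df Hf Cf] [dg Hg Cg].
by eexists; [exact: hdM Hf Hg|apply: CnD; exact: IH].
Qed.

Lemma Cn_cst n k : Cn n (fun=> k).
Proof. by elim: n k => [|n IH] k /=; [move=> x; exact: cvg_cst|exists (fun=> 0) => //; exact: hd_cst]. Qed.

Lemma CnZ n k f : Cn n f -> Cn n (fun x => k * f x).
Proof. by move=> Cf; apply: CnM => //; exact: Cn_cst. Qed.

Lemma Cn_affine n k l : Cn n (fun x => k * x + l).
Proof.
case: n => [|n]; first exact: hd_continuous (hd_affine k l).
by exists (fun=> k); [exact: hd_affine|exact: Cn_cst].
Qed.

Lemma Cn_comp_affine n f k l : Cn n f -> Cn n (fun x => f (k * x + l)).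
Proof.
elim: n f => [|n IH] f.
  move=> cf x; apply: (@continuous_comp _ _ _ (fun x => k * x + l) f); last exact: cf.
  exact: hd_continuous (hd_affine k l) x.
move=> [df Hf Cf]; eexists; first exact: hd_comp Hf (hd_affine k l).
by apply: CnM; [exact: IH|exact: Cn_cst].
Qed.

Lemma Cn_antider n f : Cn n f -> Cn n.+1 (antider f).
Proof. by move=> Cf; exists f => //; apply: antider_hd; exact: Cn_continuous Cf. Qed.

Lemma Ck_tensor n f g : Cn n f -> Cn n g -> Ck n (fun x t => f x * g t).
Proof.
have cT n' (f' g' : R -> R) : Cn n' f' -> Cn n' g' -> continuous2 (fun x t => f' x * g' t).
  move=> /Cn_continuous cf /Cn_continuous cg.
  exact: (continuous2M (continuous2_fst cf) (continuous2_swap (continuous2_fst cg))).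
elim: n f g => [|n IH] f g Cf Cg; (split; first exact: cT Cf Cg) => //.
have Cf' := CnW Cf; have Cg' := CnW Cg.
move: Cf Cg => [df Hf Cf] [dg Hg Cg].
have hx t : has_derivative (fun x => f x * g t) (fun x => df x * g t).
  have Ex : (fun x => f x * g t) = (fun x => g t * f x) by apply/funext => x; rewrite mulrC.
  by rewrite Ex; apply: hd_eq (hdZ (g t) Hf) _ => x; rewrite mulrC.
have ht x : has_derivative (fun t => f x * g t) (fun t => f x * dg t) by exact: hdZ.
split.
- by move=> x t; split; [exact: hd_derivable (hx t)|exact: hd_derivable (ht x)].
- have -> : partial_x (fun x t => f x * g t) = fun x t => df x * g t.
    by apply/funext => x; apply/funext => t; rewrite /partial_x (hd_derive1 (hx t)).
  exact: IH.
- have -> : partial_t (fun x t => f x * g t) = fun x t => f x * dg t.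
    by apply/funext => x; apply/funext => t; rewrite /partial_t (hd_derive1 (ht x)).
  exact: IH.
Qed.

Lemma expr_le_expR n y : 0 <= y -> y ^+ n <= n%:R ^+ n * expR y.
Proof.
case: n => [|n] y0; first by rewrite !expr0 mul1r -expR0 ler_expR.
have n0 : 0 < n.+1%:R :> R by rewrite ltr0n.
have h : y / n.+1%:R <= expR (y / n.+1%:R) by apply: le_trans (expR_ge1Dx _); rewrite lerDr.
have -> : expR y = expR (y / n.+1%:R) ^+ n.+1.
  by rewrite -expRM_natr divfK// gt_eqF.
rewrite -exprMn; apply: lerXn2r; rewrite ?nnegrE ?mulr_ge0 ?expR_ge0 ?ler0n//.
by rewrite mulrC -ler_pdivrMr.
Qed.

Lemma poly_le_expR p : exists2 C, 0 <= C & forall y, 0 <= y -> `|p.[y]| * expR (- y) <= C.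
Proof.
exists (\sum_(i < size p) `|p`_i| * i%:R ^+ i).
  by apply: sumr_ge0 => i _; rewrite mulr_ge0// exprn_ge0.
move=> y y0; rewrite horner_coef.
apply: (@le_trans _ _ ((\sum_(i < size p) `|p`_i| * y ^+ i) * expR (- y))).
  rewrite ler_wpM2r ?expR_ge0//; apply: le_trans (ler_norm_sum _ _ _) _.
  by apply: ler_sum => i _; rewrite normrM normrX (ger0_norm y0).
rewrite mulr_suml; apply: ler_sum => i _; rewrite -mulrA ler_wpM2l//.
by rewrite expRN ler_pdivrMr ?expR_gt0// expr_le_expR.
Qed.

(** Polynomials in 1/x times exp(-1/x). The family is closed under differentiation, [p] becoming X^2
    (p - p'), so each member is smooth by induction on the order. *)
Definition flat p x := if 0 < x then p.[x^-1] * expR (- x^-1) else 0.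

Lemma flat_hd p : has_derivative (flat p) (flat ('X^2 * (p - p^`()))).
Proof.
move=> x; have [x0|x0|x0] := ltgtP x 0.
- apply: is_derive_eps => e e0; exists (- x) => [|y]; first by rewrite oppr_gt0.
  rewrite ltr_norml => /andP[_ h]; rewrite /flat !ifN; [|by rewrite -leNgt; lra..].
  by rewrite mulr0 !subr0 normr0 mulr_ge0// ltW.
- have D1 : is_derive x (1 : R) (fun y => y^-1) (- x ^- 2 *: 1).
    by apply: is_deriveV; rewrite gt_eqF.
  have D2 : is_derive x (1 : R) (fun y => p.[y^-1] * expR (- y^-1))
      (flat ('X^2 * (p - p^`())) x).
    have D3 : is_derive x (1 : R) (fun y => p.[y^-1]) (p^`().[x^-1] * (- x ^- 2 *: 1)).
      exact: (@is_derive1_comp _ (horner p) (fun y => y^-1) x _ _ (is_derive_poly p x^-1) D1).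
    have D3' : is_derive x (1 : R) (fun y : R => - y^-1) (- (- x ^- 2 *: 1)) by exact: is_deriveN D1.
    have D4 : is_derive x (1 : R) (fun y => expR (- y^-1)) (expR (- x^-1) * (- (- x ^- 2 *: 1))).
      exact: (@is_derive1_comp _ expR (fun y => - y^-1) x _ _ (is_derive_expR (- x^-1)) D3').
    have -> : flat ('X^2 * (p - p^`())) x = p.[x^-1] *: (expR (- x^-1) * (- (- x ^- 2 *: 1)))
        + expR (- x^-1) *: (p^`().[x^-1] * (- x ^- 2 *: 1)).
      rewrite /flat x0 hornerM hornerXn hornerD hornerN /GRing.scale /=.
      by field; rewrite gt_eqF.
    exact: (@is_deriveM _ _ _ _ x 1 _ _ D3 D4).
  apply: near_eq_is_derive D2; near=> y.
  have y0 : 0 < y by near: y; exact: lt_nbhsr.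
  by rewrite /flat y0.
(* Boundedness of y^-2 p(1/y) exp(-1/y) gives a value of order y^2 near 0, hence derivative 0
   there. *)
- subst x; have [C C0 HC] := poly_le_expR ('X^2 * p).
  apply: is_derive_eps => e e0; exists (e / (C + 1)) => [|y]; first by rewrite divr_gt0//; lra.
  rewrite /flat ltxx mulr0 !subr0; case: ifPn => [y0|_ _]; last by rewrite normr0 mulr_ge0// ltW.
  rewrite (gtr0_norm y0) => ye.
  have := HC y^-1 ltac:(by rewrite invr_ge0 ltW).
  rewrite hornerM hornerXn normrM normrX (gtr0_norm (ltac:(by rewrite invr_gt0) : 0 < y^-1)).
  rewrite normrM (ger0_norm (expR_ge0 _)).
  rewrite exprVn => h.
  have E : p.[y^-1] * expR (- y^-1) = y ^+ 2 * (y ^- 2 * p.[y^-1] * expR (- y^-1)).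
    by field; rewrite gt_eqF.
  have nE : `|p.[y^-1]| * expR (- y^-1) <= y ^+ 2 * C.
    apply: (@le_trans _ _ (y ^+ 2 * (y ^- 2 * `|p.[y^-1]| * expR (- y^-1)))).
      by rewrite le_eqVlt; apply/orP; left; apply/eqP; field; rewrite gt_eqF.
    by rewrite ler_pM2l ?exprn_gt0.
  apply: le_trans nE _; rewrite expr2 -mulrA ler_pM2l//.
  apply: ltW; apply: (@le_lt_trans _ _ (y * (C + 1))); first by rewrite ler_pM2l//; lra.
  by rewrite -ltr_pdivlMr//; lra.
Unshelve. all: by end_near.
Qed.

Lemma flat_Cn n p : Cn n (flat p).
Proof.
elim: n p => [|n IH] p; first exact: hd_continuous (flat_hd p).
by exists (flat ('X^2 * (p - p^`()))) => //; exact: flat_hd.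
Qed.

End smooth_functions.

Section mollifier.
Context {R : realType}.
Local Notation leb := (@lebesgue_measure R).
Implicit Types (f df : R -> R) (x y e : R).

Lemma hd_const f df x y : has_derivative f df -> x <= y ->
  (forall z, x <= z <= y -> df z = 0) -> f y = f x.
Proof.
move=> H xy z0; have := @hd_lipschitz _ f df x y 0 H xy.
rewrite mulr0 normr_le0 subr_eq0 => h; apply/eqP/h => z /z0 ->; by rewrite normr0.
Qed.

Lemma hd_nondecreasing f df x y : has_derivative f df -> (forall z, 0 <= df z) ->
  x <= y -> f x <= f y.
Proof.
move=> H d0 xy; have [c _ E] := MVT_segment xy (fun x _ => H x) (continuous_subspaceT (hd_continuous H)).
by rewrite -subr_ge0 E mulr_ge0// subr_ge0.
Qed.

Definition bump x : R := flat 1 (1 * x + 1) * flat 1 (-1 * x + 1).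

Lemma bump_Cn n : Cn n bump.
Proof. by apply: CnM; apply: Cn_comp_affine; exact: flat_Cn. Qed.

Lemma flat_ge0 x : 0 <= flat 1 x :> R.
Proof. by rewrite /flat; case: ifP => // _; rewrite hornerC mul1r expR_ge0. Qed.

Lemma bump_ge0 x : 0 <= bump x. Proof. by rewrite mulr_ge0// flat_ge0. Qed.

Lemma bump_out x : 1 <= `|x| -> bump x = 0.
Proof.
rewrite ler_normr => h; apply/eqP; rewrite mulf_eq0; apply/orP.
case/orP: h => h; [right|left]; rewrite /flat ifN//; rewrite -leNgt; lra.
Qed.

Lemma bump_cc : cc 1 bump.
Proof. by split=> [|x /ltW]; [exact: Cn_continuous (bump_Cn 0)|exact: bump_out]. Qed.

Lemma flat_half x : 1 / 2 <= x -> expR (- 2) <= flat 1 x.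
Proof.
move=> h; have x0 : 0 < x by lra.
rewrite /flat x0 hornerC mul1r ler_expR lerN2.
by rewrite invf_ple ?posrE//; lra.
Qed.

Lemma bump_int_gt0 : 0 < \int[leb]_x bump x.
Proof.
apply: (cc_Rint_gt0 (@leb_locally_finite R) (V := `](-1/2), (1/2)[%classic) (c := expR (-2) * expR (-2)) bump_cc bump_ge0).
- exact: interval_open.
- apply: (@lt_le_trans _ _ (lebesgue_measure (`](-1/2), (1/2)[%classic : set R))) => //.
  by rewrite lebesgue_measure_itv /= lte_fin ifT; [rewrite lte_fin; lra|lra].
- by rewrite mulr_gt0// expR_gt0.
- move=> x /=; rewrite in_itv/= => /andP[h1 h2].
  by apply: ler_pM; rewrite ?expR_ge0// flat_half//; lra.
Qed.

(** [rho] is a normalised bump, [H] its primitive, a smoothed step, and [Th] the primitive of [H], a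
    smoothed positive part. Rescaled, [Th] smooths the hats, and its second derivatives are
    mollifiers. *)
Lemma mollifier_exists : exists rho H Th : R -> R,
  [/\ [/\ forall n, Cn n Th, forall n, Cn n H, has_derivative Th H & has_derivative H rho],
      [/\ forall x, 0 <= rho x, forall x, 1 <= `|x| -> rho x = 0, forall x, x <= -1 -> H x = 0 & forall x, 1 <= x -> H x = 1],
      forall x, x <= -1 -> Th x = 0, forall x, 1 <= x -> Th x = 1 * x + (Th 1 - 1) &
      forall x, `|Th x - pos x| <= 1].
Proof.
pose Z := \int[leb]_x bump x; have Z0 : 0 < Z := bump_int_gt0.
pose rho x := Z^-1 * bump x.
have cr : continuous rho by exact: Cn_continuous (CnZ (n := 0) Z^-1 (bump_Cn 0)).
have hr := antider_hd cr.
pose H x := antider rho x - antider rho (-1).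
have hH : has_derivative H rho.
  by apply: hd_eq (hdB hr (hd_cst (antider rho (-1)))) _ => x; rewrite subr0.
have cH := hd_continuous hH.
have hT' := antider_hd cH.
pose Th x := antider H x - antider H (-1).
have hTh : has_derivative Th H.
  by apply: hd_eq (hdB hT' (hd_cst (antider H (-1)))) _ => x; rewrite subr0.
have r0 x : 0 <= rho x by rewrite mulr_ge0 ?invr_ge0 ?(ltW Z0)// bump_ge0.
have rout x : 1 <= `|x| -> rho x = 0 by move=> h; rewrite /rho bump_out ?mulr0.
have CH n : Cn n H.
  by apply: CnW; apply: CnD; [apply: Cn_antider; apply: CnZ; exact: bump_Cn|exact: (Cn_cst n.+1)].
have CT n : Cn n Th.
  by apply: CnW; apply: CnD; [apply: Cn_antider; exact: CH|exact: (Cn_cst n.+1)].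
have Hl x : x <= -1 -> H x = 0.
  move=> x1; have <- : H (-1) = H x; last by rewrite /H subrr.
  apply: (hd_const hH x1) => z /andP[_ z1]; apply: rout.
  by rewrite ler0_norm; lra.
have H1 : H 1 = 1.
  have ccr : cc 1 rho := ccZ Z^-1 bump_cc.
  have := cc_FTC hH ccr; rewrite (Hl (-1))// subr0 => <-.
  by rewrite (cc_RintZ (@leb_locally_finite R) _ bump_cc) mulVf// gt_eqF.
have Hr x : 1 <= x -> H x = 1.
  move=> x1; rewrite -H1; apply: (hd_const hH x1) => z /andP[z1 _]; apply: rout.
  by rewrite ger0_norm; lra.
have H01 x : 0 <= H x <= 1.
  apply/andP; split.
    have [h|h] := leP x (-1); first by rewrite Hl.
    by rewrite -(Hl (-1))//; apply: (hd_nondecreasing hH r0); exact: ltW.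
  have [h|h] := leP 1 x; first by rewrite Hr.
  by rewrite -H1; apply: (hd_nondecreasing hH r0); exact: ltW.
have Tl x : x <= -1 -> Th x = 0.
  move=> x1; have <- : Th (-1) = Th x; last by rewrite /Th subrr.
  by apply: (hd_const hTh x1) => z /andP[_ z1]; rewrite Hl.
have Tr x : 1 <= x -> Th x = 1 * x + (Th 1 - 1).
  move=> x1; have h1 : has_derivative (fun y => Th y - (1 * y + 0)) (fun y => H y - 1).
    exact: hdB hTh (hd_affine 1 0).
  have h0 z : 1 <= z <= x -> H z - 1 = 0 by move=> /andP[z1 _]; rewrite Hr// subrr.
  by have := hd_const h1 x1 h0; lra.
have Tm x : -1 <= x -> 0 <= Th x <= x + 1.
  move=> x1; have T1 := Tl (-1) (lexx _); apply/andP; split.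
    by rewrite -T1; apply: (hd_nondecreasing hTh) => // z; have /andP[] := H01 z.
  have h1 : has_derivative (fun y => (1 * y + 1) - Th y) (fun y => 1 - H y).
    exact: hdB (hd_affine 1 1) hTh.
  have h0 z : 0 <= 1 - H z by have /andP[_ ?] := H01 z; rewrite subr_ge0.
  by have := hd_nondecreasing h1 h0 x1; rewrite T1; lra.
exists rho, H, Th; split => // x.
have [h|h] := leP x (-1); first by rewrite Tl// pos0 ?subr0 ?normr0//; lra.
have /andP[t1 t2] := Tm x (ltW h).
have [x0|x0] := leP x 0; first by rewrite pos0// ler_norml; lra.
rewrite posE ?(ltW x0)//; have [x1|x1] := leP 1 x.
  have /andP[t3 t4] := Tm 1 ltac:(lra).
  by rewrite Tr// ler_norml; lra.
by rewrite ler_norml; lra.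
Qed.

End mollifier.

(** * Distributional solutions satisfy the integrated equation *)

Section weak_is_mild.
Context {R : realType}.
Variable m : {measure set (measurableTypeR R) -> \bar R}.
Hypothesis lf : locally_finite m.
Local Notation leb := (@lebesgue_measure R).
Implicit Types (f df : R -> R) (x y s t e d r a b c A : R).

Variables rho H Th : R -> R.
Hypothesis Th_Cn : forall n, Cn n Th.
Hypothesis H_Cn : forall n, Cn n H.
Hypothesis Th_hd : has_derivative Th H.
Hypothesis H_hd : has_derivative H rho.
Hypothesis rho_ge0 : forall x, 0 <= rho x.
Hypothesis rho_out : forall x, 1 <= `|x| -> rho x = 0.
Hypothesis H_left : forall x, x <= -1 -> H x = 0.
Hypothesis H_right : forall x, 1 <= x -> H x = 1.
Hypothesis Th_left : forall x, x <= -1 -> Th x = 0.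
Hypothesis Th_right : forall x, 1 <= x -> Th x = 1 * x + (Th 1 - 1).
Hypothesis Th_pos : forall x, `|Th x - pos x| <= 1.

Let leblf := @leb_locally_finite R.

(** This is (y - x) / e, kept in affine form in [x] to match [hd_affine] and [Cn_comp_affine]. *)
Definition scl e y x := - e^-1 * x + e^-1 * y.

Lemma sclE e y x : scl e y x = (y - x) / e.
Proof. by rewrite /scl; ring. Qed.

Definition mol e y x := e^-1 * rho (scl e y x).

Lemma mol_hd e y : has_derivative (fun x => H (scl e y x)) (fun x => -1 * mol e y x).
Proof. by apply: hd_eq (hd_comp H_hd (hd_affine (- e^-1) (e^-1 * y))) _ => x; rewrite /mol; ring. Qed.

Lemma scl_far e y x : 0 < e -> e <= `|x - y| -> 1 <= `|scl e y x|.
Proof. by move=> e0 h; rewrite sclE normrM normfV (gtr0_norm e0) ler_pdivlMr// mul1r distrC. Qed.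

Lemma mol_out e y x : 0 < e -> e <= `|x - y| -> mol e y x = 0.
Proof. by move=> e0 h; rewrite /mol rho_out ?mulr0//; exact: scl_far. Qed.

Lemma mol_ge0 e y x : 0 < e -> 0 <= mol e y x.
Proof. by move=> e0; rewrite mulr_ge0 ?invr_ge0 ?(ltW e0). Qed.

Hypothesis rho_continuous : continuous rho.

Lemma mol_continuous e y : continuous (mol e y).
Proof.
move=> x; apply: cvgM; first exact: cvg_cst.
apply: (@continuous_comp _ _ _ (scl e y) rho); last exact: rho_continuous.
exact: hd_continuous (hd_affine (- e^-1) (e^-1 * y)) x.
Qed.

Lemma mol_cc e y A : 0 < e -> `|y| + e <= A -> cc A (mol e y).
Proof.
move=> e0 yA; split=> [|x Ax]; first exact: mol_continuous.
by apply: mol_out => //; have := lerB_dist x y; lra.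
Qed.

Lemma mol_int e y : 0 < e -> \int[leb]_x mol e y x = 1.
Proof.
move=> e0; pose A := `|y| + e.
have cm := mol_cc e0 (lexx A : `|y| + e <= A).
have h : has_derivative (fun x => -1 * H (scl e y x)) (mol e y).
  by apply: hd_eq (hdZ (-1) (mol_hd e y)) _ => x; ring.
rewrite (cc_FTC h cm).
have y1 := ler_norm y; have y2 := ler_norm (- y); rewrite normrN in y2.
rewrite H_left ?H_right ?sclE//.
- by ring.
- by rewrite ler_pdivlMr// /A; lra.
- by rewrite ler_pdivrMr// /A; lra.
Qed.

Lemma mol_approx f e y d : continuous f -> 0 < e ->
  (forall x, `|x - y| <= e -> `|f x - f y| <= d) ->
  `|\int[leb]_x (f x * mol e y x) - f y| <= d.
Proof.
move=> cf e0 near; have cm := mol_cc e0 (lexx (`|y| + e)).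
have c1 := ccMl cf cm; have c2 k := ccZ k cm.
have i2 k : \int[leb]_x (k * mol e y x) = k by rewrite (cc_RintZ leblf _ cm) mol_int// mulr1.
have bd x : (f y - d) * mol e y x <= f x * mol e y x <= (f y + d) * mol e y x.
  have [h|h] := leP `|x - y| e; last by rewrite mol_out ?(ltW h)// !mulr0 lexx.
  have := near x h; have := mol_ge0 y x e0; rewrite ler_norml => m0 /andP[h1 h2].
  by rewrite !ler_wpM2r//; lra.
have u : \int[leb]_x (f x * mol e y x) <= f y + d.
  by rewrite -[leRHS]i2; apply: (cc_Rint_le leblf c1 (c2 _)) => x; have /andP[] := bd x.
have l : f y - d <= \int[leb]_x (f x * mol e y x).
  by rewrite -[leLHS]i2; apply: (cc_Rint_le leblf (c2 _) c1) => x; have /andP[] := bd x.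
by rewrite ler_norml; move: l u; move: (\int[leb]_x _) => I l u; lra.
Qed.

Lemma test_tensor A s0 (f f1 f2 k k1 : R -> R) : 0 < s0 -> (forall n, Cn n f) -> (forall n, Cn n k) ->
  has_derivative f f1 -> has_derivative f1 f2 -> has_derivative k k1 ->
  cc A f -> (forall t, t <= s0 \/ A <= t -> k t = 0) ->
  [/\ test_function (fun x t => f x * k t), partial_t (fun x t => f x * k t) = (fun x t => f x * k1 t) &
      partial_x (partial_x (fun x t => f x * k t)) = (fun x t => f2 x * k t)].
Proof.
move=> s00 Cf Ck hf hf1 hk ccf k0.
have P1 (g g' : R -> R) : has_derivative g g' -> partial_x (fun x t => g x * k t) = fun x t => g' x * k t.
  move=> hg; apply/funext => x; apply/funext => t; rewrite /partial_x.
  have hd : has_derivative (fun x => g x * k t) (fun x => g' x * k t).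
    have Ex : (fun x => g x * k t) = (fun x => k t * g x) by apply/funext => z; rewrite mulrC.
    by rewrite Ex; apply: hd_eq (hdZ (k t) hg) _ => z; rewrite mulrC.
  by rewrite (hd_derive1 hd).
split.
- rewrite /test_function; set S := closure _.
  pose K : set (R * R) := `[- A, A]%classic `*` `[s0, A]%classic.
  have cK : compact K by apply: compact_setX; exact: segment_compact.
  have clK : closed K by apply: compact_closed => //; exact: norm_hausdorff.
  have SK : S `<=` K.
    rewrite (closure_id K).1//; apply: closureS => -[x t] /= nz.
    have [xA|Ax] := leP `|x| A; last by move: nz; rewrite (proj2 ccf _ Ax) mul0r eqxx.
    split; first by rewrite /= in_itv /= -ler_norml.
    rewrite /= in_itv /=; apply/andP; split; rewrite leNgt; apply/negP => h;
      by move: nz; rewrite k0 ?mulr0 ?eqxx//; solve [left; exact: ltW | right; exact: ltW].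
  split; first by move=> n; exact: Ck_tensor.
    have clS : closed S by exact: closed_closure.
    exact: (subclosed_compact clS cK SK).
  by move=> p /SK [_ /=]; rewrite in_itv /= => /andP[h _]; exact: lt_le_trans h.
- by apply/funext => x; apply/funext => t; rewrite /partial_t (hd_derive1 (hdZ (f x) hk)).
- by rewrite (P1 _ _ hf) (P1 _ _ hf1).
Qed.

Variable V : R -> R -> R.
Hypothesis cV : continuous2 V.
Hypothesis V_heat : heat_distributional m V.

(** Put G(r) = 2 \int V f dm minus the time primitive of \int V f''. Test functions f(x) k(r) show
    that [G] has the same mollified values at [s] and at [t], and shrinking the mollifier gives G(s)
    = G(t). *)
Lemma tested_in_time A (f f1 f2 : R -> R) s t : 0 < s -> s < t -> (forall n, Cn n f) ->
  has_derivative f f1 -> has_derivative f1 f2 -> cc A f -> cc A f2 ->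
  2 * (\int[m]_x (V x t * f x) - \int[m]_x (V x s * f x)) =
  prim (fun r => \int[leb]_x (V x r * f2 x)) t - prim (fun r => \int[leb]_x (V x r * f2 x)) s.
Proof.
move=> s0 st Cf hf hf1 ccf ccf2.
pose al r := \int[m]_x (V x r * f x); pose be r := \int[leb]_x (V x r * f2 x).
have cV2 := continuous2_swap cV.
have cpar (mu : {measure set (measurableTypeR R) -> \bar R}) (h : R -> R) : locally_finite mu ->
    cc A h -> continuous (fun r => \int[mu]_x (V x r * h x)).
  move=> lfmu [ch h0]; apply: (@cc_continuous_param _ _ lfmu A (fun r x => V x r * h x)).
    exact: (continuous2M cV2 (continuous2_swap (continuous2_fst ch))).
  by move=> r x Ax; rewrite h0// mulr0.
have cal : continuous al := cpar m f lf ccf.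
have cbe : continuous be := cpar leb f2 leblf ccf2.
have hB := antider_hd cbe.
pose G r := 2 * al r - antider be r.
have cG : continuous G.
  by move=> r; apply: cvgB; [apply: cvgM; [exact: cvg_cst|exact: cal]|exact: hd_continuous hB r].
have Gst : G s = G t; last first.
  have E r : 0 < r -> antider be r = prim be r by move=> r0; rewrite /antider ltW.
  move: Gst; rewrite /G (E s s0) (E t (lt_trans s0 st)) -/be -/(al t) -/(al s).
  by move: (al t) (al s) (prim be t) (prim be s) => a1 a2 a3 a4 h; lra.
have test e : 0 < e -> e <= s / 2 -> \int[leb]_r (G r * mol e s r) = \int[leb]_r (G r * mol e t r).
  move=> e0 es.
  (* A smoothed indicator of the interval from [s] to [t]; the bound [e <= s / 2] keeps its support
     at positive times. *)
  pose k r := H (scl e t r) - H (scl e s r).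
  pose k1 r := -1 * mol e t r - -1 * mol e s r.
  have hk : has_derivative k k1 by exact: hdB (mol_hd e t) (mol_hd e s).
  have kC n : Cn n k.
    apply: CnD; first exact: Cn_comp_affine.
    have -> : (fun x => - H (scl e s x)) = (fun x => -1 * H (scl e s x)) by apply/funext => x; ring.
    by apply: CnZ; exact: Cn_comp_affine.
  pose A' := `|A| + (`|t| + `|s| + e).
  have n1 := ler_norm A; have n2 := normr_ge0 A; have n3 := ler_norm t; have n4 := ler_norm s.
  have AA' : A <= A' by rewrite /A'; lra.
  have k0 r : r <= s / 2 \/ A' <= r -> k r = 0.
    rewrite /k !sclE; case=> h.
      by rewrite !H_right ?subrr// ler_pdivlMr//; lra.
    by rewrite !H_left ?subrr// ler_pdivrMr//; rewrite /A' in h; lra.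
  have s20 : 0 < s / 2 by lra.
  have [tp Et Exx] := test_tensor s20 Cf kC hf hf1 hk (cc_widen AA' ccf) k0.
  have := V_heat tp; rewrite Et Exx.
  have ck : continuous k := hd_continuous hk.
  have cm1 y : `|y| <= `|t| + `|s| -> cc A' (mol e y).
    by move=> h; apply: mol_cc => //; rewrite /A'; lra.
  have cms := cm1 s ltac:(lra); have cmt := cm1 t ltac:(have := normr_ge0 s; lra).
  have ck1 : cc A' k1 by exact: ccB (ccZ _ cmt) (ccZ _ cms).
  have kout r : r <= 0 -> k r = 0 by move=> r0; apply: k0; left; lra.
  have k1out r : r <= 0 -> k1 r = 0.
    move=> r0; apply: (hd_local0 hk s20) => y hy; apply: k0; left.
    by move: hy; rewrite ltr_norml; lra.
  have cck : cc A' k.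
    split => // r; rewrite ltr_normr => /orP[h|h]; apply: k0; [right; exact: ltW|left].
    by have := normr_ge0 A; rewrite /A' in h; lra.
  have half (h : R -> R) (mu : {measure set (measurableTypeR R) -> \bar R}) (j : R -> R) :
      locally_finite mu -> cc A h -> (forall r, r <= 0 -> j r = 0) ->
      \int[leb]_(r in `]0, +oo[) \int[mu]_x (V x r * (h x * j r)) =
      \int[leb]_r (j r * \int[mu]_x (V x r * h x)).
    move=> lfmu cch j0; rewrite [LHS]Rintegral_mkcond; congr fine; apply: eq_integral => r _.
    have Er : \int[mu]_x (V x r * (h x * j r)) = j r * \int[mu]_x (V x r * h x).
      rewrite -(cc_RintZ lfmu _ (ccMl (continuous2_slice1 (t := r) cV) cch)).
      by apply: eq_Rintegral => x _; ring.
    rewrite patchE; case: ifPn => [_|]; first by rewrite Er.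
    by rewrite notin_setE/= in_itv/= andbT => /negP; rewrite -leNgt => r0; rewrite j0// mul0r.
  rewrite (half _ _ _ lf ccf k1out) (half _ _ _ leblf ccf2 kout) -/(al _) -/(be _) => E.
  have hkB := hdM hk hB.
  have ckB : cc A' (fun r => k r * be r + antider be r * k1 r).
    by apply: ccD; [exact: ccMr|apply: ccMl => //; exact: hd_continuous hB].
  have := cc_FTC hkB ckB.
  have -> : k A' = 0 by apply: k0; right.
  have -> : k (- A') = 0 by apply: kout; rewrite /A'; lra.
  rewrite !mul0r subrr.
  have c1 : cc A' (fun r => k r * be r) by exact: ccMr.
  have c2 : cc A' (fun r => antider be r * k1 r) by apply: ccMl => //; exact: hd_continuous hB.
  have c3 : cc A' (fun r => k1 r * al r) by exact: ccMr.
  have c4 := ccMl cG cms; have c5 := ccMl cG cmt.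
  rewrite (cc_RintD leblf c1 c2) => E2.
  apply/eqP; rewrite -subr_eq0 -(cc_RintB leblf c4 c5).
  have -> : (fun r => G r * mol e s r - G r * mol e t r) = (fun r => 2 * (k1 r * al r) - antider be r * k1 r).
    by apply/funext => r; rewrite /G /k1; ring.
  rewrite (cc_RintB leblf (ccZ 2 c3) c2) (cc_RintZ leblf _ c3).
  move: E E2; move: (\int[leb]_r (k1 r * _)) (\int[leb]_r (k r * _)) (\int[leb]_r (_ * k1 r)) => I1 I2 I3 E E2.
  by apply/eqP; lra.
apply/eqP; rewrite -subr_eq0 -normr_le0; apply/ler_addgt0Pl => d d0; rewrite addr0.
have d20 : 0 < d / 2 by lra.
have /continuous_epsP cG' := cG.
have [e1 e10 He1] := cG' s _ d20; have [e2 e20 He2] := cG' t _ d20.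
pose e := Num.min (s / 2) (Num.min (e1 / 2) (e2 / 2)).
have e0 : 0 < e by rewrite !lt_min !divr_gt0.
have le1 : e <= s / 2 by rewrite ge_min lexx.
have le2 : e <= e1 / 2 by rewrite /e ge_min [X in _ || X]ge_min lexx orbT.
have le3 : e <= e2 / 2 by rewrite /e ge_min [X in _ || X]ge_min lexx !orbT.
have a1 := @mol_approx G e s (d / 2) cG e0 (fun x hx => He1 x ltac:(lra)).
have a2 := @mol_approx G e t (d / 2) cG e0 (fun x hx => He2 x ltac:(lra)).
rewrite (test e e0 le1) in a1.
move: a1 a2; move: (\int[leb]_r _) => I a1 a2.
move: (G s) (G t) a1 a2 => g1 g2; rewrite !ler_norml => /andP[? ?] /andP[? ?]; lra.
Qed.

Lemma hd_T3 (F dF : R -> R -> R) a b c : (forall y, has_derivative (F y) (dF y)) ->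
  has_derivative (fun x => T3 a b c (F^~ x)) (fun x => T3 a b c (dF^~ x)).
Proof. by move=> hF; apply: hdB; [apply: hdD|]; exact: hdZ. Qed.

Lemma Cn_T3 (F : R -> R -> R) a b c n : (forall y, Cn n (F y)) -> Cn n (fun x => T3 a b c (F^~ x)).
Proof.
move=> CF.
have -> : (fun x => T3 a b c (F^~ x)) =
    (fun x => ((c - b) * F a x + (b - a) * F c x) + -1 * ((c - a) * F b x)).
  by apply/funext => x; rewrite /T3; ring.
by apply: CnD; [apply: CnD|apply: CnZ]; exact: CnZ.
Qed.

Definition smooth_tent e a b c x := T3 a b c (fun y => e * Th (scl e y x)).

Lemma smooth_tent_dist e a b c x : 0 < e -> a < b -> b < c ->
  `|smooth_tent e a b c x - tent a b c x| <= (c - a) * (2 * e).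
Proof.
move=> e0 ab bc.
have D y : `|e * Th (scl e y x) - pos (y - x)| <= e.
  have -> : pos (y - x) = e * pos (scl e y x).
    rewrite sclE; have [h|h] := leP 0 (y - x).
      by rewrite !posE ?divr_ge0 ?(ltW e0)// mulrC divfK// gt_eqF.
    by rewrite !pos0 ?mulr0 ?(ltW h)// pmulr_lle0 ?invr_gt0// ltW.
  by rewrite -mulrBr normrM (gtr0_norm e0) ler_piMr ?(ltW e0).
by apply: T3_dist; rewrite ?(ltW ab) ?(ltW bc).
Qed.

Lemma smooth_tent_cc e a b c : 0 < e -> a < b -> b < c ->
  cc (`|a| + `|c| + e) (smooth_tent e a b c).
Proof.
move=> e0 ab bc; split.
  by apply: (@Cn_continuous _ 0); apply: Cn_T3 => y; apply: CnZ; exact: Cn_comp_affine.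
have a1 := normr_ge0 a; have c1 := normr_ge0 c; have a2 := ler_norm (- a); have c2 := ler_norm c.
rewrite normrN in a2.
move=> x; rewrite ltr_normr => /orP[h|h].
  rewrite /smooth_tent /T3 !Th_left; [ring|by rewrite sclE ler_pdivrMr//; lra..].
have [k0 Tk] : exists k, forall y, e <= y - x -> Th (scl e y x) = 1 * ((y - x) / e) + k.
  by exists (Th 1 - 1) => y hy; rewrite Th_right sclE// ler_pdivlMr// mul1r.
rewrite /smooth_tent /T3 (Tk a) ?(Tk b) ?(Tk c); [|lra..].
by field; rewrite gt_eqF.
Qed.

(** Apply [tested_in_time] to a smoothed hat. Its second derivative is the [T3] combination of
    mollifiers at [a], [b] and [c], so as the width tends to 0 the spatial term becomes [T3] of
    [V]. *)
Lemma space_time_identity a b c s t : a < b -> b < c -> 0 < s -> s < t ->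
  2 * (\int[m]_x (tent a b c x * V x t) - \int[m]_x (tent a b c x * V x s)) =
  T3 a b c (fun x => prim (V x) t - prim (V x) s).
Proof.
move=> ab bc s0 st.
apply/eqP; rewrite -subr_eq0 -normr_le0; apply/ler_addgt0Pl => d d0; rewrite addr0.
pose A := `|a| + `|c| + 1.
have na := normr_ge0 a; have nc := normr_ge0 c.
have a2 := ler_norm (- a); have c2 := ler_norm c; rewrite normrN in a2.
have A1 : 1 <= A by rewrite /A; lra.
have yA y : a <= y <= c -> `|y| + 1 <= A by move=> /andP[h1 h2]; by rewrite /A lerD2r ler_norml; lra.
pose B := A + t.
have [M HM] := continuous2_bounded B cV.
have t0 : 0 < t := lt_trans s0 st.
have M0 : 0 <= M by apply: le_trans (HM 0 0 _ _); rewrite ?normr0// /B; lra.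
(* Collects the errors of all replacements: with tolerance [d'] they add up to at most
   [K * d' = d]. *)
pose K := (t - s) * ((c - a) * 2) + 4 * (M * ((c - a) * 2) * mass m A) + 1.
have mA := mass_ge0 m A.
have K1 : 1 <= K.
  by rewrite /K lerDr addr_ge0// ?mulr_ge0//; lra.
have K0 : 0 < K by apply: lt_le_trans K1.
pose d' := d / K.
have d'0 : 0 < d' by rewrite divr_gt0.
have [e1 e10 He1] := continuous2_unif B cV d'0.
pose e := Num.min 1 (Num.min d' (e1 / 2)).
have e0 : 0 < e by rewrite !lt_min ltr01 d'0 divr_gt0.
have le1 : e <= 1 by rewrite ge_min lexx.
have le2 : e <= d' by rewrite /e ge_min [X in _ || X]ge_min lexx orbT.
have le3 : e <= e1 / 2 by rewrite /e ge_min [X in _ || X]ge_min lexx !orbT.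
have cst : cc A (smooth_tent e a b c).
  by apply: cc_widen (smooth_tent_cc e0 ab bc); rewrite /A; lra.
pose p1 x := T3 a b c (fun y => -1 * H (scl e y x)).
pose p2 x := T3 a b c (fun y => mol e y x).
have h1 : has_derivative (smooth_tent e a b c) p1.
  apply: (@hd_T3 (fun y x => e * Th (scl e y x)) (fun y x => -1 * H (scl e y x))) => y.
  apply: hd_eq (hdZ e (hd_comp Th_hd (hd_affine (- e^-1) (e^-1 * y)))) _ => x.
  by rewrite -/(scl e y x); field; rewrite gt_eqF.
have h2 : has_derivative p1 p2.
  apply: (@hd_T3 (fun y x => -1 * H (scl e y x)) (fun y x => mol e y x)) => y.
  by apply: hd_eq (hdZ (-1) (mol_hd e y)) _ => x; ring.
have cm y : a <= y <= c -> cc A (mol e y).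
  by move=> /yA h; apply: mol_cc => //; lra.
have ca := cm a ltac:(lra); have cb := cm b ltac:(lra); have ccm := cm c ltac:(lra).
have cp2 : cc A p2 by exact: ccB (ccD (ccZ _ ca) (ccZ _ ccm)) (ccZ _ cb).
have CT n : Cn n (smooth_tent e a b c).
  by apply: Cn_T3 => y; apply: CnZ; exact: Cn_comp_affine.
have E := tested_in_time s0 st CT h1 h2 cst cp2.
pose be r := \int[leb]_x (V x r * p2 x).
pose ga r := T3 a b c (V^~ r).
have beE r : be r = T3 a b c (fun y => \int[leb]_x (V x r * mol e y x)).
  have cVr := continuous2_slice1 (t := r) cV.
  have qa := ccMl cVr ca; have qb := ccMl cVr cb; have qc := ccMl cVr ccm.
  rewrite /T3 -(cc_RintZ leblf _ qa) -(cc_RintZ leblf _ qb) -(cc_RintZ leblf _ qc).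
  rewrite -(cc_RintD leblf (ccZ _ qa) (ccZ _ qc)) -(cc_RintB leblf (ccD (ccZ _ qa) (ccZ _ qc)) (ccZ _ qb)).
  by apply: eq_Rintegral => x _; rewrite /p2 /T3; ring.
have bega r : s <= r <= t -> `|be r - ga r| <= (c - a) * (2 * d').
  move=> /andP[r1 r2]; rewrite beE /ga.
  have near y : a <= y <= c -> `|\int[leb]_x (V x r * mol e y x) - V y r| <= d'.
    move=> yac; have yA' := yA y yac; apply: mol_approx => //; first exact: continuous2_slice1.
    move=> x xy; apply: He1; rewrite /B; [lra|rewrite ger0_norm; lra|lra|by rewrite subrr normr0].
  by apply: T3_dist; rewrite ?(ltW ab) ?(ltW bc)//; apply: near; rewrite ?lexx ?(ltW ab) ?(ltW bc)// ltW// (lt_trans ab bc).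
have cVx x : continuous (V x) := continuous2_slice2 cV.
have cbe : continuous be.
  apply: (@cc_continuous_param _ _ leblf A (fun r x => V x r * p2 x)).
    exact: (continuous2M (continuous2_swap cV) (continuous2_swap (continuous2_fst (proj1 cp2)))).
  by move=> r x Ax; rewrite (proj2 cp2)// mulr0.
have cga : continuous ga.
  move=> r; apply: cvgB; first apply: cvgD.
  - by apply: cvgM; [exact: cvg_cst|exact: cVx].
  - by apply: cvgM; [exact: cvg_cst|exact: cVx].
  - by apply: cvgM; [exact: cvg_cst|exact: cVx].
have n1 : `|prim be t - prim be s - (prim ga t - prim ga s)| <= (t - s) * ((c - a) * (2 * d')).
  have cbg : continuous (fun r => be r - ga r) by move=> r; apply: cvgB; [exact: cbe|exact: cga].
  have := @prim_diff_bound _ _ s t ((c - a) * (2 * d')) cbg ltac:(lra) bega.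
  rewrite (primB t cbe cga) (primB s cbe cga).
  move: (prim be t) (prim be s) (prim ga t) (prim ga s) => u1 u2 u3 u4 h.
  by rewrite (_ : u1 - u2 - (u3 - u4) = u1 - u3 - (u2 - u4)); [exact: h|ring].
have gaE z : prim ga z = T3 a b c (fun x => prim (V x) z).
  have cz k x : continuous (fun r => k * V x r).
    by move=> r; apply: cvgM; [exact: cvg_cst|exact: cVx].
  rewrite /ga /T3 primB//; last by move=> r; apply: cvgD; exact: cz.
  by rewrite primD// !primZ.
have n2 r : 0 < r -> r <= t -> `|\int[m]_x (V x r * smooth_tent e a b c x) - \int[m]_x (tent a b c x * V x r)| <=
    M * ((c - a) * (2 * d')) * mass m A.
  move=> r0 rt; have ct : cc A (tent a b c) by apply: tent_cc => //; rewrite /A; lra.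
  have cVr := continuous2_slice1 (t := r) cV.
  apply: (cc_Rint_dist lf (ccMl cVr cst) (ccMr ct cVr)) => x xA.
  rewrite [X in _ - X]mulrC -mulrBr normrM; apply: ler_pM => //.
    by apply: HM; rewrite /B; [lra|rewrite gtr0_norm; lra].
  apply: le_trans (smooth_tent_dist x e0 ab bc) _.
  by rewrite ler_pM2l; lra.
have n3 := n2 s s0 (ltW st); have n4 := n2 t t0 (lexx _).
rewrite -/be in E; rewrite !gaE in n1.
rewrite T3B; have dK : d = d' * K by rewrite /d' divfK// gt_eqF.
rewrite dK /K.
move: E n1 n3 n4; move: (prim be t) (prim be s) (T3 _ _ _ _) (T3 _ _ _ _) (mass m A).
move: (\int[m]_x _) (\int[m]_x _) (\int[m]_x _) (\int[m]_x _) => I1 I2 I3 I4 b1 b2 q1 q2 mm.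
rewrite !ler_norml => E /andP[n11 n12] /andP[n31 n32] /andP[n41 n42].
have -> : d' * ((t - s) * ((c - a) * 2) + 4 * (M * ((c - a) * 2) * mm) + 1) =
  (t - s) * ((c - a) * (2 * d')) + 4 * (M * ((c - a) * (2 * d')) * mm) + d' by ring.
move: ((t - s) * _) (_ * mm) n11 n12 n31 n32 n41 n42 => z1 z2 n11 n12 n31 n32 n41 n42.
by apply/andP; split; lra.
Qed.

End weak_is_mild.

Section weak_is_mild_relation.
Context {R : realType}.
Variable m : {measure set (measurableTypeR R) -> \bar R}.
Hypothesis lf : locally_finite m.

(** The equation concerns positive times only; continuity lets [s] tend to 0 in
    [space_time_identity]. *)
Lemma heat_Rel (V : R -> R -> R) : continuous2 V -> heat_distributional m V ->
  forall t, 0 <= t -> Rel m (fun x => prim (V x) t) (fun x => V x t - V x 0).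
Proof.
move=> cV hV t; rewrite le_eqVlt => /predU1P[<-|t0] a b c ab bc; rewrite /rel3.
  rewrite (_ : (fun x => prim (V x) 0) = (fun=> 0)); last by apply/funext => x; rewrite prim0.
  rewrite T3_cst; under eq_Rintegral do rewrite subrr mulr0.
  by rewrite Rintegral_cst// mul0r mulr0.
have [rho [H [Th [[C1 C2 h1 h2] [r1 r2 r3 r4] T1 T2 T4]]]] := @mollifier_exists R.
have cr : continuous rho.
  have [df hd cd] := C2 1%N; rewrite -(hd_derive1 h2) (hd_derive1 hd); exact: cd.
pose D s := T3 a b c (fun x => prim (V x) (pos s)) - 2 * \int[m]_x (tent a b c x * V x s).
have ct s := tent_mul_cc ab bc (continuous2_slice1 (t := s) cV).
have cD : continuous D.
  have cW := prim_param_continuous2 cV.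
  have cWx x : continuous (fun s => prim (V x) (pos s)) by exact: continuous2_slice2 cW.
  move=> s; apply: cvgB; last first.
    apply: cvgM; first exact: cvg_cst.
    apply: (@cc_continuous_param _ _ lf (`|a| + `|c|) (fun s x => tent a b c x * V x s)).
      exact: (continuous2M (continuous2_swap (continuous2_fst (tent_continuous (a := a) (b := b) (c := c)))) (continuous2_swap cV)).
    by move=> r x; exact: (proj2 (ct r)).
  by apply: cvgB; [apply: cvgD|]; apply: cvgM; try exact: cvg_cst; exact: cWx.
have Dst s : 0 < s -> s < t -> D s = D t.
  move=> s0 st; have := space_time_identity lf C1 C2 h1 h2 r1 r2 r3 r4 T1 T2 T4 cr cV hV ab bc s0 st.
  rewrite T3B /D !posE ?(ltW s0) ?(ltW t0)//.
  by move: (T3 _ _ _ _) (T3 _ _ _ _) (\int[m]_x _) (\int[m]_x _) => *; lra.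
have D0 : D 0 = D t.
  apply/eqP; rewrite -subr_eq0 -normr_le0; apply/ler_addgt0Pl => e e0; rewrite addr0.
  have /continuous_epsP /(_ 0 e e0) [d d0 Hd] := cD.
  pose s := Num.min (d / 2) (t / 2).
  have s0 : 0 < s by rewrite lt_min !divr_gt0.
  have sd : s <= d / 2 by rewrite ge_min lexx.
  have st : s <= t / 2 by rewrite ge_min lexx orbT.
  rewrite -(Dst s s0 ltac:(lra)) distrC; apply: Hd; rewrite subr0 gtr0_norm//; lra.
move: D0; rewrite /D !posE ?(ltW t0)//.
rewrite (_ : T3 a b c (fun x => prim (V x) 0) = 0); last first.
  by rewrite /T3 !prim0; ring.
have -> : (fun y => tent a b c y * (V y t - V y 0)) = (fun y => tent a b c y * V y t - tent a b c y * V y 0).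
  by apply/funext => y; ring.
rewrite (cc_RintB lf (ct t) (ct 0)).
by move: (T3 _ _ _ _) (\int[m]_x _) (\int[m]_x _) => *; lra.
Qed.

End weak_is_mild_relation.

(** * Uniqueness by a maximum principle for time primitives *)

Section uniqueness.
Context {R : realType}.
Variable m : {measure set (measurableTypeR R) -> \bar R}.
Hypothesis lf : locally_finite m.
Hypothesis m_supp : forall b : R, 0 < b ->
  supp m `&` `]-oo, - b] !=set0 /\ supp m `&` `[b, +oo[ !=set0.
Variable C1 : R.
Hypothesis C1_gt0 : 0 < C1.
Hypothesis abs_le_C1 : forall x, `|x| <= C1 * wgt m x.
Implicit Types (D : R -> R -> R) (x y t s e T A : R).

Lemma prim_cst (k s : R) : 0 <= s -> prim (fun=> k) s = s * k.
Proof.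
move=> s0; have cc0 : continuous (fun _ : R => k) by move=> r; exact: cvg_cst.
have := @prim_incr _ (fun=> k) 0 s k 0 cc0.
rewrite lexx s0 prim0 !subr0 mulr0 => /(_ isT) h; apply/eqP.
by rewrite -subr_eq0 -normr_le0 h// => r _; rewrite subrr normr0.
Qed.

Lemma hd_decreasing_left f df (t : R) : has_derivative f df -> continuous df -> df t < 0 -> 0 < t ->
  exists2 s : R, 0 <= s <= t & f t < f s.
Proof.
move=> H cd dt0 t0.
have /continuous_epsP /(_ t (- df t / 2) ltac:(lra)) [d d0 Hd] := cd.
pose s := t - Num.min (d / 2) t.
have m1 : Num.min (d / 2) t <= d / 2 by rewrite ge_min lexx.
have m2 : Num.min (d / 2) t <= t by rewrite ge_min lexx orbT.
have m3 : 0 < Num.min (d / 2) t by rewrite lt_min t0 divr_gt0.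
have st : s < t by rewrite /s; lra.
exists s; first by rewrite /s; lra.
have [c] := MVT st (fun x _ => H x) (continuous_subspaceT (hd_continuous H)).
rewrite in_itv /= => /andP[c1 c2] E; rewrite -subr_lt0 E pmulr_llt0; last lra.
have : `|df c - df t| <= - df t / 2 by apply: Hd; rewrite ltr_norml; rewrite /s in c1; lra.
by rewrite ler_norml; lra.
Qed.

(** Let F be the time primitive of D minus e w exp(C t), with C = C1 + 1. At a positive maximum at
    time s0, [max_in_supp] in space gives a maximizer [x1] with D <= e exp(C s0) |x1|, and |x1| <=
    C1 w < C w. So the time derivative of F at [x1] is negative, and F was larger slightly
    earlier. *)
Lemma parabolic_maximum D T : continuous2 D ->
  (forall t, 0 <= t -> Rel m (fun x => prim (D x) t) (fun x => D x t)) ->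
  (forall e, 0 < e -> exists2 A, 0 < A & forall x t, A <= `|x| -> 0 <= t <= T -> D x t <= e * wgt m x) ->
  forall x t, 0 <= t <= T -> prim (D x) t <= 0.
Proof.
move=> cD rD sD x t /andP[t0 tT]; apply/ler_addgt0Pl => z z0; rewrite addr0.
have cont x' : continuous (D x') := continuous2_slice2 cD.
have c1 := C1_gt0; have T0 : 0 <= T := le_trans t0 tT.
pose C := C1 + 1; have C0 : 0 < C by rewrite /C; lra.
have wp y : 0 < wgt m y := wgt_gt0 lf y.
pose e := z / (wgt m x * expR (C * T)).
have e0 : 0 < e by rewrite divr_gt0// mulr_gt0// expR_gt0.
have e10 : 0 < e / (T + 1) by rewrite divr_gt0//; lra.
have [A A0 HA] := sD _ e10.
pose B := `|x| + A + 1.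
have nx := normr_ge0 x.
have AB : A <= B by rewrite /B; lra.
have B0 : 0 < B by rewrite /B; lra.
pose F y s := prim (D y) (pos s) - e * (wgt m y * expR (C * s)).
have E1 s : 0 <= s -> 1 <= expR (C * s).
  by move=> s0; rewrite -[leLHS]expR0 ler_expR mulr_ge0// ltW.
have Fout y s : A <= `|y| -> 0 <= s <= T -> F y s < 0.
  move=> Ay /andP[s0 sT]; rewrite /F posE// subr_lt0.
  have bd : prim (D y) s <= s * (e / (T + 1) * wgt m y).
    have cB : continuous (fun r => e / (T + 1) * wgt m y - D y r).
      by move=> r; apply: cvgB; [exact: cvg_cst|exact: cont].
    have h1 : 0 <= prim (fun r => e / (T + 1) * wgt m y - D y r) s.
      rewrite /prim; apply: Rintegral_ge0 => r /=; rewrite in_itv /= => /andP[r0 rs].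
      by rewrite subr_ge0; apply: HA => //; rewrite r0 (le_trans rs).
    have h2 : prim (fun r => e / (T + 1) * wgt m y - D y r) s = s * (e / (T + 1) * wgt m y) - prim (D y) s.
      rewrite (@primB _ (fun=> e / (T + 1) * wgt m y)) ?prim_cst//.
      by move=> r; exact: cvg_cst.
    by rewrite h2 in h1; lra.
  apply: le_lt_trans bd _; apply: (@lt_le_trans _ _ (e * wgt m y)).
    have -> : s * (e / (T + 1) * wgt m y) = (s / (T + 1)) * (e * wgt m y) by ring.
    rewrite gtr_pMl ?(mulr_gt0 e0 (wp y))// ltr_pdivrMr; lra.
  by rewrite ler_pM2l// ler_peMr ?(ltW (wp y)) ?E1.
have cF : continuous2 F.
  apply: continuous2B; first exact: prim_param_continuous2.
  apply: continuous2Z; apply: continuous2M; first exact: (continuous2_fst (wgt_continuous lf)).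
  apply: continuous2_swap; apply: continuous2_fst => s.
  apply: (@continuous_comp _ _ _ (fun s : R => C * s) (@expR R)); last exact: continuous_expR.
  by apply: cvgM; [exact: cvg_cst|exact: cvg_id].
suff Fx : F x t <= 0.
  move: Fx; rewrite /F posE// subr_le0 => h; apply: le_trans h _.
  have -> : z = e * (wgt m x * expR (C * T)) by rewrite /e divfK// gt_eqF// mulr_gt0// expR_gt0.
  by rewrite !ler_pM2l// ler_expR ler_pM2l.
rewrite leNgt; apply/negP => Fx0.
pose K : set (R * R) := `[- B, B]%classic `*` `[0, T]%classic.
have cK : compact K by apply: compact_setX; exact: segment_compact.
have Kx : K (x, t).
  split; rewrite /= in_itv /=; last by rewrite t0.
  by rewrite -ler_norml /B; lra.
have [[x0 s0]] := @compact_EVT_max _ R (fun p => F p.1 p.2) K (ex_intro _ _ Kx) cK (continuous_subspaceT cF).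
rewrite inE => -[/=]; rewrite !in_itv /= => x0B /andP[s00 s0T] Fmax.
have Fm y s : `|y| <= B -> 0 <= s <= T -> F y s <= F x0 s0.
  by move=> yB sT; apply: (Fmax (y, s)); rewrite inE; split; rewrite /= in_itv //= -ler_norml.
have F0 : 0 < F x0 s0 by apply: lt_le_trans Fx0 (Fm _ _ _ _); rewrite ?t0// /B; lra.
have s0pos : 0 < s0.
  rewrite lt_def s00 andbT; apply/eqP => s0E; move: F0.
  rewrite /F s0E pos0// prim0 sub0r oppr_gt0 ltNge => /negP; apply.
  exact: (mulr_ge0 (ltW e0) (mulr_ge0 (ltW (wp x0)) (expR_ge0 _))).
pose q y := D y s0 - e * expR (C * s0) * `|y|.
have cq : continuous q.
  move=> y; apply: cvgB; first exact: continuous2_slice1.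
  by apply: cvgM; [exact: cvg_cst|exact: abs_continuous].
have cab : continuous (fun y : R => `|y|) by exact: abs_continuous.
have rF : Rel m (F^~ s0) q.
  have := RelB lf (continuous2_slice1 (t := s0) cD) _ (rD s0 s00) (RelZ lf (e * expR (C * s0)) cab (Rel_wgt lf)).
  move=> /(_ _) r; apply: (Rel_ext _ _ (r _)) => y //; last first.
    by apply: cvgM; [exact: cvg_cst|exact: cab].
  by rewrite /F posE//; ring.
have sT : 0 <= s0 <= T by rewrite s00.
have nB : `|B| = B by rewrite gtr0_norm.
have [x1 [x1B _ F1 q1]] := @max_in_supp _ m (- B) B (F^~ s0) q x0 (continuous2_slice1 (t := s0) cF) cq
  (Rel_RelI rF) x0B (lt_trans (Fout (- B) s0 ltac:(by rewrite normrN nB) sT) F0)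
  (lt_trans (Fout B s0 ltac:(by rewrite nB) sT) F0)
  (fun y yB => Fm y s0 ltac:(by rewrite ler_norml) sT).
pose f s := antider (D x1) s - e * wgt m x1 * expR (C * s + 0).
have hf : has_derivative f (fun s => D x1 s - e * wgt m x1 * (expR (C * s + 0) * C)).
  apply: hdB; first exact: antider_hd.
  by apply: hdZ; apply: hd_comp (hd_affine C 0) => y; exact: is_derive_expR.
have cdf : continuous (fun s => D x1 s - e * wgt m x1 * (expR (C * s + 0) * C)).
  move=> s; apply: cvgB; first exact: cont.
  apply: cvgM; first exact: cvg_cst; apply: cvgM; last exact: cvg_cst.
  apply: (@continuous_comp _ _ _ (fun s : R => C * s + 0) (@expR R)); last exact: continuous_expR.
  exact: hd_continuous (hd_affine C 0) s.
have df0 : D x1 s0 - e * wgt m x1 * (expR (C * s0 + 0) * C) < 0.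
  rewrite addr0; rewrite /q subr_le0 in q1.
  have k0 : 0 < e * expR (C * s0) by rewrite mulr_gt0// expR_gt0.
  have h1 : e * expR (C * s0) * `|x1| <= e * expR (C * s0) * (C1 * wgt m x1) by rewrite ler_pM2l.
  have h2 : 0 < e * expR (C * s0) * wgt m x1 by rewrite mulr_gt0.
  have -> : e * wgt m x1 * (expR (C * s0) * C) = e * expR (C * s0) * (C1 * wgt m x1) + e * expR (C * s0) * wgt m x1.
    by rewrite /C; ring.
  move: (e * expR _ * _) (e * expR _ * _) (e * expR _ * _) q1 h1 h2 => u1 u2 u3 q1 h1 h2; lra.
have [s1 /andP[s10 s1s]] := hd_decreasing_left hf cdf df0 s0pos.
have fF s : 0 <= s -> f s = F x1 s.
  by move=> h; rewrite /f /F /antider h posE// addr0 mulrA.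
rewrite !fF// ltNge => /negP; apply; rewrite F1; apply: Fm; last by rewrite s10 (le_trans s1s).
by rewrite ler_norml; move: x1B => /andP[/ltW -> /ltW ->].
Qed.

Lemma prim_eq0 D : (forall x, continuous (D x)) -> (forall x t, 0 <= t -> prim (D x) t = 0) ->
  forall x t, 0 <= t -> D x t = 0.
Proof.
move=> cD p0 x t t0; apply/eqP; rewrite -normr_le0; apply/ler_addgt0Pl => e e0; rewrite addr0.
have [d d0 Hd] := prim_deriv_eps (cD x) t0 e0.
have := Hd (t + d / 2) ltac:(lra); rewrite !p0 ?subrr ?sub0r; [|lra..].
have -> : t + d / 2 - t = d / 2 by ring.
have d20 : 0 < d / 2 by lra.
rewrite normrN (gtr0_norm d20) (normrM (d / 2) (D x t)) (gtr0_norm d20) ler_pM2l// => h; apply: h; lra.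
Qed.

(** Freezing the function at negative times makes it continuous on the whole plane; the equation
    sees positive times only. *)
Lemma solution_extension g V : is_solution m g V -> let V' := fun x t => V x (pos t) in
  [/\ continuous2 V', heat_distributional m V', forall x, V' x 0 = gbar m g x &
    forall T e, 0 <= T -> 0 < e -> exists2 A, 0 < A & forall x t, A <= `|x| -> 0 <= t <= T ->
      `|V' x t| <= e * wgt m x].
Proof.
move=> [cV sV hV V0] V'; split.
- apply/continuous2_epsP => x t e e0.
  have := iffLR (subspace_continuousP _ _) cV (x, pos t) (pos_ge0 t).
  move=> /cvgrPdist_le /(_ e e0); rewrite /within /= => /nbhs_ballP [d /= d0 Hd].
  exists d => // x' t' hx ht; rewrite distrC; apply: (Hd (x', pos t')); last exact: pos_ge0.
  split; rewrite /ball /= distrC//; exact: le_lt_trans (pos_lip _ _) ht.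
- move=> phi tp; have := hV phi tp; congr (_ = _).
    congr (_ * _); apply: eq_Rintegral => t; rewrite inE /= in_itv /= andbT => t0.
    by apply: eq_Rintegral => x _; rewrite /V' posE// ltW.
  apply: eq_Rintegral => t; rewrite inE /= in_itv /= andbT => t0.
  by apply: eq_Rintegral => x _; rewrite /V' posE// ltW.
- by move=> x; rewrite /V' pos0.
- move=> T e T0 e0; have [[M1 [_ H1]] [M2 [_ H2]]] := sV T T0 e e0.
  exists (`|M1| + `|M2| + 1) => [|x t]; first by have := normr_ge0 M1; have := normr_ge0 M2; lra.
  have n1 := ler_norm M1; have n2 := ler_norm (- M2); rewrite normrN in n2.
  have n3 := normr_ge0 M1; have n4 := normr_ge0 M2.
  rewrite ler_normr => xA tT; have P0 := Psi_ge0 lf x.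
  apply: (@le_trans _ _ (e * `|Psi m x|)); last first.
    by rewrite ler_pM2l// ger0_norm// /wgt lerDr.
  rewrite /V' posE; last by case/andP: tT.
  by case/orP: xA => xA; [apply: H1 => //; lra|apply: H2 => //; lra].
Qed.

(** The maximum principle applies to both differences, which start from 0, so the time primitive of
    the difference vanishes and with it the difference. *)
Lemma solution_unique g U V : is_solution m g U -> is_solution m g V ->
  forall x t, 0 <= t -> V x t = U x t.
Proof.
move=> /solution_extension [cU hU U0 sU] /solution_extension [cV hV V0 sV] x t t0.
have key (V1 V2 : R -> R -> R) : continuous2 V1 -> continuous2 V2 ->
    heat_distributional m V1 -> heat_distributional m V2 -> (forall y, V1 y 0 = V2 y 0) ->
    (forall T e, 0 <= T -> 0 < e -> exists2 A, 0 < A & forall y s, A <= `|y| -> 0 <= s <= T -> `|V1 y s| <= e * wgt m y) ->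
    (forall T e, 0 <= T -> 0 < e -> exists2 A, 0 < A & forall y s, A <= `|y| -> 0 <= s <= T -> `|V2 y s| <= e * wgt m y) ->
    forall y s, 0 <= s -> prim (V1 y) s - prim (V2 y) s <= 0.
  move=> c1 c2 h1 h2 E0 s1 s2 y s s0.
  rewrite -primB; [|exact: continuous2_slice2..].
  apply: (@parabolic_maximum (fun y s => V1 y s - V2 y s) s (continuous2B c1 c2)); last by rewrite s0 lexx.
    move=> r r0.
    have cc (V3 : R -> R -> R) : continuous2 V3 -> continuous (fun x => V3 x r - V3 x 0).
      by move=> c3 z; apply: cvgB; exact: continuous2_slice1.
    apply: Rel_ext (RelB lf (cc _ c1) (cc _ c2) (heat_Rel lf c1 h1 r0) (heat_Rel lf c2 h2 r0)) => z /=.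
      by rewrite primB//; exact: continuous2_slice2.
    by rewrite E0; ring.
  move=> e e0; have e20 : 0 < e / 2 by lra.
  have [A1 A10 H1] := s1 s _ s0 e20; have [A2 A20 H2] := s2 s _ s0 e20.
  exists (A1 + A2) => [|z r zA rs]; first by rewrite addr_gt0.
  have := H1 z r ltac:(lra) rs; have := H2 z r ltac:(lra) rs.
  by rewrite !ler_norml => /andP[? ?] /andP[? ?]; lra.
have E0 y : (fun x t => U x (pos t)) y 0 = (fun x t => V x (pos t)) y 0 by rewrite U0 V0.
have pz y s : 0 <= s -> prim (fun r => U y (pos r) - V y (pos r)) s = 0.
  move=> s0; apply/eqP; rewrite eq_le.
  have cu : continuous (fun r => U y (pos r)) := continuous2_slice2 cU.
  have cv : continuous (fun r => V y (pos r)) := continuous2_slice2 cV.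
  rewrite primB// (key _ _ cU cV hU hV E0 sU sV y s s0) /=.
  by have := key _ _ cV cU hV hU (fun y => esym (E0 y)) sV sU y s s0; rewrite subr_le0 subr_ge0.
have cUV y : continuous (fun r => U y (pos r) - V y (pos r)).
  by move=> r; apply: cvgB; [exact: (continuous2_slice2 cU)|exact: (continuous2_slice2 cV)].
by have := prim_eq0 cUV pz x t0; rewrite posE// => /eqP; rewrite subr_eq0 => /eqP.
Qed.

End uniqueness.

(** * Measures with a density and Gaussian expectations *)

Section densities.
Local Open Scope ereal_scope.
Context d (T : measurableType d) (R : realType).
Variables (mu nu : {measure set T -> \bar R}) (rho : T -> R).
Hypothesis rho_meas : measurable_fun setT rho.
Hypothesis rho_ge0 : forall x, (0 <= rho x)%R.
Hypothesis nuE : forall E, measurable E -> nu E = \int[mu]_(x in E) (rho x)%:E.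

Import HBNNSimple.

Let density_indic E : measurable E ->
  \int[nu]_x (\1_E x)%:E = \int[mu]_x ((\1_E x)%:E * (rho x)%:E).
Proof.
move=> mE; rewrite integral_indic// setIT nuE// integral_mkcond; apply: eq_integral => x _.
by rewrite patchE indicE; case: ifPn => _; rewrite ?mul1e ?mul0e.
Qed.

Let density_nnsfun (f : {nnsfun T >-> R}) :
  \int[nu]_x (f x)%:E = \int[mu]_x ((f x)%:E * (rho x)%:E).
Proof.
have mr : measurable_fun setT (fun x => (rho x)%:E) by exact/measurable_EFinP.
under [LHS]eq_integral do rewrite fimfunE -fsumEFin//.
rewrite [LHS]ge0_integral_fsum//; last 2 first.
  - by move=> r; exact/measurable_EFinP/measurableT_comp.
  - by move=> n x _; rewrite EFinM nnfun_muleindic_ge0.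
under [RHS]eq_integral.
  move=> x xD; rewrite fimfunE -fsumEFin// muleC ge0_mule_fsumr; last first.
    by move=> r; rewrite EFinM nnfun_muleindic_ge0.
  over.
rewrite [RHS]ge0_integral_fsum//; last 2 first.
  - move=> r; apply: emeasurable_funM => //.
    by apply/measurable_EFinP; exact: measurableT_comp.
  - move=> n x _; apply: mule_ge0; first by rewrite lee_fin.
    by rewrite EFinM nnfun_muleindic_ge0.
apply: eq_fsbigr => r _.
rewrite integralZl_indic_nnsfun//= density_indic//.
have [r0|r0] := ltP r 0%R.
  rewrite preimage_nnfun0//; under [in LHS]eq_integral do rewrite indic0 mul0e.
  under [in RHS]eq_integral do rewrite indic0 mulr0 mule0.
  by rewrite !integral0 mule0.
rewrite -ge0_integralZl//.
- by apply: eq_integral => x _; rewrite [in RHS]EFinM [RHS]muleCA [in RHS](muleC (rho x)%:E).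
- by apply: emeasurable_funM => //; exact/measurable_EFinP/measurable_indic.
- by move=> x _; rewrite mule_ge0 ?lee_fin.
Qed.

Lemma density_integral (f : T -> \bar R) : measurable_fun setT f -> (forall x, 0 <= f x) ->
  \int[nu]_x f x = \int[mu]_x (f x * (rho x)%:E).
Proof.
move=> mf f0; pose f_ := nnsfun_approx measurableT mf.
have mr : measurable_fun setT (fun x => (rho x)%:E) by exact/measurable_EFinP.
transitivity (lim (\int[nu]_x (f_ n x)%:E @[n --> \oo])).
  rewrite -monotone_convergence//=.
  - apply: eq_integral => ? /[!inE] xD; apply/esym/cvg_lim => //=.
    exact: cvg_nnsfun_approx.
  - by move=> n; exact/measurable_EFinP/measurable_funTS.
  - by move=> n ? _; rewrite lee_fin.
  - by move=> ? _ ? ? mn; rewrite lee_fin; exact/lefP/nd_nnsfun_approx.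
transitivity (lim (\int[mu]_x ((f_ n x)%:E * (rho x)%:E) @[n --> \oo])).
  by apply: congr_lim; apply/funext => n; exact: density_nnsfun.
rewrite -monotone_convergence//=.
- apply: eq_integral => x /[!inE] xD; apply/cvg_lim => //=.
  by apply: cvgeZr => //; exact: cvg_nnsfun_approx.
- by move=> n; apply: emeasurable_funM => //; exact/measurable_EFinP/measurable_funTS.
- by move=> n ? _; rewrite mule_ge0 ?lee_fin.
- by move=> x _ ? ? mn; rewrite lee_wpmul2r ?lee_fin//; exact/lefP/nd_nnsfun_approx.
Qed.

End densities.

Section gaussian.
Context {R : realType}.
Local Notation leb := (@lebesgue_measure R).
Implicit Types (f : R -> R) (x z c e M : R).
Variable dt : R.
Hypothesis dt_gt0 : 0 < dt.

Let s := Num.sqrt dt.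
Let s_neq0 : s != 0. Proof. by rewrite gt_eqF// sqrtr_gt0. Qed.
Let ss : s ^+ 2 = dt. Proof. by rewrite sqr_sqrtr// ltW. Qed.

Definition gauss_pdf x : R := normal_peak s * expR (- x ^+ 2 / (dt *+ 2)).
Local Notation p := gauss_pdf.

Lemma gauss_pdfE : normal_pdf 0 s = p.
Proof. by rewrite normal_pdfE//; apply/funext => x; rewrite /normal_fun subr0 ss. Qed.

Lemma gauss_pdf_ge0 x : 0 <= p x.
Proof. by rewrite -gauss_pdfE normal_pdf_ge0. Qed.

Lemma gauss_hd : has_derivative p (fun x => - (x / dt) * p x).
Proof.
have h1 : has_derivative (fun x : R => (- (dt *+ 2)^-1) * (x * x)) (fun x => (- (dt *+ 2)^-1) * (x * 1 + x * 1)).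
  exact: hdZ (hdM hd_id hd_id).
have h2 : has_derivative (@expR R) (@expR R) by move=> x; exact: is_derive_expR.
have -> : p = fun x => normal_peak s * expR ((- (dt *+ 2)^-1) * (x * x)).
  by apply/funext => x; congr (_ * expR _); rewrite !mulNr expr2 mulrC.
apply: hd_eq (hdZ _ (hd_comp h2 h1)) _ => x /=.
move: (expR _) => E; rewrite mulr2n; field.
by rewrite gt_eqF// gt_eqF//; have := dt_gt0; lra.
Qed.

Lemma gauss_pdfN x : p (- x) = p x.
Proof. by rewrite /p sqrrN. Qed.

Definition box (n : nat) : set R := `[- n%:R, n%:R]%classic.

Lemma measurable_box n : measurable (box n).
Proof. exact: measurable_itv. Qed.
Hint Resolve measurable_box : core.

Lemma gauss_int_le1 n : 0 <= \int[leb]_(x in box n) p x <= 1.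
Proof.
apply/andP; split; first by apply: Rintegral_ge0 => x _; exact: gauss_pdf_ge0.
have mp : measurable_fun setT (fun x => (p x)%:E).
  by apply/measurable_EFinP; apply: continuous_measurable_fun; exact: hd_continuous gauss_hd.
have h : (\int[leb]_(x in box n) (p x)%:E <= 1)%E.
  rewrite -(integral_normal_pdf 0 s) gauss_pdfE.
  apply: ge0_subset_integral; [exact: measurable_box|exact: measurableT|exact: mp| |by []].
  by move=> x _; rewrite lee_fin gauss_pdf_ge0.
rewrite -lee_fin /Rintegral fineK//.
rewrite ge0_fin_numE; first exact: le_lt_trans h (ltry _).
by apply: integral_ge0 => x _; rewrite lee_fin gauss_pdf_ge0.
Qed.

(** The bound [k] is the value given by the moments 0, dt, 0, 3 dt^2. An inequality suffices, so it
    is enough to bound the integrals over large boxes and to use monotone convergence. *)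
Lemma gauss_poly c0 c1 c2 c4 : let Q x := c0 + c1 * x + c2 * x ^+ 2 + c4 * x ^+ 4 in
  0 < c4 -> (forall x, 0 <= Q x) ->
  (\int[normal_prob 0%R s]_x (Q x)%:E <= (c0 + c2 * dt + 3 * c4 * dt ^+ 2)%:E)%E.
Proof.
move=> Q c40 Q0; set k := c0 + _ + _.
have mp : measurable_fun setT p by apply: continuous_measurable_fun; exact: hd_continuous gauss_hd.
have cQ : continuous Q.
  have H : has_derivative (fun x : R => x) (fun=> 1) := hd_id.
  have E : Q = fun x => c0 + c1 * x + c2 * (x * x) + c4 * ((x * x) * (x * x)).
    by apply/funext => x; rewrite /Q; ring.
  rewrite E; apply: (hd_continuous (hdD (hdD (hdD (hd_cst c0) (hdZ c1 H)) (hdZ c2 (hdM H H))) (hdZ c4 (hdM (hdM H H) (hdM H H))))).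
have mQ : measurable_fun setT Q by exact: continuous_measurable_fun.
have nuE E : measurable E -> normal_prob 0 s E = (\int[leb]_(x in E) (p x)%:E)%E.
  by move=> mE; transitivity (\int[leb]_(x in E) (normal_pdf 0 s x)%:E)%E => //; rewrite gauss_pdfE.
have mQE : measurable_fun setT (EFin \o Q) by exact/measurable_EFinP.
rewrite (@density_integral _ (measurableTypeR R) R leb _ p mp gauss_pdf_ge0 nuE _ mQE); last first.
  by move=> x; rewrite lee_fin.
have d0 := dt_gt0.
(* [k] is the three-node Gauss-Hermite quadrature of [Q], with nodes 0 and plus or minus the root of
   3 dt, hence a positive combination of values of [Q]. *)
have k0 : 0 <= k.
  pose y := Num.sqrt (3 * dt); have yy : y ^+ 2 = 3 * dt by rewrite sqr_sqrtr//; lra.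
  have -> : k = (Q y + Q (- y)) / 6 + 2 / 3 * Q 0.
    have e4 : y ^+ 4 = (y ^+ 2) ^+ 2 by ring.
    have e5 : (- y) ^+ 4 = (y ^+ 2) ^+ 2 by ring.
    by rewrite /Q /k e5 sqrrN e4 yy; field.
  by rewrite addr_ge0// ?mulr_ge0// addr_ge0.
pose I (n : nat) := \int[leb]_(x in box n) p x.
pose N := Num.truncn (`|c2| / c4 + 1).
have mQp : measurable_fun setT (fun x => (Q x)%:E * (p x)%:E)%E.
  by apply/measurable_EFinP; exact: measurable_funM.
have Qp0 x : (0 <= (Q x)%:E * (p x)%:E)%E by rewrite mule_ge0// lee_fin// gauss_pdf_ge0.
have step n : (N < n)%N -> (\int[leb]_(x in box n) ((Q x)%:E * (p x)%:E) <= k%:E)%E.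
  move=> Nn; have n0 : 0 <= n%:R :> R by [].
  have nn : - n%:R <= n%:R :> R by lra.
  (* An explicit antiderivative of (Q - k) p. Beyond [N] the term [c4 * n ^+ 2] dominates [|c2|],
     which gives its boundary values the favourable sign. *)
  have hF : has_derivative
      (fun x => -dt * (p x * (c1 + (c2 + 3 * dt * c4) * x + c4 * (x * (x * x)))))
      (fun x => Q x * p x - k * p x).
    have H : has_derivative (fun x : R => x) (fun=> 1) := hd_id.
    apply: hd_eq (hdZ (- dt) (hdM gauss_hd (hdD (hdD (hd_cst c1) (hdZ (c2 + 3 * dt * c4) H))
      (hdZ c4 (hdM H (hdM H H)))))) _ => x /=.
    by rewrite /Q /k; field; rewrite gt_eqF.
  have cp : continuous p := hd_continuous gauss_hd.
  have cQp : continuous (fun x => Q x * p x) by move=> x; apply: cvgM; [exact: cQ|exact: cp].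
  have ckp : continuous (fun x => k * p x) by move=> x; apply: cvgM; [exact: cvg_cst|exact: cp].
  have cB : continuous (fun x => Q x * p x - k * p x) by move=> x; apply: cvgB; [exact: cQp|exact: ckp].
  have ii u : continuous u -> leb.-integrable (box n) (EFin \o u).
    by move=> cu; apply: (continuous_integrable_itv (@leb_locally_finite R) cu (a := - n%:R) (b := n%:R)).
  have := FTC hF cB nn; rewrite RintegralB ?ii// RintegralZl ?ii// -/(I n).
  rewrite gauss_pdfN => E.
  have fin : (\int[leb]_(x in box n) ((Q x)%:E * (p x)%:E) = (\int[leb]_(x in box n) (Q x * p x))%:E)%E.
    rewrite /Rintegral; apply/esym/fineK.
    by apply: integrable_fin_num; [exact: measurable_box|exact: (ii _ cQp)].
  rewrite fin lee_fin.
  have pn := gauss_pdf_ge0 n%:R; have /andP[I0 I1] := gauss_int_le1 n.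
  have kI : k * I n <= k by rewrite ler_piMr.
  have tail : 0 <= c2 + 3 * dt * c4 + c4 * n%:R ^+ 2.
    have h1 : `|c2| / c4 + 1 < n%:R.
      by apply: lt_le_trans (truncnS_gt _) _; rewrite ler_nat.
    have h2 : 0 <= `|c2| / c4 by rewrite divr_ge0// ltW.
    have h3 : n%:R <= n%:R ^+ 2 :> R by rewrite expr2 ler_peMr//; lra.
    have h4 : `|c2| <= c4 * n%:R ^+ 2.
      by rewrite mulrC -ler_pdivrMr//; lra.
    have h5 := ler_norm (- c2); rewrite normrN in h5.
    have h6 : 0 <= 3 * dt * c4 := mulr_ge0 (mulr_ge0 (ler0n _ 3) (ltW d0)) (ltW c40).
    by lra.
  have t2 : 0 <= 2 * dt * p n%:R * n%:R * (c2 + 3 * dt * c4 + c4 * n%:R ^+ 2).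
    exact: (mulr_ge0 (mulr_ge0 (mulr_ge0 (mulr_ge0 (ler0n _ 2) (ltW d0)) pn) n0) tail).
  have -> : \int[leb]_(x in box n) (Q x * p x) =
     k * I n - 2 * dt * p n%:R * n%:R * (c2 + 3 * dt * c4 + c4 * n%:R ^+ 2).
    by rewrite -[LHS](subrK (k * I n)) E; ring.
  by lra.
have := @ge0_nondecreasing_set_cvg_integral _ (measurableTypeR R) R box
  (fun x => (Q x)%:E * (p x)%:E)%E leb.
have cov : \bigcup_n box n = [set: R].
  apply/seteqP; split => // x _; exists (Num.truncn `|x|).+1 => //=.
  by rewrite /box /= in_itv /= -ler_norml ltW// truncnS_gt.
rewrite cov => H.
have nd : nondecreasing_seq box.
  move=> a b ab; apply/subsetPset => x; rewrite /box /= !in_itv /= -!ler_norml => h.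
  by apply: le_trans h _; rewrite ler_nat.
have {}H := H nd measurable_box (fun n => measurable_funTS mQp) (fun n x _ => Qp0 x).
apply: cvge_le H; exists N.+1 => // n /= Nn; exact: step.
Qed.
Lemma taylor2_right (f f1 f2 : R -> R) x z c : has_derivative f f1 -> has_derivative f1 f2 ->
  0 <= z -> (forall y, x <= y <= x + z -> f2 y <= c) ->
  f (x + z) <= f x + f1 x * z + c * z ^+ 2 / 2.
Proof.
move=> hf hf1 z0 fc; have xz : x <= x + z by rewrite lerDl.
pose h y := f y - (f1 x * (1 * y + - x) + c / 2 * ((1 * y + - x) * (1 * y + - x))).
have H := hd_affine 1 (- x).
have hh := hdB hf (hdD (hdZ (f1 x) H) (hdZ (c / 2) (hdM H H))).
have [y] := MVT_segment xz (fun y _ => hh y) (continuous_subspaceT (hd_continuous hh)).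
rewrite in_itv /= => /andP[xy yz] E.
have [w] := MVT_segment xy (fun y _ => hf1 y) (continuous_subspaceT (hd_continuous hf1)).
rewrite in_itv /= => /andP[xw wy] E1.
have wc := fc w ltac:(by rewrite xw (le_trans wy)).
have h1 : f2 w * (y - x) <= c * (y - x) by rewrite ler_wpM2r// subr_ge0.
have h2 : (c * (y - x) - f2 w * (y - x)) * z >= 0 by rewrite mulr_ge0// subr_ge0.
rewrite -E1 in h2.
have := E; have -> : x + z - x = z by ring.
by lra.
Qed.

Lemma taylor2 (f f1 f2 : R -> R) x z c : has_derivative f f1 -> has_derivative f1 f2 ->
  (forall y, `|y - x| <= `|z| -> f2 y <= c) -> f (x + z) <= f x + f1 x * z + c * z ^+ 2 / 2.
Proof.
move=> hf hf1 fc; have [z0|z0] := leP 0 z.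
  apply: (taylor2_right hf hf1 z0) => y /andP[h1 h2]; apply: fc.
  by rewrite (ger0_norm z0) ger0_norm; lra.
have h1 : has_derivative (fun y => f (-1 * y + 0)) (fun y => -1 * f1 (-1 * y + 0)).
  by apply: hd_eq (hd_comp hf (hd_affine (-1) 0)) _ => y; ring.
have h2 : has_derivative (fun y => -1 * f1 (-1 * y + 0)) (fun y => f2 (-1 * y + 0)).
  by apply: hd_eq (hdZ (-1) (hd_comp hf1 (hd_affine (-1) 0))) _ => y; ring.
have := @taylor2_right _ _ _ (- x) (- z) c h1 h2 ltac:(lra).
have -> : -1 * (- x - z) + 0 = x + z by ring.
have -> : -1 * - x + 0 = x by ring.
have -> : f x + -1 * f1 x * - z + c * (- z) ^+ 2 / 2 = f x + f1 x * z + c * z ^+ 2 / 2 by ring.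
apply=> y /andP[y1 y2]; apply: fc; rewrite (ltr0_norm z0).
by rewrite ler_norml; lra.
Qed.

(** Near [x] the second derivative varies by at most [e]; farther than [d] the oscillation 2 M is
    absorbed by the quadratic 2 M (y - x)^2 / d^2. Taylor's formula then bounds [f (x + z)] by a
    quartic in [z], to which [gauss_poly] applies. *)
Lemma gauss_taylor (f f1 f2 : R -> R) x e d M :
  has_derivative f f1 -> has_derivative f1 f2 -> (forall y, 0 <= f y) ->
  0 < e -> 0 < d -> 0 < M -> (forall y, `|f2 y| <= M) ->
  (forall y, `|y - x| <= d -> `|f2 y - f2 x| <= e) ->
  (\int[normal_prob 0%R s]_z (f (x + z))%:E <=
    (f x + dt * (f2 x / 2) + dt * (e + 6 * M * dt / d ^+ 2))%:E)%E.
Proof.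
move=> hf hf1 f0 e0 d0 M0 fM fe.
pose c4 := 2 * M / d ^+ 2.
have c40 : 0 < c4 by rewrite divr_gt0 ?exprn_gt0// mulr_gt0.
pose Q z := f x + f1 x * z + (f2 x / 2 + e) * z ^+ 2 + c4 * z ^+ 4.
have bd y : `|f2 y - f2 x| <= e + c4 * (y - x) ^+ 2.
  have [h|h] := leP `|y - x| d.
    by apply: le_trans (fe y h) _; rewrite lerDl mulr_ge0 ?sqr_ge0 ?(ltW c40).
  have n1 := fM y; have n2 := fM x.
  have : 2 * M <= c4 * (y - x) ^+ 2.
    rewrite /c4 -mulrA ler_pMr ?mulr_gt0// mulrC -real_normK ?num_real//.
    by rewrite -exprVn -exprMn exprn_ege1// ler_pdivlMr// mul1r ltW.
  move: n1 n2; rewrite !ler_norml; move: (c4 * _) => u /andP[? ?] /andP[? ?] ?; apply/andP; split; lra.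
have fQ z : f (x + z) <= Q z.
  have near y : `|y - x| <= `|z| -> f2 y <= f2 x + e + c4 * z ^+ 2.
    move=> yz; have := le_trans (ler_norm _) (bd y).
    have : c4 * (y - x) ^+ 2 <= c4 * z ^+ 2.
      by rewrite ler_pM2l// -[leLHS]real_normK ?num_real// -[leRHS]real_normK ?num_real// lerXn2r// nnegrE.
    by lra.
  have := taylor2 hf hf1 near; rewrite /Q => h; apply: le_trans h _.
  have h1 : 0 <= e * z ^+ 2 by rewrite mulr_ge0 ?sqr_ge0// ltW.
  have h2 : 0 <= c4 * z ^+ 4 by rewrite mulr_ge0 ?(ltW c40)// (exprM z 2 2) sqr_ge0.
  have -> : (f2 x + e + c4 * z ^+ 2) * z ^+ 2 / 2 = f2 x / 2 * z ^+ 2 + e * z ^+ 2 / 2 + c4 * z ^+ 4 / 2 by field.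
  by rewrite mulrDl; lra.
have Q0 z : 0 <= Q z := le_trans (f0 _) (fQ z).
have mf : measurable_fun setT (fun z => (f (x + z))%:E).
  apply/measurable_EFinP; apply: continuous_measurable_fun => z.
  apply: (@continuous_comp _ _ _ (fun z : R => x + z) f); last exact: hd_continuous hf _.
  by apply: cvgD; [exact: cvg_cst|exact: cvg_id].
have mQ : measurable_fun setT (fun z => (Q z)%:E).
  apply/measurable_EFinP; apply: continuous_measurable_fun.
  apply: (@hd_continuous _ _ (fun z => f1 x + (f2 x / 2 + e) * (z * 1 + z * 1) + c4 * ((z * z) * (z * 1 + z * 1) + (z * z) * (z * 1 + z * 1)))).
  have H : has_derivative (fun x : R => x) (fun=> 1) := hd_id.
  have -> : Q = fun z => (f x + f1 x * z) + (f2 x / 2 + e) * (z * z) + c4 * ((z * z) * (z * z)).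
    by apply/funext => z; rewrite /Q; ring.
  apply: hd_eq (hdD (hdD (hdD (hd_cst (f x)) (hdZ (f1 x) H)) (hdZ (f2 x / 2 + e) (hdM H H)))
     (hdZ c4 (hdM (hdM H H) (hdM H H)))) _ => z; ring.
apply: (@le_trans _ _ (\int[normal_prob 0%R s]_z (Q z)%:E)%E).
  apply: ge0_le_integral => //; first by move=> z _; rewrite lee_fin.
  by move=> z _; rewrite lee_fin.
apply: le_trans (gauss_poly c40 Q0) _; rewrite lee_fin le_eqVlt; apply/orP; left; apply/eqP.
by rewrite /c4; field; rewrite gt_eqF.
Qed.

End gaussian.

(** * Image measures and Markov chains driven by independent increments *)

Section pushforward_by_measurable.
Context {R : realType} {d d' : measure_display} {T : measurableType d} {T' : measurableType d'}.
Variables (mu : {measure set T -> \bar R}) (f : T -> T').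

(** The image measure with the measurability proof as an explicit argument, so that [f] need not be
    packed into a structure. *)
Definition pushm (mf : measurable_fun setT f) : {measure set T' -> \bar R} :=
  measure_function_pushforward__canonical__measure_function_Measure mu mf.

Lemma pushmE mf A : pushm mf A = mu (f @^-1` A).
Proof. by []. Qed.

Lemma ge0_integral_pushm mf h : measurable_fun setT h -> (forall y, 0 <= h y)%E ->
  (\int[pushm mf]_y h y = \int[mu]_x h (f x))%E.
Proof.
move=> mh h0; have := @ge0_integral_pushforward _ _ _ _ R f mf mu setT h measurableT mh (fun y _ => h0 y).
by rewrite preimage_setT.
Qed.

End pushforward_by_measurable.

Section law.
Context {R : realType} {d d' : measure_display} {T : measurableType d} {T' : measurableType d'}.
Variables (P : probability T R) (f : T -> T') (mf : measurable_fun setT f).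
Let fm : {mfun T >-> T'} := HB.pack f (isMeasurableFun.Build _ _ _ _ f mf).

Definition law : probability T' R := distribution P fm.

Lemma lawE A : law A = P (f @^-1` A).
Proof. by []. Qed.

Lemma ge0_integral_law h : measurable_fun setT h -> (forall y, 0 <= h y)%E ->
  (\int[law]_y h y = \int[P]_x h (f x))%E.
Proof. by move=> mh h0; exact: ge0_integral_distribution. Qed.

End law.

Section random_chain.
Local Open Scope ereal_scope.
Context {R : realType} {d : measure_display} {Omega : measurableType d}.
Context {d' : measure_display} {T : measurableType d'}.
Variable P : probability Omega R.
Variable gam : probability (measurableTypeR R) R.
Variables (n : nat) (Z : nat -> Omega -> measurableTypeR R).
Hypothesis Z_meas : forall i, measurable_fun setT (Z i).
Hypothesis Z_law : forall i E, (i < n)%N -> measurable E -> P (Z i @^-1` E) = gam E.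
Hypothesis Z_indep : mutually_independent P (fun i : 'I_n => (Z i : Omega -> R)).
Variables (f : T * measurableTypeR R -> T) (s0 : T).
Hypothesis f_meas : measurable_fun setT f.

Fixpoint chain k (w : Omega) : T := if k is k'.+1 then f (chain k' w, Z k' w) else s0.

Lemma chain_meas k : measurable_fun setT (chain k).
Proof.
elim: k => [|k IH]; first exact: measurable_cst.
exact: (measurableT_comp f_meas (measurable_fun_pair IH (Z_meas k))).
Qed.

Definition cyl (E : nat -> set R) : set Omega := \bigcap_(i in [set: 'I_n]) (Z i @^-1` E i).

Lemma cyl_meas E : (forall i, measurable (E i)) -> measurable (cyl E).
Proof.
move=> mE; apply: fin_bigcap_measurable; first exact: finite_finset.
by move=> i _; rewrite -[X in measurable X]setTI; apply: (Z_meas i); [exact: measurableT|exact: mE].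
Qed.

Lemma cylE E : (forall i, measurable (E i)) -> P (cyl E) = \prod_(i < n) P (Z i @^-1` E i).
Proof. by move=> mE; rewrite /cyl (Z_indep (E := fun i : 'I_n => E i)). Qed.

Lemma cyl_upd E k B : (k < n)%N -> (forall i, measurable (E i)) -> measurable B -> E k = setT ->
  let E' i := if i == k then B else E i in
  cyl E' = (Z k @^-1` B) `&` cyl E /\ P (cyl E') = gam B * P (cyl E).
Proof.
move=> kn mE mB Ek E'.
have mE' i : measurable (E' i) by rewrite /E'; case: ifP.
split.
  apply/seteqP; split => w.
    move=> h; split; first by have := h (Ordinal kn) I; rewrite /= /E' eqxx.
    move=> i _; have := h i I; rewrite /= /E'; case: eqP => // ->.
    by rewrite Ek.
  by move=> [h1 h2] i _; rewrite /= /E'; case: eqP => [->|_]; [exact: h1|exact: h2].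
rewrite !cylE// (bigD1 (Ordinal kn))//= [in RHS](bigD1 (Ordinal kn))//= /E' eqxx Ek.
rewrite preimage_setT probability_setT mul1e Z_law//; congr (_ * _).
apply: eq_bigr => i ik; rewrite ifN//.
Qed.

(** The state at time [k] is independent of the increments of index at least [k]. In the induction,
    the law of (state, next increment) restricted to a cylinder is a multiple of a product measure,
    since it is one on rectangles. *)
Lemma chain_indep k E A : (k <= n)%N -> (forall i, measurable (E i)) ->
  (forall i, (i < k)%N -> E i = setT) -> measurable A ->
  P (chain k @^-1` A `&` cyl E) = P (chain k @^-1` A) * P (cyl E).
Proof.
elim: k E A => [|k IH] E A kn mE ET mA.
  rewrite /=; have [sA|sA] := pselect (A s0).
    rewrite (_ : _ @^-1` A = setT) ?setTI ?probability_setT ?mul1e//.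
    by apply/seteqP; split.
  rewrite (_ : _ @^-1` A = set0) ?set0I ?measure0 ?mul0e//.
  by apply/seteqP; split.
have mc := chain_meas k.
pose pr w := (chain k w, Z k w).
have mpr : measurable_fun setT pr by exact: measurable_fun_pair.
have mcyl := cyl_meas mE.
pose c : {nonneg R} := NngNum (fine_ge0 (measure_ge0 P (cyl E))).
have cE : c%:num%:E = P (cyl E) by rewrite /= fineK// fin_num_measure.
have ETk : E k = setT by exact: ET.
have rect F : (forall i, measurable (F i)) -> (forall i, (i <= k)%N -> F i = setT) ->
    forall A' B', measurable A' -> measurable B' ->
    P (pr @^-1` (A' `*` B') `&` cyl F) = P (cyl F) * P (chain k @^-1` A') * gam B'.
  move=> mF FT A' B' mA' mB'; have [c1 c2] := cyl_upd kn mF mB' (FT k (leqnn k)).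
  have -> : pr @^-1` (A' `*` B') `&` cyl F = chain k @^-1` A' `&` cyl (fun i => if i == k then B' else F i).
    by rewrite c1 setIA; congr (_ `&` _); apply/seteqP; split.
  rewrite IH ?(ltnW kn)//; last 2 first.
  - by move=> i; case: ifP.
  - by move=> i ik; rewrite ifN ?ltn_eqF// FT// ltnW.
  by rewrite c2 muleA [LHS]muleC muleA.
pose X := f @^-1` A.
have mX : measurable X by rewrite -[X in measurable X]setTI; apply: f_meas.
have cylT : cyl (fun=> setT) = setT by apply/seteqP; split.
have e1 := @product_measure_unique _ _ _ _ R (mscale c (law P mc)) gam (pushm (mrestr P mcyl) mpr).
have {}e1 : (mscale c (law P mc) \x gam) X = P (pr @^-1` X `&` cyl E).
  rewrite e1// => A' B' mA' mB'; transitivity (P (pr @^-1` (A' `*` B') `&` cyl E)) => //.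
  by rewrite rect// -cE.
have e2 := @product_measure_unique _ _ _ _ R (law P mc) gam (pushm P mpr).
have {}e2 : (law P mc \x gam) X = P (pr @^-1` X).
  rewrite e2// => A' B' mA' mB'; transitivity (P (pr @^-1` (A' `*` B') `&` cyl (fun=> setT))).
    by rewrite cylT setIT.
  by rewrite rect// cylT probability_setT mul1e.
transitivity (P (pr @^-1` X `&` cyl E)) => //.
transitivity (P (pr @^-1` X) * P (cyl E)) => //.
rewrite -e1 -e2 -cE muleC /product_measure1 ge0_integral_mscale//.
exact: measurable_fun_xsection.
Qed.

(** Conditioning on the past in the form of Tonelli's theorem: the joint law of state and next
    increment is a product. *)
Lemma chain_step k H : (k < n)%N -> measurable_fun setT H -> (forall p, 0 <= H p) ->
  \int[P]_w H (chain k w, Z k w) = \int[P]_w \int[gam]_z H (chain k w, z).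
Proof.
move=> kn mH H0; have mc := chain_meas k.
pose pr w := (chain k w, Z k w).
have mpr : measurable_fun setT pr by exact: measurable_fun_pair.
have mT i : measurable ((fun _ : nat => [set: R]) i) by exact: measurableT.
have cylT : cyl (fun=> setT) = setT by apply/seteqP; split.
have e2 X : measurable X -> (law P mc \x gam) X = pushm P mpr X.
  move=> mX; apply: product_measure_unique mX => A' B' mA' mB'.
  have [c1 c2] := cyl_upd kn mT mB' erefl.
  transitivity (P (chain k @^-1` A' `&` cyl (fun i => if i == k then B' else setT))).
    by rewrite c1 cylT setIT.
  rewrite chain_indep ?(ltnW kn)//; last 2 first.
  - by move=> i; case: ifP.
  - by move=> i ik; rewrite ifN// ltn_eqF.
  by rewrite c2 cylT probability_setT mule1.
transitivity (\int[pushm P mpr]_p H p); first by rewrite ge0_integral_pushm.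
transitivity (\int[law P mc \x gam]_p H p).
  by apply: eq_measure_integral => X mX _; exact: (esym (e2 X mX)).
rewrite fubini_tonelli1// ge0_integral_law//.
- exact: measurable_fun_fubini_tonelli_F.
- by move=> y; apply: integral_ge0.
Qed.

Lemma Pcst (x : \bar R) : \int[P]_w x = x.
Proof.
transitivity (x * P [set: Omega]); first exact: integral_cst.
by rewrite probability_setT mule1.
Qed.

Lemma chain_supermartingale (G : T -> \bar R) (c : R) : measurable_fun setT G -> (forall x, 0 <= G x) ->
  (0 <= c)%R -> (forall x, \int[gam]_z G (f (x, z)) <= G x + c%:E) ->
  forall k, (k <= n)%N -> \int[P]_w G (chain k w) <= G s0 + (k%:R * c)%:E.
Proof.
move=> mG G0 c0 H; elim=> [|k IH] kn.
  by rewrite /= mul0r adde0 Pcst.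
have mGf : measurable_fun setT (G \o f) by exact: measurableT_comp.
have mGk : measurable_fun setT (fun w => G (chain k w)) by exact: measurableT_comp mG (chain_meas k).
rewrite (chain_step kn mGf (fun p => G0 _)).
apply: (@le_trans _ _ (\int[P]_w (G (chain k w) + c%:E))).
  apply: ge0_le_integral => //.
  - by move=> w _; apply: integral_ge0 => z _; exact: G0.
  - apply: (measurableT_comp (f := fun x => \int[gam]_z G (f (x, z)))); last exact: chain_meas.
    by have := @measurable_fun_fubini_tonelli_F _ _ _ _ R gam (G \o f); apply => // p; exact: G0.
  - exact: emeasurable_funD.
  - by move=> w _; exact: H.
rewrite ge0_integralD//.
rewrite (Pcst c%:E) -natr1 mulrDl mul1r EFinD addeA leeD2r//.
exact: IH (ltnW kn).
Qed.

End random_chain.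

(** * Spatial averages and the one-step supermartingale estimate *)

Section averages.
Context {R : realType}.
Variable h : R.
Hypothesis h_gt0 : 0 < h.
Implicit Types (u w : R -> R) (x y L M e : R).

(** The second difference quotient. Applied to a double primitive of [u], as in [avg], it is the
    mean of [u] against the triangular kernel of half-width [h]; so [avg u] is twice differentiable
    with second derivative [avg0 u]. *)
Definition avg0 f x := (f (x + h) + f (x - h) - 2 * f x) / h ^+ 2.

(* Locked: unification must not unfold the iterated primitives. *)
Definition avg := locked (fun u => avg0 (antider (antider u)) : R -> R).

Lemma avgE u : avg u = avg0 (antider (antider u)).
Proof. by rewrite /avg -lock. Qed.

Lemma hd_avg0 f df : has_derivative f df -> has_derivative (avg0 f) (avg0 df).
Proof.
move=> H; have H1 := hdZ (h ^- 2) (hdB (hdD (hd_shift h H) (hd_shift (- h) H)) (hdZ 2 H)).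
have -> : avg0 f = fun x => h ^- 2 * (f (x + h) + f (x + - h) - 2 * f x).
  by apply/funext => x; rewrite /avg0 mulrC.
by apply: hd_eq H1 _ => x; rewrite /avg0 mulrC.
Qed.

Lemma avg_hd u : continuous u -> exists F1, has_derivative (avg u) F1 /\ has_derivative F1 (avg0 u).
Proof.
move=> cu; have h1 := antider_hd cu; have h2 := antider_hd (hd_continuous h1).
by exists (avg0 (antider u)); split; rewrite ?avgE; exact: hd_avg0.
Qed.

Lemma avg_le u x M : continuous u -> (forall y, `|y - x| <= h -> u y <= M) -> avg u x <= M.
Proof.
move=> cu uM; have h1 := antider_hd cu; have h2 := antider_hd (hd_continuous h1).
have n1 := taylor2 (z := h) h2 h1 (fun y yh => uM y (le_trans yh (ltac:(by rewrite gtr0_norm)))).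
have n2 := taylor2 (z := - h) h2 h1 (fun y yh => uM y (le_trans yh (ltac:(by rewrite normrN gtr0_norm)))).
rewrite avgE /avg0 ler_pdivrMr ?exprn_gt0//; rewrite sqrrN in n2.
by move: n1 n2; move: (antider _) => T n1 n2; lra.
Qed.

Lemma antiderZ u k : continuous u -> antider (fun x => k * u x) = fun x => k * antider u x.
Proof.
move=> cu; apply/funext => x; rewrite /antider; case: ifP => _; first by rewrite primZ.
rewrite (@primZ _ (fun r => u (- r))) ?mulrN// => r.
by apply: (@continuous_comp _ _ _ (fun r : R => - r) u); [exact: opp_continuous|exact: cu].
Qed.

Lemma antiderD u w : continuous u -> continuous w ->
  antider (fun x => u x + w x) = fun x => antider u x + antider w x.
Proof.
have co (g : R -> R) : continuous g -> continuous (fun r => g (- r)).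
  move=> cg r; by apply: (@continuous_comp _ _ _ (fun r : R => - r) g); [exact: opp_continuous|exact: cg].
move=> cu cw; apply/funext => x; rewrite /antider; case: ifP => _; first by rewrite primD.
by rewrite (primD _ (co _ cu) (co _ cw)) opprD.
Qed.

Lemma avgD u w x : continuous u -> continuous w -> avg (fun y => u y + w y) x = avg u x + avg w x.
Proof.
move=> cu cw; rewrite !avgE antiderD// antiderD; last 2 first.
- exact: hd_continuous (antider_hd cu).
- exact: hd_continuous (antider_hd cw).
move: (antider (antider u)) (antider (antider w)) => T1 T2; rewrite /avg0; field.
by rewrite gt_eqF.
Qed.

Lemma avgZ u k x : continuous u -> avg (fun y => k * u y) x = k * avg u x.
Proof.
move=> cu; rewrite !avgE antiderZ// antiderZ; last exact: hd_continuous (antider_hd cu).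
move: (antider (antider u)) => T1; rewrite /avg0; field.
by rewrite gt_eqF.
Qed.

Lemma avg_ge u x L : continuous u -> (forall y, `|y - x| <= h -> L <= u y) -> L <= avg u x.
Proof.
move=> cu uL; have cn : continuous (fun y => -1 * u y).
  by move=> y; apply: cvgM; [exact: cvg_cst|exact: cu].
have H y : `|y - x| <= h -> -1 * u y <= - L by move=> yh; rewrite mulN1r lerN2 uL.
by have := avg_le cn H; rewrite avgZ// mulN1r lerN2.
Qed.

Lemma avg_mono u w x : continuous u -> continuous w ->
  (forall y, `|y - x| <= h -> u y <= w y) -> avg u x <= avg w x.
Proof.
move=> cu cw uw.
have cn : continuous (fun y => -1 * u y) by move=> y; apply: cvgM; [exact: cvg_cst|exact: cu].
have cs : continuous (fun y => w y + -1 * u y) by move=> y; apply: cvgD; [exact: cw|exact: cn].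
have H y : `|y - x| <= h -> 0 <= w y + -1 * u y by move=> yh; rewrite mulN1r subr_ge0 uw.
by have := avg_ge cs H; rewrite (avgD x cw cn) (avgZ (-1) x cu) mulN1r subr_ge0.
Qed.

End averages.

Section one_step.
Context {R : realType}.
Variable m : {measure set (measurableTypeR R) -> \bar R}.
Hypothesis lf : locally_finite m.
Variables (h : R).
Hypothesis h_gt0 : 0 < h.
Implicit Types (x y r e d S Y : R).

(** The density of [m] smeared with the same triangular kernel (h - |x - y|)^+ / h^2 of total mass
    1. With this choice the three-point relation turns [avg0 u / 2] into an integral of the source
    against the kernel of [dens]. *)
Definition dens x : R := h ^- 3 * \int[m]_y tent (x - h) x (x + h) y.

Lemma dens_lt x : x - h < x /\ x < x + h.
Proof. by have := h_gt0; split; lra. Qed.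

Lemma dens_ge0 x : 0 <= dens x.
Proof.
rewrite mulr_ge0 ?invr_ge0 ?exprn_ge0 ?(ltW h_gt0)//; apply: Rintegral_ge0 => y _.
by have [] := dens_lt x; exact: tent_ge0.
Qed.

Lemma dens_tentE x y : tent (x - h) x (x + h) y = h * pos (h - `|x - y|).
Proof.
have h0 := h_gt0; have [l1 l2] := dens_lt x.
have [a|a] := leP y (x - h); first by rewrite tent_left// pos0 ?mulr0// ger0_norm; lra.
have [b|b] := leP (x + h) y; first by rewrite tent_right// pos0 ?mulr0// ler0_norm; lra.
have [c|c] := leP y x.
  by rewrite tentEl ?(ltW a)// ger0_norm ?posE; [ring|lra..].
by rewrite tentEr ?(ltW c) ?(ltW b)// ltr0_norm ?posE; [ring|lra..].
Qed.

Lemma dens_continuous2 : continuous2 (fun x y => tent (x - h) x (x + h) y).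
Proof.
have -> : (fun x y => tent (x - h) x (x + h) y) = (fun x y => h * pos (h - `|x - y|)).
  by apply/funext => x; apply/funext => y; exact: dens_tentE.
apply: continuous2Z => p.
apply: (@continuous_comp _ _ _ (fun p : R * R => h - `|p.1 - p.2|) (@pos R)); last exact: pos_continuous.
apply: cvgB; first exact: cvg_cst.
apply: (@continuous_comp _ _ _ (fun p : R * R => p.1 - p.2) (fun x : R => `|x|)); last exact: norm_continuous.
by apply: cvgB; [exact: cvg_fst|exact: cvg_snd].
Qed.

Lemma dens_continuous : continuous dens.
Proof.
apply: continuous_approx => A e e0; have h0 := h_gt0.
pose cut y := pos (1 - pos (`|y| - (`|A| + h))).
pose F x y := cut y * tent (x - h) x (x + h) y.
have cc0 (k : R) (g : R -> R) : continuous g -> continuous (fun y => pos (k + g y)).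
  move=> cg y; apply: (@continuous_comp _ _ _ (fun y => k + g y) (@pos R)); last exact: pos_continuous.
  by apply: cvgD; [exact: cvg_cst|exact: cg].
have ccut : continuous cut.
  have -> : cut = fun y => pos (1 + -1 * pos (- (`|A| + h) + `|y|)).
    by apply/funext => y; rewrite /cut mulN1r [_ + `|y|]addrC.
  apply: (cc0 1 (fun y => -1 * pos (- (`|A| + h) + `|y|))) => y.
  by apply: cvgM; [exact: cvg_cst|apply: (cc0 _ (fun y => `|y|)); exact: abs_continuous].
exists (fun x => h ^- 3 * \int[m]_y F x y); split.
  have ci : continuous (fun x => \int[m]_y F x y).
    apply: (cc_continuous_param lf (A := `|A| + h + 1)).
      exact: (continuous2M (continuous2_swap (continuous2_fst ccut)) dens_continuous2).
    by move=> x y hy; rewrite /F /cut (@pos0 _ (1 - _)) ?mul0r// posE; lra.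
  by move=> x; apply: cvgM; [exact: cvg_cst|exact: ci].
move=> x xA; rewrite /dens.
rewrite (_ : (fun y => F x y) = tent (x - h) x (x + h)) ?subrr ?normr0 ?(ltW e0)//.
apply/funext => y; rewrite /F dens_tentE.
have [yA|Ay] := leP `|y| (`|A| + h).
  have -> : cut y = 1; last by rewrite mul1r.
  by rewrite /cut (@pos0 _ (`|y| - _)) ?subr0 ?(@posE _ 1)//; lra.
rewrite (@pos0 _ (h - _)) ?mulr0//.
have := ler_normB x (x - y); have := ler_norm A; have -> : x - (x - y) = y by ring.
by lra.
Qed.

Variables (N t th : R) (u q v : R -> R -> R).
Hypotheses (N_gt0 : 0 < N) (t_ge0 : 0 <= t) (th_gt0 : 0 < th).
Hypotheses (cu : continuous2 u) (cq : continuous2 q) (cv : continuous2 v).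
Hypothesis u_rel : forall r, - th <= r <= t -> Rel m (u^~ r) (q^~ r).
Hypothesis q_le_v : forall x r, - th <= r <= t -> q x r <= v x r.
Hypothesis u_der : forall x r' r k, - th <= r' -> r' <= r -> r <= t ->
  (forall w, r' <= w <= r -> k <= v x w) -> (r - r') * k <= u x r - u x r'.
Hypothesis u_ge0 : forall x r, - th <= r <= t -> 0 <= u x r.
Variable osc : R.
Hypothesis osc_ge0 : 0 <= osc.
Hypothesis osc_q : forall x y r, `|x| <= N -> `|y - x| <= h -> - th <= r <= t -> q y r <= q x r + osc.
Hypothesis osc_v : forall x y r, `|x| <= N -> `|y - x| <= h -> - th <= r <= t -> v x r - osc <= v y r.

Let A := N + h + 1.
Let cl := clamp (- A) A.
Let rc := clamp (- th) t.

(** [u] with both arguments clamped: globally bounded and uniformly continuous, and equal to [u]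
    wherever a living chain evaluates its average. *)
Definition Uc r x := u (cl x) (rc r).

Let A_gt0 : 0 < A. Proof. by have := N_gt0; have := h_gt0; rewrite /A; lra. Qed.
Let AA : - A < A. Proof. by have := A_gt0; lra. Qed.
Let tht : - th < t. Proof. by have := th_gt0; have := t_ge0; lra. Qed.
Let clA x : `|cl x| <= A. Proof. by rewrite ler_norml; exact: clampI. Qed.
Let rcI r : - th <= rc r <= t. Proof. exact: clampI. Qed.

Let cl_lip x y : `|cl x - cl y| <= 2 * `|x - y|.
Proof.
have := pos_lip (x - - A) (y - - A); have := pos_lip (x - A) (y - A).
have -> : x - - A - (y - - A) = x - y by ring.
have -> : x - A - (y - A) = x - y by ring.
rewrite /cl /clamp; move: (pos _) (pos _) (pos _) (pos _) => p1 p2 p3 p4.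
by move: `|x - y| => z; rewrite !ler_norml => /andP[? ?] /andP[? ?]; apply/andP; split; lra.
Qed.

Lemma Uc_continuous2 : continuous2 (fun x r => Uc r x).
Proof.
have c1 := continuous2_comp1 cu (clamp_continuous AA).
have := continuous2_comp1 (continuous2_swap c1) (clamp_continuous tht).
exact: continuous2_swap.
Qed.

Lemma Uc_continuous r : continuous (Uc r).
Proof. exact: (continuous2_slice1 (t := r) Uc_continuous2). Qed.

Lemma Uc_bounded : exists2 B, 0 < B & forall r x, `|Uc r x| <= B.
Proof.
have [M HM] := continuous2_bounded (A + th + t) cu.
exists (`|M| + 1) => [|r x]; first by have := normr_ge0 M; lra.
have M1 := ler_norm M; have th0 := th_gt0; have t0 := t_ge0; have A0 := A_gt0.
apply: (@le_trans _ _ M); last lra.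
apply: HM; first by have := clA x; lra.
by have /andP[] := rcI r; rewrite ler_norml; lra.
Qed.

Lemma Uc_unif e : 0 < e -> exists2 d, 0 < d & forall r x y, `|y - x| <= d -> `|Uc r y - Uc r x| <= e.
Proof.
move=> e0; have [d d0 Hd] := continuous2_unif (A + th + t) cu e0.
exists (d / 4) => [|r x y yx]; first by rewrite divr_gt0.
have th0 := th_gt0; have t0 := t_ge0; have A0 := A_gt0.
apply: Hd.
- by have := clA x; lra.
- by have /andP[] := rcI r; rewrite ler_norml; lra.
- by have := cl_lip y x; lra.
- by rewrite subrr normr0.
Qed.

Lemma avg_Uc_continuous2 : continuous2 (fun x r => avg h (Uc r) x).
Proof.
apply/continuous2_epsP => x r e e0; have e20 : 0 < e / 2 by lra.
have [F1 [hF _]] := avg_hd h (@Uc_continuous r).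
have /continuous_epsP /(_ x _ e20) [d1 d10 Hd1] := hd_continuous hF.
have [d2 d20 Hd2] := continuous2_unif (`|x| + d1 + h + `|r|) Uc_continuous2 e20.
exists (Num.min d1 d2) => [|x' r']; first by rewrite lt_min d10.
rewrite !lt_min => /andP[h1 _] /andP[_ h2]; have hh := h_gt0.
have n1 := Hd1 x' h1.
have near y : `|y - x'| <= h -> `|Uc r' y - Uc r y| <= e / 2.
  move=> yx; apply: Hd2; [|by have := normr_ge0 x; lra|by rewrite subrr normr0|exact: h2].
  have := ler_normD (y - x') (x' - x); have := ler_normD (y - x) x; rewrite subrK.
  have -> : y - x' + (x' - x) = y - x by ring.
  by have := normr_ge0 r; lra.
have cc r1 k : continuous (fun y => Uc r1 y + k).
  by move=> y; apply: cvgD; [exact: Uc_continuous|exact: cvg_cst].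
have ck (k : R) : continuous (fun _ : R => k) by move=> y; exact: cvg_cst.
have avgk k : avg h (fun=> k) x' = k.
  by apply/eqP; rewrite eq_le (avg_le h_gt0 (ck k)) ?(avg_ge h_gt0 (ck k)).
have n2 : avg h (Uc r') x' <= avg h (Uc r) x' + e / 2.
  rewrite -[X in _ + X](avgk (e / 2)) -(avgD h_gt0 x' (@Uc_continuous r) (ck _)).
  apply: (avg_mono h_gt0 (@Uc_continuous r') (cc r _)) => y /near; rewrite ler_norml; lra.
have n3 : avg h (Uc r) x' <= avg h (Uc r') x' + e / 2.
  rewrite -[X in _ + X](avgk (e / 2)) -(avgD h_gt0 x' (@Uc_continuous r') (ck _)).
  apply: (avg_mono h_gt0 (@Uc_continuous r) (cc r' _)) => y /near; rewrite ler_norml; lra.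
by move: n1; rewrite !ler_norml; lra.
Qed.

Definition alive (s : R * R) : bool := [&& `|s.1| < N, 0 <= s.2 & s.2 < t].

(** The state is (position, elapsed clock): a Gaussian displacement, an increase of the clock by
    [dt * dens] at the old position, and no further motion once the chain has left the region or
    used up the time [t]. *)
Definition stepf dt (p : (R * R) * R) : R * R :=
  if alive p.1 then (p.1.1 + p.2, p.1.2 + dt * dens p.1.1) else p.1.

(** The second term decreases as the clock runs and pays for the oscillation of [q] and [v] at scale
    [h]; the margin 1 leaves room for the overshoot of the last step. *)
Definition Gf (s : R * R) : R := avg h (Uc (t - s.2)) s.1 + 3 * osc * pos (t + 1 - s.2).

Lemma Uc_ge0 r x : 0 <= Uc r x.
Proof. exact: u_ge0. Qed.

Lemma Gf_ge0 s : 0 <= Gf s.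
Proof.
have o0 : 0 <= 3 * osc by have := osc_ge0; lra.
rewrite addr_ge0 ?(mulr_ge0 o0 (pos_ge0 _))//.
by apply: (avg_ge h_gt0 (@Uc_continuous _)) => y _; exact: Uc_ge0.
Qed.

(** Let [sg = dt * dens S] be the clock increment. The Gaussian step raises the mean by about dt
    [avg0] / 2 <= sg (q + osc), by the three-point relation, while the shorter remaining time lowers
    the average by at least about sg (v - osc). As q <= v the two balance, up to the compensated
    oscillation and an error [dt * e]. *)
Lemma one_step e : 0 < e -> exists2 d0, 0 < d0 & forall dt, 0 < dt <= d0 ->
  forall s, (\int[normal_prob 0%R (Num.sqrt dt)]_z (Gf (stepf dt (s, z)))%:E <= (Gf s)%:E + (dt * e)%:E)%E.
Proof.
move=> e0; have hh := h_gt0; have th0 := th_gt0.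
have [B /ltW B0 HB] := Uc_bounded.
have [Mh HMh] := continuous_bounded N dens_continuous.
have Mh0 : 0 <= Mh by apply: le_trans (HMh 0 _); rewrite ?normr0 ?(ltW N_gt0).
have h20 : 0 < h ^+ 2 by rewrite exprn_gt0.
pose M := 4 * B / h ^+ 2 + 1.
have M0 : 0 < M by rewrite /M ltr_wpDl// divr_ge0 ?(ltW h20)// mulr_ge0.
pose e1 := e / 4; have e10 : 0 < e1 by rewrite /e1; lra.
have [d d0' Hd] := Uc_unif (ltac:(by rewrite divr_gt0// mulr_gt0) : 0 < e1 * h ^+ 2 / 4).
have d20 : 0 < d ^+ 2 by rewrite exprn_gt0.
pose e2 := e / (8 * (Mh + 1)); have e20 : 0 < e2 by rewrite divr_gt0// mulr_gt0//; lra.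
have [d3 d30 Hd3] := continuous2_unif (A + th + t) cv e20.
(* Clock increments up to 1 stay in the linear range of the compensator, up to [th] they keep the
   remaining time above [- th], and up to [d3 / 2] they control the variation of [v] in time. *)
pose d4 := Num.min (Num.min 1 th) (d3 / 2).
have d40 : 0 < d4 by rewrite !lt_min ltr01 th0 divr_gt0.
pose d0 := Num.min (d4 / (Mh + 1)) (d ^+ 2 * e / (24 * M)).
exists d0 => [|dt /andP[dt0 dtd] [S Y]].
  by rewrite lt_min !divr_gt0 ?mulr_gt0//; lra.
have [al|nal] := boolP (alive (S, Y)); last first.
  under eq_integral do rewrite /stepf /= (negbTE nal).
  have -> := Pcst (normal_prob 0 (Num.sqrt dt)) (Gf (S, Y))%:E.
  by rewrite leeDl// lee_fin (mulr_ge0 (ltW dt0) (ltW e0)).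
under eq_integral do rewrite /stepf /= al.
move: al; rewrite /alive /= => /and3P[SN Y0 Yt].
have SN' := ltW SN; have dS0 := dens_ge0 S.
have dSM : dens S <= Mh by apply: le_trans (ler_norm _) (HMh S SN').
pose sg := dt * dens S; have sg0 : 0 <= sg by rewrite mulr_ge0// ltW.
have dle1 : dt <= d4 / (Mh + 1) by apply: le_trans dtd _; rewrite ge_min lexx.
have dle2 : dt <= d ^+ 2 * e / (24 * M) by apply: le_trans dtd _; rewrite ge_min lexx orbT.
have sgd : sg <= d4.
  apply: (@le_trans _ _ (dt * (Mh + 1))); first by rewrite ler_pM2l//; lra.
  by rewrite -ler_pdivlMr//; lra.
have sg1 : sg <= 1 by apply: le_trans sgd _; rewrite /d4 !ge_min lexx.
have sgth : sg <= th by apply: le_trans sgd _; rewrite /d4 !ge_min lexx !orbT.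
have sgd3 : sg <= d3 / 2 by apply: le_trans sgd _; rewrite /d4 ge_min lexx orbT.
have [r rE] : exists r, r = t - Y by exists (t - Y).
have [r' r'E] : exists r', r' = t - (Y + sg) by exists (t - (Y + sg)).
have rI : - th <= r <= t by rewrite rE; lra.
have r'I : - th <= r' <= t by rewrite r'E; lra.
have rr' : r - r' = sg by rewrite rE r'E; ring.
have rcr : rc r = r by exact: clampE.
have rcr' : rc r' = r' by exact: clampE.
have [F1 [hF hF1]] := avg_hd h (@Uc_continuous r').
pose k0 := 3 * osc * pos (t + 1 - (Y + sg)).
pose f x := k0 + avg h (Uc r') x.
have hf : has_derivative f F1 by apply: hd_eq (hdD (hd_cst k0) hF) _ => x; rewrite add0r.
have fE x : Gf (x, Y + sg) = f x by rewrite /Gf /f /k0 /= -r'E; ring.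
have f0 x : 0 <= f x by rewrite -fE; exact: Gf_ge0.
have f2M y : `|avg0 h (Uc r') y| <= M.
  rewrite /avg0 normrM normfV (gtr0_norm h20) ler_pdivrMr//.
  have -> : M * h ^+ 2 = 4 * B + h ^+ 2 by rewrite /M; field; rewrite gt_eqF.
  have := HB r' (y + h); have := HB r' (y - h); have := HB r' y.
  rewrite !ler_norml; move: (Uc r' _) (Uc r' _) (Uc r' _) => a1 a2 a3 /andP[? ?] /andP[? ?] /andP[? ?].
  by apply/andP; split; lra.
have f2e y : `|y - S| <= d -> `|avg0 h (Uc r') y - avg0 h (Uc r') S| <= e1.
  move=> yS; have g1 := Hd r' S y yS.
  have g2 := Hd r' (S + h) (y + h) ltac:(by rewrite opprD addrACA subrr addr0).
  have g3 := Hd r' (S - h) (y - h) ltac:(by rewrite opprD addrACA subrr addr0).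
  rewrite /avg0 -mulrBl normrM normfV (gtr0_norm h20) ler_pdivrMr//.
  move: g1 g2 g3; rewrite !ler_norml; move: (e1 * _) => z.
  move: (Uc r' _) (Uc r' _) (Uc r' _) (Uc r' _) (Uc r' _) (Uc r' _) => a1 a2 a3 a4 a5 a6 /andP[? ?] /andP[? ?] /andP[? ?].
  by apply/andP; split; lra.
have := gauss_taylor dt0 hf hF1 f0 e10 d0' M0 f2M f2e.
under eq_integral do rewrite -fE.
move=> main; apply: le_trans main _; rewrite -EFinD lee_fin.
have clS y : `|y - S| <= h -> cl y = y.
  move=> yS; apply: clampE => //; rewrite -ler_norml /A.
  by have := ler_normD (y - S) S; rewrite subrK; lra.
have near r1 : - th <= r1 <= t -> forall y, `|y - S| <= h -> Uc r1 y = u y r1.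
  by move=> r1I y yS; rewrite /Uc clS// /rc clampE.
have l1 : avg0 h (Uc r') S / 2 <= dens S * (q S r' + osc).
  have [s1 s2] := dens_lt S; have rl := u_rel r'I s1 s2.
  have n1 : `|S + h - S| <= h by rewrite addrAC subrr add0r gtr0_norm.
  have n2 : `|S - h - S| <= h by rewrite addrAC subrr add0r normrN gtr0_norm.
  have n3 : `|S - S| <= h by rewrite subrr normr0 ltW.
  rewrite /avg0 (near r' r'I _ n1) (near r' r'I _ n2) (near r' r'I _ n3).
  have -> : (u (S + h) r' + u (S - h) r' - 2 * u S r') / h ^+ 2 / 2 = h ^- 3 * (T3 (S - h) S (S + h) (u^~ r') / 2).
    by rewrite /T3; field; rewrite gt_eqF.
  have half (I : R) : 2 * I / 2 = I by field.
  rewrite rl half /dens -[leRHS]mulrA ler_pM2l ?invr_gt0 ?exprn_gt0//.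
  pose D := `|S - h| + `|S + h|.
  have ctent : cc D (tent (S - h) S (S + h)).
    apply: tent_cc => //; rewrite /D.
      by have := ler_norm (- (S - h)); have := normr_ge0 (S + h); rewrite normrN; lra.
    by have := ler_norm (S + h); have := normr_ge0 (S - h); lra.
  have c1 := tent_mul_cc s1 s2 (continuous2_slice1 (t := r') cq).
  rewrite mulrC -(cc_RintZ lf _ ctent); apply: (cc_Rint_le lf c1 (ccZ _ ctent)) => y.
  rewrite mulrC; have t0 := tent_ge0 y s1 s2.
  have [yS|yS] := leP `|y - S| h; first by rewrite ler_wpM2r// osc_q.
  by rewrite dens_tentE pos0 ?mulr0// distrC; lra.
have vk y w : `|y - S| <= h -> r' <= w <= r -> v S r - osc - e2 <= v y w.
  move=> yS /andP[w1 w2].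
  have wI : - th <= w <= t by case/andP: rI => _ rt; case/andP: r'I => tr _; rewrite (le_trans tr w1) (le_trans w2 rt).
  have := osc_v SN' yS wI; have : `|v S w - v S r| <= e2.
    have t0 := t_ge0; have A0 := A_gt0; apply: Hd3.
    - by rewrite /A; lra.
    - by case/andP: rI => a1 a2; rewrite ler_norml; lra.
    - by rewrite subrr normr0.
    - by rewrite ler0_norm; lra.
  by rewrite ler_norml => /andP[a1 a2] a3; lra.
have qv : q S r' <= v S r + e2.
  apply: le_trans (q_le_v S r'I) _; have t0 := t_ge0; have A0 := A_gt0.
  have : `|v S r' - v S r| <= e2.
    apply: Hd3.
    - by rewrite /A; lra.
    - by case/andP: rI => a1 a2; rewrite ler_norml; lra.
    - by rewrite subrr normr0.
    - by rewrite ler0_norm; lra.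
  by rewrite ler_norml => /andP[a1 a2]; lra.
have l2 : avg h (Uc r') S + sg * (v S r - osc - e2) <= avg h (Uc r) S.
  have cn : continuous (fun y => -1 * Uc r' y) by move=> y; apply: cvgM; [exact: cvg_cst|exact: Uc_continuous].
  have cs : continuous (fun y => Uc r y + -1 * Uc r' y) by move=> y; apply: cvgD; [exact: Uc_continuous|exact: cn].
  have HH y : `|y - S| <= h -> sg * (v S r - osc - e2) <= Uc r y + -1 * Uc r' y.
    move=> yS; rewrite (near r)// (near r')// mulN1r -rr'.
    case/andP: rI => _ rt; case/andP: r'I => tr _.
    by apply: u_der => //; [rewrite -subr_ge0 rr'|move=> w; exact: vk].
  have := avg_ge h_gt0 cs HH; rewrite (avgD h_gt0 _ (@Uc_continuous r) cn) (avgZ h_gt0 _ _ (@Uc_continuous r')).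
  by lra.
have p1 : pos (t + 1 - Y) = t + 1 - Y by rewrite posE//; lra.
have p2 : pos (t + 1 - (Y + sg)) = t + 1 - Y - sg by rewrite posE; lra.
rewrite /Gf /f /k0 /= -rE p1 p2.
have l1' : dt * (avg0 h (Uc r') S / 2) <= sg * (q S r' + osc) by rewrite /sg -mulrA ler_pM2l.
have l3 : sg * q S r' <= sg * (v S r + e2) by rewrite ler_wpM2l.
have l4 : sg * e2 <= dt * (e / 8).
  rewrite /sg -mulrA ler_pM2l// /e2.
  apply: (@le_trans _ _ ((Mh + 1) * (e / (8 * (Mh + 1))))).
    by rewrite ler_pM2r//; lra.
  by rewrite le_eqVlt; apply/orP; left; apply/eqP; field; rewrite gt_eqF//; lra.
have l5 : 6 * M * dt / d ^+ 2 <= e / 4.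
  rewrite ler_pdivrMr//; have : dt * (24 * M) <= d ^+ 2 * e by rewrite -ler_pdivlMr// mulr_gt0.
  by lra.
have l6 : dt * (6 * M * dt / d ^+ 2) <= dt * (e / 4) by rewrite ler_pM2l.
have l7 : 0 <= sg * osc by rewrite mulr_ge0.
rewrite /e1; move: l1' l2 l3 l4 l6 l7; move: (avg h _ _) (avg h _ _) (avg0 _ _ _) (6 * M * dt / d ^+ 2) (q S r') (v S r).
by move=> z1 z2 z3 z4 z5 z6; nra.
Qed.

End one_step.

(** * Local times and the clock along a single path *)

Section occupied_path.
Context {R : realType}.
Variable m : {measure set (measurableTypeR R) -> \bar R}.
Hypothesis lf : locally_finite m.
Local Notation leb := (@lebesgue_measure R).
Variables (a : R -> R) (l : R -> R -> R).
Hypothesis a_cont : continuous a.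
Hypothesis l_cont : continuous2 l.
Hypothesis l_ge0 : forall y u, 0 <= l y u.
Hypothesis occ : forall (u : R) (E : set R), 0 <= u -> measurable E ->
  leb [set s : R | 0 <= s <= u /\ E (a s)] = (\int[leb]_(y in E) (l y u)%:E)%E.
Implicit Types (x y u s e A h T : R).

(** The occupation formula concerns integrals of local times only; with continuity in the level this
    yields pointwise inequalities. *)
Lemma le_by_intervals (f g : R -> R) y e : continuous f -> continuous g ->
  (forall y, 0 <= f y) -> (forall y, 0 <= g y) -> 0 < e ->
  (forall b c, y - e <= b -> b < c -> c <= y + e ->
    (\int[leb]_(z in `]b, c[) (f z)%:E <= \int[leb]_(z in `]b, c[) (g z)%:E)%E) -> f y <= g y.
Proof.
move=> cf cg f0 g0 e0 H; rewrite leNgt; apply/negP => gf.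
pose k := (f y - g y) / 3; have k0 : 0 < k by rewrite /k; lra.
have /continuous_epsP /(_ y k k0) [d1 d10 H1] := cf.
have /continuous_epsP /(_ y k k0) [d2 d20 H2] := cg.
pose d := Num.min (e / 2) (Num.min (d1 / 2) (d2 / 2)).
have d0 : 0 < d by rewrite !lt_min !divr_gt0.
have de : d <= e / 2 by rewrite ge_min lexx.
have dd1 : d <= d1 / 2 by rewrite /d ge_min [X in _ || X]ge_min lexx orbT.
have dd2 : d <= d2 / 2 by rewrite /d ge_min [X in _ || X]ge_min lexx !orbT.
have := H (y - d) (y + d) ltac:(lra) ltac:(lra) ltac:(lra).
set I : set R := `]y - d, y + d[%classic.
have mI : measurable I by exact: measurable_itv.
have lI : leb I = (2 * d)%:E.
  transitivity (lebesgue_measure I) => //; rewrite lebesgue_measure_itv /= lte_fin ifT; last lra.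
  by rewrite -EFinD; congr EFin; ring.
have mE (g' : R -> R) : continuous g' -> measurable_fun I (EFin \o g').
  by move=> cg'; apply/measurable_EFinP/measurable_funTS; exact: continuous_measurable_fun.
have inI z : I z -> `|z - y| < d1 /\ `|z - y| < d2.
  by rewrite /I /= in_itv /= => /andP[h1 h2]; split; rewrite ltr_norml; lra.
have l1 : (((f y - k) * (2 * d))%:E <= \int[leb]_(z in I) (f z)%:E)%E.
  rewrite EFinM -lI -(integral_cst leb mI (f y - k)%:E).
  apply: ge0_le_integral => //.
  - by move=> z _; rewrite lee_fin /k; have := g0 y; lra.
  - exact: mE.
  - by move=> z Iz; have [/H1 h _] := inI z Iz; move: h; rewrite lee_fin ler_norml; lra.
have l2 : (\int[leb]_(z in I) (g z)%:E <= ((g y + k) * (2 * d))%:E)%E.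
  rewrite EFinM -lI -(integral_cst leb mI (g y + k)%:E).
  apply: ge0_le_integral => //.
  - by move=> z _; rewrite lee_fin.
  - exact: mE.
  - by move=> z Iz; have [_ /H2 h] := inI z Iz; move: h; rewrite lee_fin ler_norml; lra.
move=> l3; have := le_trans l1 (le_trans l3 l2).
by rewrite lee_fin ler_pM2r ?mulr_gt0// /k; lra.
Qed.

Definition vis u (E : set R) : set R := [set s : R | 0 <= s <= u /\ E (a s)].

Lemma vis_meas u E : measurable E -> measurable (vis u E).
Proof.
move=> mE; have -> : vis u E = `[0, u]%classic `&` (a @^-1` E).
  by apply/seteqP; split => s; rewrite /vis /= in_itv.
have ma : measurable_fun setT a by exact: continuous_measurable_fun.
by have := ma measurableT _ mE; rewrite setTI => h; apply: measurableI => //; exact: measurable_itv.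
Qed.

Let itvm b c : measurable (`]b, c[%classic : set R). Proof. exact: measurable_itv. Qed.
Let lc u : continuous (l^~ u). Proof. exact: continuous2_slice1. Qed.

Lemma l_mono y s u : 0 <= s -> s <= u -> l y s <= l y u.
Proof.
move=> s0 su; apply: (@le_by_intervals (l^~ s) (l^~ u) y 1) => // b c _ _ _.
rewrite -!occ ?(le_trans s0)//; apply: le_measure; rewrite ?inE; try exact: vis_meas.
by move=> r [/andP[r0 rs] E]; split => //; rewrite r0 (le_trans rs).
Qed.

Lemma l_at0 y : l y 0 = 0.
Proof.
apply/eqP; rewrite eq_le l_ge0 andbT.
apply: (@le_by_intervals (l^~ 0) (fun=> 0) y 1) => //; first by move=> z; exact: cvg_cst.
move=> b c _ _ _; rewrite -occ// integral0.
apply: (@le_trans _ _ (leb [set 0 : R])); last by rewrite lebesgue_measure_set1.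
apply: le_measure; rewrite ?inE; [exact: vis_meas|exact: measurable_set1|].
by move=> r [/andP[r0 r1] _]; apply/eqP; rewrite /= eq_le r0 r1.
Qed.

Lemma l_const y s u e : 0 <= s -> s <= u -> 0 < e ->
  (forall r, s <= r <= u -> e <= `|a r - y|) -> l y u = l y s.
Proof.
move=> s0 su e0 far; apply/eqP; rewrite eq_le (l_mono y s0 su) andbT.
apply: (@le_by_intervals (l^~ u) (l^~ s) y e) => // b c h1 h2 h3.
rewrite -!occ ?(le_trans s0)//; apply: le_measure; rewrite ?inE; try exact: vis_meas.
move=> r [/andP[r0 ru]]; rewrite /= in_itv /= => /andP[E1 E2].
split; last by rewrite E1.
rewrite r0 leNgt; apply/negP => sr.
have := far r ltac:(by rewrite (ltW sr) ru); rewrite leNgt => /negP; apply.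
by rewrite ltr_norml; lra.
Qed.

Lemma l_out T A y u : (forall s, 0 <= s <= T -> `|a s| <= A) -> 0 <= u <= T -> A < `|y| -> l y u = 0.
Proof.
move=> aA /andP[u0 uT] Ay; rewrite -(l_at0 y).
apply: (@l_const y 0 u (`|y| - A)) => //; first by rewrite subr_gt0.
move=> r /andP[r0 ru]; have := aA r ltac:(by rewrite r0 (le_trans ru)).
by have := ler_normB (a r) (a r - y); rewrite (_ : a r - (a r - y) = y); [lra|ring].
Qed.

Lemma l_cc T A u : (forall s, 0 <= s <= T -> `|a s| <= A) -> 0 <= u <= T -> cc A (l^~ u).
Proof. by move=> aA uT; split => [|y Ay]; [exact: lc|exact: l_out aA uT Ay]. Qed.

Lemma path_bound T : exists A, forall s, 0 <= s <= T -> `|a s| <= A.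
Proof.
have [A HA] := continuous_bounded T a_cont; exists A => s /andP[s0 sT].
by apply: HA; rewrite ger0_norm.
Qed.

Lemma occupation (f : R -> R) u : continuous f -> (forall y, 0 <= f y) -> 0 <= u ->
  prim (fun s => f (a s)) u = \int[leb]_y (f y * l y u).
Proof.
move=> cf f0 u0.
pose D : set R := `[0, u]%classic; have mD : measurable D by exact: measurable_itv.
have ma : measurable_fun setT (a : measurableTypeR R -> measurableTypeR R) by exact: continuous_measurable_fun.
have mf : measurable_fun setT (fun y : measurableTypeR R => (f y)%:E).
  by apply/measurable_EFinP; exact: continuous_measurable_fun.
have mfa : measurable_fun setT (fun s : measurableTypeR R => (f (a s))%:E).
  exact: (measurableT_comp mf ma).
have ml : measurable_fun setT (l^~ u : measurableTypeR R -> R) by exact: continuous_measurable_fun.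
have mi : measurable_fun setT (\1_D : measurableTypeR R -> R) by exact: measurable_indic.
rewrite /prim /Rintegral; congr fine.
transitivity (\int[mrestr leb mD]_s (f (a s))%:E)%E.
  rewrite (@density_integral _ (measurableTypeR R) R leb (mrestr leb mD) (\1_D) mi _ _ _ mfa); last 3 first.
  - by move=> s; rewrite indicE.
  - move=> E mE; rewrite [RHS]integral_indic//.
    by rewrite setIC.
  - by move=> s; rewrite lee_fin.
  rewrite [LHS]integral_mkcond; apply: eq_integral => s _; rewrite patchE indicE.
  by case: ifPn => _; rewrite ?mule1 ?mule0.
transitivity (\int[pushm (mrestr leb mD) ma]_y (f y)%:E)%E.
  by rewrite ge0_integral_pushm.
rewrite (@density_integral _ (measurableTypeR R) R leb _ (l^~ u) ml _ _ _ mf)//.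
- by move=> E mE; rewrite -occ//; congr (leb _); apply/seteqP; split => s; rewrite /D /= in_itv /= => -[].
Qed.

Definition clock u : R := \int[m]_y l y (pos u).

Lemma clock_mono s u : 0 <= s -> s <= u -> clock s <= clock u.
Proof.
move=> s0 su; have u0 := le_trans s0 su; have [A HA] := path_bound u.
rewrite /clock !posE//.
by apply: (cc_Rint_le lf (l_cc HA _) (l_cc HA _)) => [||y]; [rewrite s0|rewrite u0/=|exact: l_mono].
Qed.

Lemma clock0 : clock 0 = 0.
Proof.
rewrite /clock pos0//; under eq_Rintegral do rewrite l_at0.
by rewrite Rintegral_cst// mul0r.
Qed.

Lemma clock_continuous u e : 0 <= u -> 0 < e -> exists2 d, 0 < d & forall s, 0 <= s -> `|s - u| < d ->
  `|clock s - clock u| <= e.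
Proof.
move=> u0 e0; have [A HA] := path_bound (u + 1).
(* The time is clamped to [[0, u + 1]], so that all levels reached lie in one compact set. *)
pose F s y := l y (pos s - pos (s - (u + 1))).
have cF : continuous2 F.
  apply: (continuous2_swap (F := fun y s => l y (pos s - pos (s - (u + 1))))).
  have := continuous2_comp1 (continuous2_swap l_cont) (u := fun s => pos s - pos (s - (u + 1))).
  move=> H; apply: continuous2_swap; apply: H => s; apply: cvgB; first exact: pos_continuous.
  apply: (@continuous_comp _ _ _ (fun s : R => s - (u + 1)) (@pos R)); last exact: pos_continuous.
  by apply: cvgB; [exact: cvg_id|exact: cvg_cst].
have Fout s y : A < `|y| -> F s y = 0.
  move=> Ay; apply: (l_out HA) => //.
  have [s0|s0] := leP s 0; first by rewrite !pos0; lra.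
  have [s1|s1] := leP s (u + 1); first by rewrite (posE (ltW s0)) pos0; lra.
  by rewrite !posE; lra.
have /continuous_epsP /(_ u e e0) [d d0 Hd] := cc_continuous_param lf cF Fout.
exists (Num.min d 1) => [|s s0]; first by rewrite lt_min d0 ltr01.
rewrite lt_min => /andP[sd s1]; move: (Hd s sd); rewrite ltr_norml in s1.
have E r : 0 <= r <= u + 1 -> \int[m]_y F r y = clock r.
  by move=> /andP[r0 r1]; apply: eq_Rintegral => y _; rewrite /F (@pos0 _ (r - _)) ?subr0//; lra.
by rewrite !E//; lra.
Qed.

Lemma pos_sq_hd : has_derivative (fun z : R => pos z * pos z / 2) (@pos R).
Proof.
move=> x; apply: is_derive_eps => e e0; exists e => // y ye.
apply: (@le_trans _ _ (`|y - x| * `|y - x|)); last by rewrite ler_wpM2l// ltW.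
rewrite -normrM ger0_norm ?(ger0_norm (mulr_ge0 _ _)) -?expr2 ?sqr_ge0//.
have q1 := sqr_ge0 (y - x); have q2 := sqr_ge0 x; have q3 := sqr_ge0 y.
have q4 : x * y <= 0 \/ (x <= 0 /\ y <= 0) \/ (0 < x /\ 0 < y).
  have [x0|x0] := leP x 0; have [y0|y0] := leP y 0; [by right; left| left|left|by right; right].
    by rewrite mulr_le0_ge0// ltW.
  by rewrite mulr_ge0_le0// ltW.
rewrite !expr2 in q1 q2 q3 *.
have [x0|x0] := leP x 0; have [y0|y0] := leP y 0;
  rewrite ?(pos0 x0) ?(pos0 y0) ?(posE (ltW x0)) ?(posE (ltW y0)) ler_norml; (case: q4 => [q4|[[q4 q5]|[q4 q5]]]; lra).
Qed.

Lemma tent_mass h y : 0 < h -> \int[leb]_z (h ^- 3 * tent (z - h) z (z + h) y) = 1.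
Proof.
move=> h0; pose P z : R := pos z * pos z / 2.
have hd1 := hd_shift (- y) pos_sq_hd.
have H : has_derivative (fun z => h ^- 2 * (P (z + h + - y) + P (z - h + - y) - 2 * P (z + - y)))
    (fun z => h ^- 3 * tent (z - h) z (z + h) y).
  apply: hd_eq (hdZ (h ^- 2) (hdB (hdD (hd_shift h hd1) (hd_shift (- h) hd1)) (hdZ 2 hd1))) _ => z.
  by rewrite /tent /T3; field; rewrite gt_eqF.
pose A := `|y| + h.
have cA : cc A (fun z => h ^- 3 * tent (z - h) z (z + h) y).
  apply: ccZ; split; first exact: (continuous2_slice1 (dens_continuous2 h0)).
  move=> z Az; rewrite dens_tentE// pos0 ?mulr0//.
  by have := ler_normD (z - y) y; rewrite subrK /A in Az *; lra.
rewrite (cc_FTC H cA) /P.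
have y1 := ler_norm y; have y2 := ler_norm (- y); rewrite normrN in y2.
rewrite (@posE _ (A + h + - y)) ?(@posE _ (A - h + - y)) ?(@posE _ (A + - y)); try (rewrite /A; lra).
rewrite !(@pos0 _ (- A + _ + _)) ?(@pos0 _ (- A + _)); try (rewrite /A; lra).
by field; rewrite gt_eqF.
Qed.

(** By the occupation formula the time integral of [dens] along the path is the integral of [dens]
    against the local time, and by Fubini the integral against [m] of the local time smeared at
    scale [h]. Continuity of the local time in the level does the rest. *)
Lemma clock_approx T e : 0 <= T -> 0 < e -> exists2 h0, 0 < h0 & forall h u, 0 < h -> h <= h0 -> 0 <= u <= T ->
  `|prim (fun s => dens m h (a s)) u - clock u| <= e.
Proof.
move=> T0 e0; have [A0 HA0] := path_bound T.
pose A := `|A0|; have HA s : 0 <= s <= T -> `|a s| <= A by move=> /HA0 h; apply: le_trans h (ler_norm _).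
have A00 : 0 <= A by exact: normr_ge0.
pose e' := e / (mass m (A + 1) + 1).
have mA := mass_ge0 m (A + 1).
have e'0 : 0 < e' by rewrite divr_gt0//; lra.
have [d d0 Hd] := continuous2_unif (A + 1 + T) l_cont e'0.
exists (Num.min 1 (d / 2)) => [|h u h0]; first by rewrite lt_min ltr01 divr_gt0.
rewrite le_min => /andP[h1 hd] uT; have /andP[u0 uT'] := uT.
rewrite occupation//; last 2 first.
- exact: dens_continuous.
- exact: dens_ge0.
pose F z y := h ^- 3 * tent (z - h) z (z + h) y * l z u.
have lcc := l_cc HA uT.
have cF : continuous2 F.
  exact: (continuous2M (continuous2Z (dens_continuous2 h0)) (continuous2_fst (proj1 lcc))).
have F1 z y : A < `|z| -> F z y = 0 by move=> Az; rewrite /F (proj2 lcc)// mulr0.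
have F2 z y : A + 1 < `|y| -> F z y = 0.
  move=> Ay; have [zA|/F1 //] := leP `|z| A; rewrite /F dens_tentE// pos0 ?mulr0 ?mul0r//.
  by have := ler_normB z (z - y); rewrite (_ : z - (z - y) = y); [lra|ring].
have E z : dens m h z * l z u = \int[m]_y F z y.
  have [s1 s2] := dens_lt h0 z; have D0 : cc (`|z - h| + `|z + h|) (tent (z - h) z (z + h)).
    apply: tent_cc => //.
      by have := ler_norm (- (z - h)); have := normr_ge0 (z + h); rewrite normrN; lra.
    by have := ler_norm (z + h); have := normr_ge0 (z - h); lra.
  rewrite /dens mulrAC -(cc_RintZ lf _ D0); apply: eq_Rintegral => y _; rewrite /F; ring.
rewrite (funext E) (cc_Fubini (@leb_locally_finite R) lf cF F1 F2) /clock posE//.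
have cI : cc (A + 1) (fun y => \int[leb]_z F z y).
  split; first exact: (cc_continuous_param (@leb_locally_finite R) (continuous2_swap cF) (fun y z => F1 z y)).
  by move=> y Ay; under eq_Rintegral do rewrite F2//; rewrite Rintegral_cst// mul0r.
have lcc' : cc (A + 1) (l^~ u) by apply: cc_widen lcc; lra.
have := cc_Rint_dist (e := e') lf cI lcc' _ => H.
apply: le_trans (H _) _; last first.
  by rewrite /e' mulrAC ler_pdivrMr ?ler_pM2l//; lra.
move=> y yA.
have ct : cc (A + 1 + 1) (fun z => h ^- 3 * tent (z - h) z (z + h) y).
  apply: ccZ; split; first exact: (continuous2_slice1 (dens_continuous2 h0)).
  move=> z Az; rewrite dens_tentE// pos0 ?mulr0//.
  by have := ler_normD (z - y) y; rewrite subrK; lra.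
have c1 : cc (A + 1 + 1) (F^~ y).
  by apply: (ccMr ct); exact: (proj1 lcc).
have W0 z : 0 <= h ^- 3 * tent (z - h) z (z + h) y.
  by have [s1 s2] := dens_lt h0 z; rewrite mulr_ge0 ?invr_ge0 ?exprn_ge0 ?(ltW h0)// tent_ge0.
have bd z : (l y u - e') * (h ^- 3 * tent (z - h) z (z + h) y) <= F z y <= (l y u + e') * (h ^- 3 * tent (z - h) z (z + h) y).
  rewrite /F [X in _ <= X <= _]mulrC.
  have [zy|zy] := leP `|z - y| h; last by rewrite dens_tentE// pos0 ?mulr0 ?lexx//; lra.
  have : `|l z u - l y u| <= e'.
    by apply: Hd; [lra|rewrite ger0_norm; lra|lra|by rewrite subrr normr0].
  by rewrite ler_norml => /andP[? ?]; rewrite !ler_wpM2r//; lra.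
have i1 k : \int[leb]_z (k * (h ^- 3 * tent (z - h) z (z + h) y)) = k.
  by rewrite (cc_RintZ (@leb_locally_finite R) _ ct) tent_mass// mulr1.
have g1 : l y u - e' <= \int[leb]_z F z y.
  by rewrite -[leLHS]i1; apply: (cc_Rint_le (@leb_locally_finite R) (ccZ _ ct) c1) => z; have /andP[] := bd z.
have g2 : \int[leb]_z F z y <= l y u + e'.
  by rewrite -[leRHS]i1; apply: (cc_Rint_le (@leb_locally_finite R) c1 (ccZ _ ct)) => z; have /andP[] := bd z.
by rewrite ler_norml; move: g1 g2; move: (\int[leb]_z _) => I g1 g2; lra.
Qed.

End occupied_path.

(** * The chain run along a path, and the inverse clock *)

Section stopped_path.
Context {R : realType}.
Variable m : {measure set (measurableTypeR R) -> \bar R}.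
Hypothesis lf : locally_finite m.
Local Notation leb := (@lebesgue_measure R).
Variables (a : R -> R) (l : R -> R -> R).
Hypothesis a_cont : continuous a.
Hypothesis l_cont : continuous2 l.
Hypothesis l_ge0 : forall y u, 0 <= l y u.
Hypothesis occ : forall (u : R) (E : set R), 0 <= u -> measurable E ->
  leb [set s : R | 0 <= s <= u /\ E (a s)] = (\int[leb]_(y in E) (l y u)%:E)%E.
Context {d : measure_display} {Omega : measurableType d}.
Implicit Types (x y u s e h N T lev dt : R).

Definition psum h dt k : R := \sum_(j < k) (dt * dens m h (a (j%:R * dt))).

Lemma psum_ge0 h dt k : 0 < h -> 0 <= dt -> 0 <= psum h dt k.
Proof. by move=> h0 dt0; apply: sumr_ge0 => j _; rewrite mulr_ge0// dens_ge0. Qed.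

(** When the increments are those of the path, the chain is the path sampled on the grid, with its
    Riemann-sum clock, up to the first index [k'] at which it is no longer alive. *)
Lemma chain_frozen (Z : nat -> Omega -> measurableTypeR R) w h N lev dt :
  (forall i, Z i w = a (i.+1%:R * dt) - a (i%:R * dt)) ->
  forall k, exists k', [/\ (k' <= k)%N,
    chain Z (stepf m h N lev dt) (a 0, 0) k w = (a (k'%:R * dt), psum h dt k'),
    forall i, (i < k')%N -> alive N lev (a (i%:R * dt), psum h dt i) &
    (k' < k)%N -> ~~ alive N lev (a (k'%:R * dt), psum h dt k')].
Proof.
move=> ZE; elim=> [|k [k' [k'k cE al nal]]].
  by exists 0%N; split => //; rewrite /= /psum big_ord0 mul0r.
rewrite /= cE /stepf /=; case: ifPn => [alk|nalk]; last first.
  by exists k'; split => //; exact: leqW.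
have E : k' = k.
  by apply/eqP; rewrite eqn_leq k'k leqNgt; apply/negP => /nal; rewrite alk.
subst k'; exists k.+1; split => //.
- by rewrite ZE /psum big_ord_recr /=; congr (_, _); ring.
- by move=> i; rewrite ltnS leq_eqVlt => /predU1P[->|]//; exact: al.
- by rewrite ltnn.
Qed.

Lemma psum_approx T h e : 0 < h -> 0 < T -> 0 < e -> exists n0, forall n k, (n0 <= n)%N -> (k <= n.+1)%N ->
  `|psum h (T / n.+1%:R) k - prim (fun s => dens m h (a s)) (k%:R * (T / n.+1%:R))| <= e.
Proof.
move=> h0 T0 e0.
have cd : continuous (fun s => dens m h (a s)).
  by move=> s; apply: (@continuous_comp _ _ _ a (dens m h)); [exact: a_cont|exact: dens_continuous].
have e1 : 0 < e / T by rewrite divr_gt0.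
have [dd dd0 Hd] := continuous_unif T cd e1.
exists (Num.truncn (T / dd)) => n k n0n kn.
have n10 : 0 < n.+1%:R :> R by rewrite ltr0n.
set dt := T / n.+1%:R; have dt0 : 0 < dt by rewrite divr_gt0.
have dtd : dt < dd.
  rewrite ltr_pdivrMr// mulrC -ltr_pdivrMr//; apply: lt_le_trans (truncnS_gt _) _.
  by rewrite ler_nat ltnS.
have kT : k%:R * dt <= T.
  by rewrite /dt mulrA ler_pdivrMr// mulrC ler_pM2l// ler_nat.
have := @prim_riemann _ (fun s => dens m h (a s)) (fun j => dens m h (a (j%:R * dt))) dt (e / T) k cd (ltW dt0).
rewrite /psum mulr_sumr distrC => H; apply: le_trans (H _) _; last first.
  by rewrite mulrA ler_pdivrMr// mulrC ler_pM2l.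
move=> j r jk /andP[r1 r2].
have jT : j.+1%:R * dt <= T by apply: le_trans kT; rewrite ler_pM2r// ler_nat.
have j0 : 0 <= j%:R * dt by rewrite mulr_ge0// ltW.
rewrite -natr1 mulrDl mul1r in r2 jT.
by apply: Hd; [rewrite ger0_norm//; lra|rewrite ger0_norm; lra].
Qed.

Lemma psum_clock T e : 0 < T -> 0 < e -> exists2 h0, 0 < h0 & forall h, 0 < h -> h <= h0 ->
  exists n0, forall n k, (n0 <= n)%N -> (k <= n.+1)%N ->
  `|psum h (T / n.+1%:R) k - clock m l (k%:R * (T / n.+1%:R))| <= e.
Proof.
move=> T0 e0; have e20 : 0 < e / 2 by lra.
have [h0 h00 Hh] := clock_approx lf a_cont l_cont l_ge0 occ (ltW T0) e20.
exists h0 => // h hp hh; have [n0 Hn] := psum_approx hp T0 e20.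
exists n0 => n k n0n kn; have g1 := Hn n k n0n kn.
have n10 : 0 < n.+1%:R :> R by rewrite ltr0n.
have := Hh h (k%:R * (T / n.+1%:R)) hp hh.
have -> : 0 <= k%:R * (T / n.+1%:R) <= T.
  rewrite mulr_ge0 ?divr_ge0 ?(ltW T0)//= mulrA ler_pdivrMr// mulrC ler_pM2l//.
  by rewrite ler_nat.
move=> /(_ isT); move: g1; move: (psum _ _ _) (prim _ _) (clock _ _ _) => p1 p2 p3.
by rewrite !ler_norml => /andP[? ?] /andP[? ?]; apply/andP; split; lra.
Qed.

(** The discrete clock follows the true one uniformly on [[0, T]], so the chain must stop, and it
    does so with both clocks near [lev]; [N0] exceeds the range of the path, which excludes stopping
    by exit. *)
Lemma conv_hit T lev e : 0 < T -> 0 < lev -> lev < clock m l T -> 0 < e ->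
  exists h0 N0, 0 < h0 /\ forall h N, 0 < h -> h <= h0 -> N0 <= N ->
  exists n0, forall n (Z : nat -> Omega -> measurableTypeR R) w, (n0 <= n)%N ->
  (forall i, Z i w = a (i.+1%:R * (T / n.+1%:R)) - a (i%:R * (T / n.+1%:R))) ->
  exists s Y, [/\ chain Z (stepf m h N lev (T / n.+1%:R)) (a 0, 0) n.+1 w = (a s, Y),
    0 <= s <= T, `|clock m l s - lev| <= e & `|Y - lev| <= e].
Proof.
move=> T0 lev0 levT e0.
pose e' := Num.min (e / 4) ((clock m l T - lev) / 4).
have e'0 : 0 < e' by rewrite lt_min !divr_gt0// subr_gt0.
have e'1 : e' <= e / 4 by rewrite ge_min lexx.
have e'2 : e' <= (clock m l T - lev) / 4 by rewrite ge_min lexx orbT.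
have [A HA] := path_bound a_cont T.
have [h0 h00 Hh] := psum_clock T0 e'0.
exists h0, (A + 1); split => // h N hp hh NA.
have [n1 Hn1] := Hh h hp hh.
have [Md HMd] := continuous_bounded A (@dens_continuous _ _ lf _ hp).
have A0 : 0 <= A by apply: le_trans (HA 0 _) => //; rewrite lexx ltW.
have Md0 : 0 <= Md by apply: le_trans (HMd 0 _); rewrite ?normr0.
(* Keeps the increment of the clock in one step, hence its overshoot above [lev], below [e']. *)
pose n2 := Num.truncn (T * (Md + 1) / e').
exists (maxn n1 n2) => n Z w; rewrite geq_max => /andP[n1n n2n] ZE.
have n10 : 0 < n.+1%:R :> R by rewrite ltr0n.
move: ZE; set dt := T / n.+1%:R => ZE; have dt0 : 0 < dt by rewrite divr_gt0.
have dtM : dt * Md <= e'.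
  have : T * (Md + 1) / e' < n.+1%:R by apply: lt_le_trans (truncnS_gt _) _; rewrite ler_nat ltnS.
  rewrite ltr_pdivrMr// => h1; rewrite /dt mulrAC ler_pdivrMr//.
  by have := T0; nra.
have [k' [k'n cE al nal]] := chain_frozen h N lev ZE n.+1.
have kT k : (k <= n.+1)%N -> 0 <= k%:R * dt <= T.
  move=> kn; rewrite mulr_ge0 ?(ltW dt0)//= /dt mulrA ler_pdivrMr// mulrC ler_pM2l//.
  by rewrite ler_nat.
have aN k : (k <= n.+1)%N -> `|a (k%:R * dt)| < N by move=> /kT /HA; lra.
have c1 := Hn1 n k' n1n k'n; rewrite -/dt in c1.
have Ylo : lev <= psum h dt k'.
  move: k'n; rewrite leq_eqVlt => /predU1P[E|k'n].
    move: c1; rewrite E; have -> : n.+1%:R * dt = T by rewrite /dt mulrC divfK// gt_eqF.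
    by rewrite ler_norml => /andP[? ?]; lra.
  have := nal k'n; rewrite /alive /= aN ?(ltnW k'n)//= psum_ge0 ?(ltW dt0)//= -leNgt.
  exact.
have Yhi : psum h dt k' <= lev + e'.
  case: k' k'n cE al nal c1 Ylo => [|i] k'n cE al nal c1 Ylo.
    by rewrite /psum big_ord0 in Ylo; lra.
  have := al i (ltnSn i); rewrite /alive /= => /and3P[_ _ Yi].
  rewrite /psum big_ord_recr /= -/(psum h dt i).
  have : dens m h (a (i%:R * dt)) <= Md.
    by apply: le_trans (ler_norm _) (HMd _ _); apply: HA; apply: kT; exact: ltnW.
  move=> h1; have : dt * dens m h (a (i%:R * dt)) <= dt * Md by rewrite ler_pM2l.
  by lra.
exists (k'%:R * dt), (psum h dt k'); split => //; first exact: kT.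
- by move: c1; rewrite !ler_norml => /andP[? ?]; apply/andP; split; lra.
- by rewrite ler_norml; apply/andP; split; lra.
Qed.

Lemma conv_stay T lev : 0 < T -> clock m l T < lev ->
  exists h0 N0, 0 < h0 /\ forall h N, 0 < h -> h <= h0 -> N0 <= N ->
  exists n0, forall n (Z : nat -> Omega -> measurableTypeR R) w, (n0 <= n)%N ->
  (forall i, Z i w = a (i.+1%:R * (T / n.+1%:R)) - a (i%:R * (T / n.+1%:R))) ->
  exists Y, chain Z (stepf m h N lev (T / n.+1%:R)) (a 0, 0) n.+1 w = (a T, Y).
Proof.
move=> T0 levT.
pose e' := (lev - clock m l T) / 2; have e'0 : 0 < e' by rewrite divr_gt0// subr_gt0.
have [A HA] := path_bound a_cont T.
have [h0 h00 Hh] := psum_clock T0 e'0.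
exists h0, (A + 1); split => // h N hp hh NA.
have [n1 Hn1] := Hh h hp hh.
exists n1 => n Z w n1n ZE.
have n10 : 0 < n.+1%:R :> R by rewrite ltr0n.
move: ZE; set dt := T / n.+1%:R => ZE; have dt0 : 0 < dt by rewrite divr_gt0.
have [k' [k'n cE al nal]] := chain_frozen h N lev ZE n.+1.
have kT k : (k <= n.+1)%N -> 0 <= k%:R * dt <= T.
  move=> kn; rewrite mulr_ge0 ?(ltW dt0)//= /dt mulrA ler_pdivrMr// mulrC ler_pM2l//.
  by rewrite ler_nat.
have aN k : (k <= n.+1)%N -> `|a (k%:R * dt)| < N by move=> /kT /HA; lra.
have c1 := Hn1 n k' n1n k'n; rewrite -/dt in c1.
have E : k' = n.+1.
  apply/eqP; rewrite eqn_leq k'n leqNgt; apply/negP => kn.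
  have := nal kn; rewrite /alive /= aN//= psum_ge0 ?(ltW dt0)//= -leNgt.
  have /andP[q1 q2] := kT k' k'n.
  have := clock_mono lf a_cont l_cont l_ge0 occ q1 q2.
  by move: c1; rewrite ler_norml /e' => /andP[? ?] ? ?; lra.
exists (psum h dt n.+1); rewrite cE E; congr (a _, _).
by rewrite /dt mulrC divfK// gt_eqF.
Qed.

Definition hit lev : R := inf [set u : R | 0 <= u /\ lev < clock m l u].

(** [hit t0] is the infimum of the times with clock above [t0]. By monotonicity, times whose clock
    is only slightly above [t0] lie just to the right of it. The clock is required to exceed [t0]
    strictly because it may rest at [t0] for a while before [hit t0]. *)
Lemma hit_near t0 e : 0 <= t0 -> (exists2 u, 0 <= u & t0 < clock m l u) -> 0 < e ->
  exists2 b, 0 < b & forall s, 0 <= s -> t0 < clock m l s -> clock m l s <= t0 + b ->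
    `|a s - a (hit t0)| <= e.
Proof.
move=> t00 [u0 u00 tu0] e0.
have hinf : has_inf [set u : R | 0 <= u /\ t0 < clock m l u].
  by split; [exists u0|exists 0 => u []].
have /continuous_epsP /(_ (hit t0) e e0) [dd dd0 Hd] := a_cont.
have [s2 [s20 ts2] s2d] := inf_adherent dd0 hinf.
exists ((clock m l s2 - t0) / 2) => [|s s0 ts sb]; first by rewrite divr_gt0// subr_gt0.
apply: Hd; have h1 : hit t0 <= s by apply: ge_inf => //; exact: (proj2 hinf).
have h2 : s < s2.
  rewrite ltNge; apply/negP => s2s.
  by have := clock_mono lf a_cont l_cont l_ge0 occ s20 s2s; lra.
by rewrite ger0_norm ?subr_ge0//; rewrite /hit in s2d h1 *; lra.
Qed.

(** If the position at [hit t0] had a null neighbourhood, then during the next moments local time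
    would grow only at levels not charged by [m]. The clock would stay constant, although it passes
    [t0] immediately after [hit t0]. *)
Lemma hit_supp t0 x : 0 <= t0 -> (exists2 u, 0 <= u & t0 < clock m l u) ->
  a (hit t0) = x -> supp m x.
Proof.
move=> t00 [u0 u00 tu0] ax; apply: contrapT => /not_supp [e e0 me].
have hinf : has_inf [set u : R | 0 <= u /\ t0 < clock m l u].
  by split; [exists u0|exists 0 => u []].
have A0 : 0 <= hit t0 by apply: lb_le_inf; [exact: (proj1 hinf)|move=> u []].
have cA : clock m l (hit t0) <= t0.
  rewrite leNgt; apply/negP => tA.
  have [A1|A1] := eqVneq (hit t0) 0; first by move: tA; rewrite A1 (clock0 m a_cont l_cont l_ge0 occ); lra.
  have A2 : 0 < hit t0 by rewrite lt_def A1.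
  have e1 : 0 < (clock m l (hit t0) - t0) / 2 by rewrite divr_gt0// subr_gt0.
  have [dd dd0 Hd] := clock_continuous lf a_cont l_cont l_ge0 occ A0 e1.
  pose s := hit t0 - Num.min (dd / 2) (hit t0).
  have m1 : Num.min (dd / 2) (hit t0) <= dd / 2 by rewrite ge_min lexx.
  have m2 : Num.min (dd / 2) (hit t0) <= hit t0 by rewrite ge_min lexx orbT.
  have m3 : 0 < Num.min (dd / 2) (hit t0) by rewrite lt_min A2 divr_gt0.
  have s0 : 0 <= s by rewrite /s; lra.
  have := Hd s s0 ltac:(rewrite /s ltr_norml; lra); rewrite ler_norml => /andP[h1 _].
  have : hit t0 <= s by apply: ge_inf; [exact: (proj2 hinf)|split => //; lra].
  by rewrite /s; lra.
have e20 : 0 < e / 2 by lra.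
have /continuous_epsP /(_ (hit t0) _ e20) [dd dd0 Hd] := a_cont.
have [s2 [s20 ts2] s2d] := inf_adherent dd0 hinf.
have As2 : hit t0 <= s2 by apply: ge_inf => //; exact: (proj2 hinf).
have eqc : clock m l s2 = clock m l (hit t0); last by rewrite eqc in ts2; lra.
apply/eqP; rewrite -subr_eq0 /clock !posE//.
have [A HA] := path_bound a_cont s2.
have c1 := l_cc a_cont l_cont l_ge0 occ HA (u := s2) ltac:(by rewrite s20 lexx).
have c2 := l_cc a_cont l_cont l_ge0 occ HA (u := hit t0) ltac:(by rewrite A0).
rewrite -(cc_RintB lf c1 c2); apply/eqP.
have far y : (y <= x - e) \/ (x + e <= y) -> l y s2 - l y (hit t0) = 0.
  move=> hy; apply/eqP; rewrite subr_eq0; apply/eqP.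
  apply: (l_const a_cont l_cont l_ge0 occ A0 As2 e20) => r /andP[r1 r2].
  have : `|a r - x| <= e / 2.
    by rewrite -ax; apply: Hd; rewrite ger0_norm ?subr_ge0//; rewrite /hit in s2d r1 *; lra.
  rewrite ler_norml => /andP[h1 h2]; rewrite ler_normr.
  by case: hy => hy; apply/orP; [left|right]; lra.
apply: (@Rint_null_itv _ m (x - e) (x + e)) => //.
- by move=> y hy; apply: far; left.
- by move=> y hy; apply: far; right.
- exact: (proj1 (ccB c1 c2)).
Qed.

End stopped_path.

(** * Fatou's lemma and supersolutions *)

Section fatou_bound.
Context {R : realType} {d : measure_display} {T : measurableType d}.
Variable mu : {measure set T -> \bar R}.

(** [G] is the pointwise lower limit. Packaged this way, limits are taken path by path through the
    last clause, and the expectation bound survives each of several successive passages. *)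
Lemma fatou_bound (F : nat -> T -> \bar R) (c : R) :
  (forall n, measurable_fun setT (F n)) -> (forall n w, 0 <= F n w)%E ->
  (forall e : R, 0 < e -> exists n0, forall n, (n0 <= n)%N -> (\int[mu]_w F n w <= (c + e)%:E)%E) ->
  exists G : T -> \bar R, [/\ measurable_fun setT G, forall w, (0 <= G w)%E, (\int[mu]_w G w <= c%:E)%E &
    forall w a, (exists n0, forall n, (n0 <= n)%N -> (a <= F n w)%E) -> (a <= G w)%E].
Proof.
move=> mF F0 Fc; pose G w := limn_einf (F^~ w).
have Glb w a : (exists n0, forall n, (n0 <= n)%N -> (a <= F n w)%E) -> (a <= G w)%E.
  move=> [n0 H]; rewrite /G limn_einf_lim; apply: lime_ge; first exact: is_cvg_einfs.
  exists n0 => // n /= n0n; apply: le_ereal_inf_tmp => _ [k /= nk <-].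
  by apply: H; exact: leq_trans nk.
exists G; split => //.
- have -> : G = (\- (fun w => limn_esup (fun n => - F n w)))%E by apply/funext => w; rewrite /G /limn_einf.
  apply: measurableT_comp => //; apply: measurable_fun_limn_esup => n.
  exact: measurableT_comp.
- by move=> w; apply: Glb; exists 0%N.
- apply: (le_trans (fatou mu measurableT mF (fun n w _ => F0 n w))).
  apply/lee_addgt0Pr => e e0; have [n0 H] := Fc e e0; rewrite -EFinD limn_einf_lim.
  apply: lime_le; first exact: is_cvg_einfs.
  exists n0 => // n /= n0n; apply: (@le_trans _ _ (\int[mu]_w F n w)%E); last exact: H.
  by apply: ereal_inf_lbound; exists n => /=.
Qed.

End fatou_bound.

Section supersolutions.
Context {R : realType}.
Variable m : {measure set (measurableTypeR R) -> \bar R}.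
Local Notation leb := (@lebesgue_measure R).

(* [u] is a supersolution of the heat equation on [-th, t] with [q] the
   density of the second derivative of [u] with respect to [m] and [v] a lower
   bound of the time derivative. *)
Definition supersol (u q v : R -> R -> R) (th t : R) :=
  [/\ [/\ continuous2 u, continuous2 q & continuous2 v],
      forall r, - th <= r <= t -> Rel m (u^~ r) (q^~ r),
      forall x r, - th <= r <= t -> q x r <= v x r,
      forall x r' r k, - th <= r' -> r' <= r -> r <= t ->
        (forall w, r' <= w <= r -> k <= v x w) -> (r - r') * k <= u x r - u x r' &
      forall x r, - th <= r <= t -> 0 <= u x r].

Lemma supersol_sub u q v th t t' : t' <= t -> supersol u q v th t -> supersol u q v th t'.
Proof.
move=> tt [cc rl qv ud u0]; split => //.
- by move=> r /andP[h1 h2]; apply: rl; rewrite h1 (le_trans h2).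
- by move=> x r /andP[h1 h2]; apply: qv; rewrite h1 (le_trans h2).
- by move=> x r' r k h1 h2 h3; apply: ud => //; exact: le_trans h3 tt.
- by move=> x r /andP[h1 h2]; apply: u0; rewrite h1 (le_trans h2).
Qed.

Definition occupied (a : R -> R) (l : R -> R -> R) :=
  [/\ continuous a, continuous2 l, forall y u, 0 <= l y u &
      forall (u : R) (E : set R), 0 <= u -> measurable E ->
        leb [set s : R | 0 <= s <= u /\ E (a s)] = (\int[leb]_(y in E) (l y u)%:E)%E].

End supersolutions.

(** * Supersolutions along the Brownian path stopped at a clock level *)

Section level.
Context {R : realType}.
Variable m : {measure set (measurableTypeR R) -> \bar R}.
Hypothesis lf : locally_finite m.
Context {d : measure_display} {Omega : measurableType d}.
Variable P : probability Omega R.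
Variable B : R -> {RV P >-> R}.
Hypothesis bm : brownian_motion B.
Variable x : R.

Definition bpath (w : Omega) (s : R) : R := x + B (pos s) w.

Lemma measurable_stepf h N t dt : 0 < h ->
  measurable_fun setT (stepf m h N t dt : (measurableTypeR R * measurableTypeR R) * measurableTypeR R ->
     measurableTypeR R * measurableTypeR R).
Proof.
move=> h0; apply: measurable_fun_ifT.
- have m1 : measurable_fun setT (fun p : (measurableTypeR R * measurableTypeR R) * measurableTypeR R => p.1.1).
    exact: measurableT_comp measurable_fst measurable_fst.
  have m2 : measurable_fun setT (fun p : (measurableTypeR R * measurableTypeR R) * measurableTypeR R => p.1.2).
    exact: measurableT_comp measurable_snd measurable_fst.
  apply: measurable_and; first by apply: measurable_fun_ltr => //; exact: measurableT_comp.
  by apply: measurable_and; [exact: measurable_fun_ler|exact: measurable_fun_ltr].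
- have m1 : measurable_fun setT (fun p : (measurableTypeR R * measurableTypeR R) * measurableTypeR R => p.1.1).
    exact: measurableT_comp measurable_fst measurable_fst.
  have m2 : measurable_fun setT (fun p : (measurableTypeR R * measurableTypeR R) * measurableTypeR R => p.1.2).
    exact: measurableT_comp measurable_snd measurable_fst.
  apply: measurable_fun_pair; first by apply: measurable_funD => //; exact: measurable_snd.
  apply: measurable_funD => //; apply: measurable_funM; first exact: measurable_cst.
  apply: measurableT_comp m1; apply: continuous_measurable_fun; exact: (@dens_continuous _ _ lf h h0).
- exact: measurable_fst.
Qed.

Lemma clamp_abs (th t r : R) : 0 < th -> 0 <= t -> `|clamp (- th) t r| <= `|r|.
Proof.
move=> th0 t0; have tt : - th < t by lra.
have [h|h] := leP r (- th); first by rewrite clamp_lo// !ler0_norm; lra.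
have [h'|h'] := leP t r; first by rewrite clamp_hi// !ger0_norm; lra.
by rewrite clampE// !ltW.
Qed.

(** The supermartingale bound for the sampled chain is passed through two Fatou limits: first the
    time mesh T/(n+1) tends to 0, then with [j] the smearing scale tends to 0 and the spatial bound
    to infinity. The two clauses describe a path whose clock passes [t] before [T], and a path whose
    clock does not reach [t]. *)
Lemma level_bound u q v th t T : supersol m u q v th t -> 0 < th -> 0 < t -> 0 < T ->
  exists G : Omega -> \bar R,
    [/\ measurable_fun setT G, forall w, (0 <= G w)%E, (\int[P]_w G w <= (u x t)%:E)%E &
    forall w l, occupied (bpath w) l ->
      (t < clock m l T -> forall c e, 0 < e ->
         (forall s z r, 0 <= s <= T -> `|clock m l s - t| <= e -> `|z - bpath w s| <= e -> `|r| <= e -> c <= u z r) ->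
         (c%:E <= G w)%E) /\
      (clock m l T < t -> forall c e, 0 < e ->
         (forall z r, `|z - bpath w T| <= e -> - th <= r <= t -> c <= u z r) -> (c%:E <= G w)%E)].
Proof.
move=> [[cu cq cv] rl qv ud u0] th0 t0 T0; have t0' := ltW t0.
have [B0 Bc Bi Bl] := bm.
pose N j : R := j.+1%:R; pose osc j : R := j.+1%:R^-1.
have N0 j : 0 < N j by rewrite ltr0n.
have o0 j : 0 < osc j by rewrite invr_gt0 ltr0n.
(* The scale [h j] is chosen so small that [q] and [v] oscillate by at most [osc j] over distance
   [h j] inside the ball of radius [N j]. *)
have hex j : exists h, [/\ 0 < h, h <= osc j,
    forall x y r, `|x| <= N j -> `|y - x| <= h -> - th <= r <= t -> q y r <= q x r + osc j &
    forall x y r, `|x| <= N j -> `|y - x| <= h -> - th <= r <= t -> v x r - osc j <= v y r].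
  have [d1 d10 H1] := continuous2_unif (N j + th + t) cq (o0 j).
  have [d2 d20 H2] := continuous2_unif (N j + th + t) cv (o0 j).
  have Nj := N0 j.
  exists (Num.min (osc j) (Num.min (d1 / 2) (d2 / 2))); split.
  - by rewrite !lt_min o0 !divr_gt0.
  - by rewrite ge_min lexx.
  - move=> z y r zN; rewrite !le_min => /and3P[_ zy _] /andP[r1 r2].
    have := H1 z r y r ltac:(lra) ltac:(rewrite ler_norml; lra) ltac:(lra) ltac:(rewrite subrr normr0//).
    by rewrite ler_norml; lra.
  - move=> z y r zN; rewrite !le_min => /and3P[_ _ zy] /andP[r1 r2].
    have := H2 z r y r ltac:(lra) ltac:(rewrite ler_norml; lra) ltac:(lra) ltac:(rewrite subrr normr0//).
    by rewrite ler_norml; lra.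
have {hex}[h hP] := choice hex.
pose dt n : R := T / n.+1%:R.
have dt0 n : 0 < dt n by rewrite divr_gt0.
pose Z n i w : measurableTypeR R := B (i.+1%:R * dt n) w - B (i%:R * dt n) w.
pose F j n w := (Gf (h j) (N j) t th u (osc j)
   (chain (Z n) (stepf m (h j) (N j) t (dt n)) (x, 0) n.+1 w))%:E.
have mZ n i : measurable_fun setT (Z n i) by apply: measurable_funB; exact: measurable_funPT.
have mS j n := measurable_stepf (N j) t (dt n) (let: And4 hh _ _ _ := hP j in hh).
have G0 j s : 0 <= Gf (h j) (N j) t th u (osc j) s.
  by have [hh _ _ _] := hP j; apply: Gf_ge0 => //; exact: ltW.
have mG j : measurable_fun setT (fun s : measurableTypeR R * measurableTypeR R =>
     (Gf (h j) (N j) t th u (osc j) s)%:E).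
  have [hh _ _ _] := hP j; apply/measurable_EFinP.
  apply: (@measurable_continuous2 _ (fun y r => Gf (h j) (N j) t th u (osc j) (y, r))).
  have cc : continuous2 (fun y r => avg (h j) (Uc (h j) (N j) t th u (t - r)) y).
    apply: (@continuous2_swap _ (fun r y => avg (h j) (Uc (h j) (N j) t th u (t - r)) y)).
    apply: (@continuous2_comp1 _ (fun r y => avg (h j) (Uc (h j) (N j) t th u r) y) (fun r => t - r)).
      exact: (continuous2_swap (@avg_Uc_continuous2 _ _ hh (N j) t th u (N0 j) t0' th0 cu)).
    by move=> r; apply: cvgB; [exact: cvg_cst|exact: cvg_id].
  have cp : continuous2 (fun _ r : R => 3 * osc j * pos (t + 1 - r)).
    apply: (@continuous2_swap _ (fun r _ => 3 * osc j * pos (t + 1 - r))); apply: continuous2_fst.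
    move=> r; apply: cvgM; first exact: cvg_cst.
    apply: (@continuous_comp _ _ _ (fun r => t + 1 - r) (@pos R)); last exact: pos_continuous.
    by apply: cvgB; [exact: cvg_cst|exact: cvg_id].
  by move=> p; apply: cvgD; [exact: cc|exact: cp].
have mF j n : measurable_fun setT (F j n).
  exact: (measurableT_comp (mG j) (@chain_meas _ _ _ _ (measurableTypeR R * measurableTypeR R)%type _ (mZ n) _ (x, 0) (mS j n) n.+1)).
have F0 j n w : (0 <= F j n w)%E by rewrite lee_fin G0.
have Fint j e : 0 < e -> exists n0, forall n, (n0 <= n)%N ->
    (\int[P]_w F j n w <= (Gf (h j) (N j) t th u (osc j) (x, 0) + e)%:E)%E.
  move=> e0; have [hh _ oq ov] := hP j; have eT : 0 < e / T by rewrite divr_gt0.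
  have [d0 d00 H] := one_step lf hh (N0 j) t0' th0 cu cq cv rl qv ud u0 (ltW (o0 j)) oq ov eT.
  exists (Num.bound (T / d0)) => n n0n.
  have dtd : dt n <= d0.
    rewrite /dt ler_pdivrMr ?ltr0n// mulrC -ler_pdivrMr//.
    apply: (le_trans (ltW (archi_boundP (ltW (divr_gt0 T0 d00))))); rewrite ler_nat; exact: leq_trans n0n _.
  have dts i : i.+1%:R * dt n - i%:R * dt n = dt n by rewrite -mulrBl -natrB// subSnn mul1r.
  apply: le_trans (@chain_supermartingale _ _ _ _ (measurableTypeR R * measurableTypeR R)%type P (normal_prob 0 (Num.sqrt (dt n))) n.+1 (Z n) (mZ n)
    _ _ (stepf m (h j) (N j) t (dt n)) (x, 0) (mS j n) _ (dt n * (e / T)) (mG j) _ _ _ n.+1 (leqnn _)) _.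
  - move=> i E _ mE; rewrite -(dts i); apply: Bl => //; first by rewrite mulr_ge0// ltW.
    by rewrite ltr_pM2r// ltr_nat.
  - apply: (Bi n.+1 (fun i => i%:R * dt n)); first by rewrite mul0r.
    by move=> i; rewrite ler_pM2r// ler_nat.
  - by move=> s; rewrite lee_fin G0.
  - by rewrite mulr_ge0 ?ltW.
  - by move=> s; apply: H; rewrite dt0.
  rewrite -EFinD lee_fin (_ : n.+1%:R * (dt n * (e / T)) = e)// /dt.
  by field; rewrite (gt_eqF T0) nat1r pnatr_eq0.
have [Gj GjP] := choice (fun j => fatou_bound (mF j) (F0 j) (Fint j)).
have arch (e : R) : 0 < e -> exists j0, forall j, (j0 <= j)%N -> osc j <= e /\ e^-1 <= N j.
  move=> e0; exists (Num.bound e^-1) => j jj.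
  have h1 : e^-1 <= N j.
    apply: (le_trans (ltW (archi_boundP (ltW (_ : 0 < e^-1))))); first by rewrite invr_gt0.
    by rewrite ler_nat; exact: leq_trans jj _.
  by split => //; rewrite /osc -(invrK e) lef_pV2 ?posrE ?invr_gt0//; exact: N0.
have Ucx j y r z : `|z| <= N j -> `|y - z| <= h j ->
    Uc (h j) (N j) t th u r y = u y (clamp (- th) t r).
  move=> zN yz; have [hh _ _ _] := hP j; have Nj := N0 j; rewrite /Uc clampE//.
  by have := ler_normD (y - z) z; rewrite subrK => yy; rewrite -ler_norml; lra.
have cUc j r : continuous (Uc (h j) (N j) t th u r).
  by have [hh _ _ _] := hP j; exact: (@Uc_continuous _ _ hh (N j) t th u (N0 j) t0' th0 cu).
(* The starting value of [Gf], an average around [x] plus the compensator, tends to [u x t]. *)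
have Gint e : 0 < e -> exists j0, forall j, (j0 <= j)%N -> (\int[P]_w Gj j w <= (u x t + e)%:E)%E.
  move=> e0.
  have /continuous_epsP /(_ x (e / 2) ltac:(lra)) [b b0 Hb] := continuous2_slice1 (t := t) cu.
  pose e1 := Num.min (b / 2) (Num.min (`|x| + 1)^-1 (e / (6 * (t + 1)))).
  have x1 : 0 < `|x| + 1 by have := normr_ge0 x; lra.
  have t6 : 0 < 6 * (t + 1) by lra.
  have e10 : 0 < e1 by rewrite !lt_min invr_gt0 x1 !divr_gt0.
  have [j0 Hj] := arch e1 e10; exists j0 => j /Hj [oj Nj].
  have [_ _ + _] := GjP j; move/le_trans; apply; rewrite lee_fin /Gf /= !subr0.
  have [hh ho _ _] := hP j.
  move: oj; rewrite !le_min => /and3P[ob ox oe].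
  have xN : `|x| <= N j.
    have : (`|x| + 1) <= N j.
      rewrite -(invrK (`|x| + 1)); apply: le_trans Nj.
      by rewrite lef_pV2 ?posrE ?invr_gt0// /e1 !ge_min lexx orbT.
    by lra.
  have A1 : avg (h j) (Uc (h j) (N j) t th u t) x <= u x t + e / 2.
    apply: (avg_le hh (@cUc j t)) => y yx; rewrite (Ucx j y t x xN yx) clampE; last by lra.
    by have := Hb y ltac:(lra); rewrite ler_norml; lra.
  have A2 : 3 * osc j * pos (t + 1) <= e / 2.
    rewrite posE; last lra.
    move: oe; rewrite ler_pdivlMr// => oe; rewrite (_ : 3 * _ * _ = (osc j * (6 * (t + 1))) / 2); last by field.
    by lra.
  by move: A1 A2; move: (avg _ _ _) (3 * _ * _) => p1 p2; lra.
have [G [mGG GG0 Gu Glb]] := fatou_bound (fun j => let: And4 h _ _ _ := GjP j in h)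
   (fun j => let: And4 _ h _ _ := GjP j in h) Gint.
exists G; split => // w l [ac lc l0 occ].
have Zw n i : Z n i w = bpath w (i.+1%:R * (T / n.+1%:R)) - bpath w (i%:R * (T / n.+1%:R)).
  by rewrite /Z /bpath !posE ?mulr_ge0 ?divr_ge0 ?(ltW T0)//; ring.
have a0 : bpath w 0 = x by rewrite /bpath pos0// B0 addr0.
have Glow j n a s Y c : chain (Z n) (stepf m (h j) (N j) t (T / n.+1%:R)) (bpath w 0, 0) n.+1 w = (a, Y) ->
    `|a| <= N j -> (forall z, `|z - a| <= osc j -> c <= u z (clamp (- th) t (t - Y))) -> s = w ->
    (c%:E <= F j n s)%E.
  move=> ch aN H ->; rewrite a0 in ch; have [hh ho _ _] := hP j.
  rewrite lee_fin ch /Gf /=; apply: (@le_trans _ _ (avg (h j) (Uc (h j) (N j) t th u (t - Y)) a)).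
    apply: (avg_ge hh (@cUc j _)) => y ya; rewrite (Ucx j y _ a aN ya); apply: H; exact: le_trans ho.
  by rewrite lerDl !mulr_ge0 ?pos_ge0// ltW.
have [A HA] := path_bound ac T.
split=> [tT|tT] c e e0 H.
  have [h0 [N1 [h00 Hh]]] := conv_hit lf ac lc l0 occ (Omega := Omega) T0 t0 tT e0.
  pose e1 := Num.min (Num.min e h0) (`|A| + `|N1| + 1)^-1.
  have AN : 0 < `|A| + `|N1| + 1 by have := normr_ge0 A; have := normr_ge0 N1; lra.
  have e10 : 0 < e1 by rewrite !lt_min invr_gt0 AN e0 h00.
  have [j0 Hj] := arch e1 e10; apply: Glb; exists j0 => j /Hj [oj Nj].
  have [hh ho _ _] := hP j.
  move: oj; rewrite !le_min => /andP[/andP[oe oh] _].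
  have NA : `|A| + `|N1| + 1 <= N j.
    rewrite -(invrK (_ + 1)); apply: le_trans Nj.
    by rewrite lef_pV2 ?posrE ?invr_gt0// /e1 !ge_min lexx orbT.
  have NA1 := ler_norm A; have NA2 := ler_norm N1; have NA3 := normr_ge0 A; have NA4 := normr_ge0 N1.
  have [n0 Hn] := Hh (h j) (N j) hh ltac:(lra) ltac:(lra).
  have [_ _ _ Gl] := GjP j; apply: Gl; exists n0 => n n0n.
  have [s [Y [ch sT cs Ye]]] := Hn n (Z n) w n0n (Zw n).
  apply: (Glow j n _ _ _ _ ch) => //; first by have := HA s sT; lra.
  move=> z zs; apply: (H s) => //; first by lra.
  by apply: le_trans (clamp_abs _ th0 t0') _; rewrite distrC.
have [h0 [N1 [h00 Hh]]] := conv_stay lf ac lc l0 occ (Omega := Omega) T0 tT.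
pose e1 := Num.min (Num.min e h0) (`|A| + `|N1| + 1)^-1.
have AN : 0 < `|A| + `|N1| + 1 by have := normr_ge0 A; have := normr_ge0 N1; lra.
have e10 : 0 < e1 by rewrite !lt_min invr_gt0 AN e0 h00.
have [j0 Hj] := arch e1 e10; apply: Glb; exists j0 => j /Hj [oj Nj].
have [hh ho _ _] := hP j.
move: oj; rewrite !le_min => /andP[/andP[oe oh] _].
have NA : `|A| + `|N1| + 1 <= N j.
  rewrite -(invrK (_ + 1)); apply: le_trans Nj.
  by rewrite lef_pV2 ?posrE ?invr_gt0// /e1 !ge_min lexx orbT.
have NA1 := ler_norm A; have NA2 := ler_norm N1; have NA3 := normr_ge0 A; have NA4 := normr_ge0 N1.
have [n0 Hn] := Hh (h j) (N j) hh ltac:(lra) ltac:(lra).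
have [_ _ _ Gl] := GjP j; apply: Gl; exists n0 => n n0n.
have [Y ch] := Hn n (Z n) w n0n (Zw n).
apply: (Glow j n _ _ _ _ ch) => //; first by have := HA T ltac:(by rewrite lexx ltW); lra.
move=> z zs; apply: H; first by lra.
by apply: clampI; lra.
Qed.

End level.

(** * Paths of the generalized diffusion *)

Section lebesgue_translation.
Context {R : realType}.
Local Notation leb := (@lebesgue_measure R).

Lemma ge0_integral_translation (x : R) (E : set R) (f : R -> \bar R) : measurable E ->
  measurable_fun setT (f : measurableTypeR R -> \bar R) -> (forall y, 0 <= f y)%E ->
  (\int[leb]_(y in E) f y = \int[leb]_(z in [set z | E (x + z)%R]) f (x + z)%R)%E.
Proof.
move=> mE mf f0; pose tau (z : measurableTypeR R) : measurableTypeR R := x + z.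
have mtau : measurable_fun setT tau by apply: measurable_funD.
have eqm A : measurable A -> pushm leb mtau A = leb A.
  move=> mA; have itv a b : leb (tau @^-1` `]a, b]%classic) = leb `]a, b]%classic.
    rewrite (_ : tau @^-1` _ = `](a - x), (b - x)]%classic); last first.
      by apply/seteqP; split => z; rewrite /tau /= !in_itv/= => /andP[h1 h2]; apply/andP; split; lra.
    rewrite !lebesgue_measure_itv/= !lte_fin ltrD2r; case: ifP => // _.
    by rewrite -!EFinB; congr EFin; ring.
  apply/esym/lebesgue_measure_unique => //= _ [[a b]] _ <-.
  by first [exact: itv|exact: (esym (itv _ _))].
transitivity (\int[pushm leb mtau]_(y in E) f y)%E.
  by apply: eq_measure_integral => A mA _; rewrite eqm.
rewrite (@ge0_integral_pushforward _ _ _ _ R tau mtau leb E f mE)//.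
exact: measurable_funTS.
Qed.

End lebesgue_translation.

Section diffusion_paths.
Context {R : realType}.
Variable m : {measure set (measurableTypeR R) -> \bar R}.
Hypothesis lf : locally_finite m.
Local Notation leb := (@lebesgue_measure R).
Context {d : measure_display} {Omega : measurableType d}.
Variable P : probability Omega R.
Variables (B : R -> {RV P >-> R}) (L : R -> R -> {RV P >-> R}).
Hypothesis bm : brownian_motion B.
Hypothesis lt : local_time B L.
Variable x : R.

Definition good (w : Omega) : Prop := forall (u : R) (E : set R), 0 <= u -> measurable E ->
  leb [set s : R | 0 <= s <= u /\ E (B s w)] = (\int[leb]_(y in E) (L y u w)%:E)%E.

Definition lpath (w : Omega) (y s : R) : R := L (y - x) (pos s) w.

Lemma bpath_continuous w : continuous (bpath B x w).
Proof.
have [_ Bc _ _] := bm; apply/continuous_epsP => t e e0.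
have := iffLR (subspace_continuousP _ _) (Bc w) (pos t) (pos_ge0 t).
move=> /cvgrPdist_le /(_ e e0); rewrite /within /= => /nbhs_ballP [b /= b0 Hb].
exists b => // s st; rewrite /bpath (_ : x + _ - _ = B (pos s) w - B (pos t) w); last ring.
rewrite distrC; apply: (Hb (pos s)); last exact: pos_ge0.
by rewrite /ball /= distrC; exact: le_lt_trans (pos_lip _ _) st.
Qed.

Lemma lpath_continuous2 w : continuous2 (lpath w).
Proof.
have [Lc _ _] := lt; apply/continuous2_epsP => y t e e0.
have := iffLR (subspace_continuousP _ _) (Lc w) (y - x, pos t) (pos_ge0 t).
move=> /cvgrPdist_le /(_ e e0); rewrite /within /= => /nbhs_ballP [b /= b0 Hb].
exists b => // y' t' hy ht; rewrite distrC; apply: (Hb (y' - x, pos t')); last exact: pos_ge0.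
split; rewrite /ball /= distrC; last exact: le_lt_trans (pos_lip _ _) ht.
by rewrite (_ : y' - x - (y - x) = y' - y) //; ring.
Qed.

Lemma lpath_ge0 w y s : 0 <= lpath w y s.
Proof. by have [_ + _] := lt; apply; exact: pos_ge0. Qed.

Lemma good_occupied w : good w -> occupied (bpath B x w) (lpath w).
Proof.
move=> gw; split; [exact: bpath_continuous|exact: lpath_continuous2|exact: lpath_ge0|].
move=> u E u0 mE.
have mtau : measurable_fun setT (fun z : measurableTypeR R => x + z : measurableTypeR R).
  by apply: measurable_funD.
have mE' : measurable [set z : measurableTypeR R | E (x + z)].
  by rewrite -[X in measurable X]setTI; exact: mtau.
rewrite (ge0_integral_translation x mE) //; last 2 first.
- apply/measurable_EFinP; apply: continuous_measurable_fun.
  exact: (continuous2_slice1 (t := u) (@lpath_continuous2 w)).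
- by move=> y; rewrite lee_fin lpath_ge0.
rewrite /lpath posE//; under eq_integral do rewrite addrAC subrr add0r.
rewrite -gw//; congr (leb _); apply/seteqP; split => s [/andP[s0 su] h].
  by move: h; rewrite /bpath posE// => h; split => //; apply/andP.
by split; [apply/andP|rewrite /bpath posE].
Qed.

Lemma Gamma_clock w s : good w -> 0 <= s -> Gamma m L x s w = (clock m (lpath w) s)%:E.
Proof.
move=> /good_occupied [ac lc l0 occ] s0.
have [A HA] := path_bound ac s.
have ccl := l_cc ac lc l0 occ HA (u := s) ltac:(by rewrite s0 lexx).
rewrite /clock /Gamma /Rintegral fineK.
  by rewrite posE//; apply: eq_integral => y _; rewrite /lpath posE.
by rewrite posE//; apply: integrable_fin_num => //; exact: (cc_integrable lf ccl).
Qed.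

Lemma inverse_clock_hit w t : good w -> inverse_clock m L x t w = hit m (lpath w) t.
Proof.
move=> gw; rewrite /inverse_clock /hit; congr inf; apply/seteqP; split => u [u0].
  by rewrite Gamma_clock// lte_fin.
by move=> h; split => //; rewrite Gamma_clock// lte_fin.
Qed.

Lemma inverse_clock_ge0 w t : 0 <= inverse_clock m L x t w.
Proof.
rewrite /inverse_clock; set S := [set _ | _].
have [[s Ss]|S0] := pselect (S !=set0); first by apply: lb_le_inf; [exists s|move=> u []].
by rewrite inf_out// => -[].
Qed.

Lemma diffusion_bpath w t : diffusion m B L x t w = bpath B x w (inverse_clock m L x t w).
Proof. by rewrite /diffusion /bpath posE//; exact: inverse_clock_ge0. Qed.

Lemma Gamma_measurable u : 0 <= u -> measurable_fun setT (Gamma m L x u).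
Proof.
move=> u0.
pose f (p : Omega * measurableTypeR R) := (L (p.2 - x) u p.1)%:E.
have mf : measurable_fun setT f.
  apply/measurable_EFinP; apply: (@measurable_caratheodory _ _ _ (fun w y => L (y - x) u w)).
    by move=> y; exact: measurable_funPT.
  move=> w; have := continuous2_slice1 (t := u) (@lpath_continuous2 w).
  by rewrite /lpath posE.
have f0 p : (0 <= f p)%E by rewrite lee_fin; have [_ + _] := lt; apply.
exact: (@measurable_fun_fubini_tonelli_F _ _ _ _ R (sfm lf) f mf f0).
Qed.

(** Valid for every [w], also where the occupation formula fails and [Gamma] may be infinite: it is
    Fatou's lemma with respect to [m]. The measurability of the inverse clock on all of [Omega]
    rests on it. *)
Lemma Gamma_lsc u w t : 0 <= u -> (t%:E < Gamma m L x u w)%E ->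
  exists2 e, 0 < e & forall s, 0 <= s -> `|s - u| < e -> (t%:E < Gamma m L x s w)%E.
Proof.
move=> u0 tu; apply: contrapT => H.
have {}H k : exists s, [/\ 0 <= s, `|s - u| < k.+1%:R^-1 & (Gamma m L x s w <= t%:E)%E].
  apply: contrapT => Hk; apply: H; exists k.+1%:R^-1 => [|s s0 su]; first by rewrite invr_gt0 ltr0n.
  by rewrite ltNge; apply/negP => h; apply: Hk; exists s.
have [s sP] := choice H.
have mF n : measurable_fun setT (fun y : measurableTypeR R => (L (y - x) (s n) w)%:E).
  apply/measurable_EFinP; apply: continuous_measurable_fun.
  have := continuous2_slice1 (t := s n) (@lpath_continuous2 w).
  by have [h _ _] := sP n; rewrite /lpath posE.
have F0 n (y : measurableTypeR R) : (0 <= (L (y - x) (s n) w)%:E)%E.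
  by rewrite lee_fin; have [_ + _] := lt; apply; have [] := sP n.
have [|G [mG G0 Gt Gl]] := fatou_bound (mu := m) (c := t) mF F0.
  move=> e e0; exists 0%N => n _; have [_ _ h] := sP n; apply: le_trans h _.
  by rewrite lee_fin lerDl ltW.
suff : (Gamma m L x u w <= t%:E)%E by rewrite leNgt tu.
apply: le_trans Gt; apply: ge0_le_integral => //.
- by move=> y _; rewrite lee_fin; have [_ + _] := lt; apply.
- apply/measurable_EFinP; apply: continuous_measurable_fun.
  have := continuous2_slice1 (t := u) (@lpath_continuous2 w).
  by rewrite /lpath posE.
move=> y _; apply/lee_addgt0Pr => e e0; rewrite -leeBlDr// -EFinB; apply: Gl.
have /continuous_epsP /(_ u e e0) [b b0 Hb] := continuous2_slice2 (x := y) (@lpath_continuous2 w).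
exists (Num.bound b^-1) => n nb; have [sn0 sn _] := sP n.
have : `|s n - u| < b.
  apply: (lt_le_trans sn); rewrite -(invrK b) lef_pV2 ?posrE ?invr_gt0//.
  apply: (le_trans (ltW (archi_boundP (ltW (_ : 0 < b^-1))))); first by rewrite invr_gt0.
  by rewrite ler_nat; exact: leq_trans nb _.
by move=> /Hb; rewrite /lpath !posE// lee_fin ler_norml; lra.
Qed.

Lemma inverse_clock_measurable t : measurable_fun setT (inverse_clock m L x t : Omega -> measurableTypeR R).
Proof.
pose V (q : R) : set Omega := if 0 <= q then [set w | (t%:E < Gamma m L x q w)%E] else set0.
have mV q : measurable (V q).
  rewrite /V; case: ifP => // q0; have := emeasurable_fun_o_infty measurableT (Gamma_measurable q0) t%:E.
  by rewrite setTI.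
pose S w := [set u : R | 0 <= u /\ (t%:E < Gamma m L x u w)%E].
have dense w u c : S w u -> u < c -> exists q : rat, [/\ ratr q < c & V (ratr q) w].
  move=> [u0 tu] uc; have [e e0 He] := Gamma_lsc u0 tu.
  have [q] := @rat_in_itvoo _ u (Num.min c (u + e)) ltac:(by rewrite lt_min uc ltrDl).
  rewrite in_itv/= lt_min => /andP[q1 /andP[q2 q3]]; exists q; split => //.
  have q0 : 0 <= ratr q :> R := le_trans u0 (ltW q1).
  by rewrite /V q0; apply: He => //; rewrite gtr0_norm; lra.
have VS w (q : R) : V q w -> S w q by rewrite /V; case: ifP.
first [apply: (measurability (RGenInftyO.measurableE R))|apply: (measurability _ (RGenInftyO.measurableE R))|apply: (measurability (RGenInftyO.G R)); first exact: RGenInftyO.measurableE].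
move=> _ [_ [c ->] <-]; rewrite setTI.
(* By lower semicontinuity rational times detect both whether the infimum is below [c] ([U1]) and
   whether the set is nonempty ([U2]); off [U2] the inverse clock has the default value 0. *)
pose U1 := \bigcup_(q : rat) (if ratr q < c then V (ratr q) else set0).
pose U2 := \bigcup_(q : rat) (V (ratr q)).
have mU1 : measurable U1 by apply: bigcupT_measurable_rat => q; case: ifP.
have mU2 : measurable U2 by apply: bigcupT_measurable_rat => q.
have -> : inverse_clock m L x t @^-1` `]-oo, c[%classic = U1 `|` (if 0 < c then ~` U2 else set0).
  apply/seteqP; split => w; rewrite /= in_itv/=.
    have [[s Ss]|S0] := pselect (S w !=set0).
      move=> h; left; have hi : has_inf (S w) by split; [exists s|exists 0 => u []].
      have [|u Su uc] := inf_adherent (eps := c - inf (S w)) _ hi; first by rewrite subr_gt0.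
      have [q [qc qV]] := dense w u c Su ltac:(by move: uc; rewrite addrC subrK).
      by exists q => //; rewrite qc.
    rewrite /inverse_clock inf_out; last by move=> [].
    move=> c0; right; rewrite c0 => -[q _ /VS h]; by apply: S0; exists (ratr q).
  case=> [[q _]|].
    case: ifP => // qc /VS Sq; apply: le_lt_trans qc; apply: ge_inf => //.
    by exists 0 => u [].
  case: ifP => // c0 nU; rewrite /inverse_clock inf_out// => -[[u Su] _]; apply: nU.
  by have [q [_ h]] := dense w u (u + 1) Su ltac:(by rewrite ltrDl); exists q.
by apply: measurableU => //; case: ifP => // _; exact: measurableC.
Qed.

Lemma diffusion_measurable t : measurable_fun setT (diffusion m B L x t : Omega -> measurableTypeR R).
Proof.
rewrite (_ : diffusion m B L x t = fun w => bpath B x w (inverse_clock m L x t w)); last first.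
  by apply/funext => w; exact: diffusion_bpath.
have mb := @measurable_caratheodory _ _ _ (bpath B x)
  (fun y => measurable_funD (measurable_cst x) (measurable_funPT (B (pos y)))) bpath_continuous.
have mp : measurable_fun setT (fun w => (w, inverse_clock m L x t w) : Omega * measurableTypeR R).
  have mi := inverse_clock_measurable t.
  first [exact: (measurable_fun_pair (@measurable_id _ _ setT) mi)|apply: measurable_fun_pair; [exact: measurable_id|exact: mi]|apply/measurable_fun_pairP].
exact: (measurableT_comp (f := fun p : Omega * measurableTypeR R => bpath B x p.1 p.2 : measurableTypeR R) mb mp).
Qed.

(** [level_bound] is used at the levels t + 1/(i+1), decreasing to [t], with horizons i+1. At such
    levels the stopping times have clock strictly above [t], so [hit_near] applies and the stopped
    positions converge to the diffusion at time [t]; this also covers [t = 0]. *)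
Lemma supersol_bound u q v th t : supersol m u q v th (t + 1) -> 0 < th -> 0 <= t ->
  exists G : Omega -> \bar R,
    [/\ measurable_fun setT G, forall w, (0 <= G w)%E, (\int[P]_w G w <= (u x t)%:E)%E &
    forall w, good w -> (exists2 s, 0 <= s & t < clock m (lpath w) s) ->
      ((u (diffusion m B L x t w) 0)%:E <= G w)%E].
Proof.
move=> ss th0 t0.
have [ii iiE] : exists ii : nat -> R, ii = fun i => i.+1%:R^-1 by eexists.
pose lev i : R := t + ii i.
have i0 i : 0 < ii i by rewrite iiE invr_gt0 ltr0n.
have i1 i : ii i <= 1 by rewrite iiE invf_le1 ?ltr0n// ler1n.
have lev0 i : 0 < lev i by rewrite /lev; have := i0 i; lra.
have sl i : supersol m u q v th (lev i) by apply: supersol_sub ss; rewrite /lev lerD2l.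
have [Gi GiP] := choice (fun i => level_bound lf bm x (sl i) th0 (lev0 i) (ltac:(by rewrite ltr0n) : 0 < i.+1%:R :> R)).
have [[cu _ _] _ _ _ _] := ss.
have arch (e : R) : 0 < e -> exists j0, forall j, (j0 <= j)%N -> ii j <= e /\ e^-1 <= j.+1%:R.
  move=> e0; exists (Num.bound e^-1) => j jj.
  have h1 : e^-1 <= j.+1%:R.
    apply: (le_trans (ltW (archi_boundP (ltW (_ : 0 < e^-1))))); first by rewrite invr_gt0.
    by rewrite ler_nat; exact: leq_trans jj _.
  by split => //; rewrite iiE -(invrK e) lef_pV2 ?posrE ?invr_gt0// ltr0n.
have Gint e : 0 < e -> exists j0, forall j, (j0 <= j)%N -> (\int[P]_w Gi j w <= (u x t + e)%:E)%E.
  move=> e0; have /continuous_epsP /(_ t e e0) [b b0 Hb] := continuous2_slice2 (x := x) cu.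
  have [j0 Hj] := arch (b / 2) ltac:(lra); exists j0 => j /Hj [jb _].
  have [_ _ h _] := GiP j; apply: le_trans h _; rewrite lee_fin.
  have := Hb (lev j); rewrite /lev addrAC subrr add0r gtr0_norm// => /(_ ltac:(lra)).
  by rewrite ler_norml; lra.
have [G [mG G0 Gu Gl]] := fatou_bound (fun j => let: And4 h _ _ _ := GiP j in h)
   (fun j => let: And4 _ h _ _ := GiP j in h) Gint.
exists G; split => // w gw cl; have [u0 u00 tu0] := cl.
have oc := good_occupied gw; have [ac lc l0 occ] := oc.
rewrite diffusion_bpath inverse_clock_hit//; set X := bpath B x w _.
apply/lee_addgt0Pr => e e0; rewrite -leeBlDr// -EFinB; apply: Gl.
have /continuous2_epsP /(_ X 0 e e0) [b b0 Hb] := cu.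
have [b1 b10 Hb1] := hit_near lf ac lc l0 occ t0 cl (ltac:(lra) : 0 < b / 3).
pose e1 := Num.min (Num.min (b1 / 2) ((clock m (lpath w) u0 - t) / 2)) (`|u0| + 1)^-1.
have u01 : 0 < `|u0| + 1 by have := normr_ge0 u0; lra.
have e10 : 0 < e1 by rewrite !lt_min invr_gt0 u01 !divr_gt0// subr_gt0.
have [j0 Hj] := arch e1 e10; exists j0 => j /Hj [oj Nj].
have ju : u0 <= j.+1%:R.
  have : `|u0| + 1 <= j.+1%:R.
    rewrite -(invrK (_ + 1)); apply: le_trans Nj.
    by rewrite lef_pV2 ?posrE ?invr_gt0// /e1 ge_min lexx orbT.
  by have := ler_norm u0; lra.
move: oj; rewrite !le_min => /andP[/andP[ob oc1] _].
have ij := i0 j.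
have [_ _ _ Gj] := GiP j; have [Gj1 _] := Gj w (lpath w) oc.
have cu0 := clock_mono lf ac lc l0 occ u00 ju.
apply: (Gj1 _ _ (Num.min (b / 3) (Num.min (b1 / 2) (ii j / 2)))).
- by rewrite /lev; lra.
- by rewrite !lt_min !divr_gt0.
move=> s z r /andP[s0 _]; rewrite !le_min => /and3P[_ c1 c2] /andP[zs _] /andP[rb _].
move: c1 c2; rewrite !ler_norml /lev => /andP[c1 c1'] /andP[c2 c2'].
have n1 := Hb1 s s0 ltac:(lra) ltac:(lra).
have : `|u z r - u X 0| <= e.
  apply: Hb; last by rewrite subr0; lra.
  have := ler_normD (z - bpath B x w s) (bpath B x w s - X).
  rewrite (_ : z - _ + (_ - _) = z - X); last ring.
  by move: n1 zs; rewrite -/X; lra.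
by rewrite ler_norml; lra.
Qed.

(** The density of the Brownian motion at time [T] is at most its peak, of order 1 / sqrt(T), so a
    fixed interval loses its probability. *)
Lemma bpath_escapes A e : 0 < e -> exists T0, forall T, T0 <= T -> 0 < T ->
  (P [set w | (`|bpath B x w T| < A)%R] <= e%:E)%E.
Proof.
move=> e0; have [B0 _ _ Bl] := bm.
pose a := - A - x; pose b := A - x.
pose K := `|b - a| / e.
exists (K ^+ 2) => T TK T0.
have -> : [set w | `|bpath B x w T| < A] = (B T \- B 0) @^-1` `]a, b[%classic.
  apply/seteqP; split => w; rewrite /bpath posE ?(ltW T0)// /= in_itv/= B0 subr0 /a /b ltr_norml;
    by move=> /andP[h1 h2]; apply/andP; split; lra.
rewrite Bl// subr0 /normal_prob.
have s0 : Num.sqrt T != 0 by rewrite gt_eqF// sqrtr_gt0.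
apply: (@le_trans _ _ (\int[leb]_(y in `]a, b[%classic) (normal_peak (Num.sqrt T))%:E)%E).
  apply: ge0_le_integral => //.
  - by move=> y _; rewrite lee_fin normal_pdf_ge0.
  - by apply/measurable_EFinP; apply: measurable_funTS; exact: measurable_normal_pdf.
  - by move=> y _; rewrite lee_fin normal_pdf_ub.
apply: (@le_trans _ _ ((normal_peak (Num.sqrt T))%:E * leb `]a, b[%classic)%E); first by rewrite integral_cst.
have [ab|ba] := leP b a; first by rewrite set_itv_ge ?measure0 ?mule0 ?lee_fin ?(ltW e0)// bnd_simp -leNgt.
have -> : leb `]a, b[%classic = (b - a)%:E by rewrite lebesgue_measure_itv/= lte_fin ba EFinB.
rewrite -EFinM lee_fin /normal_peak sqr_sqrtr ?(ltW T0)//.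
have ba0 : 0 < b - a by lra.
have K0 : 0 < K by rewrite divr_gt0// normr_gt0; lra.
have KT : K <= Num.sqrt (T * pi *+ 2).
  rewrite -(gtr0_norm K0) -sqrtr_sqr ler_sqrt; last by rewrite mulrn_wge0// mulr_ge0 ?pi_ge0// ltW.
  apply: (le_trans TK); rewrite -mulr_natr -mulrA ler_peMr ?(ltW T0)//.
  by have := @pi_ge2 R; lra.
apply: (@le_trans _ _ (K^-1 * (b - a))).
  by rewrite ler_wpM2r ?(ltW ba0)// lef_pV2 ?posrE//; exact: lt_le_trans KT.
by rewrite /K gtr0_norm// invf_div mulfVK// gt_eqF.
Qed.

(* A clock that stays below [t] leaves the chain running up to time [T], when
   the path is far away and the supersolution is large. *)
Lemma clock_unbounded u q v th t : supersol m u q v th (t + 1) -> 0 < th -> 0 <= t ->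
  (forall K, exists A, forall z r, A <= `|z| -> - th <= r <= t + 1 -> K <= u z r) ->
  P.-negligible [set w | good w /\ forall s, 0 <= s -> clock m (lpath w) s <= t].
Proof.
move=> ss th0 t0 uinf; have [[cu _ _] _ _ _ u0] := ss.
set D := [set w | _].
have [M HM] := continuous2_bounded (`|x| + t + 1) cu.
have lev0 : 0 < t + 1 by lra.
have M0 : 0 <= M.
  by apply: le_trans (normr_ge0 (u x t)) _; apply: HM; rewrite ?(ger0_norm t0); have := normr_ge0 x; lra.
have uM : u x (t + 1) <= M.
  apply: le_trans (ler_norm _) _; apply: HM; first by lra.
  by rewrite gtr0_norm//; have := normr_ge0 x; lra.
(* Either the path at the late time [T] is in a bounded region, which is unlikely, or [G] is at
   least [k + 1], which Markov's inequality bounds by [M / (k + 1)]. *)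
have cover k : exists S, [/\ measurable S, D `<=` S & (P S <= ((M + 1) / k.+1%:R)%:E)%E].
  pose K : R := k.+1%:R; have K0 : 0 < K by rewrite ltr0n.
  have [A HA] := uinf K.
  have [T0 HT0] := bpath_escapes (`|A| + 1) (ltac:(by rewrite invr_gt0) : 0 < K^-1).
  pose T := Num.max T0 1; have T1 : 0 < T by rewrite lt_max ltr01 orbT.
  have [G [mG G0 Gu Gl]] := level_bound lf bm x ss th0 lev0 T1.
  pose S1 := [set w | (K%:E <= G w)%E].
  have mS1 : measurable S1.
    by have := emeasurable_fun_c_infty measurableT mG K%:E; rewrite setTI.
  pose S2 := [set w | `|bpath B x w T| < `|A| + 1].
  have mS2 : measurable S2.
    rewrite -[X in measurable X]setTI.
    have mb : measurable_fun setT (fun w => `|bpath B x w T|).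
      apply: measurableT_comp => //; apply: measurable_funD => //; exact: measurable_funPT.
    have -> : S2 = (fun w => `|bpath B x w T|) @^-1` `]-oo, `|A| + 1[%classic.
      by apply/seteqP; split => w; rewrite /S2 /= in_itv.
    by apply: mb => //; exact: measurable_itv.
  exists (S1 `|` S2); split; first exact: measurableU.
    move=> w [gw cl]; have [|h] := ltP `|bpath B x w T| (`|A| + 1); first by right.
    left; have [_ H] := Gl w (lpath w) (good_occupied gw).
    apply: (H _ _ 1) => //; first by have := cl T (ltW T1); lra.
    move=> z r zT rr; apply: HA => //.
    have := ler_normD (bpath B x w T - z) z; rewrite subrK distrC => n1.
    by have := ler_norm A; lra.
  apply: (le_trans (measureU2 _ mS1 mS2)).
  rewrite (_ : (M + 1) / k.+1%:R = M / K + K^-1); last by rewrite mulrDl mul1r.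
  rewrite EFinD; apply: leeD; last by apply: HT0 => //; rewrite le_max lexx.
  have KP : (K%:E * P S1 <= M%:E)%E.
    rewrite -integral_cst//; apply: (@le_trans _ _ (\int[P]_(w in S1) G w)%E).
      by apply: ge0_le_integral => //; first [by move=> w _; rewrite lee_fin ltW|exact: measurable_funTS|by move=> w; []].
    apply: (@le_trans _ _ (\int[P]_w G w)%E); first exact: ge0_subset_integral.
    by apply: (le_trans Gu); rewrite lee_fin.
  move: KP; rewrite -[X in (_ * X)%E](@fineK _ (P S1)) ?fin_num_measure// -EFinM !lee_fin => KP.
  by rewrite -[X in (X <= _)%E](@fineK _ (P S1)) ?fin_num_measure// lee_fin ler_pdivlMr// mulrC.
have [S SP] := choice cover.
have mI : measurable (\bigcap_k S k) by apply: bigcapT_measurable => k; have [] := SP k.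
exists (\bigcap_k S k); split => //; last by move=> w Dw k _; have [_ + _] := SP k; apply.
apply/eqP; rewrite eq_le measure_ge0 andbT; apply/lee_addgt0Pr => e e0; rewrite add0e.
have M1 : 0 < M + 1 by lra.
apply: (@le_trans _ _ (P (S (Num.bound ((M + 1) / e))))).
  apply: le_measure; rewrite ?inE//; first by have [] := SP (Num.bound ((M + 1) / e)).
  by move=> w; apply.
have [_ _ h] := SP (Num.bound ((M + 1) / e)); apply: le_trans h _; rewrite lee_fin.
rewrite ler_pdivrMr ?ltr0n// mulrC -ler_pdivrMr//.
by apply: (le_trans (ltW (archi_boundP (ltW (divr_gt0 M1 e0))))); rewrite ler_nat.
Qed.

End diffusion_paths.

(** * Supersolutions built from a mild solution *)

Section mild_supersolutions.
Context {R : realType}.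
Variable m : {measure set (measurableTypeR R) -> \bar R}.
Hypothesis lf : locally_finite m.
Variable C1 : R.
Hypothesis C1_gt0 : 0 < C1.
Hypothesis abs_le_C1 : forall x, `|x| <= C1 * wgt m x.
Variables (g : R -> R) (U : R -> R -> R).
Hypothesis Um : mild m g U.

Lemma hd_lower f df (a b k : R) : has_derivative f df -> a <= b ->
  (forall x, a <= x <= b -> k <= df x) -> (b - a) * k <= f b - f a.
Proof.
move=> H ab kd.
have [c + ->] := MVT_segment ab (fun x _ => H x) (continuous_subspaceT (hd_continuous H)).
by rewrite in_itv/= => cI; rewrite mulrC ler_wpM2r ?subr_ge0// kd.
Qed.

(** For r >= - th this is the mean of [U x] over times between [r + th] and [r + 2 * th]. The window
    is shifted forward so that it stays at nonnegative times on the whole range required by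
    [supersol]. *)
Definition quot (th : R) (x r : R) : R :=
  th^-1 * (prim (U x) (pos (r + 2 * th)) - prim (U x) (pos (r + th))).

(** A supersolution: its time derivative is C1 times itself, while A of it is
    [eps * expR (C1 * r) * |x|], which is smaller because |x| <= C1 w. *)
Definition barrier (eps : R) (x r : R) : R := eps * expR (C1 * r) * wgt m x.

Lemma quot_near x r e : 0 <= r -> 0 < e ->
  exists2 d, 0 < d & forall th, 0 < th -> th < d -> `|quot th x r - U x r| <= e.
Proof.
move=> r0 e0; have [cU _ _ _] := Um; have cUx := continuous2_slice2 (x := x) cU.
have /continuous_epsP /(_ r e e0) [d d0 Hd] := cUx.
exists (d / 2) => [|th th0 thd]; first by rewrite divr_gt0.
rewrite /quot !posE; try lra.
have := prim_incr (u := U x) (s := r + th) (t := r + 2 * th) (c := U x r) (e := e) cUx ltac:(lra).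
move=> /(_ _)/wrap[].
  by move=> s /andP[s1 s2]; apply: Hd; rewrite gtr0_norm; lra.
rewrite (_ : r + 2 * th - (r + th) = th); last ring.
move: (prim _ _ - prim _ _) => D h.
have -> : th^-1 * D - U x r = th^-1 * (D - th * U x r) by field; rewrite gt_eqF.
by rewrite normrM (gtr0_norm (ltac:(by rewrite invr_gt0) : 0 < th^-1)) ler_pdivrMl.
Qed.

(* The time average of [U] over a window of length [th] is differentiable in
   time, and its second derivative in space is known by the mild equation; the
   barrier makes it positive. *)
Lemma mild_supersol sg eps t : `|sg| <= 1 -> 0 < eps -> 0 <= t ->
  exists2 K, 0 <= K & forall th, 0 < th -> th <= 1 ->
    exists q v, supersol m (fun x r => sg * quot th x r + (barrier eps x r + K)) q v th (t + 1).
Proof.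
move=> sg1 eps0 t0; have [cU _ growth rU] := Um.
have cUx x := continuous2_slice2 (x := x) cU.
have ex0 z : 0 < expR z :> R := expR_gt0 z.
have e'0 : 0 < eps * expR (- C1) by rewrite mulr_gt0.
(* All times that occur are at most [t + 3], and [eps * expR (- C1)] is a lower bound for the
   coefficient of the barrier when [r >= -1]; so barrier plus [|C|] dominates the averaged
   solution. *)
have [C HC] := growth (t + 3) _ ltac:(lra) e'0.
exists `|C| => // th th0 th1.
(* At once the time derivative of [quot] and, by the mild equation, its image under A. *)
pose Dq x r := th^-1 * (U x (r + 2 * th) - U x (r + th)).
exists (fun x r => sg * Dq x r + eps * expR (C1 * r) * `|x|).
exists (fun x r => sg * Dq x r + C1 * barrier eps x r).
have w0 x := wgt_gt0 lf x.
have cE : continuous (fun r => eps * expR (C1 * r)).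
  move=> r; apply: cvgM; first exact: cvg_cst.
  apply: (@continuous_comp _ _ _ (fun r => C1 * r) (@expR R)); last exact: continuous_expR.
  by apply: cvgM; [exact: cvg_cst|exact: cvg_id].
have cE2 : continuous2 (fun (_ r : R) => eps * expR (C1 * r)).
  exact: continuous2_swap (continuous2_fst cE).
have cb : continuous2 (barrier eps).
  exact: (continuous2M cE2 (continuous2_fst (wgt_continuous lf))).
have cDq : continuous2 Dq.
  exact: (@continuous2Z _ th^-1 _ (continuous2B (continuous2_shift (h := 2 * th) cU) (continuous2_shift (h := th) cU))).
have cquot : continuous2 (quot th).
  have cW := prim_param_continuous2 cU.
  exact: (@continuous2Z _ th^-1 _ (continuous2B (continuous2_shift (h := 2 * th) cW) (continuous2_shift (h := th) cW))).
split.
- split => p.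
  + apply: cvgD; first exact: (@continuous2Z _ sg _ cquot p).
    by apply: cvgD; [exact: cb|exact: cvg_cst].
  + apply: cvgD; first exact: (@continuous2Z _ sg _ cDq p).
    exact: (@continuous2M _ _ _ cE2 (continuous2_fst (@abs_continuous R)) p).
  + by apply: cvgD; [exact: (@continuous2Z _ sg _ cDq p)|exact: (@continuous2Z _ C1 _ cb p)].
- move=> r /andP[r1 r2].
  have cg : continuous g.
    have := continuous2_slice1 (t := 0) cU; rewrite (_ : U^~ 0 = g)//.
    by apply/funext => x; have [_ Un _ _] := Um; exact: Un.
  have cd s : continuous (fun x => U x s - g x).
    by move=> x; apply: cvgB; [exact: (continuous2_slice1 (t := s) cU)|exact: cg].
  have cdm s : continuous (fun x => - 1 * (U x s - g x)).
    by move=> x; apply: cvgM; [exact: cvg_cst|exact: cd].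
  have cdd : continuous (fun x => (U x (r + 2 * th) - g x) + - 1 * (U x (r + th) - g x)).
    by move=> x; apply: cvgD; [exact: cd|exact: cdm].
  have R2 := RelD lf (cd _) (cdm _) (rU (r + 2 * th) ltac:(lra)) (RelZ lf (- 1) (cd _) (rU (r + th) ltac:(lra))).
  have R3 := RelZ lf (sg * th^-1) cdd R2.
  have R4 := RelD lf (f := fun x => _) _ _ R3 (Rel_barrier lf (eps * expR (C1 * r)) `|C|).
  apply: Rel_ext (R4 _ _).
  + by move=> x; rewrite /quot /barrier !posE; [ring|lra|lra].
  + by move=> x; rewrite /Dq; ring.
  + by move=> x; apply: cvgM; [exact: cvg_cst|exact: cdd].
  + by move=> x; apply: cvgM; [exact: cvg_cst|exact: abs_continuous].
- move=> x r _; rewrite lerD2l /barrier.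
  rewrite (_ : C1 * (eps * expR (C1 * r) * wgt m x) = eps * expR (C1 * r) * (C1 * wgt m x)); last ring.
  by rewrite ler_wpM2l// mulr_ge0// ltW.
- move=> x r' r k h1 h2 h3 kv.
  pose f s := sg * (th^-1 * (antider (U x) (s + 2 * th) - antider (U x) (s + th)))
              + (eps * wgt m x * expR (C1 * s + 0) + `|C|).
  have ha := antider_hd (cUx x).
  have hexp : has_derivative (@expR R) (@expR R) by move=> y; exact: is_derive_expR.
  have hf := hdD (hdZ sg (hdZ th^-1 (hdB (hd_shift (2 * th) ha) (hd_shift th ha))))
    (hdD (hdZ (eps * wgt m x) (hd_comp hexp (hd_affine C1 0))) (hd_cst `|C|)).
  have fE s : - th <= s -> sg * quot th x s + (barrier eps x s + `|C|) = f s.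
    move=> sth; rewrite /quot /f /antider !posE ?ifT; try lra.
    by rewrite /barrier addr0; ring.
  rewrite !fE; try lra.
  apply: (hd_lower hf h2) => s /andP[s1 s2].
  by apply: le_trans (kv s _) _; [apply/andP|rewrite /Dq /barrier !addr0; lra].
- move=> x r /andP[r1 r2].
  have := prim_diff_bound (u := U x) (s := r + th) (t := r + 2 * th) (M := eps * expR (- C1) * wgt m x + C) (cUx x) ltac:(lra).
  move=> /(_ _)/wrap[]; first by move=> s /andP[s1 s2]; apply: HC; lra.
  rewrite (_ : r + 2 * th - (r + th) = th); last ring.
  rewrite /quot !posE; try lra.
  move: (prim _ _ - prim _ _) => D h.
  have {}h : `|sg * (th^-1 * D)| <= eps * expR (- C1) * wgt m x + C.
    rewrite normrM; apply: (@le_trans _ _ `|th^-1 * D|).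
      by rewrite -[leRHS]mul1r ler_wpM2r.
    by rewrite normrM (gtr0_norm (ltac:(by rewrite invr_gt0) : 0 < th^-1)) ler_pdivrMl.
  have h4 : eps * expR (- C1) * wgt m x <= barrier eps x r.
    rewrite /barrier ler_wpM2r ?(ltW (w0 x))// ler_wpM2l ?(ltW eps0)// ler_expR.
    have : 0 <= C1 * (r + 1) by rewrite mulr_ge0 ?(ltW C1_gt0)//; lra.
    by rewrite mulrDr mulr1; lra.
  by move: h h4 (ler_norm C); move: (barrier _ _ _) (sg * _) => b1 b2; rewrite ler_norml; lra.
Qed.

End mild_supersolutions.

(** * The stochastic representation *)

Section representation.
Context {R : realType}.
Variable m : {measure set (measurableTypeR R) -> \bar R}.
Hypothesis lf : locally_finite m.
Hypothesis m_supp : forall b : R, 0 < b ->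
  supp m `&` `]-oo, - b] !=set0 /\ supp m `&` `[b, +oo[ !=set0.
Variable C1 : R.
Hypothesis C1_gt0 : 0 < C1.
Hypothesis abs_le_C1 : forall x, `|x| <= C1 * wgt m x.
Variables (gb : R -> R) (U : R -> R -> R).
Hypothesis Um : mild m gb U.
Context {d : measure_display} {Omega : measurableType d}.
Variable P : probability Omega R.
Variables (B : R -> {RV P >-> R}) (L : R -> R -> {RV P >-> R}).
Hypothesis bm : brownian_motion B.
Hypothesis lt : local_time B L.
Variables (x t : R).
Hypothesis t0 : 0 <= t.

Local Notation X := (diffusion m B L x t).

(** With [sg = 0] the supersolution of [mild_supersol] is the barrier plus a constant, which tends
    to infinity with |x|; [clock_unbounded] applies to it. *)
Lemma ae_clock : {ae P, forall w, good B L w /\ exists2 s, 0 <= s & t < clock m (lpath L x w) s}.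
Proof.
have [K K0 HK] := mild_supersol lf C1_gt0 abs_le_C1 Um (ltac:(by rewrite normr0) : `|0 : R| <= 1) ltr01 t0.
have [q [v ss]] := HK 1 ltr01 (lexx _).
have neg := clock_unbounded lf bm lt x ss ltr01 t0.
have {}neg : P.-negligible [set w | good B L w /\ forall s, 0 <= s -> clock m (lpath L x w) s <= t].
  apply: neg => M; have ec := expR_gt0 (- C1).
  have [A A0 HA] := wgt_infty lf m_supp (M / expR (- C1)).
  exists A => z r Az /andP[r1 _]; rewrite mul0r add0r.
  apply: (@le_trans _ _ (barrier m C1 1 z r)); last by rewrite lerDl.
  rewrite /barrier mul1r; apply: (@le_trans _ _ (expR (- C1) * wgt m z)).
    by rewrite mulrC -ler_pdivrMr//; exact: HA.
  rewrite ler_wpM2r ?(ltW (wgt_gt0 lf z))// ler_expR.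
  have c0 := C1_gt0; have : 0 <= C1 * (r + 1) by rewrite mulr_ge0 ?(ltW c0)//; lra.
  by rewrite mulrDr mulr1; lra.
have [_ _ gd] := lt.
have neg' : {ae P, forall w, ~ (good B L w /\ forall s, 0 <= s -> clock m (lpath L x w) s <= t)}.
  by apply: negligibleS neg => w /=; exact: contrapT.
apply: filterS2 gd neg' => w gw nw; split => //.
apply: contrapT => H; apply: nw; split => // s s0; rewrite leNgt; apply/negP => ts.
by apply: H; exists s.
Qed.

Lemma measurable_cont_diffusion (h : R -> R) : continuous h -> measurable_fun setT (h \o X).
Proof.
move=> ch; apply: (measurableT_comp (f := h : measurableTypeR R -> R)); last exact: diffusion_measurable.
exact: continuous_measurable_fun.
Qed.

(** Let the averaging window [th] tend to 0 in [supersol_bound], by one more use of Fatou; the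
    constant [K] does not depend on [th]. *)
Lemma diffusion_bound sg eps : `|sg| <= 1 -> 0 < eps -> exists2 K, 0 <= K &
  (\int[P]_w (sg * U (X w) 0 + (eps * wgt m (X w) + K))%:E
     <= (sg * U x t + (eps * expR (C1 * t) * wgt m x + K))%:E)%E.
Proof.
move=> sg1 eps0; have [K K0 HK] := mild_supersol lf C1_gt0 abs_le_C1 Um sg1 eps0 t0.
exists K => //.
have [ii iiE] : exists ii : nat -> R, ii = fun i => i.+1%:R^-1 by eexists.
have i0 i : 0 < ii i by rewrite iiE invr_gt0 ltr0n.
have i1 i : ii i <= 1 by rewrite iiE invf_le1 ?ltr0n// ler1n.
have arch (e : R) : 0 < e -> exists j0, forall j, (j0 <= j)%N -> ii j < e.
  move=> e0; exists (Num.bound e^-1) => j jj.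
  rewrite iiE -(invrK e) ltf_pV2 ?posrE ?invr_gt0// ?ltr0n//.
  apply: (lt_le_trans (archi_boundP (ltW (_ : 0 < e^-1)))); first by rewrite invr_gt0.
  by rewrite ler_nat; exact: leq_trans jj _.
pose u i y r := sg * quot U (ii i) y r + (barrier m C1 eps y r + K).
have GnP i : exists G : Omega -> \bar R, [/\ measurable_fun setT G, forall w, (0 <= G w)%E,
   (\int[P]_w G w <= (u i x t)%:E)%E & forall w, good B L w ->
   (exists2 s, 0 <= s & t < clock m (lpath L x w) s) -> ((u i (X w) 0)%:E <= G w)%E].
  by have [q [v ss]] := HK (ii i) (i0 i) (i1 i); exact: (supersol_bound lf bm lt x ss (i0 i) t0).
have u0 i y : 0 <= u i y 0.
  by have [q [v [_ _ _ _ +]]] := HK (ii i) (i0 i) (i1 i); apply; have := i0 i; have t0' := t0; lra.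
have [Gn {}GnP] := choice GnP.
have near e y r : 0 <= r -> 0 < e -> exists j0, forall j, (j0 <= j)%N ->
    `|u j y r - (sg * U y r + (barrier m C1 eps y r + K))| <= e.
  move=> r0 e0; have [dd dd0 Hd] := quot_near Um y r0 e0.
  have [j0 Hj] := arch dd dd0; exists j0 => j /Hj h.
  rewrite /u (_ : _ - _ = sg * (quot U (ii j) y r - U y r)); last ring.
  by rewrite normrM -[leRHS]mul1r ler_pM// Hd.
have [|G [mG G0 Gu Gl]] := fatou_bound (mu := P) (c := sg * U x t + (barrier m C1 eps x t + K))
  (fun j => let: And4 h _ _ _ := GnP j in h) (fun j => let: And4 _ h _ _ := GnP j in h).
  move=> e e0; have [j0 Hj] := near e x t t0 e0; exists j0 => j /Hj h.
  by have [_ _ h' _] := GnP j; apply: le_trans h' _; rewrite lee_fin; move: h; rewrite ler_norml; lra.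
apply: le_trans Gu.
have lim y : 0 <= sg * U y 0 + (eps * wgt m y + K).
  apply/ler_addgt0Pr => e e0; have [j0 Hj] := near e y 0 (lexx _) e0.
  have := Hj j0 (leqnn _); have := u0 j0 y.
  by rewrite /barrier mulr0 expR0 mulr1; move: (u _ _ _) (sg * _ + _) => p1 p2; rewrite ler_norml; lra.
have [cU _ _ _] := Um; have cU0 := continuous2_slice1 (t := 0) cU.
apply: ae_ge0_le_integral => //.
- by move=> w _; rewrite lee_fin lim.
- apply/measurable_EFinP; apply: (@measurable_cont_diffusion (fun y => sg * U y 0 + (eps * wgt m y + K))) => y.
  apply: cvgD; first by apply: cvgM; [exact: cvg_cst|exact: cU0].
  by apply: cvgD; [apply: cvgM; [exact: cvg_cst|exact: wgt_continuous]|exact: cvg_cst].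
apply: filterS ae_clock => w [gw cl] _.
apply/lee_addgt0Pr => e e0; rewrite -leeBlDr// -EFinB; apply: Gl.
have [j0 Hj] := near e (X w) 0 (lexx _) e0; exists j0 => j /Hj h.
have [_ _ _ h'] := GnP j; apply: le_trans (h' w gw cl); rewrite lee_fin.
by move: h; rewrite /barrier mulr0 expR0 mulr1; move: (u _ _ _) (sg * _ + _) => p1 p2; rewrite ler_norml; lra.
Qed.

(** The case [sg = 0] of [diffusion_bound] bounds the expectation of the weight. *)
Lemma wgt_diffusion_integrable : P.-integrable setT (EFin \o (wgt m \o X)).
Proof.
have mw := measurable_cont_diffusion (wgt_continuous lf).
have [K K0 HK] := diffusion_bound (ltac:(by rewrite normr0) : `|0 : R| <= 1) ltr01.
apply/integrableP; split; first exact/measurable_EFinP.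
apply: (le_lt_trans _ (ltry _)); apply: le_trans HK.
apply: ge0_le_integral => //.
- by apply: measurableT_comp => //; exact/measurable_EFinP.
- apply/measurable_EFinP; apply: (@measurable_cont_diffusion (fun y => 0 * U y 0 + (1 * wgt m y + K))) => y.
  have [cU _ _ _] := Um; have cU0 := continuous2_slice1 (t := 0) cU.
  apply: cvgD; first by apply: cvgM; [exact: cvg_cst|exact: cU0].
  by apply: cvgD; [apply: cvgM; [exact: cvg_cst|exact: wgt_continuous]|exact: cvg_cst].
by move=> w _; rewrite /= lee_fin gtr0_norm ?wgt_gt0// mul0r add0r mul1r lerDl.
Qed.

Lemma small_diffusion_integrable h : C0 m h -> P.-integrable setT (EFin \o (h \o X)).
Proof.
move=> [ch sh]; have [C HC] := sh 1 ltr01.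
have iC : P.-integrable setT (EFin \o cst `|C| : Omega -> \bar R) by exact: finite_measure_integrable_cst.
apply: (le_integrable _ _ _ (integrableD _ wgt_diffusion_integrable iC)) => //.
  by apply/measurable_EFinP; exact: measurable_cont_diffusion.
move=> w _ /=; rewrite lee_fin; apply: (le_trans (HC _)); rewrite mul1r.
by apply: le_trans (ler_norm _); rewrite lerD2l ler_norm.
Qed.

(** [diffusion_bound] with [sg = 1] and [sg = -1] gives the two inequalities. By integrability the
    constant [K] cancels, and the barrier disappears with [eps]. *)
Lemma diffusion_expectation : C0 m gb -> (\int[P]_w (gb (X w))%:E = (U x t)%:E)%E.
Proof.
move=> Cgb; have iY := small_diffusion_integrable Cgb; have iV := wgt_diffusion_integrable.
have Ug y : U y 0 = gb y by have [_ h _ _] := Um; exact: h.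
rewrite -(fineK (integrable_fin_num measurableT iY)); congr EFin.
change (fine _) with (\int[P]_w (gb (X w))).
pose a := \int[P]_w (gb (X w)); pose V := \int[P]_w (wgt m (X w)).
have V0 : 0 <= V by apply: Rintegral_ge0 => w _; exact/ltW/wgt_gt0.
have key sg : `|sg| <= 1 -> sg * (a - U x t) <= 0.
  move=> sg1; apply/ler_addgt0Pr => e e0; rewrite add0r.
  have c0 : 0 < expR (C1 * t) * wgt m x by rewrite mulr_gt0 ?expR_gt0 ?wgt_gt0.
  (* This choice of [eps] makes the barrier cost exactly [e] at [(x, t)]. *)
  have ec : 0 < e / (expR (C1 * t) * wgt m x) by rewrite divr_gt0.
  have [K K0 HK] := diffusion_bound sg1 ec; move: HK.
  set eps := e / _ in ec *.
  have iK : P.-integrable setT (EFin \o cst K : Omega -> \bar R) by exact: finite_measure_integrable_cst.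
  have iY' : P.-integrable setT (fun w => (sg * gb (X w))%:E) by exact: (integrableZl measurableT sg iY).
  have iV' : P.-integrable setT (fun w => (eps * wgt m (X w))%:E) by exact: (integrableZl measurableT eps iV).
  have iVK : P.-integrable setT (fun w => (eps * wgt m (X w) + K)%:E) by exact: (integrableD measurableT iV' iK).
  have iS : P.-integrable setT (fun w => (sg * gb (X w) + (eps * wgt m (X w) + K))%:E).
    exact: (integrableD measurableT iY' iVK).
  under eq_integral do rewrite Ug.
  rewrite -(fineK (integrable_fin_num measurableT iS)) lee_fin.
  have -> : fine (\int[P]_w (sg * gb (X w) + (eps * wgt m (X w) + K))%:E)%E = sg * a + (eps * V + K).
    change (\int[P]_w (sg * gb (X w) + (eps * wgt m (X w) + K)) = sg * a + (eps * V + K)).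
    rewrite RintegralD// RintegralD// RintegralZl// RintegralZl//.
    by rewrite (_ : \int[P]_(w in setT) K = K)// /Rintegral (Pcst P K%:E).
  have -> : eps * expR (C1 * t) * wgt m x = e by rewrite /eps -mulrA divfK// gt_eqF.
  have := mulr_ge0 (ltW ec) V0; rewrite mulrBr.
  by move: (sg * a) (sg * _) (eps * V) => p1 p2 p3; lra.
have k1 := key 1 ltac:(by rewrite normr1); have k2 := key (- 1) ltac:(by rewrite normrN normr1).
by apply/eqP; rewrite eq_le; apply/andP; split; rewrite -/a; lra.
Qed.

Lemma ae_diffusion_supp : {ae P, forall w, supp m (X w)}.
Proof.
apply: filterS ae_clock => w [gw cl].
have [ac lc l0 occ] := good_occupied bm lt x gw.
apply: (hit_supp lf ac lc l0 occ t0 cl).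
by rewrite diffusion_bpath (inverse_clock_hit (B := B) lf bm lt).
Qed.

End representation.

(** * Conclusion *)

Lemma mild_solution_of (R : realType) (m : {measure set (measurableTypeR R) -> \bar R})
  (g : R -> R) (U : R -> R -> R) : locally_finite m ->
  (forall b : R, 0 < b -> supp m `&` `]-oo, - b] !=set0 /\ supp m `&` `[b, +oo[ !=set0) ->
  mild m (gbar m g) U -> is_solution m g U.
Proof.
move=> lf m_supp Um; have [cU Un growth _] := Um; split.
- exact: continuous_subspaceT.
- move=> T T0 eps eps0; have e20 : 0 < eps / 2 by rewrite divr_gt0.
  have [C HC] := growth T _ T0 e20.
  (* Where the weight exceeds this value, [eps / 2 * Psi] absorbs the constant [eps / 2 + |C|] left
     over from [eps / 2 * wgt + C]. *)
  have [A A0 HA] := wgt_infty lf m_supp (2 + 2 * `|C| / eps).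
  have far x : A <= `|x| -> forall t, 0 <= t <= T -> `|U x t| <= eps * `|Psi m x|.
    move=> xA t /andP[_ tT]; have P0 := Psi_ge0 lf x; rewrite (ger0_norm P0).
    apply: (le_trans (HC x t tT)); have := HA x xA; rewrite /wgt => h.
    have h2 : eps / 2 * (1 + 2 * `|C| / eps) <= eps / 2 * Psi m x by rewrite ler_pM2l//; lra.
    have h3 : eps / 2 * (1 + 2 * `|C| / eps) = eps / 2 + `|C| by field; rewrite gt_eqF.
    by have := ler_norm C; lra.
  split; [exists A|exists (- A)]; (split; first exact: num_real).
  + by move=> x xA; apply: far; apply: le_trans (ler_norm x); exact: ltW.
  + by move=> x xA; apply: far; rewrite -normrN; apply: le_trans (ler_norm _); rewrite lerNr ltW.
- exact: mild_heat Um.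
- by move=> x; exact: Un.
Qed.

Theorem theorem3p2 (R : realType)
  (m : {measure set (measurableTypeR R) -> \bar R})
  (m_locally_finite : locally_finite m)
  (m_supp : forall b : R, 0 < b ->
     supp m `&` `]-oo, - b] !=set0 /\ supp m `&` `[b, +oo[ !=set0)
  (g : R -> R) (g_continuous : continuous g) (g_littleo : littleo_Psi m g) :
  exists U : R -> R -> R,
    [/\ is_solution m g U,
        (forall V : R -> R -> R, is_solution m g V ->
           forall x t : R, 0 <= t -> V x t = U x t) &
        (forall (d : measure_display) (Omega : measurableType d)
           (P : probability Omega R)
           (B : R -> {RV P >-> R}) (L : R -> R -> {RV P >-> R}),
           brownian_motion B -> local_time B L ->
           forall x t : R, 0 <= t ->
             [/\ P.-integrable setT (EFin \o (g \o diffusion m B L x t)),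
                 P.-integrable setT (EFin \o (gbar m g \o diffusion m B L x t)),
                 (U x t)%:E = ('E_P[g \o diffusion m B L x t])%E &
                 (U x t)%:E = ('E_P[gbar m g \o diffusion m B L x t])%E])].
Proof.
have lf := m_locally_finite.
have [C1 C1_gt0 abs_le_C1] := abs_le_wgt lf m_supp.
have Cg : C0 m g by split => //; exact: littleo_small g_littleo.
have [Cgb _ gbg g_strong] := gbar_spec lf m_supp C1_gt0 abs_le_C1 Cg.
have [U Um] := mild_exists lf m_supp C1_gt0 abs_le_C1 Cgb g_strong.
have sol := mild_solution_of lf m_supp Um.
exists U; split => //.
  by move=> V; exact: (solution_unique lf C1_gt0 abs_le_C1 sol).
move=> d Omega P B L bm lt x t t0.
have ig := small_diffusion_integrable lf m_supp C1_gt0 abs_le_C1 Um bm lt x t0 Cg.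
have igb := small_diffusion_integrable lf m_supp C1_gt0 abs_le_C1 Um bm lt x t0 Cgb.
have EU := diffusion_expectation lf m_supp C1_gt0 abs_le_C1 Um bm lt x t0 Cgb.
have sX := ae_diffusion_supp lf m_supp C1_gt0 abs_le_C1 Um bm lt x t0.
split => //; rewrite unlock; last by rewrite -EU.
(* The diffusion lies almost surely in the support, where [g] and [gbar m g] coincide. *)
rewrite -EU; apply: ae_eq_integral => //.
- by have /integrableP[] := igb.
- by have /integrableP[] := ig.
by apply: filterS sX => w sw _; rewrite /= gbg.
Qed.
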